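(* Let $n,m\ge1$ be integers and let $\frac{2m}{m+1}<q\le\infty$. There exists a constant $C=C_{n,m,q}>0$ such that for every $\Omega\in L^q(\mathbb S^{mn-1})$ with $\int_{\mathbb S^{mn-1}}\Omega\,d\sigma_{mn-1}=0$ and all Schwartz functions $f_1,\dots,f_m$ on $\mathbb R^n$, $$\|\mathcal L_\Omega(f_1,\dots,f_m)\|_{L^{2/m}(\mathbb R^n)}\le C\,\|\Omega\|_{L^q(\mathbb S^{mn-1})}\prod_{j=1}^m\|f_j\|_{L^2(\mathbb R^n)} .$$
   Context: $\mathbb S^{mn-1}$ is the unit sphere of $(\mathbb R^n)^m=\mathbb R^{mn}$ and $\sigma_{mn-1}$ is its surface measure. For a function $\Omega$ on $\mathbb S^{mn-1}$ put $K(\vec y)=\Omega(\vec y/|\vec y|)\,|\vec y|^{-mn}$ for $\vec y=(y_1,\dots,y_m)\in(\mathbb R^n)^m\setminus\{0\}$. The $m$-linear homogeneous (rough) singular integral operator $\mathcal L_\Omega$ is defined for Schwartz functions $f_1,\dots,f_m$ on $\mathbb R^n$ by the principal value integral $$\mathcal L_\Omega(f_1,\dots,f_m)(x)=\mathrm{p.v.}\int_{(\mathbb R^n)^m}K(\vec y)\prod_{j=1}^m f_j(x-y_j)\,d\vec y=\lim_{\varepsilon\to0^+}\int_{|\vec y|>\varepsilon}K(\vec y)\prod_{j=1}^m f_j(x-y_j)\,d\vec y,\qquad x\in\mathbb R^n .$$ For $0<p<\infty$, $\|g\|_{L^p}=(\int|g|^p)^{1/p}$ (a quasi-norm if $p<1$).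 *)

(* Defs.v *)
From HB Require Import structures.
From mathcomp Require Import all_boot all_order all_algebra complex.
From mathcomp Require Import all_classical all_reals all_analysis.
From mathcomp Require Import measurable_realfun.
Set Implicit Arguments.
Unset Strict Implicit.
Unset Printing Implicit Defensive.
Import Order.TTheory GRing.Theory Num.Theory.
Import numFieldNormedType.Exports.
Local Open Scope classical_set_scope.
Local Open Scope ring_scope.

(* [Rcomplex R] is R[i] seen as a real vector space whose norm, the modulus,
   takes its values in R; the instances below make it a normed space over R. *)
Section complex_normed_module.
Variable R : realType.

Lemma Rcomplex_normrZ (l : R) (z : Rcomplex R) : `|l *: z| = `|l| * `|z|.
Proof.
case: z => a b; rewrite /Num.norm /= !exprMn -mulrDr sqrtrM ?sqr_ge0//.
by rewrite sqrtr_sqr.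
Qed.

HB.instance Definition _ :=
  PseudoMetric.copy (Rcomplex R) (pseudoMetric_normed (Rcomplex R)).
HB.instance Definition _ := isPointed.Build (Rcomplex R) 0.
HB.instance Definition _ :=
  NormedZmod_PseudoMetric_eq.Build R (Rcomplex R) erefl.
HB.instance Definition _ :=
  PseudoMetricNormedZmod_Lmodule_isNormedModule.Build R (Rcomplex R)
    Rcomplex_normrZ.

End complex_normed_module.

Section complex_integral.
Context d (T : measurableType d) (R : realType).

Definition complex_measurable (D : set T) (f : T -> Rcomplex R) :=
  measurable_fun D (fun x => complex.Re (f x)) /\
  measurable_fun D (fun x => complex.Im (f x)).

Definition complex_integral (mu : {measure set T -> \bar R}) (D : set T)
    (f : T -> Rcomplex R) : Rcomplex R :=
  Complex (\int[mu]_(x in D) complex.Re (f x))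
          (\int[mu]_(x in D) complex.Im (f x)).

Definition complex_Lnorm (mu : {measure set T -> \bar R}) (p : \bar R)
    (f : T -> Rcomplex R) : \bar R :=
  Lnorm mu p (fun x => (`|f x|)%:E).

End complex_integral.

Section image_measure.
Context d1 d2 (T1 : measurableType d1) (T2 : measurableType d2) (R : realType).
Variables (f : T1 -> T2) (mf : measurable_fun setT f).
Variable mu : {measure set T1 -> \bar R}.

Let im := pushforward mu f.

Let im0 : im set0 = 0%E. Proof. exact: measure0. Qed.

Let im_ge0 A : (0 <= im A)%E. Proof. exact: measure_ge0. Qed.

Let im_sigma_additive : semi_sigma_additive im.
Proof. exact: measure_semi_sigma_additive. Qed.

HB.instance Definition _ := isMeasure.Build _ _ _ im
  im0 im_ge0 im_sigma_additive.

Definition image_measure : {measure set T2 -> \bar R} := im.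

End image_measure.

Section tuple_lebesgue.
Variable R : realType.
Local Notation RR := (measurableTypeR R).

Definition tuple_cons n (p : RR * n.-tuple RR) : n.+1.-tuple RR :=
  [tuple of p.1 :: p.2].

Definition tuple_uncons n (t : n.+1.-tuple RR) : RR * n.-tuple RR :=
  (thead t, [tuple of behead t]).

Lemma measurable_tuple_cons n : measurable_fun setT (@tuple_cons n).
Proof. exact: measurable_cons. Qed.

Lemma measurable_tuple_uncons n : measurable_fun setT (@tuple_uncons n).
Proof.
apply/measurable_fun_pairP; split; first exact: measurable_tnth.
exact: measurable_behead.
Qed.

Lemma tuple_consK n : cancel (@tuple_cons n) (@tuple_uncons n).
Proof.
move=> [x t]; rewrite /tuple_cons /tuple_uncons theadE; congr pair.
exact/val_inj.
Qed.

Section step.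
Variables (n : nat) (mu : {sigma_finite_measure set (n.-tuple RR) -> \bar R}).

Let step : set (n.+1.-tuple RR) -> \bar R :=
  image_measure (@measurable_tuple_cons n) (@lebesgue_measure R \x mu)%E.

HB.instance Definition _ := Measure.on step.

Let step_sigma_finite : sigma_finite setT step.
Proof.
have /sigma_finiteP[F [TF ndF Foo]] := sigma_finiteT (@lebesgue_measure R).
have /sigma_finiteP[G [TG ndG Goo]] := sigma_finiteT mu.
exists (fun i => @tuple_uncons n @^-1` (F i `*` G i)).
  rewrite -preimage_bigcup (_ : \bigcup_i _ = setT) ?preimage_setT//.
  rewrite -subTset => -[x t] _.
  have [i _ Fx] : (\bigcup_i F i) x by rewrite -TF.
  have [j _ Gt] : (\bigcup_i G i) t by rewrite -TG.
  exists (maxn i j) => //; split => /=.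
    by move: x Fx; exact/subsetPset/ndF/leq_maxl.
  by move: t Gt; exact/subsetPset/ndG/leq_maxr.
move=> i; have [mF Fi] := Foo i; have [mG Gi] := Goo i; split.
  rewrite -[X in measurable X]setTI; apply: measurable_tuple_uncons => //.
  exact: measurableX.
rewrite /step /image_measure /= /pushforward -comp_preimage.
rewrite (_ : _ \o _ = id); last first.
  by apply/funext => p /=; rewrite tuple_consK.
by rewrite preimage_id product_measure1E// lte_mul_pinfty// ge0_fin_numE.
Qed.

HB.instance Definition _ := isSFinite.Build _ _ _ step
  (sfinite_measure_sigma_finite step_sigma_finite).
HB.instance Definition _ := isSigmaFinite.Build _ _ _ step step_sigma_finite.

Definition tuple_lebesgue_step :
  {sigma_finite_measure set (n.+1.-tuple RR) -> \bar R} := step.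

End step.

Let dirac_nil : set (0.-tuple RR) -> \bar R := dirac [tuple].
HB.instance Definition _ := FiniteMeasure.on dirac_nil.

Fixpoint tuple_lebesgue n : {sigma_finite_measure set (n.-tuple RR) -> \bar R} :=
  match n with
  | 0 => dirac_nil
  | n'.+1 => tuple_lebesgue_step (tuple_lebesgue n')
  end.

End tuple_lebesgue.

Definition matrix_display : measure_display -> measure_display.
Proof. exact. Qed.

Section matrix_measurable.
Variables (R : realType) (m n : nat).

Definition matrix_cylinders : set_system 'M[R]_(m, n) :=
  [set A | exists i j (B : set R),
    measurable B /\ A = (fun y : 'M[R]_(m, n) => y i j) @^-1` B].

Let matrix_set0 : <<s matrix_cylinders >> set0.
Proof. exact: sigma_algebra0. Qed.

Let matrix_setC A : <<s matrix_cylinders >> A -> <<s matrix_cylinders >> (~` A).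
Proof. exact: sigma_algebraC. Qed.

Let matrix_bigcup (F : (set 'M[R]_(m, n))^nat) :
  (forall i, <<s matrix_cylinders >> (F i)) ->
  <<s matrix_cylinders >> (\bigcup_i (F i)).
Proof. exact: sigma_algebra_bigcup. Qed.

HB.instance Definition _ :=
  @isMeasurable.Build (matrix_display default_measure_display) 'M[R]_(m, n)
    <<s matrix_cylinders >> matrix_set0 matrix_setC matrix_bigcup.

Lemma measurable_coord i j :
  measurable_fun setT (fun y : 'M[R]_(m, n) => y i j).
Proof.
by move=> _ B mB; rewrite setTI; apply: sub_sigma_algebra; exists i, j, B.
Qed.

Lemma measurable_matrix d (T : measurableType d) (f : T -> 'M[R]_(m, n)) :
  (forall i j, measurable_fun setT (fun x => f x i j)) -> measurable_fun setT f.
Proof.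
move=> mf; apply: (measurability matrix_cylinders) => //.
by move=> _ [_ [i [j [B [mB ->]]]] <-]; exact: mf.
Qed.

Definition matrix_of_tuple (t : (m * n).-tuple (measurableTypeR R)) :
    'M[R]_(m, n) :=
  \matrix_(i, j) tnth t (mxvec_index i j).

Lemma measurable_matrix_of_tuple : measurable_fun setT matrix_of_tuple.
Proof.
apply: measurable_matrix => i j.
under eq_fun do rewrite mxE.
exact: measurable_tnth.
Qed.

Definition mx_lebesgue : {measure set 'M[R]_(m, n) -> \bar R} :=
  image_measure measurable_matrix_of_tuple (tuple_lebesgue R (m * n)).

(* The Euclidean norm; the library's norm on matrices is the sup norm. *)
Definition enorm (y : 'M[R]_(m, n)) : R :=
  Num.sqrt (\sum_(i < m) \sum_(j < n) y i j ^+ 2).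

Lemma measurable_enorm : measurable_fun setT enorm.
Proof.
rewrite (_ : enorm = (fun x => x `^ 2^-1) \o
    (fun y => \sum_(i < m) \sum_(j < n) y i j ^+ 2)); last first.
  apply/funext => y /=; rewrite powR12_sqrt//.
  by apply: sumr_ge0 => i _; apply: sumr_ge0 => j _; exact: sqr_ge0.
apply: (measurableT_comp (measurable_powR _)) => /=.
apply: measurable_sum => i; apply: measurable_sum => j.
by apply: measurable_funX; exact: measurable_coord.
Qed.

Definition direction (y : 'M[R]_(m, n)) : 'M[R]_(m, n) := (enorm y)^-1 *: y.

Lemma measurable_direction : measurable_fun setT direction.
Proof.
apply: measurable_matrix => i j.
rewrite (_ : (fun _ => _) =
    (fun y : 'M[R]_(m, n) => (enorm y) `^ (-1) * y i j)); last first.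
  by apply/funext => y; rewrite mxE powR_inv1// sqrtr_ge0.
apply: measurable_funM; last exact: measurable_coord.
exact: (measurableT_comp (measurable_powR _) measurable_enorm).
Qed.

Definition unit_sphere : set 'M[R]_(m, n) := [set y | enorm y = 1].

Definition punctured_ball : set 'M[R]_(m, n) := [set y | 0 < enorm y <= 1].

Lemma measurable_punctured_ball : measurable punctured_ball.
Proof.
rewrite (_ : punctured_ball = enorm @^-1` `]0, 1]).
  by rewrite -[X in measurable X]setTI; exact: measurable_enorm.
by apply/seteqP; split => y /=; rewrite in_itv.
Qed.

(* The surface measure of the unit sphere, as a measure on the whole space
   carried by the sphere: sigma(A) is the dimension times the volume of the
   cone {r *: theta | 0 < r <= 1, theta \in A}, as dictated by integration in
   polar coordinates dy = r ^ (m * n - 1) dr dsigma. *)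
Definition surface_measure : {measure set 'M[R]_(m, n) -> \bar R} :=
  mscale (m * n)%:R%:nng
    (image_measure measurable_direction
       (mrestr mx_lebesgue measurable_punctured_ball)).

End matrix_measurable.

Section schwartz.
Variables (R : realType) (n : nat).

(* [:: i1; ...; ik] stands for the iterated partial derivative d_i1 ... d_ik *)
Fixpoint partial (s : seq 'I_n) (f : 'rV[R]_n -> Rcomplex R) :
    'rV[R]_n -> Rcomplex R :=
  if s is i :: s' then 'D_(delta_mx 0 i) (partial s' f) else f.

Definition smooth (f : 'rV[R]_n -> Rcomplex R) : Prop :=
  forall s : seq 'I_n, continuous (partial s f) /\
    forall (i : 'I_n) x, derivable (partial s f) x (delta_mx 0 i).

Definition schwartz (f : 'rV[R]_n -> Rcomplex R) : Prop :=
  smooth f /\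
  forall (a : 'I_n -> nat) (s : seq 'I_n), exists M : R,
    forall x : 'rV[R]_n, `|\prod_(i < n) x 0 i ^+ a i| * `|partial s f x| <= M.

End schwartz.

Section rough_singular_integral.
Variables (R : realType) (m n : nat).

(* (R^n)^m is the space of m x n matrices, y_j being the j-th row; a function
   on the sphere is given by any function on the whole space, of which only
   the values on the sphere matter. *)
Implicit Type Omega : 'M[R]_(m, n) -> Rcomplex R.

Definition sphere_Lnorm (q : \bar R) Omega : \bar R :=
  complex_Lnorm (@surface_measure R m n) q Omega.

Definition sphere_Lq (q : \bar R) Omega : Prop :=
  complex_measurable (@unit_sphere R m n) Omega /\
  (sphere_Lnorm q Omega < +oo)%E.

Definition sphere_integral Omega : Rcomplex R :=
  complex_integral (@surface_measure R m n) (@unit_sphere R m n) Omega.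

Definition rough_kernel Omega (y : 'M[R]_(m, n)) : Rcomplex R :=
  (enorm y ^- (m * n)) *: Omega (direction y).

Definition truncated_rough_integral Omega (f : 'I_m -> 'rV[R]_n -> Rcomplex R)
    (eps : R) (x : 'rV[R]_n) : Rcomplex R :=
  complex_integral (@mx_lebesgue R m n) [set y | eps < enorm y]
    (fun y => rough_kernel Omega y * \prod_(j < m) f j (x - row j y)).

Definition rough_integral Omega (f : 'I_m -> 'rV[R]_n -> Rcomplex R)
    (x : 'rV[R]_n) : Rcomplex R :=
  lim (truncated_rough_integral Omega f eps x @[eps --> 0^'+]).

End rough_singular_integral.

Definition Rn_Lnorm (R : realType) (n : nat) (p : R)
    (g : 'rV[R]_n -> Rcomplex R) : \bar R :=
  complex_Lnorm (@mx_lebesgue R 1 n) p%:E g.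

(* Main.v *)
(* Cut the kernel into dyadic annuli and write T_r for the operator of the annulus
   |y| ~ l_r, E_r for averaging over dyadic cubes of side l_r.
   Decay: if some f_i has mean zero on the cubes of side 2^-s l_r, the L^2 norm of
   T_r(f_1, ..., f_m) gains a factor c^s, c < 1.  For bounded Omega, Cauchy-Schwarz in
   the other m - 1 variables reduces this to convolutions with the slices of the kernel;
   homogeneity allows averaging over the dilations 1 + k/M, k < M, and these are almost
   orthogonal because a function with mean zero on small cubes only sees the cubes
   meeting the boundary of a shell.  For Omega in L^q one truncates Omega at a level
   growing exponentially in s; the remainder is controlled by AM-GM, and this is where
   q > 2m/(m+1) enters.
   Summation over r: expand f_i = (f_i - E_r f_i) + E_r f_i and let S be the set of
   indices carrying the difference.  S = 0 vanishes since Omega has mean zero.  For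
   |S| >= 2 the averages are bounded by maximal functions, and
   (sum_r |.|)^(2/|S|) <= sum_r |.|^(2/|S|) reduces to square-summability of martingale
   differences.  For |S| = 1 the sum is a martingale transform, handled by Abel summation
   and Doob's inequality, up to terms which again carry two differences.
   The general statement follows by Fatou's lemma, approximating Omega by truncations
   and f_j by E_r f_j, and the principal value by dyadic truncations. *)
Require Import Defs.
From HB Require Import structures.
From mathcomp Require Import all_boot all_order all_algebra complex.
From mathcomp Require Import all_classical all_reals all_analysis.
From mathcomp Require Import measurable_realfun ring lra zify.
Set Implicit Arguments.
Unset Strict Implicit.
Unset Printing Implicit Defensive.
Import Order.TTheory GRing.Theory Num.Theory.
Import numFieldNormedType.Exports.
Local Open Scope classical_set_scope.
Local Open Scope ring_scope.

(** The exponent 2/m can be below 1, where neither duality nor the triangle inequality is at hand.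
    Its use is therefore localized: on a cube of side l_r the operator T_r only sees neighbouring
    cubes, so its L^2 decay bounds cube averages by products of local square functions, and
    concavity of t^p turns averages of |F| into averages of |F|^p. Dilations are needed because a
    slice of a rough kernel has no regularity. A T T* argument and one more Cauchy-Schwarz replace
    the dilations by their differences, at least 1/M for distinct indices, and a function
    oscillating at scale M^-2 still oscillates after such a dilation. The critical exponent is the
    one for which weighted AM-GM bounds the kernel times m+1 functions, the inputs and a dual
    function, by terms k^q f_a^2 and the product of all squares, each of which Fubini integrates to
    norms. The final Fatou argument must also cover truncated integrals and limits that do not
    exist; both are worth 0 by convention. *)

Lemma prode_const (R : realType) (p : nat) (x : R) :
  (\prod_(j < p) x%:E = (x ^+ p)%:E)%E.
Proof.
by rewrite big_const_ord; elim: p => [|p ih]; rewrite ?expr0//= ih exprS EFinM.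
Qed.

(** * Lebesgue measure on matrices *)

Section leb.
Variable R : realType.
Notation lam := (@lebesgue_measure R).

Lemma tuple_lebesgue_box N (C : 'I_N -> set R) :
  (forall k, measurable (C k)) ->
  tuple_lebesgue R N [set t | forall k, C k (tnth t k)] =
  (\prod_(k < N) lam (C k))%E.
Proof.
elim: N C => [|N IH] C mC.
  rewrite big_ord0.
  rewrite (_ : [set t | _] = setT); last by apply/seteqP; split => // t _ [].
  exact: diracT.
rewrite big_ord_recl /= /image_measure /= /pushforward.
rewrite (_ : _ @^-1` _ = C ord0 `*`
    [set t | forall k, C (lift ord0 k) (tnth t k)]).
  rewrite product_measure1E.
  - by congr (_ * _)%E; apply: IH => k; exact: mC.
  - exact: mC.
  - rewrite (_ : [set t | _] = \bigcap_(k in [set: 'I_N])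
       ((fun t : N.-tuple (measurableTypeR R) => tnth t k) @^-1` C (lift ord0 k))).
      apply: fin_bigcap_measurable; first exact: finite_finset.
      move=> k _; rewrite -[X in measurable X]setTI.
      by apply: measurable_tnth => //; exact: mC.
    by apply/seteqP; split => t /= h k; [move=> _|]; exact: h.
apply/seteqP; split => -[x t] /= h.
  split; first by have := h ord0; rewrite tnth0.
  by move=> k; have := h (lift ord0 k); rewrite tnthS.
move=> k; case: (unliftP ord0 k) => [j ->|->]; last by rewrite tnth0; case: h.
by rewrite tnthS; case: h.
Qed.

Variables m n : nat.
Notation M := 'M[R]_(m, n).

Definition box (B : 'I_m -> 'I_n -> set R) : set M :=
  [set y | forall i j, B i j (y i j)].

Lemma measurable_box B : (forall i j, measurable (B i j)) -> measurable (box B).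
Proof.
move=> mB.
rewrite (_ : box B = \bigcap_(i in [set: 'I_m]) \bigcap_(j in [set: 'I_n])
   ((fun y : M => y i j) @^-1` B i j)).
  apply: fin_bigcap_measurable; first exact: finite_finset.
  move=> i _; apply: fin_bigcap_measurable; first exact: finite_finset.
  move=> j _; rewrite -[X in measurable X]setTI.
  by apply: measurable_coord.
by apply/seteqP; split => t /= h i; [move=> _ j _; exact: h|move=> j; exact: h].
Qed.

Lemma mx_lebesgue_box B : (forall i j, measurable (B i j)) ->
  mx_lebesgue R m n (box B) = (\prod_(i < m) \prod_(j < n) lam (B i j))%E.
Proof.
move=> mB; rewrite /mx_lebesgue /image_measure /= /pushforward.
have [f ef fe] := curry_mxvec_bij m n.
pose C k := B (f k).1 (f k).2.
rewrite (_ : _ @^-1` _ = [set t | forall k, C k (tnth t k)]).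
  rewrite tuple_lebesgue_box => [|k]; last exact: mB.
  rewrite pair_big/= (reindex (uncurry (@mxvec_index m n))) /=.
    by apply: eq_bigr => -[i j] _; rewrite /C ef.
  by exists f => k _; rewrite ?ef ?fe.
apply/seteqP; split => t /= h.
  move=> k; have := h (f k).1 (f k).2; rewrite mxE /C.
  by have := fe k; case: (f k) => i j /= ->.
by move=> i j; have := h (mxvec_index i j); rewrite mxE /C (ef (i, j)).
Qed.

Lemma boxI B B' : box B `&` box B' = box (fun i j => B i j `&` B' i j).
Proof.
apply/seteqP; split => t /=; first by move=> [h h'] i j; split; auto.
by move=> h; split => i j; have [] := h i j.
Qed.

Definition cbox (k : nat) : set M := box (fun _ _ => `[- k%:R, k%:R]%classic).

Lemma mx_lebesgue_cbox k : (mx_lebesgue R m n (cbox k) < +oo)%E.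
Proof.
rewrite mx_lebesgue_box => [|i j]; last exact: measurable_itv.
set I := [set` _]; set c := (k%:R - - k%:R : R).
suff -> : (\prod_(i < m) \prod_(j < n) lam I = (c ^+ n ^+ m)%:E)%E by rewrite ltry.
have l2 : lam I = c%:E.
  rewrite /I /c.
  rewrite lebesgue_measure_itv/= lte_fin; case: ifPn => // .
  rewrite -leNgt opprK => h.
  suff -> : k = 0%N by rewrite addr0.
  by apply/eqP; rewrite -leqn0 -(ler_nat R); lra.
by rewrite l2; under eq_bigr do rewrite prode_const; rewrite prode_const.
Qed.

Lemma cbox_cover : \bigcup_k (cbox k) = setT.
Proof.
rewrite -subTset => y _; exists (Num.truncn (\sum_i \sum_j `|y i j|)).+1 => // i j.
rewrite /= in_itv/= -ler_norml.
apply: le_trans (ltW (truncnS_gt _)).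
rewrite (bigD1 i)//= (bigD1 j)//= -addrA lerDl addr_ge0// ?sumr_ge0// => k _.
by rewrite sumr_ge0.
Qed.

Definition box_system : set (set M) :=
  [set A | exists B, (forall i j, measurable (B i j)) /\ A = box B].

Lemma measurable_boxE : @measurable _ M = <<s box_system >>.
Proof.
apply/seteqP; split.
  apply: smallest_sub; first exact: smallest_sigma_algebra.
  move=> _ [i [j [B [mB ->]]]]; apply: sub_sigma_algebra.
  exists (fun i' j' => if (i' == i) && (j' == j) then B else setT); split.
    by move=> i' j'; case: ifP.
  apply/seteqP; split => y /=; last by move=> /(_ i j); rewrite !eqxx.
  by move=> h i' j'; case: ifPn => // /andP[/eqP -> /eqP ->].
apply: smallest_sub; first exact: sigma_algebra_measurable.
by move=> _ [B [mB ->]]; exact: measurable_box.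
Qed.

(** Boxes are stable under intersection, generate the sigma-algebra, and the [cbox k] exhaust the
    space with finite measure. Every change of variables on matrices is thereby checked coordinate
    by coordinate on the line. *)
Lemma box_unique (mu : {measure set M -> \bar R}) :
  (forall B, (forall i j, measurable (B i j)) ->
    mu (box B) = (\prod_(i < m) \prod_(j < n) lam (B i j))%E) ->
  forall A, measurable A -> mu A = mx_lebesgue R m n A.
Proof.
move=> h A mA; apply/esym.
apply: (measure_unique box_system cbox) => //.
- exact: measurable_boxE.
- move=> _ _ [B [mB ->]] [B' [mB' ->]]; rewrite boxI.
  eexists; split; last reflexivity.
  by move=> i j; exact: measurableI.
- by move=> k; eexists; split; last reflexivity; move=> i j; exact: measurable_itv.
- exact: cbox_cover.
- by move=> _ [B [mB ->]]; rewrite h// mx_lebesgue_box.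
- exact: mx_lebesgue_cbox.
Qed.

End leb.

Section leb_sigma.
Variables (R : realType) (m n : nat).

(** The same measure as [mx_lebesgue], under a name that carries the sigma-finite structure required
    by Tonelli and Fubini. *)
Definition leb : set 'M[R]_(m, n) -> \bar R := mx_lebesgue R m n.
HB.instance Definition _ := Measure.on leb.

Let leb_sigma_finite : sigma_finite setT leb.
Proof.
exists (@cbox R m n); first by rewrite cbox_cover.
move=> k; split; last exact: mx_lebesgue_cbox.
by apply: measurable_box => i j; exact: measurable_itv.
Qed.

HB.instance Definition _ := isSFinite.Build _ _ _ leb
  (sfinite_measure_sigma_finite leb_sigma_finite).
HB.instance Definition _ := isSigmaFinite.Build _ _ _ leb leb_sigma_finite.

End leb_sigma.
Arguments leb : clear implicits.

(** * Changes of variables and splitting off a row *)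

Lemma lebesgue_measure_shift (R : realType) (a : R) (A : set R) : measurable A ->
  lebesgue_measure [set x | A (x + a)] = lebesgue_measure A.
Proof.
move=> mA.
have mf : measurable_fun setT (fun x : measurableTypeR R => (x + a : measurableTypeR R)).
  exact: measurable_funD.
have -> : lebesgue_measure [set x | A (x + a)] =
    image_measure mf lebesgue_measure A by [].
apply/esym/lebesgue_measure_unique => // _ [[b c]] _ <-.
rewrite /image_measure/= /pushforward.
rewrite (_ : _ @^-1` _ = `](b - a), (c - a)]%classic).
  rewrite !lebesgue_measure_itv/= !lte_fin ltrD2r; case: ifP => // _.
  by congr EFin; ring.
by apply/seteqP; split => x; rewrite /= !in_itv/= ltrBlDr lerBrDr.
Qed.

Lemma lebesgue_measure_scale (R : realType) (a : R) (A : set R) : 0 < a ->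
  measurable A ->
  lebesgue_measure [set x | A (a * x)] = (a^-1%:E * lebesgue_measure A)%E.
Proof.
move=> a0 mA.
have mf : measurable_fun setT (fun x : measurableTypeR R => (a * x : measurableTypeR R)).
  exact: measurable_funM.
have a0' : 0 <= a by exact: ltW.
suff : lebesgue_measure A =
    mscale (NngNum a0') (image_measure mf lebesgue_measure) A.
  rewrite /mscale/= => ->; rewrite muleA -EFinM mulVf ?gt_eqF// mul1e.
  by [].
apply: lebesgue_measure_unique => // _ [[b c]] _ <-.
transitivity (a%:E * lebesgue_measure [set x | `]b, c]%classic (a * x)%R])%E; last by [].
rewrite (_ : [set x | `]b, c]%classic (a * x)] = `](a^-1 * b), (a^-1 * c)]%classic).
  rewrite !lebesgue_measure_itv/= !lte_fin ltr_pM2l ?invr_gt0//.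
  case: ifP => // _; last by rewrite mule0.
  by rewrite -!EFinD -EFinM; congr EFin; field; exact: lt0r_neq0.
by apply/seteqP; split => x; rewrite /= !in_itv/= ltr_pdivrMl// ler_pdivlMl.
Qed.

Section change_of_variables.
Context {R : realType} {m n : nat}.
Notation M := 'M[R]_(m, n).
Notation lam := (@lebesgue_measure R).

Lemma measurable_shift (a : M) : measurable_fun setT (fun y : M => y + a).
Proof.
apply: measurable_matrix => i j.
under eq_fun do rewrite mxE.
by apply: measurable_funD => //; exact: measurable_coord.
Qed.

Lemma measurable_scale (a : R) : measurable_fun setT (fun y : M => a *: y).
Proof.
apply: measurable_matrix => i j.
under eq_fun do rewrite mxE.
by apply: measurable_funM => //; exact: measurable_coord.
Qed.

Lemma measurable_opp : measurable_fun setT (fun y : M => - y).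
Proof.
apply: measurable_matrix => i j.
under eq_fun do rewrite mxE.
by apply: measurable_funN => //; exact: measurable_coord.
Qed.

Lemma box_preimage (f : M -> M) (g : R -> 'I_m -> 'I_n -> R) B :
  (forall y i j, f y i j = g (y i j) i j) ->
  f @^-1` (box B) = box (fun i j => [set x | B i j (g x i j)]).
Proof. by move=> fg; apply/seteqP; split => y /= h i j; move: (h i j); rewrite fg. Qed.

Lemma leb_shift (a : M) (A : set M) : measurable A ->
  leb R m n [set y | A (y + a)] = leb R m n A.
Proof.
move=> mA.
have := @box_unique R m n (image_measure (measurable_shift a) (leb R m n)).
apply => // B mB.
rewrite /image_measure/= /pushforward (box_preimage (g := fun x i j => x + a i j)).
  rewrite mx_lebesgue_box.
    by do 2 apply: eq_bigr => ? _; rewrite lebesgue_measure_shift.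
  move=> i j; rewrite -[X in measurable X]setTI.
  by apply: measurable_funD.
by move=> y i j; rewrite mxE.
Qed.

Lemma leb_opp (A : set M) : measurable A ->
  leb R m n [set y | A (- y)] = leb R m n A.
Proof.
move=> mA.
have := @box_unique R m n (image_measure measurable_opp (leb R m n)).
apply => // B mB.
rewrite /image_measure/= /pushforward (box_preimage (g := fun x i j => - x)).
  rewrite mx_lebesgue_box.
    by do 2 apply: eq_bigr => ? _; exact: lebesgue_measureN.
  move=> i j; rewrite -[X in measurable X]setTI.
  by apply: measurable_funN.
by move=> y i j; rewrite mxE.
Qed.

Lemma leb_scale (a : R) (A : set M) : 0 < a -> measurable A ->
  leb R m n [set y | A (a *: y)] = ((a ^- (m * n))%:E * leb R m n A)%E.
Proof.
move=> a0 mA.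
have a0' : 0 <= a ^+ (m * n) by exact/exprn_ge0/ltW.
have := @box_unique R m n (mscale (NngNum a0') (image_measure (measurable_scale a) (leb R m n))).
move=> /(_ _ A mA) <-.
  transitivity ((a ^- (m * n))%:E * ((a ^+ (m * n))%:E * leb R m n [set y | A (a *: y)%R]))%E; last by [].
  by rewrite muleA -EFinM mulVf ?mul1e// expf_neq0// gt_eqF.
move=> B mB.
transitivity ((a ^+ (m * n))%:E * leb R m n ((fun y : M => (a *: y)%R) @^-1` box B))%E; first by [].
rewrite (box_preimage (g := fun x i j => a * x)) => [|y i j]; last by rewrite mxE.
rewrite mx_lebesgue_box.
  under eq_bigr do under eq_bigr do rewrite lebesgue_measure_scale//.
  under eq_bigr do rewrite big_split/=.
  rewrite big_split/= muleA; set c := (\big[_/_]_(i < m) _)%E.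
  suff -> : c = (a ^- (m * n))%:E.
    by rewrite -EFinM divff ?mul1e// expf_neq0// gt_eqF.
  rewrite mulnC -exprVn exprM -prode_const.
  by apply: eq_bigr => i _; exact: prode_const.
move=> i j; rewrite -[X in measurable X]setTI.
by apply: measurable_funM.
Qed.

Lemma ge0_integral_comp d (T : measurableType d) (mu : {measure set T -> \bar R})
    (f : T -> T) (c : R) (F : T -> \bar R) :
  0 <= c -> measurable_fun setT f ->
  (forall A, measurable A -> mu (f @^-1` A) = (c%:E * mu A)%E) ->
  measurable_fun setT F -> (forall x, 0 <= F x)%E ->
  (\int[mu]_x F (f x) = c%:E * \int[mu]_x F x)%E.
Proof.
move=> c0 mf h mF F0.
rewrite -(@ge0_integral_pushforward _ _ _ _ R f mf mu setT F)//.
rewrite -(ge0_integral_mscale mu measurableT (NngNum c0))//.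
by apply: eq_measure_integral => A mA _; first [exact: h|exact/esym/h].
Qed.

Variable F : M -> \bar R.
Hypotheses (mF : measurable_fun setT F) (F0 : forall x, (0 <= F x)%E).

Lemma ge0_integral_scale (a : R) : 0 < a ->
  (\int[leb R m n]_x F (a *: x) = (a ^- (m * n))%:E * \int[leb R m n]_x F x)%E.
Proof.
move=> a0; rewrite (@ge0_integral_comp _ _ _ _ (a ^- (m * n)) _ _ (measurable_scale a))//.
  by rewrite invr_ge0 exprn_ge0// ltW.
by move=> A mA; exact: leb_scale.
Qed.

End change_of_variables.

Section insert_row.
Context {R : realType} {m n : nat}.
Implicit Types (i : 'I_m.+1) (v : 'rV[R]_n) (z : 'M[R]_(m, n)).

(** Separates the variable y_i from the other rows; the decay estimate freezes [z] and convolves in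
    [v]. *)
Definition ins i v z : 'M[R]_(m.+1, n) :=
  \matrix_(a, b) if unlift i a is Some a' then z a' b else v 0 b.

Lemma row_ins i v z : row i (ins i v z) = v.
Proof. by apply/rowP => j; rewrite !mxE unlift_none. Qed.

Lemma row_ins_lift i v z a : row (lift i a) (ins i v z) = row a z.
Proof. by apply/rowP => j; rewrite !mxE liftK. Qed.

Lemma measurable_ins i d (T : measurableType d) (f : T -> 'rV[R]_n)
    (g : T -> 'M[R]_(m, n)) : measurable_fun setT f -> measurable_fun setT g ->
  measurable_fun setT (fun x => ins i (f x) (g x)).
Proof.
move=> mf mg; apply: measurable_matrix => a b.
under eq_fun do rewrite mxE.
case: (unlift i a) => [a'|].
  exact: (measurableT_comp (measurable_coord a' b)).
exact: (measurableT_comp (measurable_coord 0 b)).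
Qed.

Let mins i := measurable_ins i (@measurable_fst _ _ 'rV[R]_n 'M[R]_(m, n))
  (@measurable_snd _ _ 'rV[R]_n 'M[R]_(m, n)).

Lemma leb_ins i A : measurable A ->
  (leb R 1 n \x leb R m n)%E [set p | A (ins i p.1 p.2)] = leb R m.+1 n A.
Proof.
move=> mA.
have := @box_unique R m.+1 n (image_measure (mins i) (leb R 1 n \x leb R m n)%E).
apply => // B mB; rewrite /image_measure/= /pushforward.
rewrite (_ : _ @^-1` _ = box (fun _ => B i) `*` box (fun a => B (lift i a))).
  rewrite product_measure1E.
  - rewrite [X in (X * _)%E]mx_lebesgue_box => [|_ j]; last exact: mB.
    rewrite [X in (_ * X)%E]mx_lebesgue_box => [|a j]; last exact: mB.
    by rewrite [RHS](bigD1_ord i)//= big_ord1.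
  - exact: measurable_box.
  - exact: measurable_box.
apply/seteqP; split => -[v z] /= h.
  split => a j /=; first by have := h i j; rewrite mxE unlift_none (ord1 a).
  by have := h (lift i a) j; rewrite mxE liftK.
move=> a j; rewrite mxE; case: unliftP => [a'|] ->; last exact: h.1.
exact: h.2.
Qed.

Lemma ge0_integral_ins i (F : 'M[R]_(m.+1, n) -> \bar R) :
  measurable_fun setT F -> (forall x, 0 <= F x)%E ->
  (\int[leb R m.+1 n]_y F y =
   \int[leb R 1 n \x leb R m n]_p F (ins i p.1 p.2))%E.
Proof.
move=> mF F0.
rewrite -(@ge0_integral_pushforward _ _ _ _ R _ (mins i) _ setT F)//.
by apply: eq_measure_integral => A mA _; first [exact/esym/leb_ins|exact: leb_ins].
Qed.

Lemma ge0_integral_ins_iter i (F : 'M[R]_(m.+1, n) -> \bar R) :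
  measurable_fun setT F -> (forall x, 0 <= F x)%E ->
  (\int[leb R m.+1 n]_y F y =
   \int[leb R 1 n]_v \int[leb R m n]_z F (ins i v z))%E.
Proof.
move=> mF F0; rewrite (ge0_integral_ins i)// fubini_tonelli1//.
exact: (measurableT_comp mF (mins i)).
Qed.

End insert_row.

Lemma leb0 (R : realType) n (F : 'M[R]_(0, n) -> \bar R) :
  (\int[leb R 0 n]_z F z = F 0%R)%E.
Proof.
have -> : F = cst (F 0) by apply/funext => z /=; congr F; apply/matrixP => -[].
transitivity (F 0%R * leb R 0 n setT)%E; first by rewrite integral_cst.
suff -> : leb R 0 n setT = 1%E by rewrite mule1.
rewrite (_ : setT = box (fun _ _ => setT)); last by apply/seteqP; split.
by rewrite [LHS]mx_lebesgue_box// big_ord0.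
Qed.

Lemma measurable_row (R : realType) m n (a : 'I_m) :
  measurable_fun setT (fun y : 'M[R]_(m, n) => row a y).
Proof.
apply: measurable_matrix => i j; under eq_fun do rewrite mxE.
exact: measurable_coord.
Qed.

Lemma emeasurable_prod d (T : measurableType d) (R : realType) (I : Type)
    (s : seq I) (F : I -> T -> \bar R) :
  (forall i, measurable_fun setT (F i)) ->
  measurable_fun setT (fun x => \prod_(i <- s) F i x)%E.
Proof.
move=> mF; elim: s => [|i s IH].
  by under eq_fun do rewrite big_nil; exact: measurable_cst.
by under eq_fun do rewrite big_cons; exact: emeasurable_funM.
Qed.

Lemma measurable_prodr d (T : measurableType d) (R : realType) (I : Type)
    (s : seq I) (F : I -> T -> R) :
  (forall i, measurable_fun setT (F i)) ->
  measurable_fun setT (fun x => \prod_(i <- s) F i x).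
Proof.
move=> mF; elim: s => [|i s IH].
  by under eq_fun do rewrite big_nil; exact: measurable_cst.
by under eq_fun do rewrite big_cons; exact: measurable_funM.
Qed.

Lemma ge0_integral_prod_rows (R : realType) m n (F : 'I_m -> 'rV[R]_n -> \bar R) :
  (forall a, measurable_fun setT (F a)) -> (forall a x, 0 <= F a x)%E ->
  (\int[leb R m n]_y \prod_(a < m) F a (row a y) =
   \prod_(a < m) \int[leb R 1 n]_v F a v)%E.
Proof.
elim: m F => [|m IH] F mF F0; first by rewrite leb0 !big_ord0.
have mrow a : measurable_fun setT (fun y : 'M[R]_(m.+1, n) => F a (row a y)).
  exact: (measurableT_comp (mF a) (measurable_row a)).
rewrite (ge0_integral_ins_iter ord0); last 2 first.
- exact: emeasurable_prod.
- by move=> x; apply: prode_ge0.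
have prow (v : 'rV_n) : (\int[leb R m n]_z \prod_(a < m.+1) F a (row a (ins ord0 v z))
    = F ord0 v * \prod_(a < m) \int[leb R 1 n]_v F (lift ord0 a) v)%E.
  under eq_integral.
    move=> z _; rewrite big_ord_recl row_ins.
    under eq_bigr do rewrite row_ins_lift.
    over.
  rewrite ge0_integralZl//=.
  - by congr (_ * _)%E; apply: IH => a *; [exact: mF|exact: F0].
  - apply: emeasurable_prod => a.
    exact: (measurableT_comp (mF _) (measurable_row a)).
  - by move=> z _; exact: prode_ge0.
under eq_integral do rewrite prow.
rewrite ge0_integralZr//= ?big_ord_recl//.
by apply: prode_ge0 => a _; exact: integral_ge0.
Qed.

Section enorm.
Context {R : realType} {m n : nat}.
Implicit Types y z : 'M[R]_(m, n).

Lemma enorm_ge0 y : 0 <= enorm y. Proof. exact: sqrtr_ge0. Qed.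

Lemma enorm_sqr y : enorm y ^+ 2 = \sum_i \sum_j y i j ^+ 2.
Proof.
by rewrite sqr_sqrtr// sumr_ge0// => i _; rewrite sumr_ge0// => j _; exact: sqr_ge0.
Qed.

Lemma enormZ a y : enorm (a *: y) = `|a| * enorm y.
Proof.
apply/eqP; rewrite -(@eqrXn2 _ 2)// ?mulr_ge0 ?enorm_ge0//.
rewrite exprMn !enorm_sqr real_normK ?num_real// mulr_sumr; apply/eqP.
apply: eq_bigr => i _; rewrite mulr_sumr; apply: eq_bigr => j _.
by rewrite mxE exprMn.
Qed.

Lemma enormN y : enorm (- y) = enorm y.
Proof. by rewrite -scaleN1r enormZ normrN1 mul1r. Qed.

Lemma coord_le_enorm y i j : `|y i j| <= enorm y.
Proof.
rewrite -(@ler_pXn2r _ 2) ?nnegrE ?enorm_ge0// enorm_sqr real_normK ?num_real//.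
rewrite (bigD1 i)//= (bigD1 j)//= -addrA lerDl addr_ge0// ?sumr_ge0// => k _.
  exact: sqr_ge0.
by rewrite sumr_ge0// => l _; exact: sqr_ge0.
Qed.

Lemma enorm_eq0 y : enorm y = 0 -> y = 0.
Proof.
move=> y0; apply/matrixP => i j; rewrite mxE; apply/eqP; rewrite -normr_le0.
by rewrite -y0; exact: coord_le_enorm.
Qed.

Lemma enorm_le (c : R) y : 0 <= c -> (forall i j, `|y i j| <= c) ->
  enorm y <= (m * n)%:R * c.
Proof.
move=> c0 h; rewrite -(@ler_pXn2r _ 2) ?nnegrE ?enorm_ge0 ?mulr_ge0//.
rewrite enorm_sqr exprMn.
apply: (@le_trans _ _ (\sum_(i < m) \sum_(j < n) c ^+ 2)).
  apply: ler_sum => i _; apply: ler_sum => j _.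
  by rewrite -[y i j ^+ 2]real_normK ?num_real// ler_pXn2r ?nnegrE.
rewrite !sumr_const !card_ord -mulrnA -[c ^+ 2 *+ _]mulr_natl.
rewrite ler_wpM2r ?sqr_ge0// -natrX ler_nat mulnC -mulnn.
by case: (m * n)%N => // k; rewrite leq_pmulr.
Qed.

Lemma enorm_triangle y z : enorm (y + z) <= enorm y + enorm z.
Proof.
rewrite -(@ler_pXn2r _ 2) ?nnegrE ?addr_ge0 ?enorm_ge0//.
pose d := \sum_i \sum_j y i j * z i j.
have dD t : enorm (y + t *: z) ^+ 2 = enorm y ^+ 2 + t * d *+ 2 + t ^+ 2 * enorm z ^+ 2.
  rewrite !enorm_sqr /d !mulr_sumr -sumrMnl -!big_split/=.
  apply: eq_bigr => i _; rewrite !mulr_sumr -sumrMnl -!big_split/=.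
  by apply: eq_bigr => j _; rewrite !mxE; ring.
(* Cauchy-Schwarz, read off from the square of [enorm (y + t *: z)] at t = - enorm y / enorm z. *)
have dle : d <= enorm y * enorm z.
  have [z0|z0] := eqVneq (enorm z) 0.
    rewrite z0 mulr0 /d (enorm_eq0 z0).
    by rewrite big1// => i _; rewrite big1// => j _; rewrite mxE mulr0.
  have zp : 0 < enorm z by rewrite lt_def z0 enorm_ge0.
  have := sqr_ge0 (enorm (y + (- (enorm y / enorm z)) *: z)).
  rewrite dD => h.
  rewrite leNgt; apply/negP => hd.
  have yz : 0 <= enorm y / enorm z by rewrite divr_ge0 ?enorm_ge0.
  have e : (enorm y / enorm z) ^+ 2 * enorm z ^+ 2 = enorm y ^+ 2.
    by rewrite exprMn exprVn -mulrA mulVf ?mulr1// expf_neq0.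
  have e2 : enorm y / enorm z * (enorm y * enorm z) = enorm y ^+ 2.
    by rewrite mulrCA -mulrA mulVf// mulr1 expr2.
  rewrite sqrrN e in h.
  have [y0|y0] := eqVneq (enorm y) 0.
    move: hd; rewrite y0 mul0r /d (enorm_eq0 y0).
    by rewrite big1 ?ltxx// => i _; rewrite big1// => j _; rewrite mxE mul0r.
  have yp : 0 < enorm y / enorm z by rewrite divr_gt0// lt_def y0 enorm_ge0.
  have : enorm y / enorm z * (enorm y * enorm z) < enorm y / enorm z * d by rewrite ltr_pM2l.
  by rewrite e2; move: h; lra.
have := dD 1; rewrite scale1r => ->; move: dle; lra.
Qed.

Lemma enormB_lip y z : `|enorm y - enorm z| <= enorm (y - z).
Proof.
have h u v : enorm u - enorm v <= enorm (u - v :> 'M[R]_(m, n)).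
  by rewrite lerBlDr -{1}[u](subrK v) enorm_triangle.
by rewrite ler_norml h andbT lerNl opprB -[leRHS]enormN opprB h.
Qed.

End enorm.

Lemma enorm_ins (R : realType) m n (i : 'I_m.+1) (v : 'rV[R]_n) (z : 'M[R]_(m, n)) :
  enorm (ins i v z) ^+ 2 = enorm v ^+ 2 + enorm z ^+ 2.
Proof.
rewrite !enorm_sqr (bigD1_ord i)//= big_ord1; congr (_ + _).
  by apply: eq_bigr => j _; rewrite mxE unlift_none.
by apply: eq_bigr => a _; apply: eq_bigr => j _; rewrite mxE liftK.
Qed.

Lemma ins_scale (R : realType) m n (i : 'I_m.+1) t (v : 'rV[R]_n) (z : 'M[R]_(m, n)) :
  t *: ins i v z = ins i (t *: v) (t *: z).
Proof. by apply/matrixP => a b; rewrite !mxE; case: unlift => [a'|]; rewrite ?mxE. Qed.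

(** * Real-valued integrals and Fubini's theorem *)

Section Rintegrals.
Local Open Scope ring_scope.
Context d (T : measurableType d) (R : realType).
Variable mu : {measure set T -> \bar R}.

Lemma integrable_dom (f g : T -> R) : measurable_fun setT f ->
  (forall x, `|f x| <= g x) -> mu.-integrable setT (EFin \o g) ->
  mu.-integrable setT (EFin \o f).
Proof.
move=> mf fg; apply: le_integrable => //; first exact/measurable_EFinP.
by move=> x _; rewrite /= lee_fin (le_trans (fg x))// ler_norm.
Qed.

Lemma integrable_ge0 (g : T -> R) : measurable_fun setT g -> (forall x, 0 <= g x) ->
  (\int[mu]_x (g x)%:E < +oo)%E -> mu.-integrable setT (EFin \o g).
Proof.
move=> mg g0 h; apply/integrableP; split; first exact/measurable_EFinP.
by under eq_integral do rewrite /= ger0_norm//.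
Qed.

Lemma EFin_Rintegral (f : T -> R) : mu.-integrable setT (EFin \o f) ->
  (\int[mu]_x f x)%:E = (\int[mu]_x (f x)%:E)%E.
Proof. by move=> h; rewrite /Rintegral fineK//; exact: integrable_fin_num. Qed.

Lemma Rintegral_sumr (I : Type) (s : seq I) (f : I -> T -> R) :
  (forall i, mu.-integrable setT (EFin \o f i)) ->
  mu.-integrable setT (EFin \o (fun x => \sum_(i <- s) f i x)) /\
  \int[mu]_x (\sum_(i <- s) f i x) = \sum_(i <- s) \int[mu]_x f i x.
Proof.
move=> h; elim: s => [|i s [IH1 IH2]].
  split; first by under [X in EFin \o X]eq_fun do rewrite big_nil; exact: integrable0.
  by under eq_Rintegral do rewrite big_nil; rewrite Rintegral_cst// mul0r big_nil.
under [X in EFin \o X]eq_fun do rewrite big_cons.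
split; first by have := integrableD measurableT (h i) IH1; apply: eq_integrable.
by under eq_Rintegral do rewrite big_cons; rewrite RintegralD// IH2 big_cons.
Qed.

Lemma Rintegral_comp (f : T -> T) (c : R) (F : T -> R) :
  0 <= c -> measurable_fun setT f ->
  (forall A, measurable A -> mu (f @^-1` A) = (c%:E * mu A)%E) ->
  mu.-integrable setT (EFin \o F) ->
  mu.-integrable setT (EFin \o (F \o f)) /\
  \int[mu]_x F (f x) = c * \int[mu]_x F x.
Proof.
move=> c0 mf h iF.
have mF : measurable_fun setT F by exact/measurable_EFinP/(measurable_int mu iF).
have iFf : mu.-integrable setT (EFin \o (F \o f)).
  have /integrableP[_ Foo] := iF.
  apply/integrableP; split; first by apply/measurable_EFinP; exact: measurableT_comp.
  have -> : (\int[mu]_x `|(EFin \o (F \o f)) x| = c%:E * \int[mu]_x `|(EFin \o F) x|)%E.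
    have := @ge0_integral_comp R _ _ mu f c (fun x => `|(EFin \o F) x|)%E; apply => //.
    by apply: measurableT_comp => //; exact/measurable_EFinP.
  by apply: lte_mul_pinfty.
split => //.
apply: EFin_inj; rewrite EFin_Rintegral// EFinM EFin_Rintegral//.
rewrite integralE [in RHS]integralE.
have iP := integrable_funepos measurableT iF.
have iN := integrable_funeneg measurableT iF.
rewrite muleBr//; last first.
  by apply: fin_num_adde_defr; exact: integrable_fin_num.
have mP := measurable_funepos (measurable_int mu iF).
have mN := measurable_funeneg (measurable_int mu iF).
congr (_ - _)%E.
  rewrite -(@ge0_integral_comp R _ _ mu f c (EFin \o F)^\+%E c0 mf h mP).
    by apply: eq_integral => x _; rewrite !funeposE.
  by move=> x; exact: funepos_ge0.
rewrite -(@ge0_integral_comp R _ _ mu f c (EFin \o F)^\-%E c0 mf h mN).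
  by apply: eq_integral => x _; rewrite !funenegE.
by move=> x; exact: funeneg_ge0.
Qed.

End Rintegrals.

Section Rfubini.
Context d1 d2 (T1 : measurableType d1) (T2 : measurableType d2) (R : realType).
Variables (m1 : {sigma_finite_measure set T1 -> \bar R})
  (m2 : {sigma_finite_measure set T2 -> \bar R}).
Variable f : T1 * T2 -> R.
Hypothesis mf : measurable_fun setT f.
Hypothesis foo : (\int[m1]_x \int[m2]_y `|f (x, y)|%:E < +oo)%E.

Let integrable_prod : (m1 \x m2)%E.-integrable setT (EFin \o f).
Proof. by apply/(integrable12ltyP m1 m2); first exact/measurable_EFinP. Qed.

Lemma Rfubini1 : \int[m1]_x \int[m2]_y f (x, y) = \int[(m1 \x m2)%E]_z f z.
Proof.
apply: (congr1 fine); rewrite -(integral12_prod_meas1 integrable_prod).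
(* The inner real integral agrees with the extended one only where the section is integrable, hence
   almost everywhere. *)
apply: ae_eq_integral => //.
- apply/measurable_EFinP; apply: (measurableT_comp (@fine_measurable R setT measurableT)).
  exact: (measurable_fubini_F integrable_prod).
- exact: (measurable_fubini_F integrable_prod).
apply: filterS (ae_integrable1 integrable_prod) => x /= ix _.
by rewrite /Rintegral fineK//; exact: integrable_fin_num.
Qed.

Lemma Rfubini2 : \int[m2]_y \int[m1]_x f (x, y) = \int[(m1 \x m2)%E]_z f z.
Proof.
apply: (congr1 fine); rewrite -(integral21_prod_meas1 integrable_prod).
apply: ae_eq_integral => //.
- apply/measurable_EFinP; apply: (measurableT_comp (@fine_measurable R setT measurableT)).
  exact: (measurable_fubini_G integrable_prod).
- exact: (measurable_fubini_G integrable_prod).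
apply: filterS (ae_integrable2 integrable_prod) => x /= ix _.
by rewrite /Rintegral fineK//; exact: integrable_fin_num.
Qed.

Lemma Rfubini : \int[m1]_x \int[m2]_y f (x, y) = \int[m2]_y \int[m1]_x f (x, y).
Proof. by rewrite Rfubini1 Rfubini2. Qed.

End Rfubini.

(* [n2] is sealed: conversion would otherwise unfold the square root. *)
Fact n2_seal : {N : forall d (T : measurableType d) (R : realType),
   {measure set T -> \bar R} -> (T -> R) -> R |
   forall d T R mu f, N d T R mu f = Num.sqrt (\int[mu]_x f x ^+ 2)}.
Proof. by eexists; move=> *; reflexivity. Qed.
Definition n2 d (T : measurableType d) (R : realType) := sval n2_seal d T R.

(** * Bounded integrable functions and their L^2 norm *)

Section nice.
Context d (T : measurableType d) (R : realType).
Variable mu : {measure set T -> \bar R}.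
Implicit Types f g u : T -> R.

Definition bdd f := exists B, forall x, `|f x| <= B.

(** The working class of the proof. Its members are square integrable and it is stable under
    products and averages, so that the integrals below are genuine finite ones. Components of
    Schwartz functions belong to it. *)
Definition nice f :=
  [/\ measurable_fun setT f, bdd f & mu.-integrable setT (EFin \o f)].

Lemma nice_meas f : nice f -> measurable_fun setT f. Proof. by case. Qed.
Lemma nice_bdd f : nice f -> bdd f. Proof. by case. Qed.
Lemma nice_int f : nice f -> mu.-integrable setT (EFin \o f). Proof. by case. Qed.

Lemma nice0 : nice (fun=> 0).
Proof. by split; [exact: measurable_cst|exists 0 => x; rewrite normr0|exact: integrable0]. Qed.

Lemma niceD f g : nice f -> nice g -> nice (fun x => f x + g x).
Proof.
move=> [mf [B fB] fi] [mg [C gC] gi]; split; first exact: measurable_funD.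
  by exists (B + C) => x; rewrite (le_trans (ler_normD _ _))// lerD.
by have := integrableD measurableT fi gi; apply: eq_integrable.
Qed.

Lemma niceZ c f : nice f -> nice (fun x => c * f x).
Proof.
move=> [mf [B fB] fi]; split; first exact: measurable_funM.
  by exists (`|c| * B) => x; rewrite normrM ler_wpM2l.
by have := integrableZl measurableT c fi; apply: eq_integrable.
Qed.

Lemma nice_dom f g : nice g -> measurable_fun setT f ->
  (forall x, `|f x| <= `|g x|) -> nice f.
Proof.
move=> [mg [C gC] gi] mf fg; split => //; first by exists C => x; exact: le_trans (fg x) _.
apply: (integrable_dom mf fg).
by have := integrable_norm gi; apply: eq_integrable.
Qed.

Lemma niceN f : nice f -> nice (fun x => - f x).
Proof.
move=> nf; apply: (nice_dom nf) => [|x]; last by rewrite normrN.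
exact/measurable_funN/nice_meas.
Qed.

Lemma niceB f g : nice f -> nice g -> nice (fun x => f x - g x).
Proof. by move=> nf /niceN; exact: niceD. Qed.

Lemma nice_norm f : nice f -> nice (fun x => `|f x|).
Proof.
move=> nf; apply: (nice_dom nf) => [|x]; last by rewrite normr_id.
exact: (measurableT_comp _ (nice_meas nf)).
Qed.

Lemma niceM f u : nice f -> measurable_fun setT u -> bdd u ->
  nice (fun x => f x * u x).
Proof.
move=> nf mu_ [B uB]; apply: (nice_dom (niceZ B nf)).
  exact: measurable_funM (nice_meas nf) mu_.
by move=> x; rewrite !normrM mulrC ler_wpM2r// (le_trans (uB x))// ler_norm.
Qed.

Lemma niceMl f u : nice f -> measurable_fun setT u -> bdd u ->
  nice (fun x => u x * f x).
Proof.
by move=> nf mu_ bu; under eq_fun do rewrite mulrC; exact: niceM.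
Qed.

Lemma niceMM f g : nice f -> nice g -> nice (fun x => f x * g x).
Proof. by move=> nf [mg bg _]; exact: niceM. Qed.

Lemma niceX2 f : nice f -> nice (fun x => f x ^+ 2).
Proof. by move=> nf; exact: niceMM. Qed.

Lemma nice_sum (I : Type) (s : seq I) (F : I -> T -> R) :
  (forall i, nice (F i)) -> nice (fun x => \sum_(i <- s) F i x).
Proof.
move=> nF; elim: s => [|i s IH].
  by under eq_fun do rewrite big_nil; exact: nice0.
by under eq_fun do rewrite big_cons; exact: niceD.
Qed.

Lemma le_int f g : nice f -> nice g -> (forall x, f x <= g x) ->
  \int[mu]_x f x <= \int[mu]_x g x.
Proof. by move=> /nice_int nf /nice_int ng fg; exact: le_Rintegral. Qed.

Lemma intD f g : nice f -> nice g ->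
  \int[mu]_x (f x + g x) = \int[mu]_x f x + \int[mu]_x g x.
Proof. by move=> /nice_int nf /nice_int ng; exact: RintegralD. Qed.

Lemma intB f g : nice f -> nice g ->
  \int[mu]_x (f x - g x) = \int[mu]_x f x - \int[mu]_x g x.
Proof. by move=> /nice_int nf /nice_int ng; exact: RintegralB. Qed.

Lemma intZ c f : nice f -> \int[mu]_x (c * f x) = c * \int[mu]_x f x.
Proof. by move=> /nice_int nf; exact: RintegralZl. Qed.

Lemma int_sum (I : Type) (s : seq I) (F : I -> T -> R) :
  (forall i, nice (F i)) ->
  \int[mu]_x (\sum_(i <- s) F i x) = \sum_(i <- s) \int[mu]_x F i x.
Proof. by move=> nF; have [] := @Rintegral_sumr _ _ _ mu _ s F (fun i => nice_int (nF i)). Qed.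

Lemma le_norm_int f : nice f -> `|\int[mu]_x f x| <= \int[mu]_x `|f x|.
Proof. by move=> /nice_int nf; exact: le_normr_Rintegral. Qed.

Lemma int_ge0 f : (forall x, 0 <= f x) -> 0 <= \int[mu]_x f x.
Proof. by move=> f0; apply: Rintegral_ge0. Qed.

Notation n2 := (n2 mu).

Lemma n2E f : n2 f = Num.sqrt (\int[mu]_x f x ^+ 2).
Proof. exact: (svalP n2_seal). Qed.

Lemma n2_ge0 f : 0 <= n2 f. Proof. by rewrite n2E sqrtr_ge0. Qed.

Lemma n2_sqr f : n2 f ^+ 2 = \int[mu]_x f x ^+ 2.
Proof. by rewrite n2E sqr_sqrtr// int_ge0// => x; exact: sqr_ge0. Qed.

Lemma int_CS2 f g : nice f -> nice g ->
  (\int[mu]_x (f x * g x)) ^+ 2 <= (\int[mu]_x f x ^+ 2) * \int[mu]_x g x ^+ 2.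
Proof.
move=> nf ng.
set a := \int[mu]_x f x ^+ 2; set b := \int[mu]_x (f x * g x).
set c := \int[mu]_x g x ^+ 2.
have a0 : 0 <= a by apply: int_ge0 => x; exact: sqr_ge0.
have c0 : 0 <= c by apply: int_ge0 => x; exact: sqr_ge0.
have h t : 0 <= a + t * b *+ 2 + t ^+ 2 * c.
  have -> : a + t * b *+ 2 + t ^+ 2 * c = \int[mu]_x (f x + t * g x) ^+ 2.
    have -> : (fun x => (f x + t * g x) ^+ 2) =
       (fun x => (f x ^+ 2 + (t *+ 2) * (f x * g x)) + t ^+ 2 * g x ^+ 2).
      by apply/funext => x; ring.
    rewrite intD; last 2 first.
    - apply: niceD; first exact: niceX2.
      by apply: niceZ; exact: niceMM.
    - by apply: niceZ; exact: niceX2.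
    rewrite intD; [|exact: niceX2|by apply: niceZ; exact: niceMM].
    rewrite !intZ; [|exact: niceX2|exact: niceMM].
    by rewrite mulrnAl.
  by apply: int_ge0 => x; exact: sqr_ge0.
have [c1|c1] := eqVneq c 0.
  rewrite c1 mulr0; suff -> : b = 0 by rewrite expr0n.
  apply/eqP; apply: contraT => b0.
  (* For c = 0 the nonnegative quadratic is affine in t, and with b nonzero this t would give it the
     value -1. *)
  have := h (- (a + 1) / (b *+ 2)); rewrite c1 mulr0 addr0 -mulrnAr -mulrA mulVf.
    by rewrite mulr1; lra.
  by rewrite mulrn_eq0.
have cp : 0 < c by rewrite lt_def c1.
have := h (- b / c).
have -> : a + - b / c * b *+ 2 + (- b / c) ^+ 2 * c = a - b ^+ 2 / c.
  by field.
by rewrite subr_ge0 ler_pdivrMr.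
Qed.

Lemma int_CS f g : nice f -> nice g -> `|\int[mu]_x (f x * g x)| <= n2 f * n2 g.
Proof.
move=> nf ng; rewrite -(@ler_pXn2r _ 2) ?nnegrE ?mulr_ge0 ?n2_ge0//.
by rewrite real_normK ?num_real// exprMn !n2_sqr int_CS2.
Qed.

Lemma n2D f g : nice f -> nice g -> n2 (fun x => f x + g x) <= n2 f + n2 g.
Proof.
move=> nf ng; rewrite -(@ler_pXn2r _ 2) ?nnegrE ?addr_ge0 ?n2_ge0//.
rewrite n2_sqr.
have -> : (fun x => (f x + g x) ^+ 2) =
    (fun x => (f x ^+ 2 + 2 * (f x * g x)) + g x ^+ 2).
  by apply/funext => x; ring.
have nfg := niceMM nf ng.
rewrite intD; [|by apply: niceD; [exact: niceX2|exact: niceZ]|exact: niceX2].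
rewrite intD; [|exact: niceX2|exact: niceZ].
rewrite intZ// -!n2_sqr.
by have := le_trans (ler_norm _) (int_CS nf ng); lra.
Qed.

Lemma n2Z c f : nice f -> n2 (fun x => c * f x) = `|c| * n2 f.
Proof.
move=> nf; apply/eqP; rewrite -(@eqrXn2 _ 2)// ?mulr_ge0 ?n2_ge0//.
rewrite exprMn !n2_sqr real_normK ?num_real//; apply/eqP.
under eq_Rintegral do rewrite exprMn.
by rewrite intZ//; exact: niceX2.
Qed.

Lemma n2_norm f : n2 (fun x => `|f x|) = n2 f.
Proof.
by rewrite !n2E; congr Num.sqrt; apply: eq_Rintegral => x _; rewrite real_normK ?num_real.
Qed.

Lemma n20 : n2 (fun=> 0) = 0.
Proof. by rewrite n2E expr0n/= Rintegral_cst// mul0r sqrtr0. Qed.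

Lemma n2_sum (I : Type) (s : seq I) (F : I -> T -> R) : (forall i, nice (F i)) ->
  n2 (fun x => \sum_(i <- s) F i x) <= \sum_(i <- s) n2 (F i).
Proof.
move=> nF; elim: s => [|i s IH].
  by under [X in n2 X]eq_fun do rewrite big_nil; rewrite n20 big_nil.
under [X in n2 X]eq_fun do rewrite big_cons.
rewrite big_cons (le_trans (n2D (nF i) (nice_sum s nF)))//.
by rewrite lerD2l.
Qed.

Lemma le_n2 f g : nice f -> nice g -> (forall x, `|f x| <= `|g x|) -> n2 f <= n2 g.
Proof.
move=> nf ng fg; rewrite !n2E ler_wsqrtr// le_int//; [exact: niceX2|exact: niceX2|].
move=> x; rewrite -[leLHS]real_normK ?num_real// -[leRHS]real_normK ?num_real//.
by rewrite ler_pXn2r ?nnegrE.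
Qed.

Lemma n2_dual f C : nice f -> 0 <= C ->
  (forall g, nice g -> `|\int[mu]_x (f x * g x)| <= C * n2 g) -> n2 f <= C.
Proof.
move=> nf C0 /(_ f nf); have -> : \int[mu]_x (f x * f x) = n2 f ^+ 2 by rewrite n2_sqr.
rewrite ger0_norm ?sqr_ge0// expr2.
have [->//|f0] := eqVneq (n2 f) 0.
by rewrite ler_pM2r// lt_def f0 n2_ge0.
Qed.

End nice.
Arguments n2 {d T R} mu f.
Arguments nice {d T R} mu f.

Lemma measurable_boolR d (T : measurableType d) (R : realType) (b : T -> bool) :
  measurable_fun setT b -> measurable_fun setT (fun t => (b t)%:R : R).
Proof. by move=> mb; apply: (measurableT_comp (f := fun c : bool => c%:R : R)). Qed.

Lemma measurable_forall d (T : measurableType d) (I : finType) (b : I -> T -> bool) :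
  (forall i, measurable_fun setT (b i)) ->
  measurable_fun setT (fun t => [forall i, b i t]).
Proof.
move=> mb.
rewrite (_ : (fun t => _) = (fun t => \big[andb/true]_(i : I) b i t)); last first.
  by apply/funext => t; rewrite big_andE; apply: eq_forallb.
elim: (index_enum I) => [|i s IH].
  by under eq_fun do rewrite big_nil; exact: measurable_cst.
by under eq_fun do rewrite big_cons; exact: measurable_and.
Qed.

(** * Dyadic averages *)

Section cubes.
Context {R : realType} {n : nat}.
Notation V := 'rV[R]_n.
Notation mu := (leb R 1 n).
Implicit Types (x y z : V) (l : R) (f g u : V -> R).

Definition gfl l x (i : 'I_n) : int := Num.floor (x 0 i / l).
Definition same l x y := [forall i, gfl l x i == gfl l y i].
(** The width two is dictated by the kernels: one supported in enorm y <= 2 l moves a point by at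
    most 2 l in each coordinate, see [dist_near2]. *)
Definition near2 l x y := [forall i, `|gfl l x i - gfl l y i| <= 2].

Lemma measurable_gfl l i : measurable_fun setT (fun x : V => (gfl l x i)%:~R : R).
Proof.
have mf : measurable_fun setT (fun t : R => (Num.floor t)%:~R : R).
  apply: nondecreasing_measurable => // s t st.
  by rewrite ler_int le_floor.
apply: (measurableT_comp mf).
by apply: measurable_funM => //; exact: measurable_coord.
Qed.

Lemma measurable_same d (T : measurableType d) l (f g : T -> V) :
  measurable_fun setT f -> measurable_fun setT g ->
  measurable_fun setT (fun t => (same l (f t) (g t))%:R : R).
Proof.
move=> mf mg; apply: measurable_boolR; apply: measurable_forall => i.
under eq_fun do rewrite -(eqr_int R).
by apply: measurable_fun_eqr; exact: (measurableT_comp (measurable_gfl l i)).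
Qed.

Lemma measurable_near2 d (T : measurableType d) l (f g : T -> V) :
  measurable_fun setT f -> measurable_fun setT g ->
  measurable_fun setT (fun t => (near2 l (f t) (g t))%:R : R).
Proof.
move=> mf mg; apply: measurable_boolR; apply: measurable_forall => i.
under eq_fun do rewrite -(ler_int R) intr_norm rmorphB/=.
apply: measurable_fun_ler => //; apply: (measurableT_comp _) => //.
by apply: measurable_funB; exact: (measurableT_comp (measurable_gfl l i)).
Qed.

Lemma same_sym l x y : same l x y = same l y x.
Proof. by apply: eq_forallb => i; rewrite eq_sym. Qed.

Lemma same_eqP l x y : same l x y -> gfl l x =1 gfl l y.
Proof. by move=> /forallP h i; apply/eqP. Qed.

Lemma same_transl l x y z : same l x y -> same l x z = same l y z.
Proof. by move=> /same_eqP h; apply: eq_forallb => i; rewrite h. Qed.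

Lemma near2_transl l x y z : same l x y -> near2 l x z = near2 l y z.
Proof. by move=> /same_eqP h; apply: eq_forallb => i; rewrite h. Qed.

Lemma near2_sym l x y : near2 l x y = near2 l y x.
Proof. by apply: eq_forallb => i; rewrite distrC. Qed.

Lemma same_near2 l x y : same l x y -> near2 l x y.
Proof. by move=> /same_eqP h; apply/forallP => i; rewrite h subrr. Qed.

Lemma same_half l x y : 0 < l -> same (l / 2) x y -> same l x y.
Proof.
move=> l0 /same_eqP h; apply/forallP => i; have {h} := h i.
rewrite /gfl invf_div !mulrA.
set a := x 0 i * 2 / l; set b := y 0 i * 2 / l => ab; rewrite [_ == _]eq_sym; apply/eqP.
have ea : x 0 i / l = a / 2 by rewrite /a; field; exact: lt0r_neq0.
have eb : y 0 i / l = b / 2 by rewrite /b; field; exact: lt0r_neq0.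
rewrite ea eb; apply: floor_def.
have := floor_itv (a / 2); set k := Num.floor (a / 2) => /andP[h1 h2].
have k1 : (2 * k <= Num.floor a)%R.
  by rewrite floor_ge_int intrM; move: h1; lra.
have k2 : (Num.floor a < 2 * k + 2)%R.
  by rewrite floor_lt_int rmorphD/= intrM; move: h2; rewrite rmorphD/=; lra.
rewrite ab in k1 k2.
move: k1 k2; rewrite floor_ge_int floor_lt_int !rmorphD/= !intrM => k1 k2.
by apply/andP; split; lra.
Qed.

Lemma gfl_itv l x i : 0 < l ->
  (gfl l x i)%:~R * l <= x 0 i < (gfl l x i + 1)%:~R * l.
Proof.
move=> l0; have := floor_itv (x 0 i / l).
by rewrite -/(gfl l x i) ler_pdivlMr// ltr_pdivrMr.
Qed.

Lemma near2_dist l x y i : 0 < l -> near2 l x y -> `|x 0 i - y 0 i| <= 3 * l.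
Proof.
move=> l0 /forallP/(_ i); rewrite -(ler_int R) intr_norm rmorphB/=.
have := gfl_itv x i l0; have := gfl_itv y i l0; rewrite !rmorphD/=.
set a := (gfl l x i)%:~R; set b := (gfl l y i)%:~R.
move=> /andP[h1 h2] /andP[h3 h4]; rewrite !ler_norml => /andP[h5 h6].
have : (a - b) * l <= 2 * l by rewrite ler_pM2r.
have : (- 2) * l <= (a - b) * l by rewrite ler_pM2r.
by move=> h7 h8; apply/andP; split; lra.
Qed.

Lemma same_dist l x y i : 0 < l -> same l x y -> `|x 0 i - y 0 i| <= l.
Proof.
move=> l0 /forallP/(_ i) /eqP h.
have := gfl_itv x i l0; have := gfl_itv y i l0; rewrite h !rmorphD/=.
move=> /andP[h1 h2] /andP[h3 h4]; rewrite ler_norml.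
by apply/andP; split; lra.
Qed.

Lemma dist_near2 l x y : 0 < l -> (forall i, `|x 0 i - y 0 i| <= 2 * l) -> near2 l x y.
Proof.
move=> l0 h; apply/forallP => i; have := h i.
have := gfl_itv x i l0; have := gfl_itv y i l0; rewrite !rmorphD/=.
move=> /andP[h1 h2] /andP[h3 h4]; rewrite !ler_norml => /andP[h5 h6].
have h7 : ((gfl l x i)%:~R : R) * l < ((gfl l y i)%:~R + 3) * l by lra.
have h8 : ((gfl l y i)%:~R : R) * l < ((gfl l x i)%:~R + 3) * l by lra.
move: h7 h8; rewrite !ltr_pM2r// -[3]/(3%:~R) -!rmorphD/= !ltr_int => h7 h8.
by apply/andP; split; lia.
Qed.

Definition cube (a : 'I_n -> R) (l : R) : set V :=
  [set y | forall i, a i <= y 0 i < a i + l].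

Lemma cube_box a l : cube a l = box (fun _ i => `[a i, (a i + l)[%classic).
Proof.
apply/seteqP; split => y /= h; first by move=> i j; rewrite /= in_itv/= ord1 h.
by move=> j; have := h 0 j; rewrite /= in_itv.
Qed.

Lemma measurable_cube a l : measurable (cube a l).
Proof. by rewrite cube_box; apply: measurable_box => i j; exact: measurable_itv. Qed.

Lemma leb_cube a l : 0 <= l -> mu (cube a l) = (l ^+ n)%:E.
Proof.
move=> l0; rewrite cube_box [LHS]mx_lebesgue_box => [|i j]; last exact: measurable_itv.
rewrite big_ord1 -prode_const; apply: eq_bigr => i _.
rewrite lebesgue_measure_itv/= lte_fin ltrDl; case: ifP => h.
  by rewrite -EFinB; congr EFin; ring.
by congr EFin; apply/esym/eqP; rewrite eq_le l0 andbT leNgt h.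
Qed.

Lemma same_cube l x : 0 < l ->
  [set y | same l x y] = cube (fun i => (gfl l x i)%:~R * l) l.
Proof.
move=> l0; apply/seteqP; split => y /= h.
  move=> i; have := gfl_itv y i l0; rewrite -(same_eqP h) rmorphD/= mulrDl mul1r//.
apply/forallP => i; apply/eqP/esym/floor_def; have := h i.
by rewrite ler_pdivlMr// ltr_pdivrMr// rmorphD/= mulrDl mul1r.
Qed.

(** Five cubes in each direction: the source of the factors 5 ^ n below. *)
Lemma near2_cube l x : 0 < l ->
  [set y | near2 l x y] = cube (fun i => (gfl l x i - 2)%:~R * l) (5 * l).
Proof.
move=> l0; apply/seteqP; split => y /= h.
  move=> i; move: h => /forallP/(_ i); have := gfl_itv y i l0.
  rewrite -(ler_int R) intr_norm !rmorphB !rmorphD/= ler_norml.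
  set a := (gfl l x i)%:~R; set b := (gfl l y i)%:~R.
  move=> /andP[h1 h2] /andP[h3 h4].
  have : (a - 2) * l <= b * l by rewrite ler_pM2r//; lra.
  have : (b + 1) * l <= (a + 3) * l by rewrite ler_pM2r//; lra.
  by move=> h5 h6; apply/andP; split; lra.
apply/forallP => i; have := h i; have := gfl_itv y i l0; rewrite !rmorphB !rmorphD/=.
move=> /andP[h1 h2] /andP[h3 h4].
have h7 : ((gfl l x i)%:~R - 2) * l < ((gfl l y i)%:~R + 1) * l by lra.
have h8 : ((gfl l y i)%:~R : R) * l < ((gfl l x i)%:~R + 3) * l by lra.
move: h7 h8; rewrite !ltr_pM2r// -[3]/(3%:~R) -[2]/(2%:~R) -[1]/(1%:~R) -!rmorphD/= -!rmorphB/= !ltr_int => h7 h8.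
by rewrite ler_norml; apply/andP; split; lia.
Qed.

Lemma int_boolR (b : V -> bool) (A : set V) c : [set y | b y] = A -> measurable A ->
  mu A = c%:E -> nice mu (fun y => (b y)%:R) /\ \int[mu]_y (b y)%:R = c.
Proof.
move=> bA mA muA.
have -> : (fun y => (b y)%:R) = \1_A :> (V -> R).
  apply/funext => y; rewrite indicE; congr (nat_of_bool _)%:R.
  by apply/idP/idP => [h|/set_mem]; [apply/mem_set|]; rewrite -bA.
split.
  split; first exact: measurable_indic.
    by exists 1 => x; rewrite indicE normr_nat lern1; case: (_ \in _).
  apply: integrable_ge0; first exact: measurable_indic.
    by move=> x; rewrite indicE.
  by rewrite integral_indic// setIT [X in (X < _)%E]muA ltry.
by rewrite /Rintegral integral_indic// setIT [X in fine X]muA.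
Qed.

Lemma int_same l x : 0 < l -> nice mu (fun y => (same l x y)%:R) /\
  \int[mu]_y (same l x y)%:R = l ^+ n.
Proof.
move=> l0; apply: (int_boolR (same_cube x l0)); first exact: measurable_cube.
by rewrite leb_cube// ltW.
Qed.

Lemma int_near2 l x : 0 < l -> nice mu (fun y => (near2 l x y)%:R) /\
  \int[mu]_y (near2 l x y)%:R = (5 * l) ^+ n.
Proof.
move=> l0; apply: (int_boolR (near2_cube x l0)); first exact: measurable_cube.
by rewrite leb_cube// mulr_ge0// ltW.
Qed.

End cubes.

Lemma measurable_Rint d1 d2 (T1 : measurableType d1) (T2 : measurableType d2)
    (R : realType) (m2 : {sigma_finite_measure set T2 -> \bar R}) (h : T1 * T2 -> R) :
  measurable_fun setT h -> measurable_fun setT (fun x => \int[m2]_y h (x, y)).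
Proof.
move=> mh; rewrite /Rintegral.
apply: (measurableT_comp (@fine_measurable R setT measurableT)).
have mEh : measurable_fun setT (EFin \o h) by exact/measurable_EFinP.
rewrite (_ : (fun x => _) = (fun x => \int[m2]_y (EFin \o h)^\+ (x, y)
     - \int[m2]_y (EFin \o h)^\- (x, y))%E); last first.
  apply/funext => x; rewrite integralE; congr (_ - _)%E; apply: eq_integral => y _.
    by rewrite !funeposE.
  by rewrite !funenegE.
apply: emeasurable_funB.
  apply: (measurable_fun_fubini_tonelli_F (EFin \o h)^\+%E).
    exact: measurable_funepos.
  by move=> ?; exact: funepos_ge0.
apply: (measurable_fun_fubini_tonelli_F (EFin \o h)^\-%E).
  exact: measurable_funeneg.
by move=> ?; exact: funeneg_ge0.
Qed.

Lemma eint_lty d (T : measurableType d) (R : realType)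
  (mu : {measure set T -> \bar R}) (f : T -> R) : nice mu f ->
  (\int[mu]_x `|f x|%:E < +oo)%E.
Proof. by move=> /nice_int/integrableP[_]. Qed.

Lemma ge0_Rint d (T : measurableType d) (R : realType)
  (mu : {measure set T -> \bar R}) (f : T -> R) : nice mu f ->
  (\int[mu]_x (f x)%:E = (\int[mu]_x f x)%:E)%E.
Proof. by move=> /nice_int h; rewrite EFin_Rintegral. Qed.

(** * Averaging operators with symmetric zero-one kernels *)

Section kop.
Context {R : realType} {n : nat}.
Notation V := 'rV[R]_n.
Notation mu := (leb R 1 n).
Notation nice := (nice (leb R 1 n)).
Notation n2 := (n2 (leb R 1 n)).
Variables (b : V -> V -> bool) (c : R).
Hypothesis mb : measurable_fun setT (fun p : V * V => (b p.1 p.2)%:R : R).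
Hypothesis bC : forall x y, b x y = b y x.
Hypothesis b_nice : forall x, nice (fun y => (b x y)%:R).
Hypothesis b_int : forall x, \int[mu]_y (b x y)%:R = c.
Implicit Types f g u : V -> R.

Definition kop f x := \int[mu]_y ((b x y)%:R * f y).

Let mb2 x : measurable_fun setT (fun y => (b x y)%:R : R).
Proof. exact: nice_meas. Qed.

Let bdb x : bdd (fun y => (b x y)%:R : R).
Proof. exact: (nice_bdd (b_nice x)). Qed.

Lemma bf_nice f x : nice f -> nice (fun y => (b x y)%:R * f y).
Proof. by move=> nf; exact: niceMl. Qed.

Let mbf f : measurable_fun setT f -> measurable_fun setT (fun p : V * V => (b p.1 p.2)%:R * f p.2).
Proof. by move=> mf; apply: measurable_funM => //; exact: (measurableT_comp mf). Qed.

Lemma kop_meas f : measurable_fun setT f -> measurable_fun setT (kop f).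
Proof. by move=> mf; apply: (measurable_Rint _ (h := fun p => (b p.1 p.2)%:R * f p.2)); exact: mbf. Qed.

Let ekop f : nice f -> (\int[mu]_x \int[mu]_y ((b x y)%:R * `|f y|)%:E = (c * \int[mu]_x `|f x|)%:E)%E.
Proof.
move=> nf.
have mf' := nice_meas (nice_norm nf).
rewrite (fubini_tonelli (m1 := mu) (m2 := mu) (fun p => ((b p.1 p.2)%:R * `|f p.2|)%:E)); last 2 first.
- by apply/measurable_EFinP; exact: (mbf mf').
- by move=> p; rewrite lee_fin mulr_ge0.
transitivity (\int[mu]_y (c * `|f y|)%:E)%E; last by rewrite ge0_Rint ?intZ//; [exact: nice_norm|exact/niceZ/nice_norm].
apply: eq_integral => y _.
transitivity ((\int[mu]_x ((b y x)%:R * `|f y|))%:E)%E.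
  rewrite -ge0_Rint; last by under eq_fun do rewrite mulrC; exact: niceZ.
  by apply: eq_integral => x _; rewrite bC.
by rewrite RintegralZr ?b_int//; exact: nice_int (b_nice y).
Qed.

Lemma kop_nice f : nice f -> nice (kop f).
Proof.
move=> nf; split; first exact: kop_meas (nice_meas nf).
  have [B fB] := nice_bdd nf; exists (c * B) => x.
  apply: (le_trans (le_norm_int (bf_nice x nf))).
  rewrite -(b_int x) -RintegralZr//; last exact: nice_int (b_nice x).
  apply: le_int.
  - exact/nice_norm/bf_nice.
  - by under eq_fun do rewrite mulrC; exact: niceZ.
  - by move=> y; rewrite normrM ger0_norm// ler_wpM2l.
apply/integrableP; split; first by apply/measurable_EFinP; exact: kop_meas (nice_meas nf).
apply: (@le_lt_trans _ _ (\int[mu]_x \int[mu]_y ((b x y)%:R * `|f y|)%:E)%E); last first.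
  by rewrite ekop// ltry.
have mf' := nice_meas (nice_norm nf).
apply: ge0_le_integral => //.
- by apply: measurableT_comp => //; apply/measurable_EFinP; exact: kop_meas (nice_meas nf).
- apply: (measurable_fun_fubini_tonelli_F (fun p => ((b p.1 p.2)%:R * `|f p.2|)%:E)).
    by apply/measurable_EFinP; exact: (mbf mf').
  by move=> p; rewrite lee_fin mulr_ge0.
move=> x _ /=; rewrite ge0_Rint ?lee_fin; last exact/bf_nice/nice_norm.
apply: (le_trans (le_norm_int (bf_nice x nf))); apply: le_int.
- exact/nice_norm/bf_nice.
- exact/bf_nice/nice_norm.
- by move=> y; rewrite normrM ger0_norm.
Qed.

Lemma kop_sym f g : nice f -> nice g ->
  \int[mu]_x (kop f x * g x) = \int[mu]_x (f x * kop g x).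
Proof.
move=> nf ng.
pose h (p : V * V) := (b p.1 p.2)%:R * f p.2 * g p.1.
have mh : measurable_fun setT h.
  apply: measurable_funM; first exact: mbf (nice_meas nf).
  exact: (measurableT_comp (nice_meas ng)).
transitivity (\int[mu]_x \int[mu]_y h (x, y)).
  apply: eq_Rintegral => x _.
  by rewrite /kop -RintegralZr//; exact: nice_int (bf_nice _ _).
rewrite Rfubini//; last first.
  have [B gB] := nice_bdd ng.
  have B0 : 0 <= B by apply: le_trans (gB 0).
  apply: (@le_lt_trans _ _ (\int[mu]_x \int[mu]_y ((b x y)%:R * `|B * f y|)%:E)%E); last first.
    by rewrite ekop ?ltry//; exact: niceZ.
  apply: ge0_le_integral => //.
  - by move=> x _; apply: integral_ge0 => y _; rewrite lee_fin.
  - apply: (measurable_fun_fubini_tonelli_F (fun p => `|h p|%:E)) => //.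
    by apply/measurable_EFinP; exact: measurableT_comp.
  - have mBf := nice_meas (nice_norm (niceZ B nf)).
    apply: (measurable_fun_fubini_tonelli_F (fun p => ((b p.1 p.2)%:R * `|B * f p.2|)%:E)).
      by apply/measurable_EFinP; exact: (mbf mBf).
    by move=> p; rewrite lee_fin mulr_ge0.
  - move=> x _; apply: ge0_le_integral => //.
    + apply/measurable_EFinP; apply: measurableT_comp => //.
      exact: (measurableT_comp mh (measurable_pair1 x)).
    + by apply/measurable_EFinP; apply: (nice_meas (bf_nice x (nice_norm (niceZ B nf)))).
    + move=> y _; rewrite lee_fin /h/= !normrM ger0_norm// -mulrA ler_wpM2l//.
      by rewrite (ger0_norm B0) mulrC ler_wpM2r.
apply: eq_Rintegral => y _; rewrite /kop -RintegralZl//; last exact: nice_int (bf_nice _ _).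
by apply: eq_Rintegral => x _; rewrite /h/= bC mulrAC mulrC.
Qed.

Lemma kop_CS f x : nice f -> kop f x ^+ 2 <= c * kop (fun y => f y ^+ 2) x.
Proof.
move=> nf; have nb := b_nice x.
have := int_CS2 nb (bf_nice x nf).
have bb y : (b x y)%:R * (b x y)%:R = (b x y)%:R :> R.
  by case: (b x y); rewrite ?mulr1 ?mulr0.
have -> : (fun y => (b x y)%:R * ((b x y)%:R * f y)) = (fun y => (b x y)%:R * f y).
  by apply/funext => y; rewrite mulrA bb.
have -> : (fun y => (b x y)%:R ^+ 2) = (fun y => (b x y)%:R : R).
  by apply/funext => y; rewrite expr2 bb.
have -> : (fun y => ((b x y)%:R * f y) ^+ 2) = (fun y => (b x y)%:R * f y ^+ 2).
  by apply/funext => y; rewrite exprMn expr2 bb.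
by rewrite b_int.
Qed.

Lemma kop_int f : nice f -> \int[mu]_x kop f x = c * \int[mu]_x f x.
Proof.
move=> nf; transitivity (\int[mu]_x \int[mu]_y ((b x y)%:R * f y)) => //.
rewrite (Rfubini (m1 := mu) (m2 := mu) (f := fun p => (b p.1 p.2)%:R * f p.2)).
- rewrite -intZ//; apply: eq_Rintegral => y _.
  rewrite /= RintegralZr//; first by under eq_Rintegral do rewrite bC; rewrite b_int.
  by under [X in EFin \o X]eq_fun do rewrite bC; exact: nice_int (b_nice y).
- exact: mbf (nice_meas nf).
- rewrite (_ : (\int[mu]_x _)%E = (\int[mu]_x \int[mu]_y ((b x y)%:R * `|f y|)%:E)%E).
    by rewrite ekop// ltry.
  by apply: eq_integral => x _; apply: eq_integral => y _; rewrite /= normrM ger0_norm.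
Qed.

End kop.

Section avg.
Context {R : realType} {n : nat}.
Notation V := 'rV[R]_n.
Notation mu := (leb R 1 n).
Notation nice := (nice (leb R 1 n)).
Notation n2 := (n2 (leb R 1 n)).
Implicit Types (f g u : V -> R) (l : R).

Definition avg l f x := l ^- n * kop (same l) f x.
(** Normalized by the volume of one cube, not of the five times larger one, so its total mass is 5 ^
    n ([navg_int]). *)
Definition navg l f x := l ^- n * kop (near2 l) f x.
Definition cst_on l u := forall x y, same l x y -> u x = u y.

Let msame l : measurable_fun setT (fun p : V * V => (same l p.1 p.2)%:R : R).
Proof. exact: measurable_same. Qed.
Let mnear l : measurable_fun setT (fun p : V * V => (near2 l p.1 p.2)%:R : R).
Proof. exact: measurable_near2. Qed.

Section fixed_side.
Variable l : R.
Hypothesis l0 : 0 < l.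

Let snice (x : V) := (int_same x l0).1.
Let sint (x : V) := (int_same x l0).2.
Let nnice (x : V) := (int_near2 x l0).1.
Let nint (x : V) := (int_near2 x l0).2.
Let l0' : 0 <= l ^+ n. Proof. exact/exprn_ge0/ltW. Qed.
Let ln0 : l ^+ n != 0. Proof. by rewrite expf_neq0// gt_eqF. Qed.
Let l50 : 0 <= (5 * l) ^+ n.
Proof. by rewrite exprn_ge0// mulr_ge0// ltW. Qed.

Lemma sf_nice f x : nice f -> nice (fun y => (same l x y)%:R * f y).
Proof. by move=> nf; exact: (bf_nice snice). Qed.

Lemma nf_nice f x : nice f -> nice (fun y => (near2 l x y)%:R * f y).
Proof. by move=> nf; exact: (bf_nice nnice). Qed.

Lemma avg_nice f : nice f -> nice (avg l f).
Proof. by move=> nf; apply: niceZ; exact: (kop_nice (msame l) (@same_sym R n l) snice sint). Qed.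

Lemma navg_nice f : nice f -> nice (navg l f).
Proof. by move=> nf; apply: niceZ; exact: (kop_nice (mnear l) (near2_sym l) nnice nint). Qed.

Lemma avg_cst f : cst_on l (avg l f).
Proof.
move=> x y xy; congr (_ * _); apply: eq_Rintegral => z _.
by rewrite (same_transl z xy).
Qed.

Lemma avg_int f : nice f -> \int[mu]_x avg l f x = \int[mu]_x f x.
Proof.
move=> nf; rewrite intZ; last exact: (kop_nice (msame l) (@same_sym R n l) snice sint).
by rewrite (kop_int (msame l) (@same_sym R n l) snice sint)// mulrA mulVf ?mul1r.
Qed.

Lemma navg_int f : nice f -> \int[mu]_x navg l f x = 5 ^+ n * \int[mu]_x f x.
Proof.
move=> nf; rewrite intZ; last exact: (kop_nice (mnear l) (near2_sym l) nnice nint).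
rewrite (kop_int (mnear l) (near2_sym l) nnice nint)// mulrA; congr (_ * _).
by rewrite exprMn mulrCA mulVf ?mulr1.
Qed.

Lemma avg_sym f g : nice f -> nice g ->
  \int[mu]_x (avg l f x * g x) = \int[mu]_x (f x * avg l g x).
Proof.
move=> nf ng.
under eq_Rintegral do rewrite -mulrA; under [RHS]eq_Rintegral do rewrite mulrCA.
have kn h : nice h -> nice (kop (same l) h).
  exact: (kop_nice (msame l) (@same_sym R n l) snice sint).
rewrite intZ; last by apply: niceMM => //; exact: kn.
rewrite intZ; last by apply: niceMM => //; exact: kn.
by rewrite (kop_sym (msame l) (@same_sym R n l) snice sint).
Qed.

Lemma avg_sqr f x : nice f -> avg l f x ^+ 2 <= avg l (fun y => f y ^+ 2) x.
Proof.
move=> nf; rewrite /avg exprMn.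
have := kop_CS snice sint x nf.
have lp : 0 < l ^- n by rewrite invr_gt0 exprn_gt0.
rewrite -(ler_pM2l lp) -(ler_pM2l lp) => h.
rewrite expr2 -mulrA; apply: le_trans h _.
by rewrite (mulrA (l ^- n) (l ^+ n)) mulVf ?mul1r.
Qed.

Lemma avg_norm f x : nice f -> `|avg l f x| <= avg l (fun y => `|f y|) x.
Proof.
move=> nf; rewrite normrM ger0_norm ?invr_ge0// ler_pM2l ?invr_gt0 ?exprn_gt0//.
apply: (le_trans (le_norm_int (sf_nice x nf))).
by under eq_Rintegral do rewrite normrM ger0_norm//.
Qed.

Lemma avg_ge0 f x : (forall y, 0 <= f y) -> 0 <= avg l f x.
Proof.
by move=> f0; rewrite mulr_ge0 ?invr_ge0// int_ge0// => y; rewrite mulr_ge0.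
Qed.

Lemma navg_ge0 f x : (forall y, 0 <= f y) -> 0 <= navg l f x.
Proof.
by move=> f0; rewrite mulr_ge0 ?invr_ge0// int_ge0// => y; rewrite mulr_ge0.
Qed.

Lemma avg_pull u f x : nice f -> (forall y, same l x y -> u y = u x) ->
  avg l (fun y => u y * f y) x = u x * avg l f x.
Proof.
move=> nf uc; rewrite /avg [in RHS]mulrCA; congr (_ * _).
rewrite /kop -intZ; last exact: sf_nice.
apply: eq_Rintegral => y _.
by have := uc y; case: (same l x y) => [/(_ isT) ->|_]; rewrite ?mul1r// !mul0r mulr0.
Qed.

Lemma avg_id u x : (forall y, same l x y -> u y = u x) -> avg l u x = u x.
Proof.
move=> uc; rewrite /avg (_ : kop _ _ _ = \int[mu]_y (u x * (same l x y)%:R)).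
  by rewrite intZ ?sint// mulrCA mulVf ?mulr1.
apply: eq_Rintegral => y _.
by have := uc y; case: (same l x y) => [/(_ isT) ->|_]; rewrite ?mul1r ?mulr1// mul0r mulr0.
Qed.

Lemma avg_n2 f : nice f -> n2 (avg l f) <= n2 f.
Proof.
move=> nf; rewrite !n2E ler_wsqrtr// -[leRHS](avg_int (niceX2 nf)).
apply: le_int; first exact/niceX2/avg_nice.
  exact/avg_nice/niceX2.
by move=> x; exact: avg_sqr.
Qed.

Lemma avgD f g x : nice f -> nice g ->
  avg l (fun y => f y + g y) x = avg l f x + avg l g x.
Proof.
move=> nf ng; rewrite /avg -mulrDr /kop -intD; [|exact: sf_nice..].
by congr (_ * _); apply: eq_Rintegral => y _; rewrite mulrDr.
Qed.

Lemma avgB f g x : nice f -> nice g ->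
  avg l (fun y => f y - g y) x = avg l f x - avg l g x.
Proof.
move=> nf ng; rewrite /avg -mulrBr /kop -intB; [|exact: sf_nice..].
by congr (_ * _); apply: eq_Rintegral => y _; rewrite mulrBr.
Qed.

End fixed_side.

(** The tower property. By symmetry the inner average moves onto the indicator of the larger cube,
    which is constant on the smaller ones. *)
Lemma avg_avg l1 l2 f x : 0 < l1 -> 0 < l2 -> nice f ->
  (forall x y : V, same l1 x y -> same l2 x y) ->
  avg l2 (avg l1 f) x = avg l2 f x.
Proof.
move=> l10 l20 nf s12; congr (_ * _).
have ns := (int_same x l20).1.
have := avg_sym l10 ns nf; rewrite /kop => <-.
apply: eq_Rintegral => y _; rewrite (avg_id l10)// => z yz.
by rewrite same_sym (same_sym l2 x y) (same_transl x (s12 _ _ yz)).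
Qed.

End avg.

Section runmax.
Context {R : realType}.
Fixpoint runmax (s : nat -> R) k := if k is k'.+1 then Num.max (runmax s k') (s k) else s 0%N.

Lemma runmax_ge s j k : (j <= k)%N -> s j <= runmax s k.
Proof.
elim: k => [|k IH]; first by rewrite leqn0 => /eqP ->.
rewrite leq_eqVlt => /orP[/eqP ->|]; rewrite /= le_max ?lexx ?orbT//.
by rewrite ltnS => /IH ->.
Qed.

Lemma runmax_nd s j k : (j <= k)%N -> runmax s j <= runmax s k.
Proof.
elim: k => [|k IH]; first by rewrite leqn0 => /eqP ->.
rewrite leq_eqVlt => /orP[/eqP ->//|]; rewrite ltnS => /IH h.
by rewrite (le_trans h)//= le_max lexx.
Qed.

(* The pathwise form of Doob's L^2 inequality. *)
Lemma runmax_sqr s k : (forall j, 0 <= s j) ->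
  runmax s k ^+ 2 <= 2 * (runmax s k * s k - \sum_(j < k) runmax s j * (s j.+1 - s j)).
Proof.
move=> s0; have r0 j : 0 <= runmax s j by apply: le_trans (runmax_ge s (leq0n _)).
elim: k => [|k IH]; first by rewrite big_ord0 /= subr0 -expr2; have := sqr_ge0 (s 0%N); lra.
rewrite big_ord_recr/=; move: IH; set S := \sum_(_ < _) _; set r := runmax s k.
(* If the maximum does not move, both sides stay the same; if it moves, the surplus is (s k.+1 -
   r)^2. *)
have [h|h] := leP r (s k.+1); last by nra.
by have := sqr_ge0 (s k.+1 - r); nra.
Qed.

End runmax.

Lemma n2_eq0 (R : realType) d (T : measurableType d) (mu : {measure set T -> \bar R})
  (f : T -> R) : (forall x, f x = 0) -> n2 mu f = 0.
Proof. by move=> f0; rewrite (_ : f = fun=> 0) ?n20//; apply/funext. Qed.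

Lemma nice_max d (T : measurableType d) (R : realType) (mu : {measure set T -> \bar R})
  (f g : T -> R) : nice mu f -> nice mu g -> nice mu (fun x => Num.max (f x) (g x)).
Proof.
move=> nf ng; apply: (nice_dom (niceD (nice_norm nf) (nice_norm ng))).
  exact: measurable_maxr (nice_meas nf) (nice_meas ng).
move=> x; have hf := normr_ge0 (f x); have hg := normr_ge0 (g x).
rewrite [leRHS]ger0_norm ?addr_ge0//.
by case: (leP (f x) (g x)) => _; lra.
Qed.

(** * Dyadic martingales and the maximal function *)

Section levels.
Context {R : realType} {n : nat}.
Notation V := 'rV[R]_n.
Notation mu := (leb R 1 n).
Notation nice := (nice (leb R 1 n)).
Notation n2 := (n2 (leb R 1 n)).
Implicit Types (f g u : V -> R).
Variable l0 : R.
Hypothesis l0_gt0 : 0 < l0.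

(** Larger indices mean smaller cubes, so that [E r] below is a martingale in [r] with differences
    [Dm r]. *)
Definition lv r : R := l0 / 2 ^+ r.
Lemma lv_gt0 r : 0 < lv r. Proof. by rewrite divr_gt0// exprn_gt0. Qed.
Hint Resolve lv_gt0 : core.

Lemma lvS r : lv r.+1 = lv r / 2.
Proof. by rewrite /lv exprSr; field; rewrite expf_neq0. Qed.

Lemma same_lv r s (x y : V) : (r <= s)%N -> same (lv s) x y -> same (lv r) x y.
Proof.
move=> /subnK <-; elim: (s - r)%N => // k IH; rewrite addSn lvS => /same_half h.
exact/IH/h.
Qed.

Lemma cst_on_lv r s u : (r <= s)%N -> cst_on (lv r) u -> cst_on (lv s) u.
Proof. by move=> rs h x y /(same_lv rs); exact: h. Qed.

(** Sealed like [n2], so that conversion does not unfold the averages. *)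
Fact E_seal : {F : nat -> (V -> R) -> V -> R | forall r f, F r f = avg (lv r) f}.
Proof. by eexists; move=> *; reflexivity. Qed.
Definition E := sval E_seal.
Lemma E_avg r f : E r f = avg (lv r) f. Proof. exact: (svalP E_seal). Qed.
Definition Dm r f x : R := E r.+1 f x - E r f x.

Lemma E_nice r f : nice f -> nice (E r f). Proof. by rewrite E_avg; exact: avg_nice. Qed.
Lemma Dm_nice r f : nice f -> nice (Dm r f).
Proof. by move=> nf; apply: niceB; exact: E_nice. Qed.

Lemma E_cst r f : cst_on (lv r) (E r f). Proof. by rewrite E_avg; exact: avg_cst. Qed.

Lemma Dm_cst r f : cst_on (lv r.+1) (Dm r f).
Proof.
move=> x y xy; rewrite /Dm (E_cst _ xy); congr (_ - _).
exact: (cst_on_lv (leqnSn r) (@E_cst r f)).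
Qed.

Lemma E_id r u : cst_on (lv r) u -> E r u = u.
Proof. by move=> uc; rewrite E_avg; apply/funext => x; apply: avg_id => // y /uc ->. Qed.

Lemma E_ge r s f : (r <= s)%N -> E s (E r f) = E r f.
Proof. by move=> rs; apply: E_id; exact: cst_on_lv (@E_cst r f). Qed.

Lemma E_le r s f : nice f -> (r <= s)%N -> E r (E s f) = E r f.
Proof.
move=> nf rs; rewrite !E_avg; apply/funext => x; apply: avg_avg => // y z; exact: same_lv.
Qed.

Lemma E_Dm0 r k f x : nice f -> (r <= k)%N -> E r (Dm k f) x = 0.
Proof.
move=> nf rk; rewrite E_avg /Dm avgB//; [|exact: E_nice..].
rewrite -!E_avg E_le//; last exact: leq_trans rk _.
by rewrite E_le// subrr.
Qed.

Lemma E_Dm r k f : (k < r)%N -> E r (Dm k f) = Dm k f.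
Proof. by move=> kr; apply: E_id; exact: cst_on_lv (@Dm_cst k f). Qed.

Lemma E_tele N f x : E N f x = E 0 f x + \sum_(k < N) Dm k f x.
Proof. by rewrite -(big_mkord xpredT (fun k => Dm k f x)) telescope_sumr// addrC subrK. Qed.

Lemma int_cst_Dm k u f : nice u -> nice f -> cst_on (lv k) u ->
  \int[mu]_x (u x * Dm k f x) = 0.
Proof.
move=> nu nf uc; rewrite -(E_id uc) E_avg avg_sym//; last exact: Dm_nice.
rewrite (_ : (fun x => _) = (fun=> 0)); first by rewrite Rintegral_cst ?mul0r.
by apply/funext => x; rewrite -E_avg E_Dm0// mulr0.
Qed.

Lemma pythag k f : nice f -> n2 (E k.+1 f) ^+ 2 = n2 (E k f) ^+ 2 + n2 (Dm k f) ^+ 2.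
Proof.
move=> nf; have nE := E_nice k nf; have nD := Dm_nice k nf.
rewrite (n2_sqr _ (E k.+1 f)) (n2_sqr _ (E k f)) (n2_sqr _ (Dm k f)).
rewrite (_ : (fun x => E k.+1 f x ^+ 2) =
   (fun x => (E k f x ^+ 2 + Dm k f x ^+ 2) + 2 * (E k f x * Dm k f x))); last first.
  by apply/funext => x; rewrite /Dm; ring.
rewrite intD; [|exact: niceD (niceX2 nE) (niceX2 nD)|exact: niceZ (niceMM nE nD)].
rewrite intD; [|exact: niceX2|exact: niceX2].
rewrite intZ; last exact: niceMM.
by rewrite int_cst_Dm ?mulr0 ?addr0//; exact: E_cst.
Qed.

Lemma E_n2 r f : nice f -> n2 (E r f) <= n2 f. Proof. by rewrite E_avg; exact: avg_n2. Qed.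

Lemma bessel N f : nice f ->
  n2 (E 0 f) ^+ 2 + \sum_(k < N) n2 (Dm k f) ^+ 2 <= n2 f ^+ 2.
Proof.
move=> nf; have -> : n2 (E 0 f) ^+ 2 + \sum_(k < N) n2 (Dm k f) ^+ 2 = n2 (E N f) ^+ 2.
  elim: N => [|N IH]; first by rewrite big_ord0 addr0.
  by rewrite big_ord_recr/= addrA IH pythag.
by rewrite ler_pXn2r ?nnegrE ?n2_ge0 ?E_n2.
Qed.

Lemma bessel_shift s N f : nice f ->
  \sum_(r < N) n2 (Dm (s + r) f) ^+ 2 <= n2 f ^+ 2.
Proof.
move=> nf; apply: le_trans (bessel (s + N) nf).
rewrite big_split_ord/= addrA lerDr addr_ge0 ?sqr_ge0//.
by apply: sumr_ge0 => k _; exact: sqr_ge0.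
Qed.

Lemma Dm_n2 k f : nice f -> n2 (Dm k f) <= n2 f.
Proof.
move=> nf; rewrite -(@ler_pXn2r _ 2) ?nnegrE ?n2_ge0//.
by have := bessel_shift k 1 nf; rewrite big_ord1 addn0.
Qed.

(** The dyadic maximal function restricted to the levels 0 to N. This keeps it in the class [nice]
    and constant on the cubes of side [lv N]. *)
Definition mxf N f x : R := runmax (fun k => E k (fun y => `|f y|) x) N.

Lemma mxf_nice N f : nice f -> nice (mxf N f).
Proof.
move=> nf; elim: N => [|N IH]; first exact/E_nice/nice_norm.
by apply: nice_max => //; exact/E_nice/nice_norm.
Qed.

Lemma mxf_cst N f : cst_on (lv N) (mxf N f).
Proof.
elim: N => [|N IH] x y xy; first exact: E_cst.
rewrite /mxf/= (E_cst _ xy); congr Num.max.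
exact: (cst_on_lv (leqnSn N) IH).
Qed.

Lemma mxf_ge0 N f x : 0 <= mxf N f x.
Proof. by apply: le_trans (runmax_ge _ (leq0n _)); rewrite E_avg; exact: avg_ge0. Qed.

Lemma E_le_mxf k N f x : nice f -> (k <= N)%N -> `|E k f x| <= mxf N f x.
Proof.
move=> nf kN; rewrite E_avg; apply: le_trans (avg_norm _ x nf) _ => //; rewrite -E_avg.
exact: (@runmax_ge _ (fun k => E k (fun y => `|f y|) x)).
Qed.

Lemma mxf_nd k N f x : (k <= N)%N -> mxf k f x <= mxf N f x.
Proof. exact: runmax_nd. Qed.

Lemma doob N f : nice f -> n2 (mxf N f) <= 2 * n2 f.
Proof.
move=> nf; set g := fun y => `|f y|.
have ng : nice g by exact: nice_norm.
have n2g : n2 g = n2 f by exact: n2_norm.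
have nM k : nice (mxf k f) := mxf_nice k nf.
have nMD k : nice (fun x => mxf k f x * Dm k g x) by apply: niceMM => //; exact: Dm_nice.
have h : n2 (mxf N f) ^+ 2 <= 2 * (n2 (mxf N f) * n2 f).
  rewrite n2_sqr.
  apply: (@le_trans _ _ (\int[mu]_x (2 * (mxf N f x * E N g x
     - \sum_(k < N) mxf k f x * Dm k g x)))).
    apply: le_int; first exact: niceX2.
      apply: niceZ; apply: niceB; last exact: nice_sum.
      by apply: niceMM => //; exact: E_nice.
    move=> x; apply: runmax_sqr => k; rewrite E_avg; exact: avg_ge0.
  rewrite intZ; last first.
    apply: niceB; last exact: nice_sum.
    by apply: niceMM => //; exact: E_nice.
  rewrite intB; [|by apply: niceMM => //; exact: E_nice|exact: nice_sum].
  (* The sum in [runmax_sqr] integrates to zero: [mxf k] is constant on the cubes on which [Dm k]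
     has mean zero. *)
  rewrite int_sum// big1 ?subr0 => [|k _]; last by apply: int_cst_Dm => //; exact: mxf_cst.
  rewrite ler_wpM2l//; apply: le_trans (ler_norm _) _.
  apply: le_trans (int_CS (nM N) (E_nice N ng)) _.
  by rewrite ler_wpM2l ?n2_ge0// -n2g E_n2.
have [->|M0] := eqVneq (n2 (mxf N f)) 0; first by rewrite mulr_ge0 ?n2_ge0.
have Mp : 0 < n2 (mxf N f) by rewrite lt_def M0 n2_ge0.
by rewrite -(ler_pM2l Mp) -expr2; apply: le_trans h _; rewrite mulrCA.
Qed.

End levels.

(** * Translations of functions constant on cubes *)

Section translation.
Context {R : realType} {n : nat}.
Notation V := 'rV[R]_n.
Notation mu := (leb R 1 n).
Notation nice := (nice (leb R 1 n)).
Notation n2 := (n2 (leb R 1 n)).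
Implicit Types (f g u : V -> R) (v : V).

Lemma shift_Rint f v : nice f -> nice (fun x => f (x - v)) /\
  \int[mu]_x f (x - v) = \int[mu]_x f x.
Proof.
move=> [mf [B fB] fi].
have [] := @Rintegral_comp _ _ R mu (fun x => x + - v) 1 f ler01 (measurable_shift _) _ fi.
  by move=> A mA; rewrite mul1e; exact: leb_shift.
move=> h1; rewrite mul1r => h2; split => //; split => //; last by exists B => x.
exact: (measurableT_comp mf (measurable_shift (- v))).
Qed.

Lemma shift_nice f v : nice f -> nice (fun x => f (x - v)).
Proof. by move=> /(shift_Rint v)[]. Qed.

Lemma shift_int f v : nice f -> \int[mu]_x f (x - v) = \int[mu]_x f x.
Proof. by move=> /(shift_Rint v)[]. Qed.

Lemma shift_n2 f v : nice f -> n2 (fun x => f (x - v)) = n2 f.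
Proof. by move=> nf; rewrite !n2E (shift_int v (niceX2 nf)). Qed.

Variable l : R.
Hypothesis l0 : 0 < l.

Lemma bernoulli_ineq (t : R) k : 0 <= t <= 1 -> 1 - k%:R * t <= (1 - t) ^+ k.
Proof.
move=> /andP[t0 t1]; elim: k => [|k IH]; first by rewrite mul0r subr0 expr0.
have h : 0 <= 1 - t by rewrite subr_ge0.
rewrite exprS; apply: le_trans (ler_wpM2l h IH).
rewrite -natr1; have : 0 <= k%:R * t ^+ 2 by rewrite mulr_ge0// sqr_ge0.
by nra.
Qed.

(** The points of a cube which the shift by v moves out of it avoid a subcube of side l - h, and
    Bernoulli's inequality bounds l^n - (l - h)^n. For h >= l the whole cube is within the bound. *)
Lemma boundary_layer (h : R) v x : (forall i, `|v 0 i| <= h) -> 0 <= h ->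
  nice (fun y => (same l x y)%:R * (1 - (same l y (y - v))%:R)) /\
  \int[mu]_y ((same l x y)%:R * (1 - (same l y (y - v))%:R)) <= n.+1%:R * (h / l) * l ^+ n.
Proof.
move=> vh h0.
have nS := (int_same x l0).1.
have nI : nice (fun y => (same l x y)%:R * (1 - (same l y (y - v))%:R)).
  apply: niceM => //.
    apply: measurable_funB => //; apply: measurable_same => //.
    exact: measurable_shift.
  by exists 1 => y; case: same; rewrite ?subrr ?subr0 ?normr0 ?normr1.
split => //.
have lp : 0 < l ^+ n by rewrite exprn_gt0.
have [hl|hl] := leP l h.
  apply: (@le_trans _ _ (l ^+ n)).
    rewrite -(int_same x l0).2; apply: le_int => // y.
    by do 2 case: same; rewrite ?mul1r ?mul0r ?subrr ?subr0.
  apply: ler_peMl; first exact: ltW.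
  have : 1 <= h / l by rewrite ler_pdivlMr// mul1r.
  have : 1 <= n.+1%:R :> R by rewrite ler1n.
  by move: n.+1%:R (h / l) => a b; nra.
(* The lower corner is moved by the positive part of v: in the cube of side l - h starting there,
   both y and y - v lie in the original cube. *)
pose a i := (gfl l x i)%:~R * l + Num.max (v 0 i) 0.
have c_meas := measurable_cube a (l - h).
have lh : 0 <= l - h by rewrite subr_ge0 ltW.
have [nC iC] := @int_boolR R n (fun y => y \in cube a (l - h)) _ ((l - h) ^+ n)
  (set_mem_set _) c_meas (leb_cube _ lh).
apply: (@le_trans _ _ (\int[mu]_y ((same l x y)%:R - (y \in cube a (l - h))%:R))).
  apply: le_int => //; first exact: niceB.
  move=> y; case: (boolP (y \in cube a (l - h))) => [|_]; last first.
    by do 2 case: same; rewrite ?mul1r ?mul0r ?subrr ?subr0.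
  rewrite inE => yc.
  have s1 : same l x y.
    suff: [set z | same l x z] y by [].
    rewrite same_cube// => i.
    have := yc i; rewrite /a; have := vh i; rewrite ler_norml => /andP[v1 v2].
    by case: (leP (v 0 i) 0) => v3 /andP[h1 h2]; apply/andP; split; lra.
  have s2 : same l x (y - v).
    suff: [set z | same l x z] (y - v) by [].
    rewrite same_cube// => i.
    have := yc i; rewrite /a !mxE; have := vh i; rewrite ler_norml => /andP[v1 v2].
    by case: (leP (v 0 i) 0) => v3 /andP[h1 h2]; apply/andP; split; lra.
  have s3 : same l y (y - v) by rewrite -(same_transl _ s1).
  by rewrite s1 s3 !subrr mulr0.
rewrite intB// iC (int_same x l0).2.
have t01 : 0 <= h / l <= 1.
  by rewrite divr_ge0 ?(ltW l0)//= ler_pdivrMr// mul1r ltW.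
have := bernoulli_ineq n t01.
have -> : 1 - h / l = (l - h) / l by field; exact: lt0r_neq0.
rewrite expr_div_n ler_pdivlMr// -natr1 => b.
have : 0 <= h / l * l ^+ n by rewrite mulr_ge0 ?(ltW lp)//; case/andP: t01.
by lra.
Qed.

(** The difference is nonzero only where the shift crosses the boundary of a cube, and this happens
    on a proportion of order h/l of each cube. *)
Lemma translation u (h : R) v : nice u -> cst_on l u -> (forall i, `|v 0 i| <= h) ->
  0 <= h ->
  n2 (fun x => u (x - v) - u x) ^+ 2 <= 4 * n.+1%:R * (h / l) * n2 u ^+ 2.
Proof.
move=> nu uc vh h0.
pose w v x := (1 - (same l x (x - v))%:R) * u x ^+ 2.
have nw v' : nice (w v').
  apply: niceMl; first exact: niceX2.
    apply: measurable_funB => //; apply: measurable_same => //.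
    exact: measurable_shift.
  by exists 1 => y; case: same; rewrite ?subrr ?subr0 ?normr0 ?normr1.
have iw v' : (forall i, `|v' 0 i| <= h) -> \int[mu]_x w v' x <= n.+1%:R * (h / l) * n2 u ^+ 2.
  move=> v'h; rewrite -(avg_int l0 (nw v')) n2_sqr -intZ; last exact: niceX2.
  apply: le_int; first exact: avg_nice.
    exact/niceZ/niceX2.
  move=> x; rewrite /avg /kop.
  have [nb ib] := boundary_layer x v'h h0.
  rewrite (_ : (fun y => _) = (fun y => u x ^+ 2 * ((same l x y)%:R * (1 - (same l y (y - v'))%:R)))).
    rewrite intZ// mulrCA mulrC ler_wpM2r ?sqr_ge0//.
    by rewrite mulrC ler_pdivrMr ?exprn_gt0.
  apply/funext => y; rewrite /w; have := uc x y; case: (same l x y) => [/(_ isT) ->|_].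
    by rewrite !mul1r mulrC.
  by rewrite !mul0r mulr0.
have nw' : nice (fun x => w (- v) (x - v)) by exact: shift_nice.
rewrite n2_sqr.
(* (a - b)^2 <= 2 a^2 + 2 b^2; the term with u (x - v) is the boundary layer of the opposite shift,
   translated by v. *)
apply: (@le_trans _ _ (\int[mu]_x (2 * (w v x + w (- v) (x - v))))).
  apply: le_int.
  - by apply: niceX2; apply: niceB => //; exact: shift_nice.
  - by apply: niceZ; exact: niceD.
  move=> x; rewrite /w opprK subrK (same_sym l (x - v)).
  case: (boolP (same l x (x - v))) => [/uc ->|_].
    by rewrite !subrr !mul0r addr0 expr0n mulr0.
  by rewrite !subr0 !mul1r; have := sqr_ge0 (u (x - v) + u x); lra.
rewrite intZ; last exact: niceD.
rewrite intD// (shift_int v (nw (- v))).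
have := iw v vh; have : \int[mu]_x w (- v) x <= n.+1%:R * (h / l) * n2 u ^+ 2.
  by apply: iw => i; rewrite mxE normrN.
by lra.
Qed.

End translation.

(** * Integral operators with bounded kernels *)

Section kernel_operator.
Context d1 d2 (T1 : measurableType d1) (T2 : measurableType d2) (R : realType).
Variables (m1 : {sigma_finite_measure set T1 -> \bar R})
  (m2 : {sigma_finite_measure set T2 -> \bar R}).
Variable c : T1 * T2 -> R.
Hypothesis mc : measurable_fun setT c.
Hypothesis bc : bdd c.
Implicit Types (k : T2 -> R) (g : T1 -> R).

Let mkc (k : T2 -> R) : measurable_fun setT k ->
  measurable_fun setT (fun p => k p.2 * c p).
Proof. by move=> mk; apply: measurable_funM => //; exact: (measurableT_comp mk). Qed.

Let mc1 x : measurable_fun setT (fun y => c (x, y)).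
Proof. exact: (measurableT_comp mc (measurable_pair1 x)). Qed.

Let mc2 y : measurable_fun setT (fun x => c (x, y)).
Proof. exact: (measurableT_comp mc (measurable_pair2 y)). Qed.

Lemma kernel_nice1 k x : nice m2 k -> nice m2 (fun y => k y * c (x, y)).
Proof. by move=> nk; apply: niceM => //; have [B cB] := bc; exists B => y. Qed.

Lemma kernel_nice2 g y : nice m1 g -> nice m1 (fun x => g x * c (x, y)).
Proof. by move=> ng; apply: niceM => //; have [B cB] := bc; exists B => x. Qed.

Lemma kernel_meas k : measurable_fun setT k ->
  measurable_fun setT (fun x => \int[m2]_y (k y * c (x, y))).
Proof. by move=> mk; exact: (measurable_Rint _ (mkc mk)). Qed.

Lemma kernel_bdd k : nice m2 k -> bdd (fun x => \int[m2]_y (k y * c (x, y))).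
Proof.
move=> nk; have [B cB] := bc; exists (\int[m2]_y (B * `|k y|)) => x.
apply: (le_trans (le_norm_int (kernel_nice1 x nk))); apply: le_int.
- exact/nice_norm/kernel_nice1.
- exact/niceZ/nice_norm.
- by move=> y; rewrite normrM mulrC ler_wpM2r.
Qed.

Lemma kernel_nice k A : nice m2 k ->
  (forall y, \int[m1]_x `|c (x, y)|%:E <= A%:E)%E ->
  nice m1 (fun x => \int[m2]_y (k y * c (x, y))).
Proof.
move=> nk hA; have mk := nice_meas nk.
split; [exact: kernel_meas|exact: kernel_bdd|].
apply/integrableP; split; first by apply/measurable_EFinP; exact: kernel_meas.
pose h (p : T1 * T2) := `|k p.2 * c p|%:E.
have mh : measurable_fun setT h.
  by apply/measurable_EFinP; apply: measurableT_comp => //; exact: mkc.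
have h0 p : (0 <= h p)%E by rewrite lee_fin.
apply: (@le_lt_trans _ _ (\int[m1]_x \int[m2]_y h (x, y))%E).
  apply: ge0_le_integral => //.
  - by apply: measurableT_comp => //; apply/measurable_EFinP; exact: kernel_meas.
  - exact: (measurable_fun_fubini_tonelli_F h).
  move=> x _ /=; rewrite /h/= ge0_Rint ?lee_fin; last exact/nice_norm/kernel_nice1.
  exact: le_norm_int (kernel_nice1 x nk).
rewrite (fubini_tonelli (m1 := m1) (m2 := m2) h)//.
apply: (@le_lt_trans _ _ (\int[m2]_y (`|A * k y|%:E))%E); last first.
  exact/eint_lty/niceZ.
apply: ge0_le_integral => //.
- by move=> y _; apply: integral_ge0.
- exact: (measurable_fun_fubini_tonelli_G h).
- by apply/measurable_EFinP; apply: measurableT_comp => //; exact: measurable_funM.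
move=> y _; rewrite /h/=; under eq_integral do rewrite normrM EFinM.
rewrite ge0_integralZl//; last first.
  by apply/measurable_EFinP; apply: measurableT_comp => //; exact: mc2.
rewrite normrM mulrC EFinM; apply: lee_wpmul2l => //.
by apply: le_trans (hA y) _; rewrite lee_fin ler_norm.
Qed.

Lemma kernel_swap k g : nice m2 k -> nice m1 g ->
  \int[m1]_x (g x * \int[m2]_y (k y * c (x, y))) =
  \int[m2]_y (k y * \int[m1]_x (g x * c (x, y))).
Proof.
move=> nk ng; have [B cB] := bc.
pose h (p : T1 * T2) := g p.1 * (k p.2 * c p).
have mh : measurable_fun setT h.
  apply: measurable_funM; last exact: mkc (nice_meas nk).
  exact: (measurableT_comp (nice_meas ng)).
transitivity (\int[m1]_x \int[m2]_y h (x, y)).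
  apply: eq_Rintegral => x _; rewrite -intZ//.
  exact: kernel_nice1.
rewrite Rfubini//.
  apply: eq_Rintegral => y _; rewrite -intZ; last exact: kernel_nice2.
  by apply: eq_Rintegral => x _; rewrite /h/= mulrCA.
apply: (@le_lt_trans _ _ (\int[m1]_x \int[m2]_y (`|g x| * `|B * k y|)%:E)%E).
  apply: ge0_le_integral => //.
  - by move=> x _; apply: integral_ge0.
  - apply: (measurable_fun_fubini_tonelli_F (fun p => `|h p|%:E)) => //.
    by apply/measurable_EFinP; exact: measurableT_comp.
  - apply: (measurable_fun_fubini_tonelli_F (fun p => (`|g p.1| * `|B * k p.2|)%:E)) => //.
    apply/measurable_EFinP; apply: measurable_funM.
      exact: (measurableT_comp (nice_meas (nice_norm ng)) measurable_fst).
    exact: (measurableT_comp (nice_meas (nice_norm (niceZ B nk))) measurable_snd).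
  - move=> x _; apply: ge0_le_integral => //.
    + apply/measurable_EFinP; apply: measurableT_comp => //.
      exact: (measurableT_comp mh (measurable_pair1 x)).
    + by apply/measurable_EFinP; apply: measurable_funM => //; exact: nice_meas (nice_norm (niceZ B nk)).
    + move=> y _; rewrite lee_fin /h/= !normrM ler_wpM2l// mulrC ler_wpM2r//.
      by apply: le_trans (cB _) _; exact: ler_norm.
rewrite (_ : (\int[m1]_x _)%E = (\int[m1]_x (`|g x| * \int[m2]_y `|B * k y|)%:E)%E).
  rewrite ge0_Rint ?ltry//.
  by under eq_fun do rewrite mulrC; apply: niceZ; exact: nice_norm.
apply: eq_integral => x _; rewrite ge0_Rint; first by rewrite intZ//; exact/nice_norm/niceZ.
by apply: niceZ; exact/nice_norm/niceZ.
Qed.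

End kernel_operator.

(** * Balls and shells *)

Section affine.
Context {R : realType} {m n : nat}.
Notation M := 'M[R]_(m, n).

Lemma leb_affine (a : M) (t : R) (A : set M) : t != 0 -> measurable A ->
  leb R m n ((fun y : M => a + t *: y) @^-1` A) = ((`|t| ^- (m * n))%:E * leb R m n A)%E.
Proof.
move=> t0 mA.
have mA1 : measurable [set y : M | A (y + a)].
  by rewrite -[X in measurable X]setTI; exact: measurable_shift.
have mA2 : measurable [set y : M | A (- y + a)].
  by rewrite -[X in measurable X]setTI; exact: (measurable_opp _ mA1).
have [tp|tn] := ltP 0 t.
  rewrite gtr0_norm// -(leb_shift a mA) -leb_scale//.
  by congr (leb _ _ _ _); apply/seteqP; split => y /=; rewrite addrC.
have tp : 0 < - t by rewrite oppr_gt0 lt_def eq_sym t0.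
rewrite ler0_norm// -(leb_shift a mA) -(leb_opp mA1) -leb_scale//.
by congr (leb _ _ _ _); apply/seteqP; split => y /=; rewrite scaleNr opprK addrC.
Qed.

Lemma measurable_affine (a : M) t : measurable_fun setT (fun y : M => a + t *: y).
Proof.
have -> : (fun y : M => a + t *: y) = (fun y => y + a) \o (fun y => t *: y).
  by apply/funext => y /=; rewrite addrC.
exact: measurableT_comp (measurable_shift _) (measurable_scale t).
Qed.

Lemma affine_Rint (a : M) (t : R) f : t != 0 -> nice (leb R m n) f ->
  nice (leb R m n) (fun y => f (a + t *: y)) /\
  \int[leb R m n]_y f (a + t *: y) = `|t| ^- (m * n) * \int[leb R m n]_y f y.
Proof.
move=> t0 [mf [B fB] fi].
have t0' : 0 <= `|t| ^- (m * n) by rewrite invr_ge0 exprn_ge0.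
have [] := @Rintegral_comp _ _ R (leb R m n) _ _ f t0' (measurable_affine a t)
  (fun A mA => leb_affine a t0 mA) fi.
move=> h1 h2; split => //; split => //; last by exists B => x.
exact: (measurableT_comp mf (measurable_affine a t)).
Qed.

End affine.

Lemma Rint_ins (R : realType) m n (i : 'I_m.+1) (f : 'M[R]_(m.+1, n) -> R) :
  nice (leb R m.+1 n) f ->
  \int[leb R m.+1 n]_y f y = \int[leb R m n]_z \int[leb R 1 n]_v f (ins i v z).
Proof.
move=> nf.
have mins : measurable_fun setT (fun p : 'rV[R]_n * 'M[R]_(m, n) => ins i p.1 p.2).
  exact: measurable_ins.
have mfi : measurable_fun setT (fun p : 'rV[R]_n * 'M[R]_(m, n) => f (ins i p.1 p.2)).
  exact: measurableT_comp (nice_meas nf) mins.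
have foo : (\int[leb R 1 n]_v \int[leb R m n]_z `|f (ins i v z)|%:E < +oo)%E.
  rewrite -(@ge0_integral_ins_iter R m n i (fun y => `|f y|%:E))//.
    exact: eint_lty.
  by apply/measurable_EFinP; exact: nice_meas (nice_norm nf).
rewrite (@Rfubini2 _ _ _ _ R (leb R 1 n) (leb R m n) (fun p => f (ins i p.1 p.2)))//.
have ifi : (leb R 1 n \x leb R m n)%E.-integrable setT
    ((EFin \o f) \o (fun p : 'rV[R]_n * 'M[R]_(m, n) => ins i p.1 p.2)).
  apply/(integrable12ltyP (leb R 1 n) (leb R m n)) => //.
  exact/measurable_EFinP.
congr fine.
transitivity (\int[pushforward (leb R 1 n \x leb R m n)%E
    (fun p : 'rV[R]_n * 'M[R]_(m, n) => ins i p.1 p.2)]_y (EFin \o f) y)%E.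
  by apply: eq_measure_integral => A mA _; first [exact/esym/leb_ins|exact: leb_ins].
rewrite integral_pushforward//.
by apply/measurable_EFinP; exact: (nice_meas nf).
Qed.

Section balls.
Context {R : realType} {m n : nat}.
Notation M := 'M[R]_(m, n).
Notation mu := (leb R m n).
Notation nice := (nice (leb R m n)).

Definition inball (r : R) (y : M) : bool := enorm y <= r.

Lemma measurable_enorm_comp d (T : measurableType d) (f : T -> M) :
  measurable_fun setT f -> measurable_fun setT (fun t => enorm (f t)).
Proof. by move=> mf; exact: measurableT_comp (@measurable_enorm R m n) mf. Qed.

Let mball r : measurable [set y : M | inball r y].
Proof.
have := measurable_fun_ler (measurable_enorm_comp (@measurable_id _ M setT)) (@measurable_cst _ _ M R setT r).
by move=> /(_ measurableT [set true] (I : measurable [set true])); rewrite setTI.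
Qed.

Lemma ball_lty r : (mu [set y | inball r y] < +oo)%E.
Proof.
apply: le_lt_trans (mx_lebesgue_cbox R m n (Num.truncn `|r|).+1).
apply: le_measure; rewrite ?inE//.
  by apply: measurable_box => i j; exact: measurable_itv.
move=> y; rewrite /inball /= => h i j; rewrite /= in_itv/= -ler_norml.
apply: le_trans (coord_le_enorm y i j) _; apply: le_trans h _.
by apply: le_trans (ler_norm _) _; exact/ltW/truncnS_gt.
Qed.

Definition vol (r : R) : R := fine (mu [set y | inball r y]).

Lemma vol_ge0 r : 0 <= vol r. Proof. exact: fine_ge0. Qed.

Lemma int_inball r : nice (fun y => (inball r y)%:R) /\
  \int[mu]_y (inball r y)%:R = vol r.
Proof.
have -> : (fun y => (inball r y)%:R) = \1_[set y | inball r y] :> (M -> R).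
  apply/funext => y; rewrite indicE; congr (nat_of_bool _)%:R.
  by apply/idP/idP => [h|/set_mem//]; exact/mem_set.
have voo := ball_lty r.
split.
  split; first exact: measurable_indic.
    by exists 1 => x; rewrite indicE normr_nat lern1; case: (_ \in _).
  apply: integrable_ge0; first exact: measurable_indic.
    by move=> x; rewrite indicE.
  by rewrite integral_indic// setIT.
by rewrite /Rintegral integral_indic// setIT.
Qed.

Lemma bdd_supp_nice (f : M -> R) r : measurable_fun setT f -> bdd f ->
  (forall y, f y != 0 -> inball r y) -> nice f.
Proof.
move=> mf [B fB] h; apply: (nice_dom (niceZ B (int_inball r).1)) => // y.
have [->|/h ->] := eqVneq (f y) 0; first by rewrite normr0.
by rewrite mulr1; apply: le_trans (fB y) (ler_norm _).
Qed.

Lemma int_scale (t : R) (f : M -> R) : 0 < t -> nice f ->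
  nice (fun y => f (t *: y)) /\
  \int[mu]_y f (t *: y) = t ^- (m * n) * \int[mu]_y f y.
Proof.
move=> t0 nf; have := affine_Rint 0 (lt0r_neq0 t0) nf.
by under eq_fun do rewrite add0r; rewrite gtr0_norm//; under eq_Rintegral do rewrite add0r.
Qed.

Lemma vol_scale r : 0 < r -> vol r = r ^+ (m * n) * vol 1.
Proof.
move=> r0; rewrite -(int_inball r).2 -(int_inball 1).2.
have ri : 0 < r^-1 by rewrite invr_gt0.
have [_] := int_scale ri (int_inball 1).1; rewrite exprVn invrK => <-.
apply: eq_Rintegral => y _; congr (nat_of_bool _)%:R.
by rewrite /inball enormZ gtr0_norm// ler_pdivrMl// mulr1.
Qed.

Lemma subrXX_le (a b A : R) k : 0 <= b -> b <= a -> a <= A ->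
  a ^+ k.+1 - b ^+ k.+1 <= k.+1%:R * A ^+ k * (a - b).
Proof.
move=> b0 ba aA; rewrite subrXX mulrC ler_wpM2r ?subr_ge0//.
apply: (@le_trans _ _ (\sum_(i < k.+1) A ^+ k)); last by rewrite sumr_const card_ord mulr_natl.
apply: ler_sum => i _; have ik : (i <= k)%N by rewrite -ltnS.
have -> : A ^+ k = A ^+ (k.+1 - i.+1) * A ^+ i by rewrite -exprD subSS subnK.
have a0 : 0 <= a by exact: le_trans ba.
have A0 : 0 <= A by exact: le_trans aA.
have bA : b <= A by exact: le_trans aA.
by rewrite subSS; apply: ler_pM; rewrite ?exprn_ge0//; apply: lerXn2r; rewrite ?nnegrE.
Qed.

Definition shell (rho h : R) (y : M) : bool := `|enorm y - rho| <= h.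

Lemma measurable_shell d (T : measurableType d) (f : T -> M) rho h :
  measurable_fun setT f -> measurable_fun setT (fun t => (shell rho h (f t))%:R : R).
Proof.
move=> mf; apply: measurable_boolR; apply: measurable_fun_ler => //.
apply: measurableT_comp => //; apply: measurable_funB => //.
exact: measurable_enorm_comp.
Qed.

Lemma shell_nice rho h : nice (fun y => (shell rho h y)%:R).
Proof.
apply: (@bdd_supp_nice _ (rho + h)); first exact: measurable_shell.
  by exists 1 => y; case: shell; rewrite ?normr1 ?normr0.
move=> y; rewrite /shell /inball ler_norml; case: (boolP (- h <= enorm y - rho <= h)) => [/andP[_ h2] _|_]; last by rewrite eqxx.
by move: h2; lra.
Qed.

(** The bound must be linear in h, uniformly down to rho = 0. For 2 h < rho the shell lies in a
    difference of two balls; otherwise it lies in the ball of radius rho + h <= 3 h. *)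
Lemma shell_vol (H rho h : R) : (0 < m * n)%N -> 0 <= rho <= 2 -> 0 < h <= H ->
  \int[mu]_y (shell rho h y)%:R <=
  (m * n)%:R * (2 + H) ^+ (m * n).-1 * (3 * vol 1) * h.
Proof.
move=> mn0 /andP[rho0 rho2] /andP[h0 hH].
have V0 := vol_ge0 1.
have e k : (m * n)%N = k.+1 -> forall b, 0 <= b -> rho + h - b <= 3 * h -> b <= rho + h ->
  (rho + h) ^+ (m * n) - b ^+ (m * n) <= (m * n)%:R * (2 + H) ^+ (m * n).-1 * (3 * h).
  move=> -> b b0 bh ba; apply: le_trans (@subrXX_le _ b (2 + H) _ b0 ba _) _; first lra.
  rewrite ler_wpM2l//= mulr_ge0// exprn_ge0//; lra.
have {e} e := e _ (esym (prednK mn0)).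
have [_ i1] := int_inball (rho + h).
(* Radius rho - 2 h instead of rho - h: the shell is closed and its inner sphere must not be
   subtracted. *)
have [nb ib] := int_inball (rho - 2 * h).
have rh : 0 < rho + h by lra.
have [h2|h2] := ltP (2 * h) rho.
  apply: (@le_trans _ _ (\int[mu]_y ((inball (rho + h) y)%:R - (inball (rho - 2 * h) y)%:R))).
    apply: le_int; first exact: shell_nice.
      by apply: niceB => //; exact: (int_inball _).1.
    move=> y; rewrite /shell /inball ler_norml.
    case: (leP (enorm y) (rho - 2 * h)) => a1; case: (leP (enorm y) (rho + h)) => a2;
      case: (boolP (- h <= enorm y - rho <= h)) => [/andP[a3 a4]|_]; rewrite ?subrr ?subr0//; lra.
  rewrite intB//; last exact: (int_inball _).1.
  have rh2 : 0 < rho - 2 * h by lra.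
  rewrite i1 ib (vol_scale rh) (vol_scale rh2).
  have b0 : 0 <= rho - 2 * h by lra.
  have := e _ b0; rewrite -mulrBl => hh.
  apply: (@le_trans _ _ ((m * n)%:R * (2 + H) ^+ (m * n).-1 * (3 * h) * vol 1)).
    by rewrite ler_wpM2r// hh; lra.
  by rewrite le_eqVlt; apply/orP; left; apply/eqP; ring.
apply: (@le_trans _ _ (\int[mu]_y (inball (rho + h) y)%:R)).
  apply: le_int; [exact: shell_nice|exact: (int_inball _).1|].
  move=> y; rewrite /shell /inball ler_norml.
  case: (boolP (- h <= enorm y - rho <= h)) => [/andP[a3 a4]|_]//; case: (leP (enorm y) (rho + h)) => //; lra.
rewrite i1 (vol_scale rh).
have := e 0 (lexx 0); rewrite expr0n eqn0Ngt mn0/= !subr0 => hh.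
apply: (@le_trans _ _ ((m * n)%:R * (2 + H) ^+ (m * n).-1 * (3 * h) * vol 1)).
  by rewrite ler_wpM2r// hh; lra.
by rewrite le_eqVlt; apply/orP; left; apply/eqP; ring.
Qed.

End balls.

(** * Almost orthogonality of dilated kernels *)

Section bilinear.
Context d (T : measurableType d) (R : realType).
Variable mu : {sigma_finite_measure set T -> \bar R}.
Implicit Types (c e : T * T -> R) (k u : T -> R).

Definition bil c k : R := \int[mu]_y (k y * \int[mu]_y' (k y' * c (y, y'))).

Lemma bil_nice c k : measurable_fun setT c -> bdd c -> nice mu k ->
  nice mu (fun y => k y * \int[mu]_y' (k y' * c (y, y'))).
Proof.
move=> mc bc nk; apply: niceM => //.
  exact: kernel_meas (nice_meas nk).
exact: kernel_bdd.
Qed.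

Lemma bil_le c e k u : measurable_fun setT c -> bdd c -> measurable_fun setT e -> bdd e ->
  nice mu k -> nice mu u -> (forall y, `|k y| <= u y) -> (forall p, `|c p| <= e p) ->
  `|bil c k| <= bil e u.
Proof.
move=> mc bc me be nk nu ku ce.
apply: le_trans (le_norm_int (bil_nice mc bc nk)) _; apply: le_int.
- exact: nice_norm (bil_nice mc bc nk).
- exact: bil_nice me be nu.
move=> y; rewrite normrM; apply: ler_pM => //.
apply: le_trans (le_norm_int (kernel_nice1 mc bc y nk)) _; apply: le_int.
- exact: nice_norm (kernel_nice1 mc bc y nk).
- by have h := kernel_nice1 me be y nu; exact: h.
by move=> y'; rewrite normrM ler_pM.
Qed.

Lemma bil_sum (I : Type) (s : seq I) (c : I -> T * T -> R) k :
  (forall i, measurable_fun setT (c i)) -> (forall i, bdd (c i)) -> nice mu k ->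
  bil (fun p => \sum_(i <- s) c i p) k = \sum_(i <- s) bil (c i) k.
Proof.
move=> mc bc nk; rewrite /bil -int_sum; last by move=> i; exact: bil_nice.
apply: eq_Rintegral => y _; rewrite -mulr_sumr; congr (_ * _).
rewrite -int_sum; last by move=> i; exact: kernel_nice1.
by apply: eq_Rintegral => y' _; rewrite mulr_sumr.
Qed.

(** Cauchy-Schwarz in each of the two variables; u is idempotent, hence an indicator. *)
Lemma bil_CS c u : measurable_fun setT c -> bdd c -> nice mu u ->
  (forall y, u y ^+ 2 = u y) ->
  bil c u ^+ 2 <= (\int[mu]_y u y) ^+ 2 * bil (fun p => c p ^+ 2) u.
Proof.
move=> mc bc nu uu.
have mc2 : measurable_fun setT (fun p => c p ^+ 2) by exact: measurable_funX.
have bc2 : bdd (fun p => c p ^+ 2).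
  by have [B cB] := bc; exists (B ^+ 2) => p; rewrite normrX lerXn2r ?nnegrE ?(le_trans _ (cB p)).
have h (a : T -> R) : measurable_fun setT a -> bdd a ->
    (\int[mu]_y (u y * a y)) ^+ 2 <= (\int[mu]_y u y) * \int[mu]_y (u y * a y ^+ 2).
  move=> ma ba; have nua : nice mu (fun y => u y * a y) by exact: niceM.
  have := int_CS2 nu nua.
  have -> : (fun y => u y * (u y * a y)) = (fun y => u y * a y).
    by apply/funext => y; rewrite mulrA -expr2 uu.
  have -> : (fun y => u y ^+ 2) = u by apply/funext.
  by have -> : (fun y => (u y * a y) ^+ 2) = (fun y => u y * a y ^+ 2)
    by apply/funext => y; rewrite exprMn uu.
have u0 y : 0 <= u y by rewrite -uu sqr_ge0.
have mI := kernel_meas mu mc (nice_meas nu).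
have bI := kernel_bdd mc bc nu.
apply: le_trans (h _ mI bI) _; rewrite expr2 -mulrA.
apply: ler_wpM2l; first by apply: int_ge0.
rewrite -[leRHS](intZ _ (bil_nice mc2 bc2 nu)).
apply: le_int.
- apply: niceM => //; first exact: measurable_funX.
  have [B cB] := bI; exists (B ^+ 2) => p.
  by rewrite normrX lerXn2r ?nnegrE ?(le_trans _ (cB p)).
- exact: niceZ (bil_nice mc2 bc2 nu).
move=> y; rewrite [leRHS]mulrCA ler_wpM2l//; apply: h.
  exact: measurableT_comp mc (measurable_pair1 y).
by have [B cB] := bc; exists B => y'.
Qed.

End bilinear.

Section core.
Context {R : realType} {n : nat}.
Notation V := 'rV[R]_n.
Notation mu := (leb R 1 n).
Notation nice := (nice (leb R 1 n)).
Notation n2 := (n2 (leb R 1 n)).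
Hypothesis n0 : (0 < n)%N.
Variables (F : V -> R) (del : R).
Hypotheses (nF : nice F) (del0 : 0 < del) (F0 : forall x, avg del F x = 0).
Implicit Types (k : V -> R) (x y a b c : V) (t : R).

Let mF := nice_meas nF.
Let bF := nice_bdd nF.

Lemma measurable_subscale d (T : measurableType d) (f g : T -> V) t :
  measurable_fun setT f -> measurable_fun setT g ->
  measurable_fun setT (fun p => f p - t *: g p).
Proof.
move=> mf mg; apply: measurable_matrix => i j.
under eq_fun do rewrite !mxE.
apply: measurable_funB; first exact: (measurableT_comp (measurable_coord i j)).
apply: measurable_funM => //; exact: (measurableT_comp (measurable_coord i j)).
Qed.

Definition cF t (p : V * V) := F (p.1 - t *: p.2).

Lemma cF_meas t : measurable_fun setT (cF t).
Proof. by apply: (measurableT_comp mF); apply: measurable_subscale. Qed.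

Lemma cF_bdd t : bdd (cF t).
Proof. by have [B h] := bF; exists B => p; exact: h. Qed.

Lemma cF_int t y : (\int[mu]_x `|cF t (x, y)|%:E <= (\int[mu]_x `|F x|)%:E)%E.
Proof.
have nF' := shift_nice (t *: y) (nice_norm nF).
by rewrite ge0_Rint// lee_fin (shift_int (t *: y) (nice_norm nF)).
Qed.

(** The convolution of F with the dilate of k by t, up to the Jacobian of the dilation. *)
Definition dconv t k x := \int[mu]_y (k y * cF t (x, y)).

Lemma dconv_nice t k : nice k -> nice (dconv t k).
Proof.
by move=> nk; exact: (kernel_nice (@cF_meas t) (@cF_bdd t) nk (@cF_int t)).
Qed.

Definition G (w : V) := \int[mu]_x (F x * F (x - w)).

Lemma G_bdd w : `|G w| <= n2 F ^+ 2.
Proof.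
by have := int_CS nF (shift_nice w nF); rewrite shift_n2.
Qed.

Lemma absG_le v : `|\int[mu]_x (`|F x| * `|F (x - v)|)| <= n2 F ^+ 2.
Proof.
have := int_CS (nice_norm nF) (nice_norm (shift_nice v nF)).
by rewrite !n2_norm (shift_n2 v nF) expr2.
Qed.

Lemma measurable_G : measurable_fun setT G.
Proof.
apply: (measurable_Rint _ (h := fun p : V * V => F p.2 * F (p.2 - p.1))).
apply: measurable_funM; first exact: measurableT_comp.
apply: (measurableT_comp mF).
by under eq_fun do rewrite -[_.1]scale1r; apply: measurable_subscale.
Qed.

Lemma corr a b : \int[mu]_x (F (x - a) * F (x - b)) = G (b - a).
Proof.
have nf : nice (fun x => F x * F (x - (b - a))).
  by apply: niceMM => //; exact: shift_nice.
rewrite /G -(shift_int a nf); apply: eq_Rintegral => x _.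
by congr (_ * F _); rewrite opprB addrA subrK.
Qed.

Definition cG t (p : V * V) := G (t *: (p.2 - p.1)).

Lemma cG_meas t : measurable_fun setT (cG t).
Proof.
apply: (measurableT_comp measurable_G).
apply: (measurableT_comp (measurable_scale t)).
by under eq_fun do rewrite -[_.1]scale1r; apply: measurable_subscale.
Qed.

Lemma cG_bdd t : bdd (cG t).
Proof. by exists (n2 F ^+ 2) => p; exact: G_bdd. Qed.

(** The T T* argument: k enters as a quadratic form whose kernel is the autocorrelation [G] of F.
    Only the indicator part of k will have to be regular. *)
Lemma dconv_sqr t k : nice k -> \int[mu]_x dconv t k x ^+ 2 = bil mu (cG t) k.
Proof.
move=> nk; have nc := dconv_nice t nk.
transitivity (\int[mu]_x (dconv t k x * \int[mu]_y (k y * cF t (x, y)))); first by [].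
apply: etrans (kernel_swap (@cF_meas t) (@cF_bdd t) nk nc) _; apply: eq_Rintegral => y _.
congr (_ * _).
have ns : nice (fun x => cF t (x, y)) by exact: (shift_nice (t *: y) nF).
transitivity (\int[mu]_x (cF t (x, y) * \int[mu]_y' (k y' * cF t (x, y')))).
  by apply: eq_Rintegral => x _; rewrite mulrC.
apply: etrans (kernel_swap (@cF_meas t) (@cF_bdd t) nk ns) _; apply: eq_Rintegral => y' _.
by congr (_ * _); apply: etrans (corr (t *: y) (t *: y')) _; rewrite -scalerBr.
Qed.

Section one_shell.
Variables (q : V -> bool) (rs : seq R) (tau h : R).
Hypotheses (nq : nice (fun y => (q y)%:R)).
Hypothesis tau0 : tau != 0.
Hypothesis hE : n%:R * del / `|tau| <= h.
Hypothesis jump : forall y y', q y != q y' ->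
  exists2 rho, rho \in rs & shell rho (enorm (y - y')) y.

Let sh y : R := \sum_(rho <- rs) (shell rho h y)%:R.

Let sh_nice : nice sh.
Proof. by apply: nice_sum => rho; exact: shell_nice. Qed.

(** In the variable v = c - tau y the indicator q becomes b. Since F has mean zero on cubes of side
    del, b may be replaced by b minus its cube average, which vanishes on every cube where b is
    constant. On the other cubes q jumps within distance n del / |tau| <= h, so by [jump] the point
    lies in one of the shells. *)
Lemma shell_bound c :
  `|\int[mu]_y ((q y)%:R * F (c - tau *: y))| <= \int[mu]_y (sh y * `|F (c - tau *: y)|).
Proof.
have tN : - tau != 0 by rewrite oppr_eq0.
have tV : - tau^-1 != 0 by rewrite oppr_eq0 invr_neq0.
have back v : tau^-1 *: c + - tau^-1 *: (c + - tau *: v) = v.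
  rewrite scalerDr scalerA mulNr mulrN opprK mulVf// scale1r addrA scaleNr.
  by rewrite addrN add0r.
pose b v := (q (tau^-1 *: c + - tau^-1 *: v))%:R : R.
pose s v := sh (tau^-1 *: c + - tau^-1 *: v).
have nb : nice b by have [] := affine_Rint (tau^-1 *: c) tV nq.
have ns : nice s by have [] := affine_Rint (tau^-1 *: c) tV sh_nice.
have [_ i1] := affine_Rint c tN (niceMM nb nF).
have [_ i2] := affine_Rint c tN (niceMM ns (nice_norm nF)).
rewrite (_ : \int[mu]_y ((q y)%:R * F (c - tau *: y)) = `|- tau| ^- (1 * n) * \int[mu]_v (b v * F v)); last first.
  by rewrite -i1; apply: eq_Rintegral => y _; rewrite /b back scaleNr.
rewrite (_ : \int[mu]_y (sh y * `|F (c - tau *: y)|) = `|- tau| ^- (1 * n) * \int[mu]_v (s v * `|F v|)); last first.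
  by rewrite -i2; apply: eq_Rintegral => y _; rewrite /s back scaleNr.
rewrite normrM ger0_norm ?invr_ge0 ?exprn_ge0// ler_wpM2l ?invr_ge0 ?exprn_ge0//.
have nab := avg_nice del0 nb.
(* The cancellation of F: the cube average of b can be subtracted at no cost. *)
have z0 : \int[mu]_v (avg del b v * F v) = 0.
  rewrite (avg_sym del0)// (_ : (fun x => _) = (fun=> 0)) ?Rintegral_cst ?mul0r//.
  by apply/funext => x; rewrite F0 mulr0.
rewrite -[X in `|X|]subr0 -z0 -intB; [|exact: niceMM..].
apply: le_trans (le_norm_int _) _; first by apply: niceB; exact: niceMM.
apply: le_int; [by apply: nice_norm; apply: niceB; exact: niceMM|by apply: niceMM => //; exact: nice_norm|].
move=> v; rewrite -mulrBl normrM ler_wpM2r//.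
have s0 : 0 <= s v by apply: sumr_ge0.
have [hv|] := pselect (forall y, same del v y -> b y = b v).
  by rewrite (avg_id del0)// subrr normr0.
move=> /existsNP[y /not_implyP[vy bne]].
have [rho rrs rsh] : exists2 rho, rho \in rs &
    shell rho h (tau^-1 *: c + - tau^-1 *: v).
  have : q (tau^-1 *: c + - tau^-1 *: v) != q (tau^-1 *: c + - tau^-1 *: y).
    by apply: contra_notN bne => /eqP e; rewrite /b e.
  move=> /jump[rho rrs rsh]; exists rho => //; apply: le_trans rsh _; apply: le_trans hE.
  rewrite opprD addrACA subrr add0r -scalerBr enormZ normrN normfV mulrC ler_wpM2r ?invr_ge0//.
  rewrite -[X in X%:R * del]mul1n; apply: enorm_le; first exact: ltW.
  by move=> i j; rewrite ord1 !mxE; exact: same_dist.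
have s1 : 1 <= s v.
  rewrite /s /sh (big_rem rho)//= rsh lerDl; exact: sumr_ge0.
apply: le_trans s1.
have b01 w : 0 <= b w <= 1 by rewrite /b; case: (q _); rewrite ?lexx ?ler01.
have a0 : 0 <= avg del b v by apply: (avg_ge0 del0) => w; case/andP: (b01 w).
have a1 : avg del b v <= 1.
  have := @avg_id R n del del0 (fun=> 1) v (fun _ _ => erefl) => <-.
  rewrite /avg ler_pM2l ?invr_gt0 ?exprn_gt0//; apply: le_int.
  - exact: sf_nice.
  - by under eq_fun do rewrite mulr1; exact: (int_same v del0).1.
  - by move=> w; rewrite ler_wpM2l//; case/andP: (b01 w).
by have /andP[b0 b1] := b01 v; rewrite ler_norml; apply/andP; split; lra.
Qed.

(** The correlation is written as an integral in x and the order of integration exchanged, so that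
    [shell_bound] applies for each x; Cauchy-Schwarz in x then removes F. *)
Lemma shell_corr y : `|\int[mu]_y' ((q y')%:R * cG tau (y, y'))| <=
  (\int[mu]_y' sh y') * n2 F ^+ 2.
Proof.
pose cf (p : V * V) := F (p.1 - tau *: (p.2 - y)).
have cfE x y' : cf (x, y') = cF tau (x + tau *: y, y').
  by rewrite /cf /cF/= scalerBr opprB [_ - tau *: y']addrC addrA addrAC.
have mcf : measurable_fun setT cf.
  apply: (measurableT_comp mF); apply: measurable_subscale => //.
  exact: (measurableT_comp (measurable_shift (- y))).
have bcf : bdd cf by have [B h'] := bF; exists B => p; exact: h'.
rewrite (_ : (fun y' => _) = (fun y' => (q y')%:R * \int[mu]_x (F x * cf (x, y')))); last first.
  by apply/funext.
rewrite -(kernel_swap mcf bcf nq nF).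
have nk : nice (fun x => \int[mu]_y' ((q y')%:R * cf (x, y'))).
  apply: (kernel_nice mcf bcf nq (A := \int[mu]_x `|F x|)) => y'.
  have nF' := shift_nice (tau *: (y' - y)) (nice_norm nF).
  by rewrite ge0_Rint// lee_fin -[leRHS](shift_int (tau *: (y' - y)) (nice_norm nF)).
have macf : measurable_fun setT (fun p => `|cf p|) by exact: measurableT_comp.
have bacf : bdd (fun p => `|cf p|).
  by have [B h'] := bcf; exists B => p; rewrite normr_id.
have nk2 : nice (fun x => \int[mu]_y' (sh y' * `|cf (x, y')|)).
  apply: (kernel_nice macf bacf sh_nice (A := \int[mu]_x `|F x|)) => y'.
  have nF' := shift_nice (tau *: (y' - y)) (nice_norm nF).
  by under eq_integral do rewrite normr_id; rewrite ge0_Rint// lee_fin -[leRHS](shift_int (tau *: (y' - y)) (nice_norm nF)).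
apply: le_trans (le_norm_int (niceMM nF nk)) _.
apply: (@le_trans _ _ (\int[mu]_x (`|F x| * \int[mu]_y' (sh y' * `|cf (x, y')|)))).
  apply: le_int; [exact/nice_norm/niceMM|exact: niceMM (nice_norm nF) nk2|].
  move=> x; rewrite normrM ler_wpM2l//.
  under eq_Rintegral do rewrite cfE; under [leRHS]eq_Rintegral do rewrite cfE.
  exact: shell_bound.
rewrite (kernel_swap macf bacf sh_nice (nice_norm nF)).
rewrite mulrC -intZ//; apply: le_int.
- apply: niceM => //.
    have := kernel_meas mu (c := fun p => `|cf (p.2, p.1)|) _ (nice_meas (nice_norm nF)).
    apply; apply: measurableT_comp => //; apply: (measurableT_comp mcf).
    exact: measurable_fun_pair.
  exists (n2 F ^+ 2) => y'; rewrite ger0_norm; last by apply: int_ge0 => x; rewrite mulr_ge0.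
  by apply: le_trans (ler_norm _) _; exact: (absG_le (tau *: (y' - y))).
- exact: niceZ.
move=> y'; rewrite mulrC ler_wpM2r//; first exact: sumr_ge0.
by apply: le_trans (ler_norm _) _; exact: (absG_le (tau *: (y' - y))).
Qed.

End one_shell.

End core.

Lemma bdd_sum d (T : measurableType d) (I : Type) (R : realType) (s : seq I) (f : I -> T -> R) :
  (forall i, bdd (f i)) -> bdd (fun p => \sum_(i <- s) f i p).
Proof.
move=> bf; elim: s => [|i s [B IH]]; first by exists 0 => p; rewrite big_nil normr0.
have [B' h'] := bf i; exists (B' + B) => p.
by rewrite big_cons (le_trans (ler_normD _ _))// lerD.
Qed.

Lemma bilZ d (T : measurableType d) (R : realType)
  (mu : {sigma_finite_measure set T -> \bar R}) (c : T * T -> R) a (k : T -> R) :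
  measurable_fun setT c -> bdd c -> nice mu k ->
  bil mu c (fun y => a * k y) = a ^+ 2 * bil mu c k.
Proof.
move=> mc bc nk; rewrite /bil -(intZ _ (bil_nice mc bc nk)); apply: eq_Rintegral => y _.
have -> : \int[mu]_y' (a * k y' * c (y, y')) = a * \int[mu]_y' (k y' * c (y, y')).
  rewrite -intZ; last exact: (kernel_nice1 mc bc y nk).
  by apply: eq_Rintegral => y' _; rewrite mulrA.
by ring.
Qed.

Section many_dilations.
Context {R : realType} {n : nat}.
Notation V := 'rV[R]_n.
Notation mu := (leb R 1 n).
Notation nice := (nice (leb R 1 n)).
Notation n2 := (n2 (leb R 1 n)).
Hypothesis n0 : (0 < n)%N.
Variables (F : V -> R) (del : R).
Hypotheses (nF : nice F) (del0 : 0 < del) (F0 : forall x, avg del F x = 0).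
Variables (M : nat) (lam : R) (kap : V -> R).
Hypotheses (M0 : (0 < M)%N) (delM : del * M%:R ^+ 2 <= 1).
Hypotheses (mkap : measurable_fun setT kap) (kaplam : forall y, `|kap y| <= lam).
Variables (b : 'I_M -> V -> bool) (rs : 'I_M -> seq R).
Hypotheses (mb : forall k, measurable_fun setT (b k)).
Hypotheses (b2 : forall k y, b k y -> inball 2 y).
Hypotheses (rs2 : forall k, size (rs k) = 2%N).
Hypotheses (rs02 : forall k rho, rho \in rs k -> 0 <= rho <= 2).
Hypothesis jump : forall k y y', b k y != b k y' ->
  exists2 rho, rho \in rs k & shell rho (enorm (y - y')) y.

Definition dil (k : 'I_M) : R := 1 + k%:R / M%:R.

Let u (y : V) : R := (inball 2 y)%:R.
Let nu : nice u := (@int_inball R 1 n 2).1.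
Let v : R := @vol R 1 n 2.
Let iu : \int[mu]_y u y = v := (@int_inball R 1 n 2).2.
Let u2 y : u y ^+ 2 = u y.
Proof. by rewrite /u; case: inball; rewrite ?expr1n ?expr0n. Qed.

Let Mp : (0 : R) < M%:R. Proof. by rewrite ltr0n. Qed.

Definition shell_const : R := (1 * n)%:R * (2 + n%:R) ^+ (1 * n).-1 * (3 * @vol R 1 n 1).
(** The outer v^2 comes from [bil_CS]. Inside, M diagonal terms of size v^2 and M^2 off-diagonal
    terms of size 4 v [shell_const] n / M add up to M times the bracket; the 4 counts two radii for
    each of two dilations. *)
Definition dilation_const : R := v ^+ 2 * (v ^+ 2 + 4 * v * shell_const * n%:R).

Let v0 : 0 <= v. Proof. exact: vol_ge0. Qed.

Let sc0 : 0 <= shell_const.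
Proof. by rewrite /shell_const !mulr_ge0 ?vol_ge0 ?exprn_ge0 ?addr_ge0. Qed.

Let lam0 : 0 <= lam. Proof. exact: le_trans (kaplam 0). Qed.

Let eta k (p : V * V) : R := (b k p.1)%:R * (b k p.2)%:R.

Let meta k : measurable_fun setT (eta k).
Proof.
apply: measurable_funM; apply: measurable_boolR.
  exact: (measurableT_comp (mb k) measurable_fst).
exact: (measurableT_comp (mb k) measurable_snd).
Qed.

Let eta1 k p : 0 <= eta k p <= 1.
Proof. by rewrite /eta; case: b; case: b; rewrite ?mulr0 ?mulr1 ?lexx ?ler01. Qed.

Let beta k : bdd (eta k).
Proof. by exists 1 => p; have /andP[h1 h2] := eta1 k p; rewrite ger0_norm. Qed.

Let bddM (f g : V * V -> R) : bdd f -> bdd g -> bdd (fun p => f p * g p).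
Proof. by move=> [B h] [B' h']; exists (B * B') => p; rewrite normrM ler_pM. Qed.

Let c k (p : V * V) := eta k p * cG F (dil k) p.
Let mc k : measurable_fun setT (c k).
Proof. by apply: measurable_funM => //; exact: cG_meas. Qed.
Let bc k : bdd (c k). Proof. by apply: bddM => //; exact: cG_bdd. Qed.

Let Phi p := \sum_k c k p.
Let mPhi : measurable_fun setT Phi.
Proof. by apply: measurable_sum => k; exact: mc. Qed.
Let bPhi : bdd Phi.
Proof. by apply: bdd_sum => k; exact: bc. Qed.

Let ck k k' (p : V * V) := eta k p * eta k' p * cG F (dil k' - dil k) p.
Let mck k k' : measurable_fun setT (ck k k').
Proof. by apply: measurable_funM; [exact: measurable_funM|exact: cG_meas]. Qed.
Let bck k k' : bdd (ck k k').
Proof. by apply: bddM; [exact: bddM|exact: cG_bdd]. Qed.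

Let kapk k y : R := kap y * (b k y)%:R.
Let nkapk k : nice (kapk k).
Proof.
apply: (@bdd_supp_nice _ _ _ _ 2).
- by apply: measurable_funM => //; exact: measurable_boolR.
- exists lam => y; rewrite normrM; case: (b k y); rewrite ?normr1 ?mulr1// normr0 mulr0.
  exact: lam0.
- by move=> y; rewrite /kapk; case: (b k y) (b2 (k := k) (y := y)) => [->//|_]; rewrite mulr0 eqxx.
Qed.

Let kap0 y : R := kap y * u y.
Let nkap0 : nice kap0.
Proof.
apply: (@bdd_supp_nice _ _ _ _ 2).
- by apply: measurable_funM => //; exact: nice_meas nu.
- exists lam => y; rewrite normrM /u; case: inball; rewrite ?normr1 ?mulr1// normr0 mulr0.
  exact: lam0.
- by move=> y; rewrite /kap0 /u; case: inball => //; rewrite mulr0 eqxx.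
Qed.

Let total : \sum_k \int[mu]_x dconv F (dil k) (kapk k) x ^+ 2 = bil mu Phi kap0.
Proof.
transitivity (\sum_k bil mu (c k) kap0); last by rewrite -(bil_sum _ mc bc nkap0).
apply: eq_bigr => k _; apply: etrans (dconv_sqr nF (dil k) (nkapk k)) _.
apply: eq_Rintegral => y _; rewrite /kapk /kap0 /c /eta/=.
case: (boolP (b k y)) => [h|_].
  rewrite /u (b2 h) !mulr1; congr (_ * _); apply: eq_Rintegral => y' _.
  rewrite mul1r mulrA; congr (_ * _).
  by case: (boolP (b k y')) => [/b2 ->|_]; rewrite ?mulr1// !mulr0.
rewrite mulr0 mul0r (_ : (fun y' => _) = (fun=> 0)) ?Rintegral_cst ?mul0r ?mulr0//.
by apply/funext => y'; rewrite !mul0r mulr0.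
Qed.

(** [Phi p] is the scalar product of F with a sum of dilated translates of F. Cauchy-Schwarz
    replaces the dilations by the differences [dil k' - dil k], which stay away from 0 off the
    diagonal. *)
Let Phi_sqr p : `|Phi p| ^+ 2 <= n2 F ^+ 2 * \sum_k \sum_k' ck k k' p.
Proof.
pose S x := \sum_k eta k p * F (x - dil k *: (p.2 - p.1)).
have nS1 k : nice (fun x => eta k p * F (x - dil k *: (p.2 - p.1))).
  by apply: niceZ; exact: (shift_nice (dil k *: (p.2 - p.1)) nF).
have nS : nice S by exact: nice_sum.
have -> : Phi p = \int[mu]_x (F x * S x).
  transitivity (\sum_k \int[mu]_x (F x * (eta k p * F (x - dil k *: (p.2 - p.1))))).
    apply: eq_bigr => k _; rewrite /c /cG /G -intZ.
      by apply: eq_Rintegral => x _; rewrite mulrCA.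
    by apply: niceMM => //; exact: (shift_nice (dil k *: (p.2 - p.1)) nF).
  rewrite -int_sum; last by move=> k; exact: niceMM.
  by apply: eq_Rintegral => x _; rewrite mulr_sumr.
rewrite real_normK ?num_real//; apply: le_trans (int_CS2 nF nS) _.
rewrite n2_sqr ler_wpM2l//; first by apply: int_ge0 => x; exact: sqr_ge0.
rewrite le_eqVlt; apply/orP; left; apply/eqP.
pose f k x := eta k p * F (x - dil k *: (p.2 - p.1)).
transitivity (\sum_k \sum_k' \int[mu]_x (f k x * f k' x)).
  have nff k : nice (fun x => f k x * S x) := niceMM (nS1 k) nS.
  transitivity (\sum_k \int[mu]_x (f k x * S x)).
    rewrite -(int_sum _ nff); apply: eq_Rintegral => x _.
    by rewrite expr2 mulr_suml.
  apply: eq_bigr => k _; have nff' k' : nice (fun x => f k x * f k' x) := niceMM (nS1 k) (nS1 k').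
  by rewrite -(int_sum _ nff'); apply: eq_Rintegral => x _; rewrite mulr_sumr.
apply: eq_bigr => k _; apply: eq_bigr => k' _; rewrite /ck /cG scalerBl -corr//.
rewrite -intZ; first by apply: eq_Rintegral => x _; rewrite /f; ring.
by apply: niceMM; [exact: (shift_nice (dil k *: (p.2 - p.1)) nF)|exact: (shift_nice (dil k' *: (p.2 - p.1)) nF)].
Qed.

Let cG_le t p : `|cG F t p| <= n2 F ^+ 2. Proof. exact: G_bdd. Qed.

Let diag k : bil mu (ck k k) u <= v ^+ 2 * n2 F ^+ 2.
Proof.
apply: le_trans (ler_norm _) _.
apply: (@le_trans _ _ (bil mu (fun=> n2 F ^+ 2) u)).
  apply: bil_le => //.
  - by exists (n2 F ^+ 2) => p; rewrite ger0_norm// sqr_ge0.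
  - by move=> y; rewrite ger0_norm.
  move=> p; rewrite /ck; have /andP[h1 h2] := eta1 k p.
  rewrite normrM -[leRHS]mul1r; apply: ler_pM => //.
  by rewrite ger0_norm ?mulr_ge0// mulr_ile1.
rewrite /bil (_ : (fun y => _) = (fun y => v * n2 F ^+ 2 * u y)).
  by rewrite intZ// iu le_eqVlt; apply/orP; left; apply/eqP; ring.
apply/funext => y; rewrite (_ : \int[mu]_y' _ = n2 F ^+ 2 * v); first by ring.
by rewrite -iu -intZ//; apply: eq_Rintegral => y' _; rewrite mulrC.
Qed.

Let offdiag k k' : k != k' ->
  bil mu (ck k k') u <= v * (4 * shell_const * (n%:R / M%:R) * n2 F ^+ 2).
Proof.
move=> kk'; set tau := dil k' - dil k; set h := n%:R / M%:R.
have tauE : tau = (k'%:R - k%:R) / M%:R by rewrite /tau /dil; field; rewrite gt_eqF.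
have k1 : 1 <= `|k'%:R - k%:R : R|.
  rewrite -[k'%:R]/((k' : int)%:~R) -[k%:R]/((k : int)%:~R) -rmorphB/= -intr_norm ler1z.
  by have : nat_of_ord k != nat_of_ord k' by []; lia.
have ktau : M%:R^-1 <= `|tau|.
  by rewrite tauE normrM normfV (ger0_norm (ltW Mp)) ler_peMl ?invr_ge0// ltW.
have tau0 : tau != 0.
  by rewrite -normr_gt0; apply: lt_le_trans ktau; rewrite invr_gt0.
(* This is where del <= M^-2 is used: after a dilation by |tau| >= 1/M the cubes still have diameter
   of order 1/M. *)
have hE : n%:R * del / `|tau| <= h.
  rewrite -mulrA ler_wpM2l// ler_pdivrMr ?normr_gt0//.
  apply: (@le_trans _ _ (M%:R^-1 * M%:R^-1)); last by rewrite ler_wpM2l ?invr_ge0 ?(ltW Mp).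
  by rewrite -expr2 exprVn -[leRHS]mul1r ler_pdivlMr ?exprn_gt0.
pose q y := b k y && b k' y.
have mq : measurable_fun setT q by exact: measurable_and.
have qu y : q y -> inball 2 y by move=> /andP[/b2].
have nq : nice (fun y => (q y)%:R).
  apply: (@bdd_supp_nice _ _ _ _ 2); first exact: measurable_boolR.
    by exists 1 => y; case: (q y); rewrite ?normr1 ?normr0.
  by move=> y; have := qu y; case: (q y) => [->|_]//; rewrite eqxx.
have jq y y' : q y != q y' ->
    exists2 rho, rho \in rs k ++ rs k' & shell rho (enorm (y - y')) y.
  rewrite /q => hq; have [e|e] := eqVneq (b k y) (b k y').
    have : b k' y != b k' y' by apply: contraNneq hq => ->; rewrite e.
    by move=> /jump[rho r1 r2]; exists rho => //; rewrite mem_cat r1 orbT.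
  by have [rho r1 r2] := jump e; exists rho => //; rewrite mem_cat r1.
have sc y : `|\int[mu]_y' ((q y')%:R * cG F tau (y, y'))| <=
    4 * shell_const * h * n2 F ^+ 2.
  apply: le_trans (shell_corr nF del0 F0 nq tau0 hE jq y) _.
  rewrite ler_wpM2r ?sqr_ge0// int_sum; last by move=> rho; exact: shell_nice.
  apply: (@le_trans _ _ (\sum_(rho <- rs k ++ rs k') shell_const * h)).
    rewrite big_seq [leRHS]big_seq; apply: ler_sum => rho.
    rewrite mem_cat => rr; rewrite /shell_const; apply: shell_vol.
    - by rewrite mul1n.
    - by case/orP: rr => /rs02.
    - rewrite /h divr_gt0 ?ltr0n//= ler_pdivrMr// -natrM ler_nat.
      by rewrite leq_pmulr.
  by rewrite big_const_seq count_predT size_cat !rs2 /= !addr0 le_eqVlt; apply/orP; left; apply/eqP; ring.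
apply: le_trans (ler_norm _) _.
rewrite /bil; apply: le_trans (le_norm_int (bil_nice (mck k k') (bck k k') nu)) _.
rewrite mulrC -iu -intZ//; apply: le_int.
- exact: nice_norm (bil_nice (mck k k') (bck k k') nu).
- exact: niceZ.
move=> y; rewrite normrM mulrC [`|u y|]ger0_norm// ler_wpM2r//.
apply: le_trans _ (sc y).
set I := (X in `|X| <= _).
have -> : I = (q y)%:R * \int[mu]_y' ((q y')%:R * cG F tau (y, y')).
  rewrite -intZ; last by have h' := kernel_nice1 (cG_meas nF tau) (cG_bdd nF tau) y nq; exact: h'.
  apply: eq_Rintegral => y' _; rewrite /ck /eta /q/= /u.
  case: (boolP (b k y')) => [/b2 ->|_]; last by rewrite !(mulr0, mul0r).
  by case: (b k y); case: (b k' y); case: (b k' y'); rewrite !(mulr0, mul0r, mul1r, mulr1).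
by rewrite normrM ler_piMl//; case: (q y); rewrite ?normr1 ?normr0.
Qed.

(** Term by term the left-hand side is of order M^2; almost orthogonality brings it down to order M.
    The squaring comes from applying Cauchy-Schwarz to the quadratic form of [Phi]. *)
Lemma dilations_bound :
  (\sum_k \int[mu]_x dconv F (dil k) (fun y => kap y * (b k y)%:R) x ^+ 2) ^+ 2 <=
  dilation_const * lam ^+ 4 * M%:R * n2 F ^+ 4.
Proof.
rewrite -/(kapk _) total.
have maPhi : measurable_fun setT (fun p => `|Phi p|) by exact: measurableT_comp.
have baPhi : bdd (fun p => `|Phi p|) by have [B h] := bPhi; exists B => p; rewrite normr_id.
have nlu : nice (fun y => lam * u y) by exact: niceZ.
have h1 : `|bil mu Phi kap0| <= lam ^+ 2 * bil mu (fun p => `|Phi p|) u.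
  rewrite -bilZ//; apply: bil_le => //.
  by move=> y; rewrite /kap0 normrM ler_pM// ger0_norm.
have h2 : bil mu (fun p => `|Phi p|) u ^+ 2 <=
    v ^+ 2 * (n2 F ^+ 2 * (M%:R * n2 F ^+ 2 * (v ^+ 2 + 4 * v * shell_const * n%:R))).
  apply: le_trans (bil_CS maPhi baPhi nu u2) _; rewrite iu ler_wpM2l ?sqr_ge0//.
  pose Q p := \sum_k \sum_k' ck k k' p.
  have mQk k : measurable_fun setT (fun p => \sum_k' ck k k' p).
    by apply: measurable_sum => k'; exact: mck.
  have bQk k : bdd (fun p => \sum_k' ck k k' p) by apply: bdd_sum => k'; exact: bck.
  have mQ : measurable_fun setT Q by apply: measurable_sum => k; exact: mQk.
  have bQ : bdd Q by apply: bdd_sum => k; exact: bQk.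
  have mQ2 : measurable_fun setT (fun p => n2 F ^+ 2 * Q p) by exact: measurable_funM.
  have bQ2 : bdd (fun p => n2 F ^+ 2 * Q p).
    by have [B h] := bQ; exists (`|n2 F ^+ 2| * B) => p; rewrite normrM ler_wpM2l.
  apply: (@le_trans _ _ (bil mu (fun p => n2 F ^+ 2 * Q p) u)).
    apply: le_trans (ler_norm _) _; apply: bil_le => //.
    - exact: measurable_funX.
    - have [B h] := baPhi; exists (B ^+ 2) => p.
      by rewrite normrX lerXn2r ?nnegrE ?(le_trans _ (h p)).
    - by move=> y; rewrite ger0_norm.
    - by move=> p; rewrite ger0_norm ?sqr_ge0// Phi_sqr.
  have -> : bil mu (fun p => n2 F ^+ 2 * Q p) u = n2 F ^+ 2 * bil mu Q u.
    rewrite /bil -(intZ _ (bil_nice mQ bQ nu)); apply: eq_Rintegral => y _.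
    rewrite mulrCA; congr (_ * _).
    rewrite -(intZ _ (kernel_nice1 mQ bQ y nu)); apply: eq_Rintegral => y' _.
    by rewrite mulrCA.
  rewrite ler_wpM2l ?sqr_ge0//.
  rewrite (bil_sum _ mQk bQk nu).
  rewrite (eq_bigr (fun k => \sum_k' bil mu (ck k k') u)); last first.
    by move=> k _; rewrite (bil_sum _ (mck k) (bck k) nu).
  set e := v * (4 * shell_const * (n%:R / M%:R) * n2 F ^+ 2).
  have e0 : 0 <= e.
    apply: mulr_ge0 => //; apply: mulr_ge0; last exact: sqr_ge0.
    by apply: mulr_ge0; [exact: mulr_ge0|exact: divr_ge0].
  apply: (@le_trans _ _ (\sum_(k < M) (v ^+ 2 * n2 F ^+ 2 + M%:R * e))).
    apply: ler_sum => k _; rewrite (bigD1 k)//=; apply: lerD; first exact: diag.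
    apply: (@le_trans _ _ (\sum_(k' < M) e)); last by rewrite sumr_const card_ord mulr_natl.
    rewrite [leRHS](bigID (fun k' => k' != k))/= -[leLHS]addr0; apply: lerD.
      by apply: ler_sum => k' kk'; apply: offdiag; rewrite eq_sym.
    by apply: sumr_ge0.
  rewrite sumr_const card_ord -[leLHS]mulr_natl /e le_eqVlt; apply/orP; left; apply/eqP.
  by field; rewrite gt_eqF.
rewrite -[leLHS]real_normK ?num_real//.
apply: (@le_trans _ _ ((lam ^+ 2 * bil mu (fun p => `|Phi p|) u) ^+ 2)).
  rewrite lerXn2r ?nnegrE//; first exact: le_trans h1.
rewrite exprMn; apply: (@le_trans _ _ ((lam ^+ 2) ^+ 2 * (v ^+ 2 * (n2 F ^+ 2 * (M%:R * n2 F ^+ 2 * (v ^+ 2 + 4 * v * shell_const * n%:R)))))).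
  by rewrite ler_wpM2l ?sqr_ge0.
by rewrite /dilation_const le_eqVlt; apply/orP; left; apply/eqP; ring.
Qed.

End many_dilations.

(** * Decay for bounded kernels *)

Section product_functions.
Context {R : realType} {n : nat}.
Notation V := 'rV[R]_n.

Lemma prod_rows_meas d (T : measurableType d) m (f : 'I_m -> V -> R) (h : T -> V)
    (g : T -> 'M[R]_(m, n)) : (forall a, measurable_fun setT (f a)) ->
  measurable_fun setT h -> measurable_fun setT g ->
  measurable_fun setT (fun p => \prod_a f a (h p - row a (g p))).
Proof.
move=> mf mh mg; apply: measurable_prodr => a; apply: (measurableT_comp (mf a)).
have mr : measurable_fun setT (fun p => row a (g p)).
  exact: (measurableT_comp (measurable_row a) mg).
by under eq_fun do rewrite -[row _ _]scale1r; apply: measurable_subscale.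
Qed.

Lemma prod_bdd d (T : measurableType d) (I : Type) (s : seq I) (f : I -> T -> R) :
  (forall i, bdd (f i)) -> bdd (fun p => \prod_(i <- s) f i p).
Proof.
move=> bf; elim: s => [|i s [B IH]]; first by exists 1 => p; rewrite big_nil normr1.
have [B' h'] := bf i; exists (B' * B) => p.
by rewrite big_cons normrM ler_pM.
Qed.

Lemma prod_rows_bdd d (T : measurableType d) m (f : 'I_m -> V -> R) (h : T -> V)
    (g : T -> 'M[R]_(m, n)) : (forall a, bdd (f a)) ->
  bdd (fun p => \prod_a f a (h p - row a (g p))).
Proof.
move=> bf; apply: prod_bdd => a; have [B hB] := bf a; exists B => p; exact: hB.
Qed.

Lemma sub_nice (f : V -> R) x : nice (leb R 1 n) f ->
  nice (leb R 1 n) (fun v => f (x - v)) /\ \int[leb R 1 n]_v f (x - v) = \int[leb R 1 n]_v f v.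
Proof.
move=> nf; have t0 : -1 != 0 :> R by rewrite oppr_eq0 oner_eq0.
have := affine_Rint x t0 nf; rewrite normrN1 expr1n invr1 mul1r.
have -> : (fun v => f (x + -1 *: v)) = (fun v => f (x - v)) => //.
by apply/funext => v; rewrite scaleN1r.
Qed.

Lemma prod_rows_int m (f : 'I_m -> V -> R) x : (forall a, nice (leb R 1 n) (f a)) ->
  nice (leb R m n) (fun y => \prod_a f a (x - row a y)) /\
  ((forall a v, 0 <= f a v) ->
  \int[leb R m n]_y \prod_a f a (x - row a y) = \prod_a \int[leb R 1 n]_v f a v).
Proof.
move=> nf.
have mP : measurable_fun setT (fun y : 'M[R]_(m, n) => \prod_a f a (x - row a y)).
  apply: (prod_rows_meas (f := f) (h := fun=> x) (g := id)) => // a.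
  exact: nice_meas (nf a).
have bP : bdd (fun y : 'M[R]_(m, n) => \prod_a f a (x - row a y)).
  by apply: (prod_rows_bdd (fun=> x) id) => a; exact: nice_bdd (nf a).
have key (g : 'I_m -> V -> R) : (forall a, nice (leb R 1 n) (g a)) -> (forall a v, 0 <= g a v) ->
    (\int[leb R m n]_y (\prod_a g a (x - row a y))%:E = (\prod_a \int[leb R 1 n]_v g a v)%:E)%E.
  move=> ng g0.
  transitivity (\int[leb R m n]_y \prod_a (g a (x - row a y))%:E)%E.
    by apply: eq_integral => y _; rewrite prodEFin.
  rewrite (ge0_integral_prod_rows (F := fun a v => (g a (x - v))%:E)).
  - rewrite -prodEFin; apply: eq_bigr => a _.
    by have [h1 <-] := sub_nice x (ng a); rewrite ge0_Rint.
  - by move=> a; apply/measurable_EFinP; exact: nice_meas (sub_nice x (ng a)).1.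
  - by move=> a v; rewrite lee_fin.
have nP : nice (leb R m n) (fun y => \prod_a f a (x - row a y)).
  split => //; apply/integrableP; split; first exact/measurable_EFinP.
  under eq_integral do rewrite /= normr_prod.
  rewrite (key (fun a v => `|f a v|)) ?ltry// => a.
  exact: nice_norm.
split => // f0; apply: EFin_inj; rewrite EFin_Rintegral ?key//.
exact: nice_int.
Qed.

End product_functions.

Section operators.
Context {R : realType} {m n : nat}.
Notation V := 'rV[R]_n.
Notation MM := 'M[R]_(m.+1, n).
Notation N := (m.+1 * n)%N.
Notation mu := (leb R 1 n).
Notation niceMM := (nice (leb R m.+1 n)).
Notation nice := (nice (leb R 1 n)).
Notation n2 := (n2 (leb R 1 n)).
Implicit Types (K : MM -> R) (f : 'I_m.+1 -> V -> R).

Definition ann (r : R) (y : MM) : bool := r < enorm y <= 2 * r.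
Definition homog K := forall t y, 0 < t -> K (t *: y) = t ^- N * K y.
Definition Kr r K y : R := K y * (ann r y)%:R.
Definition Top r K f x : R := \int[leb R m.+1 n]_y (Kr r K y * \prod_a f a (x - row a y)).

Lemma measurable_annb r d (T : measurableType d) (g : T -> MM) : measurable_fun setT g ->
  measurable_fun setT (fun p => ann r (g p)).
Proof.
move=> mg; apply: measurable_and.
  by apply: measurable_fun_ltr => //; exact: measurable_enorm_comp.
by apply: measurable_fun_ler => //; exact: measurable_enorm_comp.
Qed.

Lemma measurable_Kr r K : measurable_fun setT K -> measurable_fun setT (Kr r K).
Proof.
by move=> mK; apply: measurable_funM => //; apply: measurable_boolR; exact: measurable_annb.
Qed.

Let cf f (p : V * MM) := \prod_a f a (p.1 - row a p.2).

Lemma cf_meas f : (forall a, nice (f a)) -> measurable_fun setT (cf f).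
Proof. by move=> nf; apply: prod_rows_meas => // a; exact: nice_meas (nf a). Qed.

Lemma cf_bdd f : (forall a, nice (f a)) -> bdd (cf f).
Proof. by move=> nf; apply: (prod_rows_bdd fst snd) => a; exact: nice_bdd (nf a). Qed.

Lemma cf_int f : (forall a, nice (f a)) -> exists A : R,
  forall y, (\int[mu]_x `|cf f (x, y)|%:E <= A%:E)%E.
Proof.
move=> nf.
have [B hB] : bdd (fun p : V * MM => \prod_(a < m) f (lift ord0 a) (p.1 - row (lift ord0 a) p.2)).
  apply: prod_bdd => a; have [B hB] := nice_bdd (nf (lift ord0 a)); exists B => p; exact: hB.
exists (\int[mu]_x `|B * f ord0 x|) => y.
have nF' := niceZ B (nf ord0); have nF'' := shift_nice (row ord0 y) (nice_norm nF').
rewrite -(shift_int (row ord0 y) (nice_norm nF')) -ge0_Rint//.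
apply: ge0_le_integral => //.
- apply/measurable_EFinP; apply: measurableT_comp => //.
  exact: (measurableT_comp (cf_meas nf) (measurable_pair2 y)).
- by apply/measurable_EFinP; exact: nice_meas nF''.
move=> x _; rewrite lee_fin /cf/= big_ord_recl !normrM mulrC ler_wpM2r//.
by apply: le_trans (hB (x, y)) _; exact: ler_norm.
Qed.

Lemma Top_nice r K f : niceMM (Kr r K) -> (forall a, nice (f a)) ->
  nice (Top r K f).
Proof.
move=> nK nf; have [A hA] := cf_int nf.
exact: (kernel_nice (cf_meas nf) (cf_bdd nf) nK hA).
Qed.

End operators.

Lemma scale_le {R : realType} (c : R) (I J : \bar R) : c != 0 -> 1 <= c -> (0 <= I)%E ->
  ((c^-1 ^+ 2)%:E * I = c^-1%:E * J)%E -> (J <= I)%E.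
Proof.
move=> c0 c1 I0 e.
have : (c%:E * ((c^-1 ^+ 2)%:E * I) = J)%E by rewrite e muleA -EFinM mulfV// mul1e.
rewrite muleA -EFinM expr2 mulrA mulfV// mul1r => <-.
by rewrite gee_pMl// ?lee_fin ?invf_le1// (lt_le_trans ltr01).
Qed.

(** * Slices of a bounded homogeneous kernel *)

Section bounded_kernel.
Context {R : realType} {m n : nat}.
Notation V := 'rV[R]_n.
Notation Z := 'M[R]_(m, n).
Notation MM := 'M[R]_(m.+1, n).
Notation N := (m.+1 * n)%N.
Notation mu := (leb R 1 n).
Notation niceZZ := (nice (leb R m n)).
Notation niceMM := (nice (leb R m.+1 n)).
Notation nice := (nice (leb R 1 n)).
Notation n2 := (n2 (leb R 1 n)).
Hypothesis n0 : (0 < n)%N.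
Variables (K : MM -> R) (lam : R) (i : 'I_m.+1).
Hypotheses (mK : measurable_fun setT K) (hK : homog K).
Hypothesis Kb : forall y, 2^-1 < enorm y <= 2 -> `|K y| <= lam.
Variables (F : V -> R) (del : R) (M : nat).
Hypotheses (nF : nice F) (del0 : 0 < del) (F0 : forall x, avg del F x = 0).
Hypotheses (M0 : (0 < M)%N) (delM : del * M%:R ^+ 2 <= 1).

Let lam0 : 0 <= lam.
Proof.
have n1 : (n = n.-1.+1)%N by rewrite prednK.
have [y ey] : exists y : MM, enorm y = 1.
  pose d : MM := const_mx 1.
  have d0 : enorm d != 0.
    apply/eqP => /enorm_eq0 /matrixP /(_ ord0 (cast_ord (esym n1) ord0)).
    by rewrite !mxE => /eqP; rewrite oner_eq0.
  exists ((enorm d)^-1 *: d); rewrite enormZ normfV ger0_norm ?enorm_ge0//.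
  by rewrite mulVf.
apply: le_trans (normr_ge0 (K y)) (Kb _); rewrite ey ler1n andbT.
by rewrite invf_lt1// ltr1n.
Qed.

(** Contains the annuli 1 < t |y| <= 2 for all t in [1, 2]. The slice [kz] is therefore the same for
    all dilations, and t only enters through the zero-one factor [bz t]. *)
Let fat (y : MM) : bool := 2^-1 < enorm y <= 2.
Let kz (z : Z) (y : V) : R := K (ins i y z) * (fat (ins i y z))%:R.
Let bz t (z : Z) (y : V) : bool := ann 1 (t *: ins i y z).
Let W t (z : Z) (x : V) : R :=
  \int[mu]_y (K (ins i y z) * (bz t z y)%:R * F (x - t *: y)).
Let P t z : R := \int[mu]_x W t z x ^+ 2.

Let mins' : measurable_fun setT (fun p : (Z * V) * V => ins i p.2 p.1.1).
Proof.
apply: measurable_ins => //.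
exact: (measurableT_comp measurable_fst measurable_fst).
Qed.

Let mW t : measurable_fun setT (fun p : Z * V => W t p.1 p.2).
Proof.
apply: (measurable_Rint _ (h := fun p : (Z * V) * V =>
  K (ins i p.2 p.1.1) * (bz t p.1.1 p.2)%:R * F (p.1.2 - t *: p.2))).
apply: measurable_funM; first apply: measurable_funM.
- exact: (measurableT_comp mK mins').
- apply: measurable_boolR; apply: measurable_annb.
  exact: (measurableT_comp (measurable_scale t) mins').
- apply: (measurableT_comp (nice_meas nF)); apply: measurable_subscale => //.
  exact: (measurableT_comp measurable_snd measurable_fst).
Qed.

Let mP t : measurable_fun setT (P t).
Proof.
by apply: (measurable_Rint _ (h := fun p : Z * V => W t p.1 p.2 ^+ 2)); exact: measurable_funX.
Qed.

Let P0 t z : 0 <= P t z. Proof. by apply: int_ge0 => x; exact: sqr_ge0. Qed.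

Let enorm_ins_le (y : V) (z : Z) : enorm y <= enorm (ins i y z) /\ enorm z <= enorm (ins i y z).
Proof.
by split; rewrite -(@ler_pXn2r _ 2) ?nnegrE ?enorm_ge0// enorm_ins ?lerDl ?lerDr ?sqr_ge0.
Qed.

Section dilated.
Variable t : R.
Hypothesis t12 : 1 <= t <= 2.
Let t0 : 0 < t. Proof. by case/andP: t12 => h _; apply: lt_le_trans h. Qed.

Lemma bz_ins z y : bz t z y -> 2^-1 < enorm (ins i y z) <= 2.
Proof.
rewrite /bz /ann enormZ gtr0_norm// mulr1 => /andP[h1 h2].
have := enorm_ge0 (ins i y z); case/andP: t12 => h3 h4 h5.
by apply/andP; split; nra.
Qed.

Lemma kzb z y : kz z y * (bz t z y)%:R = K (ins i y z) * (bz t z y)%:R.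
Proof.
rewrite /kz /fat; case: (boolP (bz t z y)) => [/bz_ins ->|_]; rewrite ?mulr1//.
by rewrite !mulr0.
Qed.

Lemma W_dconv z x : W t z x = dconv F t (fun y => kz z y * (bz t z y)%:R) x.
Proof. by apply: eq_Rintegral => y _; rewrite kzb. Qed.

Lemma mbz z : measurable_fun setT (bz t z).
Proof.
apply: measurable_annb; apply: (measurableT_comp (measurable_scale t)).
by apply: measurable_ins.
Qed.

Lemma mkz z : measurable_fun setT (kz z).
Proof.
have mi : measurable_fun setT (fun y => ins i y z) by apply: measurable_ins.
apply: measurable_funM; first exact: (measurableT_comp mK mi).
apply: measurable_boolR; apply: measurable_and.
  by apply: measurable_fun_ltr => //; exact: measurable_enorm_comp.
by apply: measurable_fun_ler => //; exact: measurable_enorm_comp.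
Qed.

Lemma kz_lam z y : `|kz z y| <= lam.
Proof.
rewrite /kz /fat; case: (boolP (2^-1 < enorm (ins i y z) <= 2)) => [/Kb|_]; first by rewrite mulr1.
by rewrite mulr0 normr0.
Qed.

Lemma bz2 z y : bz t z y -> inball 2 y.
Proof.
move=> /bz_ins/andP[_ h]; rewrite /inball.
by apply: le_trans h; have [] := enorm_ins_le y z.
Qed.

Lemma nkb z : nice (fun y => kz z y * (bz t z y)%:R).
Proof.
apply: (@bdd_supp_nice _ _ _ _ 2).
- by apply: measurable_funM; [exact: mkz | apply: measurable_boolR; exact: mbz].
- exists lam => y; rewrite normrM; have := kz_lam z y; case: (bz t z y); rewrite ?normr1 ?mulr1//.
  by rewrite normr0 mulr0.
- by move=> y; case: (boolP (bz t z y)) => [/bz2//|_]; rewrite mulr0 eqxx.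
Qed.

Lemma nW z : nice (W t z).
Proof.
have -> : W t z = dconv F t (fun y => kz z y * (bz t z y)%:R) by apply/funext => x; exact: W_dconv.
exact: (dconv_nice nF t (nkb z)).
Qed.

Lemma W_scale z x : W 1 (t *: z) x = t ^- (m * n) * W t z x.
Proof.
pose h y := K (ins i y (t *: z)) * (bz 1 (t *: z) y)%:R * F (x - 1 *: y).
have hE y : h (t *: y) = t ^- N * (K (ins i y z) * (bz t z y)%:R * F (x - t *: y)).
  by rewrite /h /bz -ins_scale hK// !scale1r !mulrA.
have nh : nice h.
  have nh' : nice (fun y => h (t *: y)).
    rewrite (_ : (fun y => h (t *: y)) = (fun y => t ^- N * (kz z y * (bz t z y)%:R * cF F t (x, y)))).
      apply: niceZ; apply: niceM; first exact: nkb.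
        exact: (measurableT_comp (cF_meas nF t) (measurable_pair1 x)).
      by have [B hB] := cF_bdd nF t; exists B => y.
    by apply/funext => y; rewrite hE kzb.
  have tV : 0 < t^-1 by rewrite invr_gt0.
  have [] := int_scale tV nh'.
  rewrite (_ : (fun y => h (t *: (t^-1 *: y))) = h)//.
  by apply/funext => y; rewrite scalerA mulfV ?gt_eqF// scale1r.
have [nht] := int_scale t0 nh; rewrite mul1n => e.
have tn0 : t ^+ n != 0 by rewrite expf_neq0// gt_eqF.
have -> : W 1 (t *: z) x = t ^+ n * \int[mu]_y h (t *: y).
  by rewrite e mulrA mulfV// mul1r.
rewrite (_ : \int[mu]_y h (t *: y) = t ^- N * W t z x).
  rewrite mulrA; congr (_ * _); rewrite mulSn exprD invfM mulrA mulfV// mul1r//.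
rewrite /W -intZ; first by apply: eq_Rintegral => y _; rewrite hE.
have := niceZ (t ^+ N) nht; rewrite (_ : (fun y => _) = (fun y => K (ins i y z) * (bz t z y)%:R * F (x - t *: y)))//.
apply/funext => y; rewrite hE mulrA mulfV ?mul1r//.
by rewrite expf_neq0// gt_eqF.
Qed.

Lemma P_scale : (\int[leb R m n]_z (P 1 z)%:E <= \int[leb R m n]_z (P t z)%:E)%E.
Proof.
have tmn : t ^+ (m * n) != 0 by rewrite expf_neq0// gt_eqF.
have mP1 : measurable_fun setT (fun z => (P 1 z)%:E) by exact/measurable_EFinP.
have mPt : measurable_fun setT (fun z => (P t z)%:E) by exact/measurable_EFinP.
have P01 z : (0 <= (P 1 z)%:E)%E by rewrite lee_fin.
have := ge0_integral_scale mP1 P01 t0.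
have e1 : (\int[leb R m n]_z (P 1 (t *: z))%:E =
    \int[leb R m n]_z ((t ^- (m * n) ^+ 2)%:E * (P t z)%:E))%E.
  apply: eq_integral => z _; rewrite -EFinM; congr EFin.
  rewrite /P -(intZ _ (niceX2 (nW z))).
  by apply: eq_Rintegral => x _; rewrite W_scale exprMn.
have Pt0 z : True -> (0 <= (P t z)%:E)%E by rewrite lee_fin.
have e2 : (\int[leb R m n]_z ((t ^- (m * n) ^+ 2)%:E * (P t z)%:E) =
    (t ^- (m * n) ^+ 2)%:E * \int[leb R m n]_z (P t z)%:E)%E.
  by apply: ge0_integralZl => //; rewrite lee_fin sqr_ge0.
move=> e0; have e := etrans (esym e2) (etrans (esym e1) e0).
have I0 : (0 <= \int[leb R m n]_z (P t z)%:E)%E by apply: integral_ge0 => z _; rewrite lee_fin.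
exact: scale_le tmn (exprn_ege1 _ (proj1 (andP t12))) I0 e.
Qed.

End dilated.

Let dilE (k : 'I_M) : 1 <= (dil k : R) <= 2.
Proof.
rewrite /dil lerDl divr_ge0//= -lerBrDl; have -> : 2 - 1 = 1 :> R by lra.
by rewrite ler_pdivrMr ?ltr0n// mul1r ler_nat ltnW.
Qed.

(** The slice at z of the ball of radius r is the ball of radius [rho z r]. If the slice is empty
    the square root is 0 by convention, which still is an admissible radius for [shell]. *)
Let rho (z : Z) r : R := Num.sqrt (r ^+ 2 - enorm z ^+ 2).

Let rho_jump (z : Z) r (y y' : V) : 0 <= r -> enorm (ins i y z) <= r < enorm (ins i y' z) ->
  shell (rho z r) (enorm (y - y')) y /\ shell (rho z r) (enorm (y - y')) y'.
Proof.
move=> r0 /andP[h1 h2].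
have h1' : enorm y ^+ 2 <= r ^+ 2 - enorm z ^+ 2.
  by rewrite lerBrDr -(enorm_ins i) lerXn2r ?nnegrE ?enorm_ge0.
have h2' : r ^+ 2 - enorm z ^+ 2 <= enorm y' ^+ 2.
  rewrite lerBlDr -(enorm_ins i); apply: lerXn2r; rewrite ?nnegrE ?enorm_ge0//.
  exact: ltW.
have h0 : 0 <= r ^+ 2 - enorm z ^+ 2 := le_trans (sqr_ge0 _) h1'.
have r1 : enorm y <= rho z r.
  by rewrite /rho -[enorm y]ger0_norm ?enorm_ge0// -sqrtr_sqr ler_wsqrtr.
have r2 : rho z r <= enorm y'.
  by rewrite /rho -[enorm y']ger0_norm ?enorm_ge0// -sqrtr_sqr ler_wsqrtr.
have := enormB_lip y y'; rewrite /shell !ler_norml => /andP[a1 a2].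
by split; apply/andP; split; lra.
Qed.

Let Ptot z : \sum_(k < M) P (dil k) z <=
  (inball 2 z)%:R * (Num.sqrt (@dilation_const R n * M%:R) * lam ^+ 2 * n2 F ^+ 2).
Proof.
have PE (k : 'I_M) : P (dil k) z = \int[mu]_x dconv F (dil k) (fun y => kz z y * (bz (dil k) z y)%:R) x ^+ 2.
  by apply: eq_Rintegral => x _; rewrite (W_dconv (dilE k)).
case: (boolP (inball 2 z)) => [_|zn]; last first.
  rewrite mul0r big1// => k _; rewrite PE (_ : (fun x => _) = (fun=> 0)) ?Rintegral_cst ?mul0r//.
  apply/funext => x; rewrite /dconv (_ : (fun y => _) = (fun=> 0)) ?Rintegral_cst ?mul0r ?expr0n//.
  apply/funext => y; case: (boolP (bz (dil k) z y)) => [h|_]; last by rewrite mulr0 mul0r.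
  have /andP[_ h'] := bz_ins (dilE k) h; move: zn; rewrite /inball.
  by rewrite (le_trans _ h')//; have [] := enorm_ins_le y z.
rewrite mul1r (eq_bigr _ (fun k _ => PE k)).
pose rs (k : 'I_M) := [:: rho z (dil k)^-1; rho z (2 / dil k)].
have d0 (k : 'I_M) : 0 < dil k :> R by case/andP: (dilE k) => h _; apply: lt_le_trans h.
have rs02 k r : r \in rs k -> 0 <= r <= 2.
  have h s : 0 <= s <= 2 -> 0 <= rho z s <= 2.
    move=> /andP[s0 s2]; rewrite sqrtr_ge0/= -(ler_sqr _ _) ?nnegrE ?sqrtr_ge0//.
    have [h|h] := leP 0 (s ^+ 2 - enorm z ^+ 2).
      rewrite sqr_sqrtr//; apply: (@le_trans _ _ (s ^+ 2)); first by rewrite gerBl sqr_ge0.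
      by rewrite lerXn2r ?nnegrE.
    by rewrite /rho ler0_sqrtr ?expr0n ?sqr_ge0// ltW.
  case/andP: (dilE k) => h1 h2.
  rewrite !inE => /orP[|] /eqP ->; apply: h.
    by rewrite invr_ge0 (ltW (d0 k))/= (@le_trans _ _ 1)// ?invf_le1 ?ler1n.
  by rewrite divr_ge0 ?(ltW (d0 k))//= ler_pdivrMr// ler_peMr.
have jump k y y' : bz (dil k) z y != bz (dil k) z y' ->
    exists2 r, r \in rs k & shell r (enorm (y - y')) y.
  rewrite /bz /ann !enormZ !gtr0_norm// !mulr1 => hb.
  have e y1 : (1 < dil k * enorm (ins i y1 z)) = ((dil k)^-1 < enorm (ins i y1 z)).
    by rewrite -[(dil k)^-1]mulr1 ltr_pdivrMl.
  have e2 y1 : (dil k * enorm (ins i y1 z) <= 2) = (enorm (ins i y1 z) <= 2 / dil k).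
    by rewrite ler_pdivlMr// mulrC.
  move: hb; rewrite !e !e2 => hb.
  have i0 : 0 <= (dil k : R)^-1 by rewrite invr_ge0 ltW.
  have i2 : 0 <= 2 / (dil k : R) by rewrite divr_ge0// ltW.
  have J r y1 y2 : 0 <= r -> enorm (ins i y1 z) <= r < enorm (ins i y2 z) ->
     shell (rho z r) (enorm (y1 - y2)) y1 /\ shell (rho z r) (enorm (y1 - y2)) y2.
    exact: rho_jump.
  have sw : enorm (y' - y) = enorm (y - y') by rewrite -enormN opprB.
  have [h1|h1] := leP (enorm (ins i y z)) (dil k)^-1;
   have [h2|h2] := leP (enorm (ins i y' z)) (dil k)^-1.
  - by move: hb; rewrite !ltNge h1 h2.
  - exists (rho z (dil k)^-1); first by rewrite !inE eqxx.
    by have [] := J _ y y' i0 _ => //; rewrite h1.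
  - exists (rho z (dil k)^-1); first by rewrite !inE eqxx.
    by have [|_] := J _ y' y i0 _; rewrite ?h2//= sw.
  - exists (rho z (2 / dil k)); first by rewrite !inE eqxx orbT.
    have [h3|h3] := leP (enorm (ins i y z)) (2 / dil k);
     have [h4|h4] := leP (enorm (ins i y' z)) (2 / dil k).
    + by move: hb; rewrite h1 h2 h3 h4.
    + by have [] := J _ y y' i2 _ => //; rewrite h3.
    + by have [|_] := J _ y' y i2 _; rewrite ?h4//= sw.
    + by move: hb; rewrite h1 h2 !leNgt h3 h4.
have := @dilations_bound R n n0 F del nF del0 F0 M lam (kz z) M0 delM (mkz z) (kz_lam z)
  (fun k => bz (dil k) z) rs (fun k => mbz (dil k) z) (fun k => bz2 (dilE k) (z := z))
  (fun k => erefl) rs02 jump.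
set S := \sum_(k < M) _ => h.
have S0 : 0 <= S by apply: sumr_ge0 => k _; apply: int_ge0 => x; exact: sqr_ge0.
have c0 : 0 <= @dilation_const R n * M%:R.
  rewrite mulr_ge0// /dilation_const mulr_ge0 ?sqr_ge0// addr_ge0 ?sqr_ge0//.
  by rewrite /shell_const !mulr_ge0 ?vol_ge0 ?exprn_ge0 ?addr_ge0.
have B0 : 0 <= Num.sqrt (@dilation_const R n * M%:R) * lam ^+ 2 * n2 F ^+ 2.
  by apply: mulr_ge0; [apply: mulr_ge0; [exact: sqrtr_ge0|exact: sqr_ge0]|exact: sqr_ge0].
rewrite -(@ler_pXn2r _ 2) ?nnegrE//.
apply: le_trans h _; rewrite !exprMn sqr_sqrtr// le_eqVlt; apply/orP; left; apply/eqP.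
by ring.
Qed.

Definition core_const := @vol R m n 2 * Num.sqrt (@dilation_const R n).

Lemma core_bound : (\int[leb R m n]_z (P 1 z)%:E <=
  (core_const * lam ^+ 2 * n2 F ^+ 2 / Num.sqrt M%:R)%:E)%E.
Proof.
have Mp : 0 < M%:R :> R by rewrite ltr0n.
set B := Num.sqrt (@dilation_const R n * M%:R) * lam ^+ 2 * n2 F ^+ 2.
have c0 : 0 <= @dilation_const R n.
  rewrite /dilation_const mulr_ge0 ?sqr_ge0// addr_ge0 ?sqr_ge0//.
  by rewrite /shell_const !mulr_ge0 ?vol_ge0 ?exprn_ge0 ?addr_ge0.
have B0 : 0 <= B.
  by apply: mulr_ge0; [apply: mulr_ge0; [exact: sqrtr_ge0|exact: sqr_ge0]|exact: sqr_ge0].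
(* Each of the M dilations dominates the left-hand integral, while [Ptot] bounds their sum by order
   sqrt M; division by M leaves the gain 1 / sqrt M. *)
have h1 : (\sum_(k < M) \int[leb R m n]_z (P 1 z)%:E <= (B * @vol R m n 2)%:E)%E.
  apply: (@le_trans _ _ (\sum_(k < M) \int[leb R m n]_z (P (dil k) z)%:E)%E).
    by apply: lee_sum => k _; exact: P_scale.
  rewrite -ge0_integral_sum//; last 2 first.
  - by move=> k; exact/measurable_EFinP.
  - by move=> k z _; rewrite lee_fin.
  have [nb ib] := @int_inball R m n 2.
  rewrite -ib -(intZ B nb) -ge0_Rint; last exact: niceZ.
  apply: ge0_le_integral => //.
  - by move=> z _; apply: sume_ge0 => k _; rewrite lee_fin.
  - by apply: emeasurable_sum => k; exact/measurable_EFinP.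
  - by apply/measurable_EFinP; exact: nice_meas (niceZ B nb).
  by move=> z _; rewrite sumEFin lee_fin mulrC; exact: Ptot.
move: h1; rewrite sumr_const card_ord.
set J := (\int[_]_z _)%E => h1.
have J0 : (0 <= J)%E by apply: integral_ge0 => z _; rewrite lee_fin.
have : (M%:R%:E * J <= (B * @vol R m n 2)%:E)%E by rewrite mule_natl.
rewrite -lee_pdivlMl// -EFinM => /le_trans; apply; rewrite lee_fin /B /core_const sqrtrM//.
have sM : Num.sqrt M%:R != 0 :> R by rewrite gt_eqF// sqrtr_gt0.
rewrite le_eqVlt; apply/orP; left; apply/eqP.
have -> : M%:R^-1 = (Num.sqrt M%:R)^-1 ^+ 2 :> R by rewrite exprVn sqr_sqrtr.
by field.
Qed.

Variable f : 'I_m.+1 -> V -> R.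
Hypotheses (nf : forall a, nice (f a)) (fi : f i = F).

Lemma Top_core : n2 (Top 1 K f) ^+ 2 <=
  core_const * lam ^+ 2 / Num.sqrt M%:R * \prod_a n2 (f a) ^+ 2.
Proof.
have nK : niceMM (Kr 1 K).
  apply: (@bdd_supp_nice _ _ _ _ 2); first exact: measurable_Kr.
    exists lam => y; rewrite /Kr /ann; case: (boolP (1 < enorm y <= 2 * 1)) => [/andP[h1 h2]|_]; last by rewrite mulr0 normr0.
    rewrite mulr1 Kb//; apply/andP; split; lra.
  move=> y; rewrite /Kr /inball /ann mulr1; case: (boolP (1 < enorm y <= 2)) => [/andP[]//|_].
  by rewrite mulr0 eqxx.
have nT := Top_nice nK nf.
pose Pi x (z : Z) := \prod_a f (lift i a) (x - row a z).
have TE x : Top 1 K f x = \int[leb R m n]_z (Pi x z * W 1 z x).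
  rewrite /Top (Rint_ins i); last first.
    by apply: (kernel_nice1 (cf_meas nf) (cf_bdd nf) x nK).
  apply: eq_Rintegral => z _; rewrite /W.
  have nk1 : nice (fun y => K (ins i y z) * (bz 1 z y)%:R * F (x - 1 *: y)).
    rewrite (_ : (fun y => _) = (fun y => kz z y * (bz 1 z y)%:R * cF F 1 (x, y))).
      apply: niceM; first by apply: nkb; rewrite lexx ler1n.
        exact: (measurableT_comp (cF_meas nF 1) (measurable_pair1 x)).
      by have [B hB] := cF_bdd nF 1; exists B => y.
    by apply/funext => y; rewrite kzb// lexx ler1n.
  rewrite -intZ//; apply: eq_Rintegral => y _.
  rewrite (bigD1_ord i)//= row_ins fi /Kr /bz !scale1r.
  under eq_bigr do rewrite row_ins_lift.
  by rewrite /Pi; ring.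
have nPi x := prod_rows_int x (fun a => nf (lift i a)).
have iPi x : \int[leb R m n]_z Pi x z ^+ 2 = \prod_a n2 (f (lift i a)) ^+ 2.
  have [_ h] := prod_rows_int x (fun a => niceX2 (nf (lift i a))).
  under eq_bigr do rewrite n2_sqr.
  rewrite -h => [|a v]; last exact: sqr_ge0.
  by apply: eq_Rintegral => z _; rewrite prodrXl.
have nWz x : niceZZ (fun z => W 1 z x).
  have bW : bdd (fun z => W 1 z x).
    have [B hB] := nice_bdd nF.
    have B0 : 0 <= B by exact: le_trans (hB 0).
    exists (\int[mu]_y (lam * B * (inball 2 y)%:R)) => z.
    have h1 : 1 <= (1 : R) <= 2 by rewrite lexx ler1n.
    rewrite W_dconv//; have nk := kernel_nice1 (cF_meas nF 1) (cF_bdd nF 1) x (nkb h1 z).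
    apply: le_trans (le_norm_int nk) _; apply: le_int.
    - exact: nice_norm nk.
    - by apply: niceZ; exact: (int_inball 2).1.
    move=> y; rewrite normrM [X in X * _]normrM; case: (boolP (bz 1 z y)) => [h|_].
      by rewrite (bz2 h1 h) mulr1 normr1 mulr1; apply: ler_pM => //; [exact: kz_lam|exact: hB].
    by rewrite normr0 mulr0 mul0r mulr_ge0// mulr_ge0.
  apply: (@bdd_supp_nice _ _ _ _ 2) => //.
    exact: (measurableT_comp (mW 1) (measurable_pair2 x)).
  move=> z; apply: contraNT => zn; apply/eqP; rewrite /W.
  rewrite (_ : (fun y => _) = (fun=> 0)) ?Rintegral_cst ?mul0r//.
  apply/funext => y; case: (boolP (bz 1 z y)) => [h|_]; last by rewrite mulr0 mul0r.
  have h1 : 1 <= (1 : R) <= 2 by rewrite lexx ler1n.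
  have /andP[_ h'] := bz_ins h1 h; move: zn; rewrite /inball.
  by rewrite (le_trans _ h')//; have [] := enorm_ins_le y z.
have pw x : Top 1 K f x ^+ 2 <= \prod_a n2 (f (lift i a)) ^+ 2 * \int[leb R m n]_z W 1 z x ^+ 2.
  by rewrite TE -(iPi x); apply: int_CS2 => //; exact: (nPi x).1.
rewrite n2_sqr -lee_fin -ge0_Rint; last exact: niceX2.
set Q := \prod_a n2 (f (lift i a)) ^+ 2 in pw *.
have Q0 : 0 <= Q by apply: prodr_ge0 => a _; exact: sqr_ge0.
pose h (p : V * Z) := ((W 1 p.2 p.1) ^+ 2)%:E.
have mh : measurable_fun setT h.
  apply/measurable_EFinP; apply: measurable_funX.
  exact: (measurableT_comp (mW 1) (@measurable_swap _ _ _ _)).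
have h0 p : (0 <= h p)%E by rewrite lee_fin sqr_ge0.
apply: (@le_trans _ _ (\int[mu]_x (Q%:E * \int[leb R m n]_z h (x, z)))%E).
  apply: ge0_le_integral => //.
  - by move=> x _; rewrite lee_fin sqr_ge0.
  - by apply/measurable_EFinP; exact: nice_meas (niceX2 nT).
  - by apply: emeasurable_funM => //; exact: (measurable_fun_fubini_tonelli_F h).
  move=> x _; rewrite /h/= ge0_Rint; last exact: niceX2.
  by rewrite -EFinM lee_fin.
rewrite ge0_integralZl//; last 2 first.
- exact: (measurable_fun_fubini_tonelli_F h).
- by move=> x _; exact: integral_ge0.
rewrite (fubini_tonelli (m1 := mu) (m2 := leb R m n) h)//.
rewrite (_ : (\int[leb R m n]_z \int[mu]_x h (x, z))%E = (\int[leb R m n]_z (P 1 z)%:E)%E); last first.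
  apply: eq_integral => z _; rewrite /h/= ge0_Rint//; apply: niceX2; apply: nW.
  by rewrite lexx ler1n.
apply: (@le_trans _ _ (Q%:E * (core_const * lam ^+ 2 * n2 F ^+ 2 / Num.sqrt M%:R)%:E)%E).
  by rewrite lee_wpmul2l ?lee_fin//; exact: core_bound.
rewrite -EFinM lee_fin (bigD1_ord i)//= fi /Q le_eqVlt; apply/orP; left; apply/eqP.
by ring.
Qed.

End bounded_kernel.

(** * Decay for kernels in L^q *)

Section scalar.
Context {R : realType}.
Implicit Types u v x p th : R.

(** Young's inequality with the conjugate exponents 1 / th and 1 / (1 - th). *)
Lemma wagm u v th : 0 <= u -> 0 <= v -> 0 < th <= 1 ->
  u `^ th * v `^ (1 - th) <= th * u + (1 - th) * v.
Proof.
move=> u0 v0 /andP[t0]; rewrite le_eqVlt => /orP[/eqP ->|t1].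
  by rewrite subrr powRr0 powRr1// mul0r addr0 mulr1 mul1r.
have t1' : 0 < 1 - th by rewrite subr_gt0.
have := @conjugate_powR R (u `^ th) (v `^ (1 - th)) th^-1 (1 - th)^-1.
rewrite !powR_ge0 !invr_gt0 t0 t1' !invrK => /(_ isT isT isT isT).
rewrite -!powRrM !mulfV ?gt_eqF// !powRr1// addrC subrK => /(_ erefl).
by rewrite (mulrC u) (mulrC v).
Qed.

Lemma agm_mean (k : nat) (v : 'I_k.+1 -> R) : (forall a, 0 <= v a) ->
  (\prod_a v a) `^ k.+1%:R^-1 <= (\sum_a v a) / k.+1%:R.
Proof.
move=> v0; have := (@leif_AGM R _ predT v (fun a _ => v0 a)).1.
rewrite card_ord => h.
have S0 : 0 <= (\sum_a v a) / k.+1%:R by rewrite divr_ge0// sumr_ge0.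
have -> : (\sum_a v a) / k.+1%:R = (((\sum_a v a) / k.+1%:R) ^+ k.+1) `^ k.+1%:R^-1.
  by rewrite -powR_mulrn// -powRrM mulfV// powRr1.
apply: ge0_ler_powR; rewrite ?nnegrE ?invr_ge0//.
- exact: prodr_ge0.
- exact: exprn_ge0.
Qed.

(* The critical exponent for [m.+1] functions. *)
Definition crit (m : nat) : R := 2 * m.+1%:R / m.+2%:R.

Lemma crit_ge1 m : 1 <= crit m.
Proof.
rewrite /crit ler_pdivlMr// mul1r -natrM ler_nat; lia.
Qed.

Lemma crit_inv m : 0 < (crit m)^-1 <= 1.
Proof.
have h := crit_ge1 m; have h0 : 0 < crit m by apply: lt_le_trans h.
by rewrite invr_gt0 h0 invf_le1.
Qed.

(** The origin of the critical exponent. The entries are the m+1 inputs and a dual function. With S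
    the mean of the squares and P the product, (k^q0 S)^th (P^2)^(1 - th), th = 1 / q0, is at least
    k P because S >= (P^2)^(1 / (m+2)), provided 2 th / (m+2) + 2 (1 - th) = 1; this gives q0 = 2
    (m+1) / (m+2). Both terms on the right integrate over all variables to products of norms. *)
Lemma young_rough m (k : R) (f : 'I_m.+2 -> R) : 0 <= k -> (forall a, 0 <= f a) ->
  k * \prod_a f a <= (crit m)^-1 * (k `^ crit m * ((\sum_a f a ^+ 2) / m.+2%:R)) +
    (1 - (crit m)^-1) * \prod_a f a ^+ 2.
Proof.
move=> k0 f0; set th := (crit m)^-1; set P := \prod_a f a.
have P0 : 0 <= P by exact: prodr_ge0.
have PE : \prod_a f a ^+ 2 = P ^+ 2 by rewrite prodrXl.
set S := (\sum_a _) / _.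
have S0 : 0 <= S by rewrite divr_ge0// sumr_ge0// => a _; exact: sqr_ge0.
have qp : 0 < crit m by apply: lt_le_trans (crit_ge1 m).
have SP : (P ^+ 2) `^ m.+2%:R^-1 <= S.
  by rewrite -PE; apply: agm_mean => a; exact: sqr_ge0.
have th01 := crit_inv m; rewrite PE.
apply: le_trans (wagm (mulr_ge0 (powR_ge0 k (crit m)) S0) (sqr_ge0 P) th01).
have [->|Pn] := eqVneq P 0.
  by rewrite mulr0 mulr_ge0// powR_ge0.
rewrite powRM ?powR_ge0// -powRrM mulfV ?gt_eqF// powRr1// -mulrA ler_wpM2l//.
have st : ((P ^+ 2) `^ m.+2%:R^-1) `^ th <= S `^ th.
  by apply: ge0_ler_powR; rewrite ?nnegrE ?powR_ge0//; case/andP: th01 => /ltW.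
apply: le_trans (ler_wpM2r (powR_ge0 _ _) st).
rewrite -[P ^+ 2]powR_mulrn// -!powRrM -powRD; last by rewrite Pn implybT.
rewrite -[X in X <= _](powRr1 P0) le_eqVlt; apply/orP; left; apply/eqP; congr (_ `^ _).
rewrite /th /crit; field.
by rewrite !gt_eqF// ltr_pwDl.
Qed.

Lemma powR_le_mul x (B p : R) : 0 <= x <= B -> 1 <= p -> x `^ p <= B `^ (p - 1) * x.
Proof.
move=> /andP[x0 xB] p1; have [->|xn] := eqVneq x 0.
  by rewrite powR0 ?mulr0// gt_eqF// (lt_le_trans ltr01).
have {1}-> : p = (p - 1) + 1 by rewrite subrK.
rewrite powRD ?xn ?implybT// powRr1// ler_wpM2r//.
by apply: ge0_ler_powR; rewrite ?nnegrE ?subr_ge0// (le_trans x0).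
Qed.

Lemma powR_le_add1 x p q : 0 <= x -> 0 < p -> p <= q -> x `^ p <= 1 + x `^ q.
Proof.
move=> x0 p0 pq; have [x1|x1] := leP x 1.
  apply: (@le_trans _ _ 1); last by rewrite lerDl powR_ge0.
  have -> : (1 : R) = 1 `^ p by rewrite powR1.
  by apply: ge0_ler_powR; rewrite ?nnegrE// ltW.
by apply: (@le_trans _ _ (x `^ q)); [apply: ler_powR => //; exact: ltW | rewrite lerDr].
Qed.

(** Allows a multilinear bound to be normalized by numbers strictly above the norms, so that
    vanishing norms need no separate treatment. *)
Lemma prod_inf (k : nat) (v : 'I_k -> R) (B x : R) : (forall a, 0 <= v a) -> 0 <= B ->
  (forall t : 'I_k -> R, (forall a, v a < t a) -> x <= B * \prod_a t a) -> x <= B * \prod_a v a.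
Proof.
move=> v0 B0 h.
(* For e > 0 the choice t a = e + v a is admissible; as a polynomial in e the right-hand side is
   continuous at 0. *)
pose p : {poly R} := B *: \prod_a ('X + (v a)%:P).
have pE e : p.[e] = B * \prod_a (e + v a).
  by rewrite hornerZ horner_prod; congr (_ * _); apply: eq_bigr => a _; rewrite !hornerE.
have -> : B * \prod_a v a = p.[0].
  by rewrite pE; congr (_ * _); apply: eq_bigr => a _; rewrite add0r.
have c : (fun e : R => p.[e]) e @[e --> 0^'+] --> p.[0].
  by apply: cvg_at_right_filter; exact: continuous_horner.
apply: (ler_cvg_to (cvg_cst x) c); near=> e; rewrite pE; apply: h => a.
by rewrite ltrDr; near: e; exact: nbhs_right_gt.
Unshelve. all: by end_near. Qed.

Lemma powR_lt1 (b r : R) : 1 < b -> r < 0 -> b `^ r < 1.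
Proof.
move=> b1 r0; have t0 : 0 < - r by rewrite oppr_gt0.
rewrite -[r]opprK powRN invf_lt1; last by rewrite powR_gt0// (lt_trans ltr01).
have -> : (1 : R) = 1 `^ (- r) by rewrite powR1.
by apply: gt0_ltr_powR; rewrite ?nnegrE// ltW// (lt_trans ltr01).
Qed.

Lemma powR_expr (a b : R) (k : nat) : 0 <= a -> (a ^+ k) `^ b = (a `^ b) ^+ k.
Proof.
by move=> a0; rewrite -powR_mulrn// -powRrM mulrC powRrM powR_mulrn// powR_ge0.
Qed.

End scalar.

Lemma kernel_int d1 d2 (T1 : measurableType d1) (T2 : measurableType d2) (R : realType)
  (m1 : {sigma_finite_measure set T1 -> \bar R}) (m2 : {sigma_finite_measure set T2 -> \bar R})
  (c : T1 * T2 -> R) (k : T2 -> R) A :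
  0 <= A -> measurable_fun setT c -> bdd c -> (forall p, 0 <= c p) -> (forall y, 0 <= k y) -> nice m2 k ->
  (forall y, nice m1 (fun x => c (x, y)) /\ \int[m1]_x c (x, y) = A) ->
  nice m1 (fun x => \int[m2]_y (k y * c (x, y))) /\
  \int[m1]_x \int[m2]_y (k y * c (x, y)) = A * \int[m2]_y k y.
Proof.
move=> A0 mc bc c0 k0 nk hc.
have hn : nice m1 (fun x => \int[m2]_y (k y * c (x, y))).
  apply: (@kernel_nice _ _ _ _ _ m1 m2 c mc bc k A nk) => y.
  rewrite ge0_Rint; last exact: nice_norm (hc y).1.
  rewrite lee_fin -(hc y).2 le_eqVlt; apply/orP; left; apply/eqP.
  by apply: eq_Rintegral => x _; rewrite ger0_norm.
split=> //; apply: EFin_inj; rewrite -ge0_Rint// EFinM -(ge0_Rint nk).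
pose F (p : T1 * T2) : \bar R := (k p.2 * c p)%:E.
have mF : measurable_fun setT F.
  apply/measurable_EFinP; apply: measurable_funM => //.
  exact: (measurableT_comp (nice_meas nk) measurable_snd).
have F0 p : (0 <= F p)%E by rewrite lee_fin mulr_ge0.
have e1 : (\int[m1]_x (\int[m2]_y (k y * c (x, y)))%:E = \int[m1]_x \int[m2]_y F (x, y))%E.
  apply: eq_integral => x _; rewrite -ge0_Rint//.
  by have h := kernel_nice1 mc bc x nk; exact: h.
rewrite e1 (fubini_tonelli (m1 := m1) (m2 := m2) F mF F0).
have e2 : (\int[m2]_y \int[m1]_x F (x, y) = \int[m2]_y (A%:E * (k y)%:E))%E.
  apply: eq_integral => y _; rewrite /F/= ge0_Rint; last exact: niceZ (hc y).1.
  by rewrite intZ; [rewrite (hc y).2 mulrC EFinM|exact: (hc y).1].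
rewrite e2 ge0_integralZl//.
- by apply/measurable_EFinP; exact: nice_meas nk.
- by move=> y _; rewrite lee_fin.
Qed.

Lemma nice_powR (R : realType) d (T : measurableType d) (nu : {measure set T -> \bar R}) (k : T -> R) p :
  (forall y, 0 <= k y) -> 1 <= p -> nice nu k -> nice nu (fun y => k y `^ p).
Proof.
move=> k0 p1 nk; have [B hB] := nice_bdd nk.
apply: (nice_dom (niceZ (`|B| `^ (p - 1)) nk)).
  exact: (measurableT_comp (measurable_powR p) (nice_meas nk)).
move=> y; rewrite ger0_norm ?powR_ge0//; apply: le_trans (ler_norm _).
apply: powR_le_mul => //; rewrite k0/=; apply: le_trans (ler_norm B).
exact: le_trans (ler_norm _) (hB y).
Qed.

Section size_estimate.
Context {R : realType} {m n : nat}.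
Notation V := 'rV[R]_n.
Notation MM := 'M[R]_(m.+1, n).
Notation mu := (leb R 1 n).
Notation niceY := (nice (leb R m.+1 n)).
Notation nice := (nice (leb R 1 n)).
Notation n2 := (n2 (leb R 1 n)).

Lemma rows_int (k : MM -> R) (h : V -> R) a : niceY k -> nice h -> (forall y, 0 <= k y) ->
  (forall x, 0 <= h x) -> nice (fun x => \int[leb R m.+1 n]_y (k y * h (x - row a y))) /\
  \int[mu]_x \int[leb R m.+1 n]_y (k y * h (x - row a y)) =
    (\int[mu]_x h x) * \int[leb R m.+1 n]_y k y.
Proof.
move=> nk nh k0 h0.
pose c (p : V * MM) := h (p.1 - row a p.2).
have mc : measurable_fun setT c.
  apply: (measurableT_comp (nice_meas nh)).
  have -> : (fun p : V * MM => p.1 - row a p.2) = (fun p => p.1 - 1 *: row a p.2).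
    by apply/funext => p; rewrite scale1r.
  apply: measurable_subscale => //.
  exact: (measurableT_comp (measurable_row a) measurable_snd).
have bc : bdd c by have [B hB] := nice_bdd nh; exists B => p; exact: hB.
apply: (@kernel_int _ _ _ _ _ mu (leb R m.+1 n) c k _ (int_ge0 _ h0) mc bc _ k0 nk) => [p|y]; first exact: h0.
by split; [exact: (shift_nice (row a y) nh)|exact: (shift_int (row a y) nh)].
Qed.

Variables (K : MM -> R) (f : 'I_m.+1 -> V -> R).
Hypotheses (nK : niceY (Kr 1 K)) (nf : forall a, nice (f a)).

Let k y := `|Kr 1 K y|.
Let k0 y : 0 <= k y. Proof. exact: normr_ge0. Qed.
Let nk : niceY k. Proof. exact: nice_norm. Qed.
Let nkq : niceY (fun y => k y `^ (@crit R m)).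
Proof. exact: nice_powR (@crit_ge1 R m) nk. Qed.

(** Normalized data, because the two terms of [young_rough] scale differently; [size_bound] restores
    the constants by homogeneity. *)
Lemma size_unit : \int[leb R m.+1 n]_y (k y `^ (@crit R m)) <= 1 -> (forall a, n2 (f a) <= 1) ->
  n2 (Top 1 K f) <= 1.
Proof.
move=> kq f1; set kap := \int[_]_y _ in kq.
have nT := Top_nice nK nf.
have kap0 : 0 <= kap by apply: int_ge0 => y; exact: powR_ge0.
apply: (n2_dual nT ler01) => g0 ng0.
(* The dual function has to be normalized as well, since it enters the AM-GM inequality on the same
   footing as the inputs. *)
suff H g : nice g -> n2 g <= 1 -> `|\int[mu]_x (Top 1 K f x * g x)| <= 1.
  rewrite mul1r; have [z|nz] := eqVneq (n2 g0) 0.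
    by have := int_CS nT ng0; rewrite z mulr0.
  have ngi := niceZ (n2 g0)^-1 ng0.
  have gp : 0 < n2 g0 by rewrite lt_def nz n2_ge0.
  have e1 : n2 (fun x => (n2 g0)^-1 * g0 x) = 1.
    by rewrite (n2Z _ ng0) ger0_norm ?invr_ge0 ?n2_ge0// mulVf.
  have := H _ ngi; rewrite e1 lexx => /(_ isT).
  rewrite (_ : \int[mu]_x _ = (n2 g0)^-1 * \int[mu]_x (Top 1 K f x * g0 x)); last first.
    rewrite -(intZ _ (niceMM nT ng0)).
    by apply: eq_Rintegral => x _; rewrite mulrCA.
  by rewrite normrM normfV [`|n2 g0|]ger0_norm ?n2_ge0// ler_pdivrMl// mulr1.
move=> ng g1.
pose A a x := \int[leb R m.+1 n]_y (k y `^ (@crit R m) * (f a (x - row a y) ^+ 2)).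
have hA a : nice (A a) /\ \int[mu]_x A a x = n2 (f a) ^+ 2 * kap.
  rewrite n2_sqr; apply: (rows_int a nkq (niceX2 (nf a))) => [y|x]; first exact: powR_ge0.
  exact: sqr_ge0.
pose Q := \prod_a n2 (f a) ^+ 2.
have Q1 : 0 <= Q <= 1.
  rewrite prodr_ge0 => [|a _]; last exact: sqr_ge0.
  apply: (@le_trans _ _ (\prod_(a < m.+1) (1 : R))); last by rewrite big1.
  apply: ler_prod => a _; rewrite sqr_ge0/=.
  by rewrite -[leRHS](expr1n R 2) lerXn2r ?nnegrE ?n2_ge0.
set th := (@crit R m)^-1.
have /andP[th0 th1] : 0 < th <= 1 := @crit_inv R m.
pose H x := th / m.+2%:R * (g x ^+ 2 * kap + \sum_a A a x) + (1 - th) * Q * g x ^+ 2.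
have ng2 := niceX2 ng.
have ngk : nice (fun x => g x ^+ 2 * kap).
  by have := niceZ kap ng2; rewrite (_ : (fun _ => _) = (fun x => g x ^+ 2 * kap))//; apply/funext => x; rewrite mulrC.
have nS : nice (fun x => \sum_a A a x) by apply: nice_sum => a; exact: (hA a).1.
have nH1 := niceD ngk nS.
have nH : nice H by apply: niceD; apply: niceZ.
have pw x : `|Top 1 K f x * g x| <= H x.
  have nY := kernel_nice1 (cf_meas nf) (cf_bdd nf) x nK.
  pose U y := th / m.+2%:R * (k y `^ (@crit R m) * g x ^+ 2 +
    \sum_a k y `^ (@crit R m) * f a (x - row a y) ^+ 2) +
    (1 - th) * g x ^+ 2 * \prod_a f a (x - row a y) ^+ 2.
  have nfa a : niceY (fun y => k y `^ (@crit R m) * f a (x - row a y) ^+ 2).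
    apply: niceM nkq _ _.
      apply: measurable_funX; apply: (measurableT_comp (nice_meas (nf a))).
      have -> : (fun y : MM => x - row a y) = (fun y => x - 1 *: row a y).
        by apply/funext => p; rewrite scale1r.
      by apply: measurable_subscale => //; exact: measurable_row.
    have [B hB] := nice_bdd (nf a); exists (B ^+ 2) => y.
    by rewrite normrX lerXn2r ?nnegrE// (le_trans _ (hB 0)).
  have [nP iP] := prod_rows_int x (fun a => niceX2 (nf a)).
  have nkg : niceY (fun y => k y `^ (@crit R m) * g x ^+ 2).
    have := niceZ (g x ^+ 2) nkq; rewrite (_ : (fun _ => _) = (fun y => k y `^ (@crit R m) * g x ^+ 2))//.
    by apply/funext => y; rewrite mulrC.
  have nsa : niceY (fun y => \sum_a k y `^ (@crit R m) * f a (x - row a y) ^+ 2).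
    exact: nice_sum.
  have nU1 := niceD nkg nsa.
  have nU : niceY U by apply: niceD; apply: niceZ.
  have -> : H x = \int[leb R m.+1 n]_y U y.
    rewrite (intD (niceZ _ nU1) (niceZ _ nP)) (intZ _ nU1) (intZ _ nP) (intD nkg nsa) (int_sum _ nfa).
    rewrite iP => [|a v]; last exact: sqr_ge0.
    rewrite /H; congr (_ * (_ + _) + _).
      by apply: etrans (esym (intZ (g x ^+ 2) nkq)) _; apply: eq_Rintegral => y _; rewrite mulrC.
    rewrite -[RHS]mulrA [in RHS](mulrC (g x ^+ 2)) -!mulrA; congr (_ * (_ * _)).
    by apply: eq_bigr => a _; rewrite n2_sqr.
  rewrite normrM mulrC.
  apply: (@le_trans _ _ (`|g x| * \int[leb R m.+1 n]_y `|Kr 1 K y * \prod_a f a (x - row a y)|)).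
    by rewrite ler_wpM2l// le_norm_int.
  rewrite -(intZ _ (nice_norm nY)); apply: le_int => //.
    exact: niceZ (nice_norm nY).
  move=> y; rewrite /= normrM.
  (* The dual function is the extra entry, at index 0. *)
  pose F (a : 'I_m.+2) := if unlift ord0 a is Some a' then `|f a' (x - row a' y)| else `|g x|.
  have F0 a : 0 <= F a by rewrite /F; case: (unlift ord0 a) => [a'|]; exact: normr_ge0.
  have e1 : \prod_a F a = `|g x| * \prod_a `|f a (x - row a y)|.
    by rewrite big_ord_recl /F unlift_none; congr (_ * _); apply: eq_bigr => a _; rewrite liftK.
  have e2 : \sum_a F a ^+ 2 = g x ^+ 2 + \sum_a f a (x - row a y) ^+ 2.
    rewrite big_ord_recl /F unlift_none real_normK ?num_real//; congr (_ + _).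
    by apply: eq_bigr => a _; rewrite liftK real_normK ?num_real.
  have e3 : \prod_a F a ^+ 2 = g x ^+ 2 * \prod_a f a (x - row a y) ^+ 2.
    rewrite big_ord_recl /F unlift_none real_normK ?num_real//; congr (_ * _).
    by apply: eq_bigr => a _; rewrite liftK real_normK ?num_real.
  have := young_rough (k0 y) F0; rewrite e1 e2 e3.
  rewrite normr_prod mulrCA => /le_trans; apply.
  rewrite /U -/th -mulr_sumr le_eqVlt; apply/orP; left; apply/eqP; ring.
apply: le_trans (le_norm_int (niceMM nT ng)) _.
apply: (le_trans (le_int (nice_norm (niceMM nT ng)) nH pw)).
rewrite (intD (niceZ _ nH1) (niceZ _ ng2)) (intZ _ nH1) (intZ _ ng2) (intD ngk nS) int_sum; last by move=> a; exact: (hA a).1.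
have -> : \int[mu]_x (g x ^+ 2 * kap) = n2 g ^+ 2 * kap.
  by rewrite n2_sqr mulrC -(intZ _ ng2); apply: eq_Rintegral => x _; rewrite mulrC.
have sq1 h : n2 h <= 1 -> n2 h ^+ 2 <= 1.
  by move=> h1; rewrite -[leRHS](expr1n R 2) lerXn2r ?nnegrE ?n2_ge0.
have b1 h : n2 h <= 1 -> n2 h ^+ 2 * kap <= 1.
  by move=> h1; rewrite mulr_ile1 ?sqr_ge0// sq1.
have S1 : n2 g ^+ 2 * kap + \sum_a \int[mu]_x A a x <= m.+2%:R.
  rewrite -natr1 addrC; apply: lerD; last exact: b1.
  apply: le_trans (ler_sum _ (_ : forall a, true -> _ <= 1)) _; last by rewrite sumr_const card_ord.
  by move=> a _; rewrite (hA a).2 b1.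
rewrite -n2_sqr; apply: (@le_trans _ _ (th / m.+2%:R * m.+2%:R + (1 - th) * 1)).
  apply: lerD; first by rewrite ler_wpM2l// divr_ge0// ltW.
  by rewrite -mulrA ler_wpM2l ?subr_ge0// mulr_ile1 ?sqr_ge0 ?sq1//; case/andP: Q1.
by rewrite divfK ?pnatr_eq0// mulr1 addrC subrK.
Qed.

End size_estimate.

Section decay.
Context {R : realType} {m n : nat}.
Notation V := 'rV[R]_n.
Notation MM := 'M[R]_(m.+1, n).
Notation N := (m.+1 * n)%N.
Notation mu := (leb R 1 n).
Notation niceY := (nice (leb R m.+1 n)).
Notation nice := (nice (leb R 1 n)).
Notation n2 := (n2 (leb R 1 n)).

Lemma Kr_nice (K : MM -> R) : measurable_fun setT K ->
  (exists lam, forall y, 2^-1 < enorm y <= 2 -> `|K y| <= lam) -> niceY (Kr 1 K).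
Proof.
move=> mK [lam Kb]; apply: (@bdd_supp_nice _ _ _ _ 2); first exact: measurable_Kr.
  exists `|lam| => y; rewrite /Kr /ann.
  case: (boolP (1 < enorm y <= 2 * 1)) => [/andP[h1 h2]|_]; last by rewrite mulr0 normr0.
  rewrite mulr1 (le_trans _ (ler_norm _))// Kb//; apply/andP; split; lra.
move=> y; rewrite /Kr /inball /ann mulr1; case: (boolP (1 < enorm y <= 2)) => [/andP[]//|_].
by rewrite mulr0 eqxx.
Qed.

Lemma TopZ r c (K : MM -> R) (t : 'I_m.+1 -> R) f x : niceY (Kr r K) -> (forall a, nice (f a)) ->
  Top r (fun y => c * K y) (fun a v => t a * f a v) x = c * \prod_a t a * Top r K f x.
Proof.
move=> nK nf; have nY := kernel_nice1 (cf_meas nf) (cf_bdd nf) x nK.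
apply: etrans (intZ (c * \prod_a t a) nY).
by apply: eq_Rintegral => y _; rewrite /Kr big_split/=; ring.
Qed.

Lemma TopD r (K L : MM -> R) f x : niceY (Kr r K) -> niceY (Kr r L) -> (forall a, nice (f a)) ->
  Top r (fun y => K y + L y) f x = Top r K f x + Top r L f x.
Proof.
move=> nK nL nf.
have n1 := kernel_nice1 (cf_meas nf) (cf_bdd nf) x nK.
have n2 := kernel_nice1 (cf_meas nf) (cf_bdd nf) x nL.
apply: etrans (intD n1 n2).
by apply: eq_Rintegral => y _; rewrite /Kr/=; ring.
Qed.

Lemma size_bound (K : MM -> R) f B : niceY (Kr 1 K) -> (forall a, nice (f a)) -> 0 < B ->
  \int[leb R m.+1 n]_y (`|Kr 1 K y| `^ (@crit R m)) <= B `^ (@crit R m) ->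
  n2 (Top 1 K f) <= B * \prod_a n2 (f a).
Proof.
move=> nK nf B0 hB; apply: prod_inf => [a||t ht]; [exact: n2_ge0|exact: ltW|].
have t0 a : 0 < t a := le_lt_trans (n2_ge0 _ _) (ht a).
have nK' : niceY (Kr 1 (fun y => B^-1 * K y)).
  rewrite (_ : Kr 1 _ = (fun y => B^-1 * Kr 1 K y)); first exact: niceZ.
  by apply/funext => y; rewrite /Kr mulrA.
have nf' a : nice (fun v => (t a)^-1 * f a v) by exact: niceZ.
have nkq := nice_powR (fun y => normr_ge0 (Kr 1 K y)) (@crit_ge1 R m) (nice_norm nK).
have P0 : 0 < B * \prod_a t a by rewrite mulr_gt0// prodr_gt0.
have := size_unit nK' nf'.
have -> : \int[leb R m.+1 n]_y (`|Kr 1 (fun y => B^-1 * K y) y| `^ (@crit R m)) =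
    (B^-1 `^ (@crit R m)) * \int[leb R m.+1 n]_y (`|Kr 1 K y| `^ (@crit R m)).
  apply: etrans (intZ _ nkq); apply: eq_Rintegral => y _.
  by rewrite /Kr -mulrA normrM ger0_norm ?invr_ge0 ?(ltW B0)// powRM// ?invr_ge0 ltW.
have h1 : B^-1 `^ (@crit R m) * \int[leb R m.+1 n]_y (`|Kr 1 K y| `^ (@crit R m)) <= 1.
  apply: le_trans (ler_wpM2l (powR_ge0 _ _) hB) _.
  by rewrite -powRM ?invr_ge0 ?(ltW B0)// mulVf ?gt_eqF// powR1.
have h2 a : n2 (fun v => (t a)^-1 * f a v) <= 1.
  rewrite (n2Z _ (nf a)) ger0_norm ?invr_ge0 ?(ltW (t0 a))// ler_pdivrMl// mulr1 ltW//.
move=> /(_ h1 h2).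
have -> : Top 1 (fun y => B^-1 * K y) (fun a v => (t a)^-1 * f a v) =
    (fun x => (B * \prod_a t a)^-1 * Top 1 K f x).
  by apply/funext => x; rewrite TopZ// prodfV invfM mulrC.
rewrite (n2Z _ (Top_nice nK nf)) ger0_norm ?invr_ge0 ?(ltW P0)//.
by rewrite ler_pdivrMl// mulr1.
Qed.

Variables (q : R).
Hypotheses (n0 : (0 < n)%N) (hq : @crit R m < q).

Let q0 := @crit R m.
Let q0p : 0 < q0. Proof. by apply: lt_le_trans (crit_ge1 m). Qed.
(** The decay rate of the part of the kernel above level 2 ^ u: its L^q0 norm on the annulus is at
    most c1 ^ u, and c1 < 1 exactly because q > q0. *)
Let c1 : R := 2 `^ ((q0 - q) / q0).
Let c0 : R := Num.max 2^-1 c1.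
Let c01 : 0 < c0 < 1.
Proof.
rewrite /c0 lt_max invr_gt0 ltr0n/= gt_max; apply/andP; split.
  by rewrite invf_lt1// ltr1n.
apply: powR_lt1; rewrite ?ltr1n//.
by rewrite pmulr_llt0 ?invr_gt0// subr_lt0.
Qed.

Let Cd := 1 + Num.sqrt (@core_const R m n) * (2 ^+ N) ^+ 2.
Let C2 := @vol R m.+1 n 2 + 1.

(* The bound [lam] is only qualitative: no constant depends on it. *)
Definition good_kernel (K : MM -> R) := [/\ measurable_fun setT K, homog K,
  exists lam, forall y, 2^-1 < enorm y <= 2 -> `|K y| <= lam,
  \int[leb R m.+1 n]_y (`|Kr 1 K y| `^ q) <= 1 &
  \int[leb R m.+1 n]_y Kr 1 K y = 0].

Section kernel.
Variable K : MM -> R.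
Hypothesis gK : good_kernel K.

Lemma good_nice : niceY (Kr 1 K).
Proof. by have [mK _ Kb _ _] := gK; exact: Kr_nice. Qed.

Let nkq p : 1 <= p -> niceY (fun y => `|Kr 1 K y| `^ p).
Proof. by move=> p1; exact: nice_powR (fun y => normr_ge0 _) p1 (nice_norm good_nice). Qed.

Let q1 : 1 <= q. Proof. exact: le_trans (crit_ge1 m) (ltW hq). Qed.

Lemma good_pow p : 1 <= p -> p <= q -> \int[leb R m.+1 n]_y (`|Kr 1 K y| `^ p) <= C2.
Proof.
move=> p1 pq; have [_ _ _ Kq _] := gK.
have p0 : 0 < p by apply: lt_le_trans p1.
have [nb ib] := @int_inball R m.+1 n 2.
rewrite /C2 -ib; apply: (le_trans (y := \int[leb R m.+1 n]_y ((inball 2 y)%:R + `|Kr 1 K y| `^ q))).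
  apply: le_int; [exact: nkq|exact: niceD nb (nkq q1)|move=> y].
  rewrite /inball; have [h|h] := leP (enorm y) 2; first exact: powR_le_add1.
  have hf : (enorm y <= 2) = false by rewrite leNgt h.
  rewrite /Kr /ann mulr1 hf andbF mulr0 normr0 (powR0 (lt0r_neq0 p0)) add0r.
  exact: powR_ge0.
by rewrite (intD nb (nkq q1)) lerD2l.
Qed.

Lemma Top_unit0 f : (forall a, nice (f a)) -> n2 (Top 1 K f) <= C2 * \prod_a n2 (f a).
Proof.
move=> nf; have C21 : 1 <= C2 by rewrite lerDr vol_ge0.
apply: (size_bound good_nice nf); first exact: lt_le_trans C21.
apply: le_trans (good_pow (crit_ge1 m) (ltW hq)) _.
by rewrite -[leLHS]powRr1 ?(le_trans ler01)//; apply: ler_powR => //; exact: crit_ge1.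
Qed.

Lemma Top_unit s f i : (forall a, nice (f a)) -> (forall x, avg (2 ^+ s)^-1 (f i) x = 0) ->
  n2 (Top 1 K f) <= Cd * c0 ^+ (s %/ 16) * \prod_a n2 (f a).
Proof.
move=> nf F0; have [mK hK [lam0 Kb] Kq _] := gK.
set u := (s %/ 16)%N.
have P0 : 0 <= \prod_a n2 (f a) by apply: prodr_ge0 => a _; exact: n2_ge0.
(* The quantity |K y| |y|^N has degree 0, so cutting at one of its levels preserves homogeneity. The
   factor 2 ^ N ensures |K y| > 2 ^ u for large points of the annulus 1 < |y| <= 2. *)
pose big y := 2 ^+ N * 2 ^+ u < `|K y| * enorm y ^+ N.
pose K1 y := K y * (~~ big y)%:R; pose K2 y := K y * (big y)%:R.
have mbig : measurable_fun setT big.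
  apply: measurable_fun_ltr => //; apply: measurable_funM.
    exact: measurableT_comp.
  by apply: measurable_funX; exact: measurable_enorm.
have mK1 : measurable_fun setT K1.
  by apply: measurable_funM => //; apply: measurable_boolR; exact: measurable_neg.
have mK2 : measurable_fun setT K2 by apply: measurable_funM => //; exact: measurable_boolR.
have hbig t y : 0 < t -> big (t *: y) = big y.
  move=> t0; rewrite /big hK// normrM enormZ exprMn (gtr0_norm t0).
  rewrite ger0_norm ?invr_ge0 ?exprn_ge0 ?(ltW t0)// mulrACA mulVf ?mul1r//.
  by rewrite expf_neq0// gt_eqF.
have hK1 : homog K1 by move=> t y t0; rewrite /K1 hbig// hK// mulrA.
have K2b y : 2^-1 < enorm y <= 2 -> `|K2 y| <= lam0.
  move=> /Kb h; rewrite /K2 normrM; apply: le_trans h; rewrite ler_piMr//.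
  by case: (big y); rewrite ?normr1 ?normr0.
have K1b y : 2^-1 < enorm y <= 2 -> `|K1 y| <= (2 ^+ N) ^+ 2 * 2 ^+ u.
  move=> /andP[h1 h2]; rewrite /K1 /big -leNgt normrM.
  case: (boolP (`|K y| * enorm y ^+ N <= 2 ^+ N * 2 ^+ u)) => [h|_]; last by rewrite normr0 mulr0 mulr_ge0 ?exprn_ge0.
  have e0 : 0 < enorm y by apply: lt_trans h1; rewrite invr_gt0.
  rewrite normr1 mulr1 expr2 -mulrA -ler_pdivrMl ?exprn_gt0//.
  apply: le_trans h; rewrite mulrC ler_wpM2l// -exprVn.
  by rewrite lerXn2r ?nnegrE ?invr_ge0 ?ltW.
have nK1 : niceY (Kr 1 K1) by apply: Kr_nice => //; exists ((2 ^+ N) ^+ 2 * 2 ^+ u).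
have nK2 : niceY (Kr 1 K2) by apply: Kr_nice => //; exists lam0.
have -> : Top 1 K f = (fun x => Top 1 K1 f x + Top 1 K2 f x).
  apply/funext => x; rewrite -TopD//; congr (Top _ _ _ _); apply/funext => y.
  by rewrite /K1 /K2 -mulrDr; case: (big y); rewrite ?addr0 ?add0r mulr1.
apply: le_trans (n2D (Top_nice nK1 nf) (Top_nice nK2 nf)) _.
have uc : forall c : R, 0 <= c <= c0 -> c ^+ u <= c0 ^+ u.
  by move=> c /andP[ca cb]; rewrite lerXn2r ?nnegrE// ltW//; case/andP: c01.
rewrite /Cd (addrC 1) !mulrDl; apply: lerD.
  (* In [Top_core] the squared level contributes 2^(2u) and 1 / sqrt M contributes 2^(-4u), so the
     norm gains 2^(-u). The condition del M^2 <= 1 with del = 2^-s requires 16 u <= s, whence the 16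
     in the definition of u. *)
  pose M := (2 ^ (8 * u))%N.
  have M0 : (0 < M)%N by rewrite expn_gt0.
  have ME : M%:R = 2 ^+ (8 * u) :> R by rewrite natrX.
  have d0 : 0 < (2 ^+ s)^-1 :> R by rewrite invr_gt0 exprn_gt0.
  have dM : (2 ^+ s)^-1 * M%:R ^+ 2 <= 1 :> R.
    rewrite ME -exprM ler_pdivrMl ?exprn_gt0// mulr1; apply: ler_weXn2l; first by rewrite ler1n.
    by move: (leq_trunc_div s 16); rewrite -/u; clear; lia.
  have h := Top_core n0 mK1 hK1 K1b (nf i) d0 F0 M0 dM nf erefl.
  have cc0 : 0 <= @core_const R m n by rewrite mulr_ge0 ?vol_ge0 ?sqrtr_ge0.
  have vc : (2^-1) ^+ u <= c0 ^+ u :> R by apply: uc; rewrite invr_ge0 ler0n/= le_max lexx.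
  have X0 : 0 <= Num.sqrt (@core_const R m n) * (2 ^+ N) ^+ 2 * (2^-1) ^+ u * \prod_a n2 (f a) :> R.
    by rewrite mulr_ge0// mulr_ge0 ?exprn_ge0 ?invr_ge0// mulr_ge0 ?sqrtr_ge0// sqr_ge0.
  apply: (@le_trans _ _ (Num.sqrt (@core_const R m n) * (2 ^+ N) ^+ 2 * (2^-1) ^+ u * \prod_a n2 (f a))).
    rewrite -(@ler_pXn2r _ 2) ?nnegrE ?n2_ge0//; apply: le_trans h _.
    have sM : Num.sqrt M%:R = 2 ^+ (4 * u) :> R.
      have e8 : (8 * u = 4 * u * 2)%N by rewrite mulnAC.
      rewrite ME e8.
      by rewrite exprM sqrtr_sqr ger0_norm ?exprn_ge0.
    rewrite sM !exprMn sqr_sqrtr// prodrXl le_eqVlt; apply/orP; left; apply/eqP.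
    have -> : 2 ^+ (4 * u) = (2 ^+ u) ^+ 4 :> R by rewrite -exprM mulnC.
    rewrite exprVn; have : (2 ^+ u : R) != 0 by rewrite expf_neq0.
    move: (2 ^+ u : R) (2 ^+ N : R) => w1 w2 w0; by field.
  rewrite ler_wpM2r// ler_wpM2l// mulr_ge0 ?sqrtr_ge0 ?sqr_ge0//.
rewrite mul1r; have c1u0 : 0 < c1 ^+ u by rewrite exprn_gt0// powR_gt0.
apply: (@le_trans _ _ (c1 ^+ u * \prod_a n2 (f a))); last first.
  by rewrite ler_wpM2r// uc// powR_ge0/= le_max lexx orbT.
apply: (size_bound nK2 nf c1u0).
have E : (c1 ^+ u) `^ q0 = (2 ^+ u) `^ (q0 - q).
  by rewrite !powR_expr ?powR_ge0// /c1 -powRrM divfK ?gt_eqF.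
rewrite -/q0 E.
have nk2 := nice_powR (fun y => normr_ge0 (Kr 1 K2 y)) (crit_ge1 m) (nice_norm nK2).
(* Where the kernel exceeds 2^u, its power q0 is at most 2^(u (q0 - q)) times its power q. *)
apply: (@le_trans _ _ (\int[leb R m.+1 n]_y ((2 ^+ u) `^ (q0 - q) * `|Kr 1 K y| `^ q))); last first.
  by rewrite (intZ _ (nkq q1)) ger_pMr// powR_gt0// exprn_gt0.
apply: le_int => //; first exact: niceZ (nkq q1).
move=> y; rewrite /Kr /K2.
have qq0 : q != 0 by rewrite gt_eqF// (lt_trans q0p).
case: (boolP (ann 1 y)) => [|_]; last by rewrite !mulr0 normr0 !powR0 ?mulr0// gt_eqF.
rewrite /ann mulr1 !mulr1 => /andP[h1 h2].
case: (boolP (big y)) => [|_]; last first.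
  by rewrite mulr0 normr0 powR0 ?gt_eqF// mulr_ge0 ?powR_ge0.
rewrite mulr1 /big => hb.
have Ku : 2 ^+ u < `|K y|.
  rewrite -(ltr_pM2l (_ : 0 < 2 ^+ N)) ?exprn_gt0//; apply: lt_le_trans hb _.
  by rewrite mulrC ler_wpM2r// lerXn2r ?nnegrE ?enorm_ge0.
have u0 : 0 < 2 ^+ u :> R by rewrite exprn_gt0.
have Kp : 0 < `|K y| := lt_trans u0 Ku.
have -> : `|K y| `^ q0 = `|K y| `^ (q0 - q) * `|K y| `^ q.
  by rewrite -powRD ?subrK// (gt_eqF Kp) implybT.
rewrite ler_wpM2r ?powR_ge0// -opprB !powRN lef_pV2 ?posrE ?powR_gt0//.
by apply: ge0_ler_powR; rewrite ?nnegrE ?subr_ge0 ?ltW.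
Qed.

End kernel.

Lemma Kr_scale (K : MM -> R) rho y : homog K -> 0 < rho ->
  Kr rho K (rho *: y) = rho ^- N * Kr 1 K y.
Proof.
move=> hK r0; rewrite /Kr hK// /ann enormZ gtr0_norm// -mulrA; congr (_ * (_ * _%:R)).
by rewrite mulrC -[X in X < _]mul1r ltr_pM2r// ler_pM2r// !mulr1.
Qed.

Lemma Kr_nice_scale (K : MM -> R) rho : homog K -> 0 < rho -> niceY (Kr 1 K) -> niceY (Kr rho K).
Proof.
move=> hK r0 nK; have ri : 0 < rho^-1 by rewrite invr_gt0.
have [h _] := int_scale ri (niceZ (rho ^- N) nK).
rewrite (_ : Kr rho K = (fun y => rho ^- N * Kr 1 K (rho^-1 *: y)))//.
by apply/funext => y; rewrite -Kr_scale// scalerA mulfV ?gt_eqF// scale1r.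
Qed.

Lemma Kr_int_scale (K : MM -> R) rho (p : R -> R) : homog K -> 0 < rho -> niceY (fun y => p (Kr rho K y)) ->
  \int[leb R m.+1 n]_y p (Kr rho K y) = rho ^+ N * \int[leb R m.+1 n]_y p (rho ^- N * Kr 1 K y).
Proof.
move=> hK r0 nK; have [_ h] := int_scale r0 nK.
have rN : rho ^+ N != 0 by rewrite expf_neq0// gt_eqF.
have -> : \int[leb R m.+1 n]_y p (rho ^- N * Kr 1 K y) = \int[leb R m.+1 n]_y p (Kr rho K (rho *: y)).
  by apply: eq_Rintegral => y _; rewrite Kr_scale.
by rewrite h mulrA mulfV// mul1r.
Qed.

Lemma Top_scale (K : MM -> R) rho f x : homog K -> 0 < rho -> niceY (Kr 1 K) -> (forall a, nice (f a)) ->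
  Top rho K f (rho *: x) = Top 1 K (fun a v => f a (rho *: v)) x.
Proof.
move=> hK r0 nK nf; have nKr := Kr_nice_scale hK r0 nK.
have nY := kernel_nice1 (cf_meas nf) (cf_bdd nf) (rho *: x) nKr.
have nf' a : nice (fun v => f a (rho *: v)) := (int_scale r0 (nf a)).1.
have nY' := kernel_nice1 (cf_meas nf') (cf_bdd nf') x nK.
have [_ h] := int_scale r0 nY.
have rN : rho ^+ N != 0 by rewrite expf_neq0// gt_eqF.
apply: (mulfI (invr_neq0 rN)); apply: etrans (esym h) _.
apply: etrans (intZ (rho ^- N) nY'); apply: eq_Rintegral => y _ /=.
rewrite Kr_scale// -mulrA; congr (_ * (_ * _)); apply: eq_bigr => a _; congr (f a _).
by rewrite scalerBr; congr (_ - _); apply/rowP => j; rewrite !mxE.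
Qed.

Lemma n2_scale (h : V -> R) rho : 0 < rho -> nice h ->
  n2 (fun x => h (rho *: x)) = Num.sqrt (rho ^- n) * n2 h.
Proof.
move=> r0 nh; have [_ e] := int_scale r0 (niceX2 nh).
rewrite !n2E e mul1n sqrtrM// invr_ge0 exprn_ge0// ltW//.
Qed.

Lemma avg_scale (h : V -> R) rho l x : 0 < rho -> 0 < l -> nice h ->
  avg l (fun x => h (rho *: x)) x = avg (rho * l) h (rho *: x).
Proof.
move=> r0 l0 nh; have rl0 : 0 < rho * l by rewrite mulr_gt0.
have [_ e] := int_scale r0 (sf_nice rl0 (rho *: x) nh).
have sE y : same (rho * l) (rho *: x) (rho *: y) = same l x y.
  rewrite /same; apply: eq_forallb => i; rewrite /gfl !mxE.
  have e1 (z : R) : rho * z / (rho * l) = z / l.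
    by rewrite invfM mulrACA mulfV ?mul1r// gt_eqF.
  by rewrite !e1.
rewrite /avg /kop exprMn invfM -mulrA mulrCA; congr (_ * _).
rewrite mul1n in e; rewrite -e; apply: eq_Rintegral => y _; by rewrite sE.
Qed.

End decay.

(** Only the index with the largest s is exploited, and its decay is shared out among all m+1
    indices by taking a root of the rate. The power of rho is dictated by scaling: m+1 functions
    enter and one comes out. *)
Lemma Top_decay (R : realType) (m n : nat) (q : R) : (0 < n)%N -> @crit R m < q ->
  exists C c : R, [/\ 0 < C, 0 < c < 1 &
  forall K : 'M[R]_(m.+1, n) -> R, good_kernel q K -> forall rho (f : 'I_m.+1 -> 'rV[R]_n -> R) (s : 'I_m.+1 -> nat),
    0 < rho -> (forall a, nice (leb R 1 n) (f a)) ->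
    (forall a, (0 < s a)%N -> forall x, avg (rho / 2 ^+ s a) (f a) x = 0) ->
    n2 (leb R 1 n) (Top rho K f) <=
    C * \prod_a c ^+ s a * Num.sqrt (rho ^- n) ^+ m * \prod_a n2 (leb R 1 n) (f a)].
Proof.
move=> n0 hq.
have q0p : 0 < @crit R m by apply: lt_le_trans (crit_ge1 m).
pose c1 : R := 2 `^ ((@crit R m - q) / @crit R m).
pose c0 : R := Num.max 2^-1 c1.
have /andP[c00 c01] : 0 < c0 < 1.
  rewrite /c0 lt_max invr_gt0 ltr0n/= gt_max; apply/andP; split.
    by rewrite invf_lt1// ltr1n.
  apply: powR_lt1; rewrite ?ltr1n//.
  by rewrite pmulr_llt0 ?invr_gt0// subr_lt0.
(* The factor m+1 distributes the decay over the indices; the 16 is the divisor in [Top_unit]. *)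
pose k := (16 * m.+1)%N.
pose c := c0 `^ k%:R^-1.
have cp : 0 < c by rewrite powR_gt0.
have kp : 0 < k%:R^-1 :> R by rewrite invr_gt0 ltr0n.
have cl : c < 1.
  have := @gt0_ltr_powR R k%:R^-1 kp c0 1; rewrite !nnegrE powR1; apply => //; exact: ltW.
have ck : c ^+ k = c0.
  by rewrite -powR_mulrn ?ltW// -powRrM mulVf ?pnatr_eq0// powRr1// ltW.
pose Cd : R := 1 + Num.sqrt (@core_const R m n) * (2 ^+ (m.+1 * n)) ^+ 2.
pose C2 := @vol R m.+1 n 2 + 1.
have C21 : 1 <= C2 by rewrite lerDr vol_ge0.
have Cd1 : 1 <= Cd by rewrite lerDl mulr_ge0 ?sqrtr_ge0// sqr_ge0.
(* The division by c ^ k pays for the rounding in s %/ 16. *)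
pose C := (Cd + C2) / c ^+ k.
have cki : 1 <= (c ^+ k)^-1.
  by rewrite invf_ge1 ?exprn_gt0// exprn_ile1 ?ltW.
have CC : C2 <= C.
  rewrite /C; apply: (@le_trans _ _ (Cd + C2)); first by rewrite lerDr (le_trans ler01).
  by rewrite ler_peMr// addr_ge0 ?(le_trans ler01).
exists C, c; split; first by apply: lt_le_trans CC; apply: lt_le_trans C21.
  by rewrite cp.
move=> K gK rho f s r0 nf f0.
have [mK hK Kb Kq K0] := gK.
have nK := good_nice gK.
pose g a v := f a (rho *: v).
have ng a : nice (leb R 1 n) (g a) := (int_scale r0 (nf a)).1.
set sg := Num.sqrt (rho ^- n).
have sg0 : 0 < sg by rewrite sqrtr_gt0 invr_gt0 exprn_gt0.
have U : n2 (leb R 1 n) (Top 1 K g) <= C * \prod_a c ^+ s a * \prod_a n2 (leb R 1 n) (g a).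
  have P0 : 0 <= \prod_a n2 (leb R 1 n) (g a) by apply: prodr_ge0 => a _; exact: n2_ge0.
  pose i := [arg max_(a > ord0) s a].
  have imax a : (s a <= s i)%N by rewrite /i; case: arg_maxnP => // j _; apply.
  have cs : c ^+ (m.+1 * s i) <= \prod_a c ^+ s a.
    rewrite -[X in c ^+ (X * _)](card_ord m.+1) -sum_nat_const.
    rewrite -(big_morph _ (exprD c) (expr0 c)).
    apply: ler_wiXn2l; rewrite ?ltW//; exact: leq_sum.
  have [si|si] := posnP (s i).
    apply: le_trans (Top_unit0 hq gK ng) _; rewrite ler_wpM2r//.
    have C0 : 0 <= C := le_trans (le_trans ler01 C21) CC.
    apply: le_trans CC _; apply: ler_peMr => //.
    by apply: le_trans cs; rewrite si muln0 expr0.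
  have gi x : avg (2 ^+ s i)^-1 (g i) x = 0.
    by rewrite /g avg_scale ?invr_gt0 ?exprn_gt0//; exact: f0.
  apply: le_trans (Top_unit n0 hq gK ng gi) _; rewrite ler_wpM2r//.
  apply: (@le_trans _ _ (C * c ^+ (m.+1 * s i))); last first.
    by rewrite ler_wpM2l// (le_trans (le_trans ler01 C21) CC).
  apply: (@le_trans _ _ (Cd * (c ^+ k) ^+ (s i %/ 16))); first by rewrite ck.
  rewrite /C -[leRHS]mulrA; apply: ler_pM.
  - exact: le_trans Cd1.
  - by rewrite exprn_ge0// exprn_ge0// ltW.
  - by rewrite lerDl (le_trans ler01).
  rewrite mulrC ler_pdivlMr ?exprn_gt0// -exprM -exprD; apply: ler_wiXn2l; rewrite ?ltW//.
  by rewrite addnC -mulnS /k -mulnA mulnCA leq_mul2l /= mulnC ltnW// ltn_ceil.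
have TE : n2 (leb R 1 n) (Top 1 K g) = sg * n2 (leb R 1 n) (Top rho K f).
  rewrite -n2_scale//; last exact: Top_nice (Kr_nice_scale hK r0 nK) nf.
  by congr (n2 _ _); apply/funext => x; rewrite Top_scale.
move: U; rewrite TE.
have -> : \prod_a n2 (leb R 1 n) (g a) = sg ^+ m.+1 * \prod_a n2 (leb R 1 n) (f a).
  by rewrite /g (eq_bigr (fun a => sg * n2 (leb R 1 n) (f a)))=> [|a _]; rewrite ?n2_scale// big_split/= prodr_const card_ord.
move=> U; rewrite -(ler_pM2l sg0); apply: le_trans U _.
by rewrite exprS le_eqVlt; apply/orP; left; apply/eqP; ring.
Qed.

(** * Localization and oscillation *)

Section weighted_sums.
Context {R : realType}.

Lemma wsum_CS (T : nat) (w a : nat -> R) : (forall s, 0 <= w s) ->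
  (\sum_(s < T) w s * a s) ^+ 2 <= (\sum_(s < T) w s) * \sum_(s < T) w s * a s ^+ 2.
Proof.
move=> w0; elim: T => [|T IH]; first by rewrite !big_ord0 expr0n mul0r.
rewrite !big_ord_recr/=.
have W0 : 0 <= \sum_(s < T) w s by exact: sumr_ge0.
have Q0 : 0 <= \sum_(s < T) w s * a s ^+ 2.
  by apply: sumr_ge0 => s _; rewrite mulr_ge0// sqr_ge0.
move: (\sum_(s < T) w s * a s) (\sum_(s < T) w s) (\sum_(s < T) w s * a s ^+ 2) (w T) (a T) (w0 T) IH W0 Q0.
move=> S W Q v b v0 IH W0 Q0.
have h : 2 * (S * b) <= W * b ^+ 2 + Q.
  apply: le_trans (ler_norm _) _; rewrite -(@ler_pXn2r _ 2) ?nnegrE//; last first.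
    by rewrite addr_ge0// mulr_ge0// sqr_ge0.
  rewrite real_normK ?num_real//.
  have := ler_wpM2r (sqr_ge0 b) IH; have := sqr_ge0 (W * b ^+ 2 - Q); nra.
have := ler_wpM2l v0 h; nra.
Qed.

Lemma geo_sum (c : R) T : 0 <= c < 1 -> \sum_(s < T) c ^+ s <= (1 - c)^-1.
Proof.
move=> /andP[c0 c1]; have d0 : 0 < 1 - c by rewrite subr_gt0.
have := subrX1 c T; rewrite -opprB -[c - 1]opprB mulNr => /oppr_inj e.
by rewrite -[leRHS]mul1r ler_pdivlMr// mulrC -e gerBl exprn_ge0.
Qed.

Lemma geo_CS (c : R) T (a : nat -> R) : 0 <= c < 1 ->
  (\sum_(s < T) c ^+ s * a s) ^+ 2 <= (1 - c)^-1 * \sum_(s < T) c ^+ s * a s ^+ 2.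
Proof.
move=> c01; have c0 : 0 <= c by case/andP: c01.
apply: le_trans (wsum_CS T a (fun s => exprn_ge0 s c0)) _.
rewrite ler_wpM2r ?geo_sum//; apply: sumr_ge0 => s _.
by apply: mulr_ge0; [exact: exprn_ge0|exact: sqr_ge0].
Qed.

Lemma sum_nat_le (F : nat -> R) A B : (A <= B)%N -> (forall s, 0 <= F s) ->
  \sum_(s < A) F s <= \sum_(s < B) F s.
Proof.
move=> /subnKC <- F0; elim: (B - A)%N => [|k IH]; first by rewrite addn0.
by rewrite addnS big_ord_recr/=; apply: le_trans IH _; rewrite lerDl.
Qed.

(** The distance |r - k|: one of the two truncated differences is always zero. *)
Definition dist (r k : nat) : nat := (r - k + (k - r))%N.

Lemma distC r k : dist r k = dist k r. Proof. exact: addnC. Qed.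

Lemma dist_sum (c : R) k T : 0 <= c < 1 -> \sum_(r < T) c ^+ dist r k <= 2 * (1 - c)^-1.
Proof.
move=> /andP[c0 c1]; have d0 : 0 < 1 - c by rewrite subr_gt0.
have h1 : (1 - c) * \sum_(r < T) (k <= r)%N%:R * c ^+ (r - k) <= 1 - c ^+ (T - k).
  elim: T => [|T IH]; first by rewrite big_ord0 mulr0 sub0n expr0 subrr.
  rewrite big_ord_recr/= mulrDr; case: (leqP k T) => h.
    by rewrite subSn// mul1r exprS; move: IH; lra.
  by move: IH; rewrite mul0r mulr0 addr0 (eqP (_ : T - k == 0)%N) ?subn_eq0 ?(ltnW h)// (eqP (_ : T.+1 - k == 0)%N) ?subn_eq0.
have h2 : (1 - c) * \sum_(r < T) (r <= k)%N%:R * c ^+ (k - r) <= c ^+ (k.+1 - T).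
  elim: T {h1} => [|T IH]; first by rewrite big_ord0 mulr0 exprn_ge0.
  rewrite big_ord_recr/= mulrDr subSS; case: (leqP T k) => h.
    by rewrite mul1r; move: IH; rewrite subSn// exprS; lra.
  by move: IH; rewrite mul0r mulr0 addr0 (eqP (_ : k.+1 - T == 0)%N) ?subn_eq0// (eqP (_ : k - T == 0)%N) ?subn_eq0 ?(ltnW h).
have h3 : \sum_(r < T) c ^+ dist r k <= \sum_(r < T) (k <= r)%N%:R * c ^+ (r - k) +
    \sum_(r < T) (r <= k)%N%:R * c ^+ (k - r).
  rewrite -big_split/=; apply: ler_sum => r _; rewrite /dist; case: (leqP k r) => h.
    by rewrite (eqP (_ : k - r == 0)%N) ?subn_eq0// addn0 mul1r lerDl mulr_ge0 ?exprn_ge0.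
  by rewrite (eqP (_ : r - k == 0)%N) ?subn_eq0 ?(ltnW h)// add0n mul0r mul1r add0r.
apply: le_trans h3 _; rewrite ler_pdivlMr// mulrC mulrDr.
have l1 : c ^+ (k.+1 - T) <= 1 by rewrite exprn_ile1// ltW.
by have := exprn_ge0 (T - k) c0; move: h1 h2 l1; lra.
Qed.

Lemma dist_sum2 (c : R) (u : nat -> R) A B : 0 <= c < 1 -> (forall k, 0 <= u k) ->
  \sum_(r < A) \sum_(k < B) c ^+ dist r k * u k <= 2 * (1 - c)^-1 * \sum_(k < B) u k.
Proof.
move=> c01 u0; rewrite exchange_big/= mulr_sumr; apply: ler_sum => k _.
by rewrite -mulr_suml ler_wpM2r// dist_sum.
Qed.

End weighted_sums.

(** The bound on c is asked only where k is nonzero: translation estimates hold only for the shifts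
    in the support of the kernel. *)
Lemma kernel_int_le d1 d2 (T1 : measurableType d1) (T2 : measurableType d2) (R : realType)
  (m1 : {sigma_finite_measure set T1 -> \bar R}) (m2 : {sigma_finite_measure set T2 -> \bar R})
  (c : T1 * T2 -> R) (k : T2 -> R) A :
  0 <= A -> measurable_fun setT c -> bdd c -> (forall p, 0 <= c p) -> (forall y, 0 <= k y) -> nice m2 k ->
  (forall y, k y != 0 -> nice m1 (fun x => c (x, y)) /\ \int[m1]_x c (x, y) <= A) ->
  (\int[m1]_x (\int[m2]_y (k y * c (x, y)))%:E <= (A * \int[m2]_y k y)%:E)%E.
Proof.
move=> A0 mc bc c0 k0 nk hc; rewrite EFinM -(ge0_Rint nk).
pose F (p : T1 * T2) : \bar R := (k p.2 * c p)%:E.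
have mF : measurable_fun setT F.
  apply/measurable_EFinP; apply: measurable_funM => //.
  exact: (measurableT_comp (nice_meas nk) measurable_snd).
have F0 p : (0 <= F p)%E by rewrite lee_fin mulr_ge0.
have e1 : (\int[m1]_x (\int[m2]_y (k y * c (x, y)))%:E = \int[m1]_x \int[m2]_y F (x, y))%E.
  apply: eq_integral => x _; rewrite -ge0_Rint//.
  by have h := kernel_nice1 mc bc x nk; exact: h.
rewrite e1 (fubini_tonelli (m1 := m1) (m2 := m2) F mF F0).
have e2 : (\int[m2]_y (A%:E * (k y)%:E) = A%:E * \int[m2]_y (k y)%:E)%E.
  apply: ge0_integralZl => //.
  - by apply/measurable_EFinP; exact: nice_meas nk.
  - by move=> y _; rewrite lee_fin.
rewrite -e2; apply: ge0_le_integral => //.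
- by move=> y _; exact: integral_ge0.
- exact: (measurable_fun_fubini_tonelli_G F).
- by apply: emeasurable_funM => //; apply/measurable_EFinP; exact: nice_meas nk.
move=> y _; have [k00|kn] := eqVneq (k y) 0.
  by rewrite k00 mule0 /F/= k00 integral0_eq// => x _; rewrite mul0r.
have [nc hA] := hc y kn.
rewrite /F/= ge0_Rint; last exact: niceZ nc.
by rewrite (intZ _ nc) -EFinM lee_fin mulrC ler_wpM2r.
Qed.

(** Expanding the integral of k (A c - B)^2, where A and B are the integrals of k and k c, avoids
    taking the square root of the weight. *)
Lemma wCS d (T : measurableType d) (R : realType) (mu : {measure set T -> \bar R}) (k c : T -> R) :
  nice mu k -> (forall y, 0 <= k y) -> measurable_fun setT c -> bdd c ->
  (\int[mu]_y (k y * c y)) ^+ 2 <= (\int[mu]_y k y) * \int[mu]_y (k y * c y ^+ 2).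
Proof.
move=> nk k0 mc bc; set A := \int[mu]_y k y; set B := \int[mu]_y (k y * c y); set D := \int[mu]_y (k y * c y ^+ 2).
have A0 : 0 <= A by exact: int_ge0.
have mc2 : measurable_fun setT (fun y => c y ^+ 2) by exact: measurable_funX.
have bc2 : bdd (fun y => c y ^+ 2).
  have [b hb] := bc; exists (b ^+ 2) => y.
  by rewrite normrX lerXn2r ?nnegrE// (le_trans _ (hb y)).
have n1 := niceM nk mc bc; have n2 := niceM nk mc2 bc2.
have [A00|An] := eqVneq A 0.
  suff -> : B = 0 by rewrite A00 mul0r expr0n.
  have [b hb] := bc; apply/eqP; rewrite -normr_le0; apply: le_trans (le_norm_int n1) _.
  apply: (le_trans (le_int (nice_norm n1) (niceZ b nk) _)); last by rewrite (intZ _ nk) -/A A00 mulr0.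
  by move=> y; rewrite normrM ger0_norm// mulrC ler_wpM2r.
have Ap : 0 < A by rewrite lt_def An.
have : 0 <= \int[mu]_y (k y * (A * c y - B) ^+ 2).
  by apply: int_ge0 => y; rewrite mulr_ge0// sqr_ge0.
have -> : \int[mu]_y (k y * (A * c y - B) ^+ 2) = A * (A * D - B ^+ 2).
  have -> : \int[mu]_y (k y * (A * c y - B) ^+ 2) =
      \int[mu]_y (A ^+ 2 * (k y * c y ^+ 2) - (2 * A * B * (k y * c y) - B ^+ 2 * k y)).
    by apply: eq_Rintegral => y _; ring.
  have nB := niceB (niceZ (2 * A * B) n1) (niceZ (B ^+ 2) nk).
  rewrite (intB (niceZ (A ^+ 2) n2) nB) (intB (niceZ (2 * A * B) n1) (niceZ (B ^+ 2) nk)).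
  by rewrite (intZ _ n1) (intZ _ n2) (intZ _ nk) -/A -/B -/D; ring.
by rewrite pmulr_rge0// subr_ge0.
Qed.

Section oscillation.
Context {R : realType} {n : nat}.
Notation V := 'rV[R]_n.
Notation mu := (leb R 1 n).
Notation nice := (nice (leb R 1 n)).
Notation n2 := (n2 (leb R 1 n)).

Lemma translation_sqr l (u : V -> R) (h : R) (v : V) : 0 < l -> nice u -> cst_on l u ->
  (forall i, `|v 0 i| <= h) -> 0 <= h ->
  nice (fun x => (u (x - v) - u x) ^+ 2) /\
  \int[mu]_x (u (x - v) - u x) ^+ 2 <= 4 * n.+1%:R * (h / l) * n2 u ^+ 2.
Proof.
move=> l0 nu cu vh h0; split; first exact: niceX2 (niceB (shift_nice v nu) nu).
by rewrite -n2_sqr; apply: translation.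
Qed.

Definition osc l (u : V -> R) x := l ^- n * \int[mu]_y ((near2 l x y)%:R * (u y - u x) ^+ 2).

Lemma oscE l u x : 0 < l -> nice u ->
  osc l u x = navg l (fun y => u y ^+ 2) x - 2 * u x * navg l u x + 5 ^+ n * u x ^+ 2.
Proof.
move=> l0 nu; rewrite /osc /navg /kop.
have [n1 i1] := int_near2 x l0.
have nu1 := nf_nice l0 x nu; have nu2 := nf_nice l0 x (niceX2 nu).
have -> : \int[mu]_y ((near2 l x y)%:R * (u y - u x) ^+ 2) =
   \int[mu]_y ((near2 l x y)%:R * u y ^+ 2 - (2 * u x * ((near2 l x y)%:R * u y) - u x ^+ 2 * (near2 l x y)%:R)).
  by apply: eq_Rintegral => y _; ring.
have nB := niceB (niceZ (2 * u x) nu1) (niceZ (u x ^+ 2) n1).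
rewrite (intB nu2 nB) (intB (niceZ (2 * u x) nu1) (niceZ (u x ^+ 2) n1)) (intZ _ nu1) (intZ _ n1) i1.
have ln : l ^+ n != 0 by rewrite expf_neq0// gt_eqF.
by rewrite exprMn; move: (l ^+ n) ln => w wn; field.
Qed.

Lemma osc_nice l u : 0 < l -> nice u -> nice (osc l u).
Proof.
move=> l0 nu; rewrite (_ : osc l u = (fun x => navg l (fun y => u y ^+ 2) x - 2 * u x * navg l u x + 5 ^+ n * u x ^+ 2)).
  apply: niceD; last exact: niceZ (niceX2 nu).
  apply: niceB; first exact: navg_nice (niceX2 nu).
  exact: niceMM (niceZ 2 nu) (navg_nice l0 nu).
by apply/funext => x; exact: oscE.
Qed.

Lemma osc_ge0 l u x : 0 < l -> 0 <= osc l u x.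
Proof.
move=> l0; apply: mulr_ge0; first by rewrite invr_ge0 exprn_ge0// ltW.
by apply: int_ge0 => y; rewrite mulr_ge0// sqr_ge0.
Qed.

(** The points of near cubes differ by at most 3 l in each coordinate, so [osc] is at most the
    integral of the squared differences over these shifts, divided by l^n. The constant comes from a
    ball containing them. *)
Lemma osc_int_gen l u A : (0 < n)%N -> 0 < l -> nice u -> 0 <= A ->
  (forall v : V, (forall i, `|v 0 i| <= 3 * l) -> \int[mu]_x (u (x - v) - u x) ^+ 2 <= A) ->
  \int[mu]_x osc l u x <= (3 * n%:R + 1) ^+ n * @vol R 1 n 1 * A.
Proof.
move=> n0 l0 nu A0 hA.
pose rad := (3 * n%:R + 1) * l.
have rad0 : 0 < rad by rewrite mulr_gt0// ltr_wpDl.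
have [nb ib] := @int_inball R 1 n rad.
pose bx (v : V) : bool := [forall i, `|v 0 i| <= 3 * l].
have mbx : measurable_fun setT bx.
  apply: measurable_forall => i; apply: measurable_fun_ler => //.
  by apply: measurableT_comp => //; exact: measurable_coord.
have bxb v : bx v -> inball rad v.
  move=> /forallP h; rewrite /inball; apply: (@le_trans _ _ ((1 * n)%:R * (3 * l))).
    by apply: enorm_le => [|i j]; [rewrite mulr_ge0// ltW|rewrite ord1].
  by rewrite mul1n /rad; have := l0; nra.
have nbx : nice (fun v => (bx v)%:R).
  apply: nice_dom nb _ _; first exact: measurable_boolR.
  by move=> v; case: (boolP (bx v)) => [/bxb ->//|_]; rewrite normr0.
have ibx : \int[mu]_v (bx v)%:R <= @vol R 1 n rad.
  rewrite -ib; apply: le_int => // v; case: (boolP (bx v)) => [/bxb ->//|_]; exact: ler0n.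
pose c (p : V * V) := (u (p.1 - p.2) - u p.1) ^+ 2.
have mc : measurable_fun setT c.
  apply: measurable_funX; apply: measurable_funB; last exact: (measurableT_comp (nice_meas nu) measurable_fst).
  apply: (measurableT_comp (nice_meas nu)).
  have -> : (fun p : V * V => p.1 - p.2) = (fun p => p.1 - 1 *: p.2) by apply/funext => p; rewrite scale1r.
  exact: measurable_subscale.
have bc : bdd c.
  have [B hB] := nice_bdd nu; exists ((B + B) ^+ 2) => p.
  rewrite normrX lerXn2r ?nnegrE ?addr_ge0 ?(le_trans _ (hB 0))//.
  by apply: le_trans (ler_normB _ _) _; exact: lerD.
have c0 p : 0 <= c p by exact: sqr_ge0.
have k0 v : 0 <= (bx v)%:R :> R by exact: ler0n.
have hc v : (bx v)%:R != 0 :> R -> nice (fun x => c (x, v)) /\ \int[mu]_x c (x, v) <= A.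
  case: (boolP (bx v)) => [/forallP h _|_]; last by rewrite eqxx.
  split; last exact: hA.
  exact: niceX2 (niceB (shift_nice v nu) nu).
have key := kernel_int_le A0 mc bc c0 k0 nbx hc.
have ln : 0 < l ^+ n by rewrite exprn_gt0.
have no := osc_nice l0 nu.
have pw x : osc l u x <= l ^- n * \int[mu]_v ((bx v)%:R * c (x, v)).
  rewrite /osc ler_wpM2l ?invr_ge0 ?(ltW ln)//.
  have nn : nice (fun y => (near2 l x y)%:R * (u y - u x) ^+ 2).
    apply: niceM (int_near2 x l0).1 _ _.
      by apply: measurable_funX; apply: measurable_funB => //; exact: nice_meas nu.
    have [B hB] := nice_bdd nu; exists ((B + B) ^+ 2) => p.
    rewrite normrX lerXn2r ?nnegrE ?addr_ge0 ?(le_trans _ (hB 0))//.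
    by apply: le_trans (ler_normB _ _) _; exact: lerD.
  have [nn' <-] := sub_nice x nn.
  apply: le_int => //; first by have h := kernel_nice1 mc bc x nbx; exact: h.
  move=> v; rewrite ler_wpM2r ?sqr_ge0//.
  case: (boolP (near2 l x (x - v))) => [h|_]; last exact: ler0n.
  have -> : bx v; last by [].
  apply/forallP => i; have := near2_dist i l0 h.
  by rewrite !mxE opprB addrC subrK.
have mI : measurable_fun setT (fun x => \int[mu]_v ((bx v)%:R * c (x, v))).
  apply: (measurable_Rint _ (h := fun p : V * V => (bx p.2)%:R * c p)).
  by apply: measurable_funM => //; exact: (measurableT_comp (nice_meas nbx) measurable_snd).
rewrite -lee_fin -ge0_Rint//.
apply: (@le_trans _ _ (\int[mu]_x ((l ^- n)%:E * (\int[mu]_v ((bx v)%:R * c (x, v)))%:E))%E).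
  apply: ge0_le_integral => //.
  - by move=> x _; rewrite lee_fin osc_ge0.
  - by apply/measurable_EFinP; exact: nice_meas no.
  - by apply: emeasurable_funM => //; exact/measurable_EFinP.
  by move=> x _; rewrite -EFinM lee_fin.
rewrite ge0_integralZl//; last 3 first.
- exact/measurable_EFinP.
- by move=> x _; rewrite lee_fin; apply: int_ge0 => v; rewrite mulr_ge0.
- by rewrite lee_fin invr_ge0 ltW.
apply: le_trans (lee_wpmul2l _ key) _; first by rewrite lee_fin invr_ge0 ltW.
rewrite -EFinM lee_fin.
apply: (@le_trans _ _ (l ^- n * (A * @vol R 1 n rad))).
  by rewrite ler_wpM2l ?invr_ge0 ?(ltW ln)// ler_wpM2l.
rewrite (vol_scale rad0) mul1n /rad exprMn le_eqVlt; apply/orP; left; apply/eqP.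
move: (l ^+ n) (gt_eqF ln) (@vol R 1 n 1) ((3 * n%:R + 1) ^+ n) => w wn v1 v2.
by field; rewrite wn.
Qed.

Definition osc_const : R := (3 * n%:R + 1) ^+ n * @vol R 1 n 1 * (12 * n.+1%:R).

Lemma osc_int l L u : (0 < n)%N -> 0 < l -> 0 < L -> nice u -> cst_on L u ->
  \int[mu]_x osc l u x <= osc_const * (l / L) * n2 u ^+ 2.
Proof.
move=> n0 l0 L0 nu cu.
have A0 : 0 <= 4 * n.+1%:R * (3 * l / L) * n2 u ^+ 2.
  by apply: mulr_ge0; [apply: mulr_ge0 => //; rewrite divr_ge0 ?mulr_ge0 ?ltW|exact: sqr_ge0].
have hA (v : V) : (forall i, `|v 0 i| <= 3 * l) ->
    \int[mu]_x (u (x - v) - u x) ^+ 2 <= 4 * n.+1%:R * (3 * l / L) * n2 u ^+ 2.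
  by move=> vh; apply: (proj2 (translation_sqr L0 nu cu vh _)); rewrite mulr_ge0// ltW.
apply: le_trans (osc_int_gen n0 l0 nu A0 hA) _.
by rewrite /osc_const le_eqVlt; apply/orP; left; apply/eqP; ring.
Qed.

End oscillation.

(** * Kernels with cancellation and decay at every scale *)

Section tame_kernels.
Context {R : realType} {m n : nat}.
Notation V := 'rV[R]_n.
Notation MM := 'M[R]_(m.+1, n).
Notation mu := (leb R 1 n).
Notation niceY := (nice (leb R m.+1 n)).
Notation nice := (nice (leb R 1 n)).
Notation n2 := (n2 (leb R 1 n)).

(** All that the summation over scales uses of a kernel: integrability, cancellation and an L^1
    bound on each annulus, and decay with constants independent of the kernel's size. *)
Definition tame (C c : R) (K : MM -> R) := [/\ measurable_fun setT K,
  forall rho, 0 < rho -> niceY (Kr rho K),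
  forall rho, 0 < rho -> \int[leb R m.+1 n]_y Kr rho K y = 0,
  forall rho, 0 < rho -> \int[leb R m.+1 n]_y `|Kr rho K y| <= C &
  forall rho (f : 'I_m.+1 -> V -> R) (s : 'I_m.+1 -> nat), 0 < rho -> (forall a, nice (f a)) ->
    (forall a, (0 < s a)%N -> forall x, avg (rho / 2 ^+ s a) (f a) x = 0) ->
    n2 (Top rho K f) <= C * \prod_a c ^+ s a * Num.sqrt (rho ^- n) ^+ m * \prod_a n2 (f a)].

Lemma good_tame (q : R) : (0 < n)%N -> @crit R m < q ->
  exists C c : R, [/\ 0 < C, 0 < c < 1 & forall K, good_kernel q K -> tame C c K].
Proof.
move=> n0 hq; have [C [c [C0 c01 H]]] := @Top_decay R m n q n0 hq.
have C20 : 0 <= @vol R m.+1 n 2 + 1 by rewrite addr_ge0 ?vol_ge0.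
exists (C + (@vol R m.+1 n 2 + 1)), c; split => //; first exact: ltr_wpDr.
move=> K gK; have [mK hK Kb Kq K0] := gK; have nK := good_nice gK.
have nKr rho : 0 < rho -> niceY (Kr rho K) by move=> r0; exact: Kr_nice_scale.
have q1 := le_trans (@crit_ge1 R m) (ltW hq).
split => //.
- move=> rho r0; rewrite (@Kr_int_scale _ _ _ K rho id)//; last exact: nKr.
  by rewrite (intZ _ nK) K0 !mulr0.
- move=> rho r0; rewrite (@Kr_int_scale _ _ _ K rho (fun x => `|x|))//; last exact: nice_norm (nKr _ r0).
  have := good_pow hq gK (lexx 1) q1.
  have -> : \int[leb R m.+1 n]_y (`|rho ^- (m.+1 * n) * Kr 1 K y|) =
      \int[leb R m.+1 n]_y (rho ^- (m.+1 * n) * `|Kr 1 K y| `^ 1).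
    apply: eq_Rintegral => y _; rewrite powRr1// normrM ger0_norm// invr_ge0 exprn_ge0// ltW//.
  have n1 := nice_powR (fun y => normr_ge0 (Kr 1 K y)) (lexx 1) (nice_norm nK).
  have r1 : rho ^+ (m.+1 * n) != 0 by rewrite expf_neq0// gt_eqF.
  rewrite (intZ _ n1) mulrA mulfV// mul1r => /le_trans; apply.
  by rewrite lerDr ltW.
move=> rho f s r0 nf f0; apply: le_trans (H K gK rho f s r0 nf f0) _.
rewrite ler_wpM2r ?prodr_ge0// => [a _|]; first exact: n2_ge0.
rewrite ler_wpM2r ?exprn_ge0 ?sqrtr_ge0// ler_wpM2r ?lerDl//.
by apply: prodr_ge0 => a _; rewrite exprn_ge0// ltW//; case/andP: c01.
Qed.

(** The reflected kernel is that of the adjoint of the linear operator [Gop] below, which must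
    satisfy the same bounds. *)
Lemma good_opp (q : R) (K : MM -> R) : 1 <= q -> good_kernel q K -> good_kernel q (fun y => K (- y)).
Proof.
move=> q1 gK; have [mK hK [lam Kb] Kq K0] := gK; have nK := good_nice gK.
have m1 : (-1 : R) != 0 by rewrite oppr_eq0 oner_eq0.
have E (p : R -> R) : niceY (fun y => p (Kr 1 K y)) ->
    \int[leb R m.+1 n]_y p (Kr 1 (fun y => K (- y)) y) = \int[leb R m.+1 n]_y p (Kr 1 K y).
  move=> np; have [_] := affine_Rint (0 : MM) m1 np.
  rewrite normrN1 expr1n invr1 mul1r => <-; apply: eq_Rintegral => y _.
  by rewrite add0r scaleN1r /Kr /ann enormN.
split.
- exact: (measurableT_comp mK measurable_opp).
- by move=> t y t0; rewrite -scalerN hK.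
- by exists lam => y hy; apply: Kb; rewrite enormN.
- by rewrite (E (fun x => `|x| `^ q))//; exact: nice_powR (fun y => normr_ge0 _) q1 (nice_norm nK).
- by rewrite (E id).
Qed.

End tame_kernels.

Section dyadic.
Context {R : realType} {n : nat}.
Notation V := 'rV[R]_n.
Notation mu := (leb R 1 n).
Notation nice := (nice (leb R 1 n)).
Notation n2 := (n2 (leb R 1 n)).
Variable l0 : R.
Hypothesis l0_gt0 : 0 < l0.
Notation lv := (lv l0).
Notation E := (E l0).
Notation Dm := (Dm l0).
Let lvp r : 0 < lv r := lv_gt0 l0_gt0 r.

(** The index is shifted by one against [Dm], so that [Dd k] is constant on cubes of side [lv k] and
    [E 0] becomes the zeroth difference. *)
Definition Dd k (f : V -> R) : V -> R := if k is k'.+1 then Dm k' f else E 0 f.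

Lemma Dd_nice k f : nice f -> nice (Dd k f).
Proof. by case: k => [|k] nf; [exact: E_nice|exact: Dm_nice]. Qed.

Lemma Dd_cst k f : cst_on (lv k) (Dd k f).
Proof. by case: k => [|k]; [exact: E_cst|exact: Dm_cst]. Qed.

Lemma Dd_sum r (f : V -> R) (x : V) : E r f x = \sum_(k < r.+1) Dd k f x.
Proof. by rewrite E_tele// big_ord_recl. Qed.

Lemma Dd_bessel T f : nice f -> \sum_(k < T) n2 (Dd k f) ^+ 2 <= n2 f ^+ 2.
Proof.
case: T => [|T] nf; first by rewrite big_ord0 sqr_ge0.
by rewrite big_ord_recl; exact: bessel.
Qed.

Lemma Dd_n2 k f : nice f -> n2 (Dd k f) <= n2 f.
Proof. by case: k => [|k] nf; [exact: E_n2|exact: Dm_n2]. Qed.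

Lemma E_step r T (f : V -> R) (x : V) : E (r + T) f x = E r f x + \sum_(s < T) Dm (r + s) f x.
Proof.
elim: T => [|T IH]; first by rewrite big_ord0 addn0 addr0.
by rewrite big_ord_recr/= addrA -IH /Dm addrC subrK addnS.
Qed.

Lemma lv_add r s : lv r / 2 ^+ s = lv (r + s).
Proof. by rewrite /lv exprD invfM mulrA. Qed.

Lemma near_nice l x g : 0 < l -> measurable_fun setT g -> bdd g -> nice (fun y => (near2 l x y)%:R * g y).
Proof. by move=> l_gt0 mg bg; exact: niceM (int_near2 x l_gt0).1 mg bg. Qed.

(** [E r f] is a sum of differences [Dd k f] with k <= r, each constant on much larger cubes than
    those of side [lv r]; by [osc_int] its oscillation at that scale gains 2^-(r - k). *)
Lemma E_osc T f : (0 < n)%N -> nice f ->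
  \sum_(r < T) \int[mu]_x osc (lv r) (E r f) x <= 24 * @osc_const R n * n2 f ^+ 2.
Proof.
move=> n0 nf.
have oc0 : 0 <= @osc_const R n by rewrite /osc_const !mulr_ge0 ?exprn_ge0 ?vol_ge0 ?addr_ge0 ?mulr_ge0.
have b0 : 0 <= 3 / 4 :> R by rewrite divr_ge0.
have one r : \int[mu]_x osc (lv r) (E r f) x <=
    4 * @osc_const R n * \sum_(k < r.+1) (2 / 3) ^+ dist r k * n2 (Dd k f) ^+ 2.
  have pw x : osc (lv r) (E r f) x <= 4 * \sum_(k < r.+1) (4 / 3) ^+ (r - k) * osc (lv r) (Dd k f) x.
    have nn u : nice u -> nice (fun y => (near2 (lv r) x y)%:R * (u y - u x) ^+ 2).
      move=> nu; apply: near_nice => //.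
        by apply: measurable_funX; apply: measurable_funB => //; exact: nice_meas nu.
      have [B hB] := nice_bdd nu; exists ((B + B) ^+ 2) => p.
      rewrite normrX lerXn2r ?nnegrE ?addr_ge0 ?(le_trans _ (hB 0))//.
      by apply: le_trans (ler_normB _ _) _; exact: lerD.
    have nS (k : 'I_r.+1) : nice (fun y => (4 / 3) ^+ (r - k) * ((near2 (lv r) x y)%:R * (Dd k f y - Dd k f x) ^+ 2)).
      by apply: niceZ; apply: nn; exact: Dd_nice.
    have e : \sum_(k < r.+1) (4 / 3) ^+ (r - k) * osc (lv r) (Dd k f) x = lv r ^- n *
       \int[mu]_y \sum_(k < r.+1) (4 / 3) ^+ (r - k) * ((near2 (lv r) x y)%:R * (Dd k f y - Dd k f x) ^+ 2).
      rewrite (int_sum _ nS) mulr_sumr; apply: eq_bigr => k _.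
      by rewrite /osc mulrCA; congr (_ * _); rewrite (intZ _ (nn _ (Dd_nice k nf))).
    have li : 0 <= lv r ^- n by rewrite invr_ge0 exprn_ge0// ltW.
    rewrite e mulrCA /osc; apply: ler_wpM2l => //.
    rewrite -(intZ _ (nice_sum _ nS)); apply: le_int.
    - exact: nn (E_nice l0_gt0 r nf).
    - exact: niceZ (nice_sum _ nS).
    move=> y; rewrite !Dd_sum -sumrB.
    (* Weights for Cauchy-Schwarz: their sum is at most 4, and their inverses (4/3)^(r - k),
       multiplied by the gain 2^-(r - k), leave the summable (2/3)^(r - k). *)
    pose w k : R := (3 / 4) ^+ (r - k).
    pose a k := (4 / 3) ^+ (r - k) * (Dd k f y - Dd k f x).
    have wa k : w k * (4 / 3) ^+ (r - k) = 1 by rewrite /w -exprMn (_ : 3 / 4 * (4 / 3) = 1 :> R) ?expr1n//; field.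
    have := @wsum_CS R r.+1 w a (fun k => exprn_ge0 _ b0).
    rewrite (eq_bigr (fun k : 'I_r.+1 => Dd k f y - Dd k f x)); last by move=> k _; rewrite /a mulrA wa mul1r.
    rewrite [X in _ <= _ * X -> _](eq_bigr (fun k : 'I_r.+1 => (4 / 3) ^+ (r - k) * (Dd k f y - Dd k f x) ^+ 2)); last first.
      move=> k _; have := wa k; rewrite /a; move: (w k) ((4 / 3) ^+ (r - k)) (Dd k f y - Dd k f x) => p t d h.
      by rewrite (_ : p * (t * d) ^+ 2 = (p * t) * (t * d ^+ 2)); [rewrite h mul1r|ring].
    set Q := \sum_(k < _) _ * _ => h.
    have W4 : \sum_(k < r.+1) w k <= 4.
      rewrite (reindex_inj rev_ord_inj)/=; have := @geo_sum R (3/4) r.+1.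
      have -> : (1 - 3 / 4)^-1 = 4 :> R by field.
      move=> g; apply: le_trans (g _); last by apply/andP; split; lra.
      by apply: ler_sum => k _; rewrite /w subSS subKn// -ltnS.
    have Q0 : 0 <= Q by apply: sumr_ge0 => k _; rewrite mulr_ge0 ?sqr_ge0// exprn_ge0// divr_ge0.
    have -> : \sum_(k < r.+1) (4 / 3) ^+ (r - k) * ((near2 (lv r) x y)%:R * (Dd k f y - Dd k f x) ^+ 2) =
       (near2 (lv r) x y)%:R * Q.
      by rewrite mulr_sumr; apply: eq_bigr => k _; rewrite mulrCA.
    rewrite (mulrCA 4) ler_wpM2l//; apply: le_trans h _; exact: ler_wpM2r.
  have no k : nice (osc (lv r) (Dd k f)) by apply: osc_nice => //; exact: Dd_nice.
  have nos (k : 'I_r.+1) : nice (fun x => (4 / 3) ^+ (r - k) * osc (lv r) (Dd k f) x) by exact: niceZ.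
  apply: le_trans (le_int (osc_nice (lvp r) (E_nice l0_gt0 r nf)) (niceZ 4 (nice_sum _ nos)) pw) _.
  rewrite (intZ _ (nice_sum _ nos)) (int_sum _ nos) -mulrA ler_wpM2l// mulr_sumr; apply: ler_sum => k _.
  rewrite (intZ _ (no k)).
  have kr : (k <= r)%N by rewrite -ltnS.
  have := osc_int n0 (lvp r) (lvp k) (Dd_nice k nf) (@Dd_cst k f).
  have -> : lv r / lv k = 2^-1 ^+ (r - k).
    rewrite /lv -{1}(subnKC kr) exprD exprVn invfM mulrA mulrAC divff ?mul1r//.
    by rewrite gt_eqF// divr_gt0// exprn_gt0.
  move=> h; apply: le_trans (ler_wpM2l _ h) _; first by rewrite exprn_ge0// divr_ge0.
  rewrite /dist (eqP (_ : k - r == 0)%N) ?subn_eq0// addn0.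
  have -> : (2 / 3) ^+ (r - k) = (4 / 3) ^+ (r - k) * 2^-1 ^+ (r - k) :> R.
    by rewrite -exprMn; congr (_ ^+ _); field.
  by rewrite le_eqVlt; apply/orP; left; apply/eqP; ring.
apply: (@le_trans _ _ (\sum_(r < T) 4 * @osc_const R n * \sum_(k < r.+1) (2 / 3) ^+ dist r k * n2 (Dd k f) ^+ 2)).
  by apply: ler_sum => r _; exact: one.
rewrite -mulr_sumr; have -> : 24 * @osc_const R n * n2 f ^+ 2 = 4 * @osc_const R n * (6 * n2 f ^+ 2) by ring.
have c40 : 0 <= 4 * @osc_const R n by apply: mulr_ge0.
apply: ler_wpM2l => //.
apply: (@le_trans _ _ (\sum_(r < T) \sum_(k < T) (2 / 3) ^+ dist r k * n2 (Dd k f) ^+ 2)).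
  apply: ler_sum => r _; apply: (@sum_nat_le _ (fun k => (2 / 3) ^+ dist r k * n2 (Dd k f) ^+ 2)) => // k.
  by rewrite mulr_ge0 ?sqr_ge0// exprn_ge0// divr_ge0.
have c23 : 0 <= (2 / 3 : R) < 1 by apply/andP; split; lra.
apply: le_trans (dist_sum2 T T c23 (fun k => sqr_ge0 (n2 (Dd k f)))) _.
have -> : (1 - 2 / 3)^-1 = 3 :> R by field.
by have := Dd_bessel T nf; lra.
Qed.

End dyadic.

Section concave_powers.
Context {R : realType}.
Implicit Types a b p : R.

Lemma agm_set (I : finType) (A : {set I}) (v : I -> R) : (0 < #|A|)%N -> (forall i, 0 <= v i) ->
  (\prod_(i in A) v i) `^ #|A|%:R^-1 <= (\sum_(i in A) v i) / #|A|%:R.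
Proof.
move=> A0 v0; have [h _] := @leif_AGM R I [in A] v (fun i _ => v0 i).
have S0 : 0 <= (\sum_(i in A) v i) / #|A|%:R by rewrite divr_ge0// sumr_ge0.
have -> : (\sum_(i in A) v i) / #|A|%:R = (((\sum_(i in A) v i) / #|A|%:R) ^+ #|A|) `^ #|A|%:R^-1.
  by rewrite -powR_mulrn// -powRrM mulfV ?powRr1// pnatr_eq0 -lt0n.
apply: ge0_ler_powR; rewrite ?nnegrE ?invr_ge0//.
- by apply: prodr_ge0.
- exact: exprn_ge0.
Qed.

Lemma powR_subadd a b p : 0 <= a -> 0 <= b -> 0 < p <= 1 -> (a + b) `^ p <= a `^ p + b `^ p.
Proof.
move=> a0 b0 /andP[p0 p1].
have [->|an] := eqVneq a 0; first by rewrite add0r lerDr powR_ge0.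
have ap : 0 < a by rewrite lt_def an.
have [->|bn] := eqVneq b 0; first by rewrite addr0 lerDl powR_ge0.
have bp : 0 < b by rewrite lt_def bn.
have key c d : 0 < c -> 0 < d -> c * (c + d) `^ (p - 1) <= c `^ p.
  move=> c0 d0; have -> : c `^ p = c * c `^ (p - 1).
    by rewrite -[X in X * _](powRr1 (ltW c0)) -powRD ?(gt_eqF c0) ?implybT// addrC subrK.
  rewrite ler_wpM2l ?(ltW c0)//.
  rewrite -opprB !powRN lef_pV2 ?posrE ?powR_gt0 ?addr_gt0//.
  by apply: ge0_ler_powR; rewrite ?nnegrE ?subr_ge0// ?addr_ge0 ?ltW// ltrDl.
have ab : 0 < a + b by rewrite addr_gt0.
have -> : (a + b) `^ p = (a + b) * (a + b) `^ (p - 1).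
  by rewrite -[X in X * _](powRr1 (ltW ab)) -powRD ?(gt_eqF ab) ?implybT// (addrC 1) subrK.
rewrite mulrDl lerD ?key//.
by rewrite addrC key.
Qed.

Lemma powR_sum_le (T : nat) (u : 'I_T -> R) p : (forall r, 0 <= u r) -> 0 < p <= 1 ->
  (\sum_r u r) `^ p <= \sum_r u r `^ p.
Proof.
move=> u0 hp; elim: T u u0 => [|T IH] u u0.
  by rewrite !big_ord0 powR0// gt_eqF//; case/andP: hp.
rewrite !big_ord_recr/=; apply: le_trans (powR_subadd (sumr_ge0 _ _) (u0 _) hp) _ => //.
by rewrite lerD2r; apply: IH.
Qed.

End concave_powers.

Section averages.
Context {R : realType} {n : nat}.
Notation V := 'rV[R]_n.
Notation mu := (leb R 1 n).
Notation nice := (nice (leb R 1 n)).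
Notation n2 := (n2 (leb R 1 n)).

Lemma same_nice l x g : 0 < l -> measurable_fun setT g -> bdd g -> nice (fun y => (same l x y)%:R * g y).
Proof. by move=> l_gt0 mg bg; exact: niceM (int_same x l_gt0).1 mg bg. Qed.

(** Jensen's inequality for the concave power p <= 1. It transfers L^1 bounds on cubes to the
    exponents 2 / |S|. *)
Lemma avg_powR l x (F : V -> R) B p : 0 < l -> measurable_fun setT F -> bdd F -> (forall y, 0 <= F y) ->
  0 < p <= 1 -> 0 <= B -> avg l F x <= B -> avg l (fun y => F y `^ p) x <= B `^ p.
Proof.
move=> l_gt0 mF bF F0 hp B0 hB; have /andP[p0 p1] := hp.
have mFp : measurable_fun setT (fun y => F y `^ p) by exact: (measurableT_comp (measurable_powR p) mF).
have bFp : bdd (fun y => F y `^ p).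
  have [b hb] := bF; exists (b `^ p) => y; rewrite ger0_norm ?powR_ge0//.
  have Fb : F y <= b by exact: le_trans (ler_norm _) (hb y).
  by apply: ge0_ler_powR; rewrite ?nnegrE ?(ltW p0)// (le_trans (F0 y)).
(* The power lies below its tangent at w = B + e; the e keeps w positive when B = 0. *)
have step e : 0 < e -> avg l (fun y => F y `^ p) x <= (B + e) `^ p.
  move=> e0; set w := B + e; have w0 : 0 < w by rewrite ltr_wpDl.
  have pw y : F y `^ p <= w `^ (p - 1) * p * F y + w `^ (p - 1) * (1 - p) * w.
    have := wagm (F0 y) (ltW w0) hp.
    have wp : 0 < w `^ (1 - p) by rewrite powR_gt0.
    rewrite -ler_pdivlMr// => /le_trans; apply.
    by rewrite -[p - 1]opprB powRN le_eqVlt; apply/orP; left; apply/eqP; ring.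
  have [ns is_] := int_same x l_gt0.
  have nF := same_nice x l_gt0 mF bF.
  have nD : nice (fun y => w `^ (p - 1) * p * ((same l x y)%:R * F y) + w `^ (p - 1) * (1 - p) * w * (same l x y)%:R).
    by apply: niceD; exact: niceZ.
  have h : \int[mu]_y ((same l x y)%:R * F y `^ p) <= \int[mu]_y (w `^ (p - 1) * p * ((same l x y)%:R * F y) + w `^ (p - 1) * (1 - p) * w * (same l x y)%:R).
    apply: le_int => //; first exact: same_nice.
    by move=> y; apply: le_trans (ler_wpM2l (ler0n _ _) (pw y)) _; rewrite le_eqVlt; apply/orP; left; apply/eqP; ring.
  have ln : 0 < l ^+ n by rewrite exprn_gt0.
  have lni : 0 <= l ^- n by rewrite invr_ge0 ltW.
  rewrite /avg /kop; apply: le_trans (ler_wpM2l lni h) _.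
  rewrite (intD (niceZ _ nF) (niceZ _ ns)) (intZ _ nF) (intZ _ ns) is_ mulrDr mulrCA.
  have -> : l ^- n * (w `^ (p - 1) * (1 - p) * w * l ^+ n) = w `^ (p - 1) * (1 - p) * w.
    by rewrite mulrCA mulVf ?mulr1// gt_eqF.
  have -> : w `^ p = w `^ (p - 1) * w.
    by rewrite -[X in _ * X](powRr1 (ltW w0)) -powRD ?(gt_eqF w0) ?implybT// subrK.
  rewrite -!mulrA -mulrDr ler_wpM2l ?powR_ge0//.
  have : avg l F x <= w by apply: le_trans hB _; rewrite lerDl ltW.
  by rewrite /avg /kop => h2; have := ler_wpM2l (ltW p0) h2; lra.
apply/ler_addgt0Pr => e e0.
have p1' : 0 <= p^-1 by rewrite invr_ge0 ltW.
(* With this choice subadditivity of the power yields exactly the error e. *)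
apply: le_trans (step (e `^ p^-1) _) _; first by rewrite powR_gt0.
apply: le_trans (powR_subadd B0 (powR_ge0 _ _) hp) _.
by rewrite lerD2l -powRrM mulVf ?gt_eqF// powRr1// ltW.
Qed.

(** In extended form, because it serves for powers of |[Fop]|, which are bounded but not known to be
    integrable. *)
Lemma avg_tonelli l (g : V -> R) : 0 < l -> measurable_fun setT g -> bdd g -> (forall y, 0 <= g y) ->
  (\int[mu]_x (g x)%:E = \int[mu]_x (avg l g x)%:E)%E.
Proof.
move=> l_gt0 mg bg g0; have ln : 0 < l ^+ n by rewrite exprn_gt0.
pose F (p : V * V) : \bar R := ((same l p.1 p.2)%:R * g p.2)%:E.
have mF : measurable_fun setT F.
  apply/measurable_EFinP; apply: measurable_funM; first exact: measurable_same.
  exact: (measurableT_comp mg measurable_snd).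
have F0 p : (0 <= F p)%E by rewrite lee_fin mulr_ge0.
have e1 : (\int[mu]_x (avg l g x)%:E = \int[mu]_x ((l ^- n)%:E * \int[mu]_y F (x, y)))%E.
  apply: eq_integral => x _; rewrite /avg /kop EFinM; congr (_ * _)%E.
  by rewrite /F/= ge0_Rint//; exact: same_nice.
rewrite e1 ge0_integralZl//; last 3 first.
- exact: (measurable_fun_fubini_tonelli_F F).
- by move=> x _; exact: integral_ge0.
- by rewrite lee_fin invr_ge0 ltW.
rewrite (fubini_tonelli (m1 := mu) (m2 := mu) F mF F0).
have e2 : (\int[mu]_y \int[mu]_x F (x, y) = \int[mu]_y ((l ^+ n)%:E * (g y)%:E))%E.
  apply: eq_integral => y _; rewrite /F/=.
  have [ns is_] := int_same y l_gt0.
  have e3 : (\int[mu]_x ((same l x y)%:R * g y)%:E = \int[mu]_x (g y * (same l y x)%:R)%:E)%E.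
    by apply: eq_integral => x _; rewrite same_sym mulrC.
  rewrite e3 ge0_Rint; last exact: niceZ.
  by rewrite (intZ _ ns) is_ -EFinM mulrC.
rewrite e2 ge0_integralZl//; last 3 first.
- exact/measurable_EFinP.
- by move=> y _; rewrite lee_fin.
- by rewrite lee_fin ltW.
by rewrite muleA -EFinM mulVf ?gt_eqF// mul1e.
Qed.

Definition alpha l (h : V -> R) x := Num.sqrt (navg l (fun y => h y ^+ 2) x).

Lemma alphaE l h x : 0 < l ->
  Num.sqrt (l ^- n) * n2 (fun y => (near2 l x y)%:R * h y) = alpha l h x.
Proof.
move=> l_gt0; rewrite n2E -sqrtrM ?invr_ge0 ?exprn_ge0 ?ltW//; congr (Num.sqrt (_ * _)).
by apply: eq_Rintegral => y _; rewrite exprMn; case: (near2 l x y); rewrite ?expr1n ?expr0n.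
Qed.

Lemma alpha_sqr l h x : 0 < l -> alpha l h x ^+ 2 = navg l (fun y => h y ^+ 2) x.
Proof. by move=> l_gt0; rewrite sqr_sqrtr// navg_ge0// => y; exact: sqr_ge0. Qed.

Lemma alpha_osc l u x : alpha l (fun y => u y - u x) x = Num.sqrt (osc l u x).
Proof. by []. Qed.

Lemma alpha_ge0 l h x : 0 <= alpha l h x. Proof. exact: sqrtr_ge0. Qed.

End averages.

(** * Local estimates at one scale *)

Section local_estimate.
Context {R : realType} {m n : nat}.
Notation V := 'rV[R]_n.
Notation MM := 'M[R]_(m.+1, n).
Notation mu := (leb R 1 n).
Notation niceY := (nice (leb R m.+1 n)).
Notation nice := (nice (leb R 1 n)).
Notation n2 := (n2 (leb R 1 n)).
Variable l0 : R.
Hypothesis l0_gt0 : 0 < l0.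
Notation lv := (lv l0).
Notation E := (E l0).
Notation Dm := (Dm l0).
Let lvp r : 0 < lv r := lv_gt0 l0_gt0 r.
Variables (C c : R) (K : MM -> R).
Hypotheses (C0 : 0 < C) (c01 : 0 < c < 1) (tK : tame C c K).

(* The averages of the functions outside [S] are constant on cubes and factor out. *)
Definition Fop (S : {set 'I_m.+1}) r (f : 'I_m.+1 -> V -> R) x : R :=
  \int[leb R m.+1 n]_y (Kr (lv r) K y *
    \prod_a (if a \in S then f a (x - row a y) - E r (f a) x else 1)).

(** The effective local size of f - E r f (x) near x, as seen by the operator of scale [lv r]: the
    oscillation of [E r f], plus the finer martingale differences weighted by the decay they
    cause. *)
Definition orad T r (f : V -> R) x : R :=
  Num.sqrt (osc (lv r) (E r f) x) + \sum_(s < T) c ^+ s * alpha (lv r) (Dm (r + s) f) x.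

Lemma orad_ge0 T r f x : 0 <= orad T r f x.
Proof.
rewrite addr_ge0 ?sqrtr_ge0//; apply: sumr_ge0 => s _; rewrite mulr_ge0 ?sqrtr_ge0//.
by rewrite exprn_ge0// ltW//; case/andP: c01.
Qed.

Lemma Top_sum T r (h : 'I_m.+1 -> nat -> V -> R) x : 0 < r -> (forall a s, nice (h a s)) ->
  Top r K (fun a y => \sum_(s < T) h a s y) x =
  \sum_(phi : {ffun 'I_m.+1 -> 'I_T}) Top r K (fun a => h a (phi a)) x.
Proof.
move=> r0 nh; have [_ nKr _ _ _] := tK.
have nn (phi : {ffun 'I_m.+1 -> 'I_T}) : niceY (fun y => Kr r K y * \prod_a h a (phi a) (x - row a y)).
  have nf a : nice (h a (phi a)) by [].
  by have h1 := kernel_nice1 (cf_meas nf) (cf_bdd nf) x (nKr r r0); exact: h1.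
apply: etrans (int_sum _ nn); apply: eq_Rintegral => y _.
rewrite (bigA_distr_bigA (fun a (s : 'I_T) => h a s (x - row a y))) mulr_sumr.
by apply: eq_bigr => phi _.
Qed.

Variables (f : 'I_m.+1 -> V -> R).
Hypothesis nf : forall a, nice (f a).

(** The kernel is supported in |y| <= 2 [lv r], so on the cube of x0 only the values on near cubes
    matter, and there the average [E r (f a)] may be frozen at x0. *)
Lemma Fop_local S r x0 x : same (lv r) x0 x ->
  Fop S r f x = Top (lv r) K (fun a y => (near2 (lv r) x0 y)%:R *
     (if a \in S then f a y - E r (f a) x0 else 1)) x.
Proof.
move=> sx; apply: eq_Rintegral => y _; rewrite /Kr.
case: (boolP (ann (lv r) y)) => [/andP[_ hy]|_]; last by rewrite !mulr0 !mul0r.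
congr (_ * _); apply: eq_bigr => a _.
have -> : near2 (lv r) x0 (x - row a y).
  rewrite (near2_transl _ sx); apply: dist_near2 => // i.
  rewrite !mxE opprB addrC subrK; apply: le_trans hy.
  exact: coord_le_enorm.
by rewrite mul1r (E_cst (f a) sx).
Qed.

Let cS (S : {set 'I_m.+1}) r (p : V * MM) := \prod_a (if a \in S then f a (p.1 - row a p.2) - E r (f a) p.1 else 1).

Let cS_meas S r : measurable_fun setT (cS S r).
Proof.
apply: measurable_prodr => a; case: (a \in S); last exact: measurable_cst.
apply: measurable_funB; last exact: (measurableT_comp (nice_meas (E_nice l0_gt0 r (nf a))) measurable_fst).
apply: (measurableT_comp (nice_meas (nf a))).
have -> : (fun p : V * MM => p.1 - row a p.2) = (fun p => p.1 - 1 *: row a p.2).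
  by apply/funext => p; rewrite scale1r.
apply: measurable_subscale => //; exact: (measurableT_comp (measurable_row a) measurable_snd).
Qed.

Let cS_bdd S r : bdd (cS S r).
Proof.
apply: prod_bdd => a; case: (a \in S); last by exists 1 => p; rewrite normr1.
have [B hB] := nice_bdd (nf a); have [B' hB'] := nice_bdd (E_nice l0_gt0 r (nf a)).
by exists (B + B') => p; apply: le_trans (ler_normB _ _) _; exact: lerD.
Qed.

Lemma Fop_meas S r : measurable_fun setT (Fop S r f).
Proof.
have [_ nKr _ _ _] := tK.
have nk := nKr _ (lvp r).
apply: (measurable_Rint _ (h := fun p : V * MM => Kr (lv r) K p.2 * cS S r p)).
by apply: measurable_funM => //; exact: (measurableT_comp (nice_meas nk) measurable_snd).
Qed.

Lemma Fop_bdd S r : bdd (Fop S r f).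
Proof.
have [_ nKr _ _ _] := tK.
by have h := kernel_bdd (cS_meas S r) (cS_bdd S r) (nKr _ (lvp r)); exact: h.
Qed.

Lemma Fop0 r x : Fop finset.set0 r f x = 0.
Proof.
have [_ _ K0 _ _] := tK; rewrite -(K0 _ (lvp r)); apply: eq_Rintegral => y _.
by rewrite big1 ?mulr1// => a _; rewrite inE.
Qed.

Lemma Top_expand r x : Top (lv r) K f x =
  \sum_(S : {set 'I_m.+1}) (\prod_(a | a \notin S) E r (f a) x) * Fop S r f x.
Proof.
have [_ nKr _ _ _] := tK.
have nn S : niceY (fun y => Kr (lv r) K y * cS S r (x, y)).
  by have h := kernel_nice1 (cS_meas S r) (cS_bdd S r) x (nKr _ (lvp r)); exact: h.
have nn' (S : {set 'I_m.+1}) : niceY (fun y => (\prod_(a | a \notin S) E r (f a) x) * (Kr (lv r) K y * cS S r (x, y))).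
  exact: niceZ.
rewrite (eq_bigr (fun S : {set 'I_m.+1} => \int[leb R m.+1 n]_y ((\prod_(a | a \notin S) E r (f a) x) * (Kr (lv r) K y * cS S r (x, y))))); last first.
  by move=> S _; rewrite (intZ _ (nn S)).
apply: etrans (int_sum _ nn'); apply: eq_Rintegral => y _.
have -> : \prod_a f a (x - row a y) = \prod_a ((f a (x - row a y) - E r (f a) x) + E r (f a) x).
  by apply: eq_bigr => a _; rewrite subrK.
rewrite bigA_distr mulr_sumr; apply: eq_bigr => S _; rewrite mulrCA; congr (_ * _).
rewrite /cS [in RHS]big_mkcond/= -big_split/=; apply: eq_bigr => a _.
by case: (a \in S); rewrite ?mul1r ?mulr1.
Qed.

Variable T : nat.
Hypothesis fT : forall a, cst_on (lv T) (f a).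

Definition loc_const := C * (5 ^+ n) ^+ m.+1.

(** Every localized input is expanded into its martingale differences and the multilinear operator
    into the corresponding products. Each product decays in all its indices at once, so the sum over
    index tuples factors into the product over a of single sums, which are the [orad]. *)
Lemma Fop_bound S r x0 :
  Num.sqrt (lv r ^- n) * n2 (fun x => (same (lv r) x0 x)%:R * Fop S r f x) <=
  loc_const * \prod_(a in S) orad T r (f a) x0.
Proof.
have [mK nKr K0 K1 dK] := tK; set sg := Num.sqrt _; set l := lv r.
have l_gt0 : 0 < l := lvp r.
have sg0 : 0 <= sg by exact: sqrtr_ge0.
have c0 : 0 <= c by apply: ltW; case/andP: c01.
(* Index 0 carries the oscillation of [E r (f a)] and index s+1 the difference [Dm (r + s)]. Outside
   S only index 0 is nonzero, where the localizing indicator remains. *)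
pose H a s y : R := if a \in S then
   (if s is s'.+1 then Dm (r + s') (f a) y else E r (f a) y - E r (f a) x0) else (s == 0%N)%:R.
pose h a s y := (near2 l x0 y)%:R * H a s y.
have H_meas a s : measurable_fun setT (H a s).
  rewrite /H; case: (a \in S); last exact: measurable_cst.
  case: s => [|s]; last exact: nice_meas (Dm_nice l0_gt0 _ (nf a)).
  by apply: measurable_funB => //; exact: nice_meas (E_nice l0_gt0 r (nf a)).
have H_bdd a s : bdd (H a s).
  rewrite /H; case: (a \in S); last by exists 1 => y; rewrite normr_nat; case: (s == 0)%N.
  case: s => [|s]; last exact: nice_bdd (Dm_nice l0_gt0 _ (nf a)).
  have [B hB] := nice_bdd (E_nice l0_gt0 r (nf a)).
  by exists (B + B) => y; apply: le_trans (ler_normB _ _) _; exact: lerD.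
have nh a s : nice (h a s) by exact: near_nice.
have fE a y : f a y = E r (f a) y + \sum_(s < T) Dm (r + s) (f a) y.
  by rewrite -E_step E_id//; exact: (cst_on_lv l0_gt0 (leq_addl r T) (fT a)).
have gE a : (fun y => (near2 l x0 y)%:R * (if a \in S then f a y - E r (f a) x0 else 1)) =
    (fun y => \sum_(s < T.+1) h a s y).
  apply/funext => y; rewrite -mulr_sumr; congr (_ * _); rewrite big_ord_recl /H.
  case: (a \in S); last by rewrite big1 ?addr0.
  by rewrite fE addrAC.
pose G x := Top l K (fun a y => \sum_(s < T.+1) h a s y) x.
have nT (phi : {ffun 'I_m.+1 -> 'I_T.+1}) : nice (Top l K (fun a => h a (phi a))).
  by apply: Top_nice => //; exact: nKr.
have GE : G = (fun x => \sum_(phi : {ffun 'I_m.+1 -> 'I_T.+1}) Top l K (fun a => h a (phi a)) x).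
  by apply/funext => x; rewrite /G Top_sum.
have nG : nice G by rewrite GE; exact: nice_sum.
apply: (@le_trans _ _ (sg * n2 G)).
  rewrite ler_wpM2l//; apply: le_n2 => //; first exact: same_nice (Fop_meas S r) (Fop_bdd S r).
  move=> x; case: (boolP (same (lv r) x0 x)) => [sx|_]; last by rewrite mul0r normr0.
  have -> : Fop S r f x = G x.
    by rewrite (Fop_local S sx); congr (Top _ _ _ _); apply/funext => a; rewrite gE.
  by rewrite mul1r.
have sgm : 0 <= sg ^+ m by rewrite exprn_ge0.
have term (phi : {ffun 'I_m.+1 -> 'I_T.+1}) :
  sg * n2 (Top l K (fun a => h a (phi a))) <= C * \prod_a (c ^+ (phi a).-1 * (sg * n2 (h a (phi a)))).
  (* Index s+1 is used with decay exponent s; indices 0 and 1 get exponent 0 and thus need no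
     cancellation. *)
  have hz a : (0 < (phi a : nat).-1)%N -> forall x, avg (l / 2 ^+ (phi a).-1) (h a (phi a)) x = 0.
    rewrite /h /H; case: (phi a : nat) => [//|s]; rewrite /= => s0 x.
    have ls : 0 < l / 2 ^+ s by rewrite divr_gt0// exprn_gt0.
    case: (a \in S); last first.
      rewrite /avg /kop (_ : (fun y => _) = (fun=> 0)) ?Rintegral_cst ?mul0r ?mulr0//.
      by apply/funext => y; rewrite !mulr0.
    (* The localization does not destroy the cancellation: the indicator is constant on the finer
       cubes on which the difference has mean zero. *)
    rewrite (avg_pull ls (u := fun y => (near2 l x0 y)%:R)); last 2 first.
    - exact: Dm_nice.
    - move=> y sxy; congr (_%:R); rewrite ![near2 l x0 _]near2_sym.
      apply/esym/congr1; apply: near2_transl.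
      by move: sxy; rewrite /l lv_add => sxy; exact: (same_lv l0_gt0 (leq_addr s r) sxy).
    by rewrite {1}/l lv_add -E_avg E_Dm0 ?mulr0.
  have := dK l (fun a => h a (phi a)) (fun a => (phi a : nat).-1) l_gt0 (fun a => nh a (phi a)) hz.
  move=> /(ler_wpM2l sg0) /le_trans; apply; rewrite !big_split/= prodr_const card_ord exprS -/sg.
  by rewrite le_eqVlt; apply/orP; left; apply/eqP; ring.
apply: (@le_trans _ _ (\sum_(phi : {ffun 'I_m.+1 -> 'I_T.+1}) C * \prod_a (c ^+ (phi a).-1 * (sg * n2 (h a (phi a)))))).
  apply: le_trans (_ : sg * \sum_(phi : {ffun 'I_m.+1 -> 'I_T.+1}) n2 (Top l K (fun a => h a (phi a))) <= _).
    by rewrite ler_wpM2l// GE; exact: n2_sum.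
  by rewrite mulr_sumr; apply: ler_sum => phi _; exact: term.
rewrite -mulr_sumr -(bigA_distr_bigA (fun a (s : 'I_T.+1) => c ^+ (s : nat).-1 * (sg * n2 (h a s)))).
rewrite /loc_const -mulrA ler_wpM2l ?(ltW C0)//.
have p51 : 1 <= 5 ^+ n :> R by rewrite exprn_ege1// ler1n.
have -> : (5 ^+ n) ^+ m.+1 * \prod_(a in S) orad T r (f a) x0 =
    \prod_a (5 ^+ n * (if a \in S then orad T r (f a) x0 else 1)).
  by rewrite big_split/= prodr_const card_ord -big_mkcond.
apply: ler_prod => a _; apply/andP; split.
  by apply: sumr_ge0 => s _; rewrite !mulr_ge0 ?n2_ge0 ?exprn_ge0.
rewrite big_ord_recl /h /H /=.
case: (a \in S); last first.
  rewrite big1 => [|s _]; last by rewrite n2_eq0 ?mulr0// => y; rewrite mulr0.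
  (* An index outside S contributes the normalized norm of the indicator of 5^n cubes, that is the
     square root of 5^n, bounded here by 5^n. *)
  rewrite addr0 expr0 mul1r mulr1 alphaE// -(@ler_pXn2r _ 2) ?nnegrE ?alpha_ge0 ?exprn_ge0//.
  rewrite alpha_sqr// /navg /kop.
  have [_ i5] := int_near2 x0 l_gt0.
  rewrite (_ : \int[mu]_y _ = (5 * l) ^+ n); last by rewrite -i5; apply: eq_Rintegral => y _; rewrite expr1n mulr1.
  have ln0 : lv r ^+ n != 0 by rewrite gt_eqF// exprn_gt0.
  have -> : lv r ^- n * (5 * l) ^+ n = 5 ^+ n.
    by rewrite [(5 * l) ^+ n]exprMn (mulrC (lv r ^- n)) -mulrA /l mulfV// mulr1.
  by rewrite expr2 ler_peMl// exprn_ge0.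
rewrite expr0 mul1r alphaE// alpha_osc.
rewrite (eq_bigr (fun s : 'I_T => c ^+ s * alpha (lv r) (Dm (r + s) (f a)) x0)); last first.
  by move=> s _; rewrite alphaE.
by rewrite -/(orad T r (f a) x0) ler_peMl ?orad_ge0.
Qed.

Lemma Fop_avg S r x0 : avg (lv r) (fun x => `|Fop S r f x|) x0 <=
  loc_const * \prod_(a in S) orad T r (f a) x0.
Proof.
apply: le_trans (Fop_bound S r x0); set l := lv r.
have l_gt0 : 0 < l := lvp r.
have ln : 0 < l ^+ n by rewrite exprn_gt0.
have nF : nice (fun x => (same l x0 x)%:R * Fop S r f x) by exact: same_nice (Fop_meas S r) (Fop_bdd S r).
have [ns is_] := int_same x0 l_gt0.
have h := int_CS ns (nice_norm nF).
have e : \int[mu]_x ((same l x0 x)%:R * `|(same l x0 x)%:R * Fop S r f x|) =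
   \int[mu]_x ((same l x0 x)%:R * `|Fop S r f x|).
  by apply: eq_Rintegral => x _; case: (same l x0 x); rewrite ?mul1r ?mul0r.
have -> : avg l (fun x => `|Fop S r f x|) x0 = l ^- n * \int[mu]_x ((same l x0 x)%:R * `|Fop S r f x|) by [].
rewrite -e; apply: le_trans (ler_wpM2l _ (le_trans (ler_norm _) h)) _; first by rewrite invr_ge0 ltW.
rewrite n2_norm mulrA ler_wpM2r ?n2_ge0//.
have -> : n2 (fun x => (same l x0 x)%:R) = Num.sqrt (l ^+ n).
  rewrite n2E -is_; congr (Num.sqrt _); apply: eq_Rintegral => x _.
  by case: (same l x0 x); rewrite ?expr1n ?expr0n.
have sq : Num.sqrt (l ^+ n) != 0 by rewrite gt_eqF// sqrtr_gt0.
rewrite sqrtrV ?(ltW ln)// -{1}(sqr_sqrtr (ltW ln)) expr2 invfM -mulrA mulVf ?mulr1//.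
Qed.

Lemma Fop_avg2 S r x0 : avg (lv r) (fun x => Fop S r f x ^+ 2) x0 <=
  (loc_const * \prod_(a in S) orad T r (f a) x0) ^+ 2.
Proof.
have P0 : 0 <= Num.sqrt (lv r ^- n) * n2 (fun x => (same (lv r) x0 x)%:R * Fop S r f x).
  by rewrite mulr_ge0 ?sqrtr_ge0 ?n2_ge0.
have h := Fop_bound S r x0; have := lerXn2r 2 P0 (le_trans P0 h) h.
have lvi : 0 <= lv r ^- n by rewrite invr_ge0 exprn_ge0// ltW.
apply: le_trans; rewrite exprMn sqr_sqrtr// n2_sqr /avg /kop.
rewrite le_eqVlt; apply/orP; left; apply/eqP; congr (_ * _); apply: eq_Rintegral => x _.
by rewrite exprMn; case: (same _ x0 x); rewrite ?expr1n ?expr0n.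
Qed.

End local_estimate.

(** * Two or more differences *)

Section off_diagonal.
Context {R : realType} {m n : nat}.
Notation V := 'rV[R]_n.
Notation MM := 'M[R]_(m.+1, n).
Notation mu := (leb R 1 n).
Notation nice := (nice (leb R 1 n)).
Notation n2 := (n2 (leb R 1 n)).
Variable l0 : R.
Hypothesis l0_gt0 : 0 < l0.
Notation lv := (lv l0).
Notation E := (E l0).
Notation Dm := (Dm l0).
Let lvp r : 0 < lv r := lv_gt0 l0_gt0 r.
Hypothesis n0 : (0 < n)%N.
Variables (C c : R).
Hypotheses (C0 : 0 < C) (c01 : 0 < c < 1).

(** A majorant of the square of [orad] which is linear in local integrals of squares, by (a + b)^2
    <= 2 a^2 + 2 b^2 and [geo_CS]; its integral can be summed over r by Bessel's inequality. *)
Definition osq T r (f : V -> R) x : R := 2 * osc (lv r) (E r f) x +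
  2 * (1 - c)^-1 * \sum_(s < T) c ^+ s * navg (lv r) (fun y => Dm (r + s) f y ^+ 2) x.

Lemma osq_nice T r f : nice f -> nice (osq T r f).
Proof.
move=> nf; apply: niceD; apply: niceZ; first exact: osc_nice (lvp r) (E_nice l0_gt0 r nf).
apply: nice_sum => s; apply: niceZ; apply: navg_nice => //; apply: niceX2; exact: Dm_nice.
Qed.

Lemma orad_sqr T r f x : orad l0 c T r f x ^+ 2 <= osq T r f x.
Proof.
rewrite /orad /osq.
have o0 : 0 <= osc (lv r) (E r f) x by exact: osc_ge0.
have c1 : 0 <= c < 1 by case/andP: c01 => /ltW -> ->.
have := geo_CS T (fun s => alpha (lv r) (Dm (r + s) f) x) c1.
rewrite [X in _ <= _ * X -> _](eq_bigr (fun s : 'I_T => c ^+ s * navg (lv r) (fun y => Dm (r + s) f y ^+ 2) x)); last first.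
  by move=> s _; rewrite alpha_sqr.
rewrite -[X in _ -> _ <= 2 * X + _](sqr_sqrtr o0).
set a := Num.sqrt _; set b := \sum_(s < T) _; set d := \sum_(s < T) _ => h.
by have := sqr_ge0 (a - b); nra.
Qed.

Definition orad_const : R := 48 * @osc_const R n + 2 * (1 - c)^-1 * ((1 - c)^-1 * 5 ^+ n).

Lemma orad_const_ge0 : 0 <= orad_const.
Proof.
have d0 : 0 <= (1 - c)^-1 by rewrite invr_ge0 subr_ge0 ltW//; case/andP: c01.
rewrite addr_ge0//; last by rewrite !mulr_ge0 ?exprn_ge0.
by rewrite mulr_ge0// /osc_const !mulr_ge0 ?exprn_ge0 ?vol_ge0 ?addr_ge0 ?mulr_ge0.
Qed.

Lemma orad_sum T T' f : nice f ->
  \sum_(r < T') \int[mu]_x osq T r f x <= orad_const * n2 f ^+ 2.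
Proof.
move=> nf.
have c1 : 0 <= c < 1 by case/andP: c01 => /ltW -> ->.
have cp : 0 <= c by case/andP: c1.
have nN r s : nice (navg (lv r) (fun y => Dm (r + s) f y ^+ 2)).
  by apply: navg_nice => //; apply: niceX2; exact: Dm_nice.
have nS r (s : 'I_T) : nice (fun x => c ^+ s * navg (lv r) (fun y => Dm (r + s) f y ^+ 2) x) by exact: niceZ.
have e r : \int[mu]_x osq T r f x = 2 * \int[mu]_x osc (lv r) (E r f) x +
    2 * (1 - c)^-1 * \sum_(s < T) c ^+ s * (5 ^+ n * n2 (Dm (s + r) f) ^+ 2).
  have no := osc_nice (lvp r) (E_nice l0_gt0 r nf).
  rewrite (intD (niceZ _ no) (niceZ _ (nice_sum _ (nS r)))) (intZ _ no) (intZ _ (nice_sum _ (nS r))).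
  rewrite (int_sum _ (nS r)); congr (_ + _ * _); apply: eq_bigr => s _.
  rewrite (intZ _ (nN r s)) navg_int//; last by apply: niceX2; exact: Dm_nice.
  by rewrite n2_sqr addnC.
rewrite (eq_bigr _ (fun (r : 'I_T') _ => e r)) big_split/= -!mulr_sumr exchange_big/=.
have d0 : 0 <= (1 - c)^-1 by rewrite invr_ge0 subr_ge0 ltW//; case/andP: c01.
have h1 := E_osc l0_gt0 T' n0 nf.
have h2 : \sum_(s < T) \sum_(r < T') c ^+ s * (5 ^+ n * n2 (Dm (s + r) f) ^+ 2) <=
    (1 - c)^-1 * 5 ^+ n * n2 f ^+ 2.
  apply: (@le_trans _ _ (\sum_(s < T) c ^+ s * (5 ^+ n * n2 f ^+ 2))).
    apply: ler_sum => s _; rewrite -mulr_sumr ler_wpM2l ?exprn_ge0// -mulr_sumr ler_wpM2l ?exprn_ge0//.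
    exact: bessel_shift.
  rewrite -mulr_suml -mulrA ler_wpM2r ?geo_sum//.
  by apply: mulr_ge0; [exact: exprn_ge0|exact: sqr_ge0].
have h3 := ler_wpM2l (mulr_ge0 (ler0n R 2) d0) h2.
apply: le_trans (lerD (ler_wpM2l (ler0n R 2) h1) h3) _.
by rewrite /orad_const le_eqVlt; apply/orP; left; apply/eqP; ring.
Qed.

Variable K : MM -> R.
Hypothesis tK : tame C c K.
Variables (f : 'I_m.+1 -> V -> R) (T : nat).
Hypotheses (nf : forall a, nice (f a)) (fT : forall a, cst_on (lv T) (f a)).

(** The exponent 2 / |S| is at most 1 precisely when |S| >= 2. It is also the one for which AM-GM
    turns the power of a product of |S| local sizes into a mean of their squares, which are summable
    over r. *)
Lemma off_diagonal (S : {set 'I_m.+1}) T' : (2 <= #|S|)%N -> (forall a, n2 (f a) <= 1) ->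
  (\int[mu]_x ((\sum_(r < T') `|Fop l0 K S r f x|) `^ (2 / #|S|%:R))%:E <=
   ((@loc_const R m n C) `^ (2 / #|S|%:R) * orad_const)%:E)%E.
Proof.
move=> S2 f1; set p := 2 / _; set LC := @loc_const R m n C.
have Sp : 0 < #|S|%:R :> R by rewrite ltr0n (leq_trans _ S2).
have hp : 0 < p <= 1.
  by rewrite divr_gt0//= ler_pdivrMr// mul1r ler_nat.
have /andP[p0 p1] := hp.
have LC0 : 0 <= LC by rewrite mulr_ge0 ?ltW// !exprn_ge0.
have mF r : measurable_fun setT (Fop l0 K S r f) by exact: (Fop_meas l0_gt0 tK nf).
have bF r : bdd (fun x => `|Fop l0 K S r f x|).
  by have [B hB] := Fop_bdd l0_gt0 tK nf S r; exists B => x; rewrite normr_id.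
have mFn r : measurable_fun setT (fun x => `|Fop l0 K S r f x|) by exact: measurableT_comp.
have mFp r : measurable_fun setT (fun x => `|Fop l0 K S r f x| `^ p).
  exact: (measurableT_comp (measurable_powR p) (mFn r)).
have bFp r : bdd (fun x => `|Fop l0 K S r f x| `^ p).
  have [b hb] := bF r; exists (b `^ p) => y; rewrite ger0_norm ?powR_ge0//.
  have Fb : `|Fop l0 K S r f y| <= b by exact: le_trans (ler_norm _) (hb y).
  by apply: ge0_ler_powR; rewrite ?nnegrE ?(ltW p0)// (le_trans (normr_ge0 _) Fb).
have nq a r := osq_nice T r (nf a).
have nqs r : nice (fun x => \sum_(a in S) osq T r (f a) x).
  rewrite (_ : (fun x => _) = (fun x => \sum_a (if a \in S then osq T r (f a) x else 0))); last first.
    by apply/funext => x; rewrite big_mkcond.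
  by apply: nice_sum => a; case: (a \in S) => //; exact: nice0.
have one r : (\int[mu]_x (`|Fop l0 K S r f x| `^ p)%:E <=
    (LC `^ p / #|S|%:R * \sum_(a in S) \int[mu]_x osq T r (f a) x)%:E)%E.
  (* Averaging over cubes leaves the integral unchanged and makes the local bound of [Fop_avg]
     applicable. *)
  rewrite (avg_tonelli (lvp r) (mFp r) (bFp r) (fun y => powR_ge0 _ _)).
  have nB := niceZ (LC `^ p / #|S|%:R) (nqs r).
  apply: (@le_trans _ _ (\int[mu]_x (LC `^ p / #|S|%:R * \sum_(a in S) osq T r (f a) x)%:E)%E).
    apply: ge0_le_integral => //.
    - by move=> x _; rewrite lee_fin avg_ge0// => y; exact: powR_ge0.
    - apply/measurable_EFinP.
      have ms : measurable_fun setT (fun q : V * V => (same (lv r) q.1 q.2)%:R * `|Fop l0 K S r f q.2| `^ p).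
        apply: measurable_funM; first exact: measurable_same.
        exact: (measurableT_comp (mFp r) measurable_snd).
      by apply: measurable_funM => //; exact: (measurable_Rint _ ms).
    - by apply/measurable_EFinP; exact: nice_meas nB.
    move=> x _; rewrite lee_fin.
    have P0 : 0 <= \prod_(a in S) orad l0 c T r (f a) x.
      by apply: prodr_ge0 => a _; exact: orad_ge0.
    have h := avg_powR (x := x) (lvp r) (mFn r) (bF r) (fun y => normr_ge0 _) hp (mulr_ge0 LC0 P0)
      (Fop_avg l0_gt0 C0 c01 tK nf fT S r x).
    apply: le_trans h _; rewrite powRM// -mulrA ler_wpM2l ?powR_ge0//.
    have -> : (\prod_(a in S) orad l0 c T r (f a) x) `^ p = (\prod_(a in S) orad l0 c T r (f a) x ^+ 2) `^ #|S|%:R^-1.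
      by rewrite prodrXl -powR_mulrn// -powRrM.
    apply: le_trans (agm_set (leq_trans _ S2) _) _ => //; first by move=> a; exact: sqr_ge0.
    rewrite mulrC ler_wpM2l ?invr_ge0 ?(ltW Sp)//; apply: ler_sum => a _; exact: orad_sqr.
  rewrite ge0_Rint// lee_fin (intZ _ (nqs r)) ler_wpM2l ?divr_ge0 ?powR_ge0 ?(ltW Sp)//.
  rewrite [X in _ <= X]big_mkcond/=.
  have nq' a : nice (fun x => if a \in S then osq T r (f a) x else 0) by case: (a \in S) => //; exact: nice0.
  rewrite (_ : \int[mu]_x _ = \int[mu]_x \sum_a (if a \in S then osq T r (f a) x else 0)); last first.
    by apply: eq_Rintegral => x _; rewrite big_mkcond.
  rewrite (int_sum _ nq'); apply: ler_sum => a _; case: (a \in S) => //.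
  by rewrite Rintegral_cst ?mul0r.
apply: (@le_trans _ _ (\int[mu]_x \sum_(r < T') (`|Fop l0 K S r f x| `^ p)%:E)%E).
  apply: ge0_le_integral => //.
  - by move=> x _; rewrite lee_fin powR_ge0.
  - apply/measurable_EFinP; apply: (measurableT_comp (measurable_powR p)).
    by apply: measurable_sum => r.
  - by apply: emeasurable_sum => r; exact/measurable_EFinP.
  by move=> x _; rewrite sumEFin lee_fin; exact: powR_sum_le.
have eS : (\int[mu]_x \sum_(r < T') (`|Fop l0 K S r f x| `^ p)%:E =
    \sum_(r < T') \int[mu]_x (`|Fop l0 K S r f x| `^ p)%:E)%E.
  by apply: ge0_integral_sum => // r; exact/measurable_EFinP.
rewrite eS.
apply: (@le_trans _ _ (\sum_(r < T') (LC `^ p / #|S|%:R * \sum_(a in S) \int[mu]_x osq T r (f a) x)%:E)%E).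
  by apply: lee_sum => r _; exact: one.
rewrite sumEFin lee_fin -mulr_sumr -mulrA ler_wpM2l ?powR_ge0//.
rewrite exchange_big/= mulrC ler_pdivrMr// mulr_natr -sumr_const.
apply: ler_sum => a _; apply: le_trans (orad_sum T T' (nf a)) _.
rewrite ler_piMr ?orad_const_ge0//.
by rewrite -[leRHS](expr1n R 2) lerXn2r ?nnegrE ?n2_ge0.
Qed.

End off_diagonal.

Section abel.
Context {R : realType}.

(** Summation by parts: the increments of the monotone weights add up to at most w L, and the
    boundary term costs another w L. *)
Lemma abel_bound (w z : nat -> R) M L : (forall j, 0 <= w j) -> (forall j, w j <= w j.+1) ->
  (forall k, (k <= L)%N -> `|\sum_(j < k.+1) z j| <= M) ->
  `|w 0%N * z 0%N + \sum_(j < L) w j * z j.+1| <= 2 * w L * M.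
Proof.
move=> w0 wi hM.
have M0 : 0 <= M by apply: le_trans (hM 0%N (leq0n _)).
have wL k : w 0%N <= w k by elim: k => // k IH; exact: le_trans IH (wi k).
have key k : (k <= L)%N -> `|w 0%N * z 0%N + \sum_(j < k) w j * z j.+1 - w k * \sum_(j < k.+1) z j| <= (w k - w 0%N) * M.
  elim: k => [|k IH] kL; first by rewrite big_ord0 addr0 big_ord_recr big_ord0/= add0r !subrr normr0 mul0r.
  have h := IH (ltnW kL); have h2 := hM _ kL.
  rewrite big_ord_recr/= [\sum_(j < k.+2) z j]big_ord_recr/=.
  move: h h2; rewrite [\sum_(j < k.+2) z j]big_ord_recr/=.
  set P := \sum_(j < k) _; set Z := \sum_(j < k.+1) _ => h h2.
  have -> : w 0%N * z 0%N + (P + w k * z k.+1) - w k.+1 * (Z + z k.+1) =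
    (w 0%N * z 0%N + P - w k * Z) - (w k.+1 - w k) * (Z + z k.+1) by ring.
  apply: le_trans (ler_normB _ _) _; rewrite normrM (ger0_norm (_ : 0 <= w k.+1 - w k)) ?subr_ge0//.
  have := ler_wpM2l (_ : 0 <= w k.+1 - w k) h2; rewrite subr_ge0 => /(_ (wi k)) h3.
  by apply: le_trans (lerD h h3) _; rewrite le_eqVlt; apply/orP; left; apply/eqP; ring.
have h := key L (leqnn L); have h2 := ler_wpM2l (w0 L) (hM L (leqnn L)).
have := ler_normD (w 0%N * z 0%N + \sum_(j < L) w j * z j.+1 - w L * \sum_(j < L.+1) z j) (w L * \sum_(j < L.+1) z j).
rewrite subrK normrM (ger0_norm (w0 L)) => h3; apply: le_trans h3 _.
apply: le_trans (lerD h h2) _; have := mulr_ge0 (w0 0%N) M0; lra.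
Qed.

(** The factors are exchanged one at a time, so that each summand carries exactly one difference. *)
Lemma prod_diff k (u v B : 'I_k -> R) : (forall a, `|u a| <= B a) -> (forall a, `|v a| <= B a) ->
  `|\prod_a u a - \prod_a v a| <= \sum_a \prod_b (if b == a then `|u b - v b| else B b).
Proof.
elim: k u v B => [|k IH] u v B hu hv; first by rewrite !big_ord0 subrr normr0.
have B0 a : 0 <= B a by apply: le_trans (hu a).
rewrite !big_ord_recl.
set P := \prod_(i < k) u (lift ord0 i); set Q := \prod_(i < k) v (lift ord0 i).
have -> : u ord0 * P - v ord0 * Q = (u ord0 - v ord0) * P + v ord0 * (P - Q) by ring.
apply: le_trans (ler_normD _ _) _; apply: lerD.
  rewrite eqxx normrM ler_wpM2l// normr_prod; apply: ler_prod => a _.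
  by rewrite normr_ge0/=; exact: hu.
rewrite normrM; apply: (@le_trans _ _ (B ord0 * \sum_a \prod_b (if b == a then `|u (lift ord0 b) - v (lift ord0 b)| else B (lift ord0 b)))).
  by apply: ler_pM => //; apply: IH.
rewrite mulr_sumr; apply: ler_sum => a _; rewrite [in X in _ <= X]big_ord_recl/=.
rewrite le_eqVlt; apply/orP; left; apply/eqP; congr (_ * _).
Qed.

End abel.

(** * One difference *)

Section linear_operator.
Context {R : realType} {m n : nat}.
Notation V := 'rV[R]_n.
Notation MM := 'M[R]_(m.+1, n).
Notation mu := (leb R 1 n).
Notation niceY := (nice (leb R m.+1 n)).
Notation nice := (nice (leb R 1 n)).
Notation n2 := (n2 (leb R 1 n)).
Variable l0 : R.
Hypothesis l0_gt0 : 0 < l0.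
Notation lv := (lv l0).
Notation E := (E l0).
Notation Dm := (Dm l0).
Notation Dd := (Dd l0).
Let lvp r : 0 < lv r := lv_gt0 l0_gt0 r.
Hypothesis n0 : (0 < n)%N.
Variables (C c : R).
Hypotheses (C0 : 0 < C) (c01 : 0 < c < 1).
Variable i : 'I_m.+1.

(** What remains of the multilinear operator when only the index i carries a difference: convolution
    with the i-th marginal of the kernel. *)
Definition Gop (K : MM -> R) r (h : V -> R) x : R :=
  \int[leb R m.+1 n]_y (Kr (lv r) K y * h (x - row i y)).

Let ch (h : V -> R) (p : V * MM) := h (p.1 - row i p.2).

Let ch_meas h : measurable_fun setT h -> measurable_fun setT (ch h).
Proof.
move=> mh; apply: (measurableT_comp mh).
have -> : (fun p : V * MM => p.1 - row i p.2) = (fun p => p.1 - 1 *: row i p.2).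
  by apply/funext => p; rewrite scale1r.
apply: measurable_subscale => //; exact: (measurableT_comp (measurable_row i) measurable_snd).
Qed.

Let ch_bdd h : bdd h -> bdd (ch h).
Proof. by move=> [B hB]; exists B => p; exact: hB. Qed.

Section one_kernel.
Variable K : MM -> R.
Hypothesis tK : tame C c K.

Let nk r : niceY (Kr (lv r) K).
Proof. by have [_ nKr _ _ _] := tK; exact: nKr. Qed.

Let G_arg r h x : nice h -> niceY (fun y => Kr (lv r) K y * h (x - row i y)).
Proof.
move=> nh.
by have e := kernel_nice1 (ch_meas (nice_meas nh)) (ch_bdd (nice_bdd nh)) x (nk r); exact: e.
Qed.

Lemma Gop_nice r h : nice h -> nice (Gop K r h).
Proof.
move=> nh.
apply: (@kernel_nice _ _ _ _ _ mu (leb R m.+1 n) (ch h) (ch_meas (nice_meas nh)) (ch_bdd (nice_bdd nh)) _ (\int[mu]_x `|h x|) (nk r)) => y.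
have nc : nice (fun x => ch h (x, y)) := shift_nice (row i y) nh.
rewrite ge0_Rint; last exact: nice_norm nc.
by rewrite lee_fin (shift_int (row i y) (nice_norm nh)).
Qed.

Lemma Gop_sum r (I : Type) (s : seq I) (h : I -> V -> R) x : (forall j, nice (h j)) ->
  Gop K r (fun y => \sum_(j <- s) h j y) x = \sum_(j <- s) Gop K r (h j) x.
Proof.
move=> nh; apply: etrans (int_sum _ (fun j => G_arg r x (nh j))).
by apply: eq_Rintegral => y _; rewrite mulr_sumr.
Qed.

Lemma GopB r g h x : nice g -> nice h ->
  Gop K r (fun y => g y - h y) x = Gop K r g x - Gop K r h x.
Proof.
move=> ng nh; apply: etrans (intB (G_arg r x ng) (G_arg r x nh)).
by apply: eq_Rintegral => y _; rewrite mulrBr.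
Qed.

Lemma Gop_Fop r (f : 'I_m.+1 -> V -> R) x : nice (f i) ->
  Fop l0 K [set i]%SET r f x = Gop K r (f i) x.
Proof.
move=> nf; have [_ _ K0 _ _] := tK.
have -> : Fop l0 K [set i]%SET r f x =
    \int[leb R m.+1 n]_y (Kr (lv r) K y * f i (x - row i y) - E r (f i) x * Kr (lv r) K y).
  apply: eq_Rintegral => y _; rewrite (bigD1 i)//= inE eqxx big1 => [|a ai]; last by rewrite inE (negbTE ai).
  by rewrite mulr1; ring.
by rewrite (intB (G_arg r x nf) (niceZ _ (nk r))) (intZ _ (nk r)) K0 ?mulr0 ?subr0.
Qed.

(* Weighted Cauchy-Schwarz reduces an L2 bound for an average of [h y x] over the
   kernel to a bound for each [h y]. *)
Lemma Gop_wCS r (u : V * MM -> R) A g : measurable_fun setT u -> bdd u -> nice g -> 0 <= A ->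
  (forall y, Kr (lv r) K y != 0 -> nice (fun x => u (x, y) ^+ 2) /\ \int[mu]_x u (x, y) ^+ 2 <= A) ->
  (forall x, g x = \int[leb R m.+1 n]_y (Kr (lv r) K y * u (x, y))) ->
  n2 g ^+ 2 <= C ^+ 2 * A.
Proof.
move=> mu_ bu ng A0 hA gE; have [_ _ _ K1 _] := tK.
have hC := K1 _ (lvp r).
pose k y := `|Kr (lv r) K y|.
have nkn : niceY k := nice_norm (nk r).
have k0 y : 0 <= k y by exact: normr_ge0.
pose c2 p := u p ^+ 2.
have mc2 : measurable_fun setT c2 by exact: measurable_funX.
have bc2 : bdd c2.
  have [B hB] := bu; exists (B ^+ 2) => p.
  by rewrite normrX lerXn2r ?nnegrE// (le_trans _ (hB p)).
have hA' y : k y != 0 -> nice (fun x => c2 (x, y)) /\ \int[mu]_x c2 (x, y) <= A.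
  by rewrite normr_eq0; exact: hA.
have key := kernel_int_le A0 mc2 bc2 (fun p => sqr_ge0 _) k0 nkn hA'.
have nk0 : 0 <= \int[leb R m.+1 n]_y k y by exact: int_ge0.
have pw x : g x ^+ 2 <= C * \int[leb R m.+1 n]_y (k y * c2 (x, y)).
  have mux : measurable_fun setT (fun y => `|u (x, y)|).
    by apply: measurableT_comp => //; exact: (measurableT_comp mu_ (measurable_pair1 x)).
  have bux : bdd (fun y => `|u (x, y)|) by have [B hB] := bu; exists B => y; rewrite normr_id.
  have nku : niceY (fun y => Kr (lv r) K y * u (x, y)).
    by have e := kernel_nice1 mu_ bu x (nk r); exact: e.
  have h1 : `|g x| <= \int[leb R m.+1 n]_y (k y * `|u (x, y)|).
    rewrite gE; apply: le_trans (le_norm_int nku) _.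
    by rewrite le_eqVlt; apply/orP; left; apply/eqP; apply: eq_Rintegral => y _; rewrite normrM.
  have h2 := wCS nkn k0 mux bux.
  have h3 : g x ^+ 2 <= (\int[leb R m.+1 n]_y (k y * `|u (x, y)|)) ^+ 2.
    rewrite -[leLHS]real_normK ?num_real// lerXn2r ?nnegrE//.
    by apply: int_ge0 => y; rewrite mulr_ge0.
  apply: le_trans h3 (le_trans h2 _).
  have -> : \int[leb R m.+1 n]_y (k y * `|u (x, y)| ^+ 2) = \int[leb R m.+1 n]_y (k y * c2 (x, y)).
    by apply: eq_Rintegral => y _; rewrite real_normK ?num_real.
  by rewrite ler_wpM2r// int_ge0// => y; rewrite mulr_ge0 ?sqr_ge0.
have mI : measurable_fun setT (fun x => \int[leb R m.+1 n]_y (k y * c2 (x, y))).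
  apply: (measurable_Rint _ (h := fun p : V * MM => k p.2 * c2 p)).
  by apply: measurable_funM => //; exact: (measurableT_comp (nice_meas nkn) measurable_snd).
rewrite n2_sqr -lee_fin -ge0_Rint; last exact: niceX2.
apply: (@le_trans _ _ (\int[mu]_x (C%:E * (\int[leb R m.+1 n]_y (k y * c2 (x, y)))%:E))%E).
  apply: ge0_le_integral => //.
  - by move=> x _; rewrite lee_fin sqr_ge0.
  - by apply/measurable_EFinP; exact: nice_meas (niceX2 ng).
  - by apply: emeasurable_funM => //; exact/measurable_EFinP.
  by move=> x _; rewrite -EFinM lee_fin.
have eZ : (\int[mu]_x (C%:E * (\int[leb R m.+1 n]_y (k y * c2 (x, y)))%:E) =
    C%:E * \int[mu]_x (\int[leb R m.+1 n]_y (k y * c2 (x, y)))%:E)%E.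
  apply: ge0_integralZl => //; first exact/measurable_EFinP.
    by move=> x _; rewrite lee_fin int_ge0// => y; rewrite mulr_ge0 ?sqr_ge0.
  by rewrite lee_fin ltW.
rewrite eZ; apply: le_trans (lee_wpmul2l _ key) _; first by rewrite lee_fin ltW.
rewrite -EFinM lee_fin expr2 -mulrA ler_wpM2l ?(ltW C0)// mulrC ler_wpM2r//.
Qed.

Lemma Gop_n2 r h : nice h -> n2 (Gop K r h) <= C * n2 h.
Proof.
move=> nh; rewrite -(@ler_pXn2r _ 2) ?nnegrE ?n2_ge0 ?mulr_ge0 ?n2_ge0 ?(ltW C0)//.
rewrite exprMn; apply: (@Gop_wCS r (ch h) (n2 h ^+ 2)) => //.
- exact: ch_meas (nice_meas nh).
- exact: ch_bdd (nice_bdd nh).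
- exact: Gop_nice.
- exact: sqr_ge0.
move=> y _; split; first exact: niceX2 (shift_nice (row i y) nh).
by rewrite n2_sqr (shift_int (row i y) (niceX2 nh)).
Qed.

(** Since the kernel has mean zero, h may be replaced by h (x - y_i) - h x, with shifts of size 2
    [lv r] small compared to the cubes on which h is constant. *)
Lemma Gop_coarse r k h : (k <= r)%N -> nice h -> cst_on (lv k) h ->
  n2 (Gop K r h) <= C * (3 * n.+1%:R) * (3 / 4) ^+ (r - k) * n2 h.
Proof.
move=> kr nh ch_; have [_ _ K0 _ _] := tK.
have q0 : 0 <= (3 / 4 : R) by rewrite divr_ge0.
rewrite -(@ler_pXn2r _ 2) ?nnegrE ?n2_ge0//; last first.
  by rewrite !mulr_ge0 ?n2_ge0 ?(ltW C0)// exprn_ge0.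
pose u (p : V * MM) := ch h p - h p.1.
pose A := 4 * n.+1%:R * (2 * lv r / lv k) * n2 h ^+ 2.
have A0 : 0 <= A.
  by apply: mulr_ge0; [apply: mulr_ge0 => //; rewrite divr_ge0 ?mulr_ge0 ?ltW|exact: sqr_ge0].
have mh1 : measurable_fun setT (fun p : V * MM => h p.1) by exact: (measurableT_comp (nice_meas nh) measurable_fst).
have bu : bdd u.
  have [B hB] := nice_bdd nh; exists (B + B) => p.
  by apply: le_trans (ler_normB _ _) _; apply: lerD; exact: hB.
have hu y : Kr (lv r) K y != 0 -> nice (fun x => u (x, y) ^+ 2) /\ \int[mu]_x u (x, y) ^+ 2 <= A.
  rewrite /Kr; case: (boolP (ann (lv r) y)) => [/andP[_ hy] _|_]; last by rewrite mulr0 eqxx.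
  have hy' j : `|row i y 0 j| <= 2 * lv r.
    by apply: le_trans hy; rewrite mxE; exact: coord_le_enorm.
  have r20 : 0 <= 2 * lv r by rewrite mulr_ge0// ltW.
  have [t1 t2] := translation_sqr (lvp k) nh ch_ hy' r20.
  by split; [exact: t1|exact: t2].
have hG x : Gop K r h x = \int[leb R m.+1 n]_y (Kr (lv r) K y * u (x, y)).
  have -> : \int[leb R m.+1 n]_y (Kr (lv r) K y * u (x, y)) =
     \int[leb R m.+1 n]_y (Kr (lv r) K y * h (x - row i y) - h x * Kr (lv r) K y).
    by apply: eq_Rintegral => y _; rewrite /u /ch/=; ring.
  by rewrite (intB (G_arg r x nh) (niceZ _ (nk r))) (intZ _ (nk r)) K0 ?mulr0 ?subr0.
have mu_ : measurable_fun setT u by apply: measurable_funB => //; exact: ch_meas (nice_meas nh).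
apply: le_trans (Gop_wCS mu_ bu (Gop_nice r nh) A0 hu hG) _.
have e : lv r / lv k = 2^-1 ^+ (r - k).
  rewrite /lv -{1}(subnKC kr) exprD exprVn invfM mulrA mulrAC divff ?mul1r//.
  by rewrite gt_eqF// divr_gt0// exprn_gt0.
(* 1/2 <= (3/4)^2: the square root of the gain in [translation] is replaced by a rational rate. *)
have h1 : (2^-1 : R) ^+ (r - k) <= ((3 / 4) ^+ (r - k)) ^+ 2.
  rewrite -exprM mulnC exprM lerXn2r ?nnegrE ?sqr_ge0 ?invr_ge0//; lra.
have n1 : 1 <= n.+1%:R :> R by rewrite ler1n.
have -> : A = 4 * n.+1%:R * (2 * 2^-1 ^+ (r - k)) * n2 h ^+ 2 by rewrite /A -[2 * lv r / lv k]mulrA e.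
have x10 : 0 <= (2^-1 : R) ^+ (r - k) by rewrite exprn_ge0 ?invr_ge0.
move: h1 x10 n1; move: (2^-1 ^+ (r - k)) ((3 / 4) ^+ (r - k)) (n.+1%:R : R) (n2 h) => x1 w nn N h1 x10 n1.
have -> : C ^+ 2 * (4 * nn * (2 * x1) * N ^+ 2) = (C ^+ 2 * N ^+ 2) * (8 * nn * x1) by ring.
have -> : (C * (3 * nn) * w * N) ^+ 2 = (C ^+ 2 * N ^+ 2) * (9 * nn ^+ 2 * w ^+ 2) by ring.
apply: ler_wpM2l; first by apply: mulr_ge0; exact: sqr_ge0.
apply: (@le_trans _ _ (9 * nn ^+ 2 * x1)).
  by rewrite ler_wpM2r//; nra.
by rewrite ler_wpM2l// mulr_ge0 ?sqr_ge0.
Qed.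

(** The local estimate for S = {i}, with the single martingale difference as input: in its [orad]
    every term vanishes except the one of index s, which carries c ^ s. *)
Lemma Gop_fine r s f : nice f ->
  n2 (Gop K r (Dm (r + s) f)) <= @loc_const R m n C * 5 ^+ n * c ^+ s * n2 (Dm (r + s) f).
Proof.
move=> nf; set h := Dm (r + s) f; have nh : nice h := Dm_nice l0_gt0 (r + s) nf.
pose F (a : 'I_m.+1) := h; have nF a : nice (F a) by [].
have hT a : cst_on (lv (r + s).+1) (F a) by exact: Dm_cst.
have LC0 : 0 <= @loc_const R m n C by rewrite mulr_ge0 ?ltW// !exprn_ge0.
have cp : 0 <= c by apply: ltW; case/andP: c01.
have p51 : 1 <= 5 ^+ n :> R by rewrite exprn_ege1// ler1n.
have nG := Gop_nice r nh.
have Eh : E r h = (fun=> 0) by apply/funext => x; rewrite E_Dm0// leq_addr.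
have DD k : Dm k h = if k == (r + s)%N then h else (fun=> 0).
  apply/funext => x; rewrite {1}/Dm; case: (ltngtP k (r + s)) => kk.
  - by rewrite !E_Dm0 ?subrr// ltnW.
  - by rewrite !E_Dm ?subrr// ltnW.
  by rewrite kk E_Dm// E_Dm0// subr0.
have o x : orad l0 c (r + s).+1 r h x = c ^+ s * alpha (lv r) h x.
  rewrite /orad Eh (_ : osc (lv r) (fun=> 0) x = 0) ?sqrtr0 ?add0r; last first.
    rewrite /osc (_ : (fun y => _) = (fun=> 0)) ?Rintegral_cst ?mul0r ?mulr0//.
    by apply/funext => y; rewrite subrr expr0n mulr0.
  have sr : (s < (r + s).+1)%N by rewrite ltnS leq_addl.
  rewrite (bigD1 (Ordinal sr))//= DD eqxx big1 ?addr0// => k ks.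
  rewrite DD eqn_add2l; have -> : (nat_of_ord k == s) = false by apply/negbTE; apply: contraNN ks => /eqP e; apply/eqP/val_inj.
  rewrite /alpha /navg /kop (_ : (fun y => _) = (fun=> 0)) ?Rintegral_cst ?mul0r ?mulr0 ?sqrtr0 ?mulr0//.
  by apply/funext => y; rewrite expr0n mulr0.
have RH0 : 0 <= @loc_const R m n C * 5 ^+ n * c ^+ s * n2 h.
  by rewrite mulr_ge0 ?n2_ge0// mulr_ge0 ?exprn_ge0// mulr_ge0 ?exprn_ge0.
rewrite -(@ler_pXn2r _ 2) ?nnegrE ?n2_ge0//.
have nav : nice (navg (lv r) (fun y => h y ^+ 2)) by apply: navg_nice => //; exact: niceX2.
rewrite n2_sqr -(avg_int (lvp r) (niceX2 nG)).
apply: (@le_trans _ _ (\int[mu]_x ((@loc_const R m n C * c ^+ s) ^+ 2 * navg (lv r) (fun y => h y ^+ 2) x))).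
  apply: le_int; [by apply: avg_nice => //; exact: niceX2|exact: niceZ|move=> x].
  have := Fop_avg2 l0_gt0 C0 c01 tK nF hT [set i]%SET r x.
  rewrite (_ : (fun x => Fop l0 K [set i]%SET r F x ^+ 2) = (fun x => Gop K r h x ^+ 2)); last first.
    by apply/funext => z; rewrite Gop_Fop.
  by rewrite finset.big_set1 o mulrA exprMn alpha_sqr.
rewrite (intZ _ nav) navg_int//; last exact: niceX2.
rewrite -n2_sqr; have p0 : 0 <= 5 ^+ n :> R by exact: exprn_ge0.
move: p0 p51; move: (@loc_const R m n C) (c ^+ s) (5 ^+ n : R) (n2 h) => L w p N p0 p51.
have -> : (L * w) ^+ 2 * (p * N ^+ 2) = (L ^+ 2 * w ^+ 2 * N ^+ 2) * p by ring.
have -> : (L * p * w * N) ^+ 2 = (L ^+ 2 * w ^+ 2 * N ^+ 2) * p ^+ 2 by ring.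
apply: ler_wpM2l; first by apply: mulr_ge0; [apply: mulr_ge0|]; exact: sqr_ge0.
by rewrite expr2 ler_peMl.
Qed.

Definition b_rate : R := Num.max c (3 / 4).

Lemma b_rate01 : 0 < b_rate < 1.
Proof.
have /andP[h1 h2] := c01; rewrite /b_rate lt_max h1/= gt_max h2/=; lra.
Qed.

(** The division by c compensates the index shift between [Dd] and [Dm]: the distance from r to k+1
    exceeds the exponent k - r of [Gop_fine] by one. *)
Definition G_const : R := C * (3 * n.+1%:R) + @loc_const R m n C * 5 ^+ n / c.

Lemma G_const_ge0 : 0 <= G_const.
Proof.
have cp : 0 <= c by apply: ltW; case/andP: c01.
by rewrite addr_ge0// ?divr_ge0 ?mulr_ge0 ?(ltW C0)// ?mulr_ge0 ?exprn_ge0 ?(ltW C0).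
Qed.

Lemma Gop_Dd r k f : nice f ->
  n2 (Gop K r (Dd k f)) <= G_const * b_rate ^+ dist r k * n2 (Dd k f).
Proof.
move=> nf; have /andP[cp c1] := c01.
have LC0 : 0 <= @loc_const R m n C * 5 ^+ n by rewrite !mulr_ge0 ?(ltW C0)// !exprn_ge0.
have CC0 : 0 <= C * (3 * n.+1%:R) by rewrite !mulr_ge0 ?(ltW C0).
have cb : c <= b_rate by rewrite le_max lexx.
have qb : 3 / 4 <= b_rate by rewrite le_max lexx orbT.
have b0 : 0 <= b_rate by apply: le_trans cb; exact: ltW.
have [kr|rk] := leqP k r.
  apply: le_trans (Gop_coarse kr (Dd_nice l0_gt0 k nf) (@Dd_cst _ _ _ l0_gt0 k f)) _.
  rewrite ler_wpM2r ?n2_ge0// /dist (eqP (_ : k - r == 0)%N) ?subn_eq0// addn0.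
  have h34 : 0 <= (3 / 4) ^+ (r - k) :> R by rewrite exprn_ge0// divr_ge0.
  apply: ler_pM => //; first by rewrite lerDl divr_ge0// ltW.
  by rewrite lerXn2r ?nnegrE ?divr_ge0.
case: k rk => // k; rewrite ltnS => rk.
have := Gop_fine r (k - r) nf; rewrite subnKC// => h; apply: le_trans h _.
rewrite ler_wpM2r ?n2_ge0// /dist (eqP (_ : r - k.+1 == 0)%N) ?subn_eq0 ?(leqW rk)// add0n subSn//.
apply: (@le_trans _ _ (@loc_const R m n C * 5 ^+ n / c * c ^+ (k - r).+1)).
  by rewrite exprS mulrA divfK// gt_eqF.
apply: ler_pM.
- by rewrite divr_ge0// ltW.
- by rewrite exprn_ge0// ltW.
- by rewrite lerDr.
by rewrite lerXn2r ?nnegrE// ltW.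
Qed.

End one_kernel.

Lemma Dd_sym k f g : nice f -> nice g -> \int[mu]_x (Dd k f x * g x) = \int[mu]_x (f x * Dd k g x).
Proof.
move=> nf ng.
have Es r : \int[mu]_x (E r f x * g x) = \int[mu]_x (f x * E r g x).
  by rewrite !E_avg; exact: avg_sym.
case: k => [|k]; first exact: Es.
have ne h r g' : nice h -> nice g' -> nice (fun x => E r h x * g' x).
  by move=> nh ng'; exact: niceMM (E_nice l0_gt0 r nh) ng'.
have ne' h r g' : nice h -> nice g' -> nice (fun x => h x * E r g' x).
  by move=> nh ng'; exact: niceMM nh (E_nice l0_gt0 r ng').
have -> : \int[mu]_x (Dd k.+1 f x * g x) = \int[mu]_x (E k.+1 f x * g x - E k f x * g x).
  by apply: eq_Rintegral => x _; rewrite mulrBl.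
have -> : \int[mu]_x (f x * Dd k.+1 g x) = \int[mu]_x (f x * E k.+1 g x - f x * E k g x).
  by apply: eq_Rintegral => x _; rewrite mulrBr.
rewrite (intB (ne _ _ _ nf ng) (ne _ _ _ nf ng)) (intB (ne' _ _ _ nf ng) (ne' _ _ _ nf ng)).
by rewrite !Es.
Qed.

Lemma Dd_idem k f : nice f -> Dd k (Dd k f) = Dd k f.
Proof.
move=> nf; apply/funext => x; case: k => [|k] /=; first by rewrite E_ge.
by rewrite {1}/Dm E_Dm// E_Dm0// subr0.
Qed.

(** The adjoint of a convolution is the convolution with the reflected kernel. It converts decay in
    the input level into decay in the output level. *)
Lemma Gop_adj K r f g : tame C c K -> nice f -> nice g ->
  \int[mu]_x (g x * Gop K r f x) = \int[mu]_x (Gop (fun y => K (- y)) r g x * f x).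
Proof.
move=> tK nf ng; have [_ nKr _ _ _] := tK; have nk := nKr _ (lvp r).
have := kernel_swap (ch_meas (nice_meas nf)) (ch_bdd (nice_bdd nf)) nk ng => h.
apply: etrans h _.
have m1 : (-1 : R) != 0 by rewrite oppr_eq0 oner_eq0.
have nk' : niceY (Kr (lv r) (fun y => K (- y))).
  have [h _] := affine_Rint (0 : MM) m1 nk.
  rewrite (_ : Kr (lv r) _ = (fun y => Kr (lv r) K (0 + -1 *: y)))//.
  by apply/funext => y; rewrite add0r scaleN1r /Kr /ann enormN.
have := kernel_swap (ch_meas (nice_meas ng)) (ch_bdd (nice_bdd ng)) nk' nf => h'.
have -> : \int[mu]_x (Gop (fun y => K (- y)) r g x * f x) =
   \int[leb R m.+1 n]_y (Kr (lv r) (fun y => K (- y)) y * \int[mu]_x (f x * ch g (x, y))).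
  by rewrite -h'; apply: eq_Rintegral => x _; rewrite mulrC.
pose J y := Kr (lv r) K y * \int[mu]_x (g x * ch f (x, y)).
have sw y : \int[mu]_x (f x * ch g (x, - y)) = \int[mu]_x (g x * ch f (x, y)).
  have nfg : nice (fun x => g x * ch f (x, y)) by exact: niceMM ng (shift_nice (row i y) nf).
  rewrite -(shift_int (- row i y) nfg); apply: eq_Rintegral => x _.
  rewrite /ch/= opprK addrK mulrC; congr (g _ * _); congr (_ + _).
  by apply/rowP => j; rewrite !mxE opprK.
have nJ : niceY J.
  have b : bdd (fun y => \int[mu]_x (g x * ch f (x, y))).
    have [B hB] := nice_bdd nf; exists (\int[mu]_x (`|g x| * B)) => y.
    have nfg : nice (fun x => g x * ch f (x, y)) by exact: niceMM ng (shift_nice (row i y) nf).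
    apply: le_trans (le_norm_int nfg) _; apply: le_int; first exact: nice_norm nfg.
      rewrite (_ : (fun x => _) = (fun x => B * `|g x|)); first exact: niceZ (nice_norm ng).
      by apply/funext => x; rewrite mulrC.
    by move=> x; rewrite normrM ler_wpM2l//; exact: hB.
  apply: niceM nk _ b.
  apply: (measurable_Rint _ (h := fun p : MM * V => g p.2 * ch f (p.2, p.1))).
  apply: measurable_funM; first exact: (measurableT_comp (nice_meas ng) measurable_snd).
  exact: (measurableT_comp (ch_meas (nice_meas nf)) (@measurable_swap _ _ _ _)).
have [_ e] := affine_Rint (0 : MM) m1 nJ.
move: e; rewrite normrN1 expr1n invr1 mul1r => <-; apply: eq_Rintegral => y _.
rewrite add0r scaleN1r /J -sw opprK; congr (_ * _).
by rewrite /Kr /ann enormN.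
Qed.

(** Testing [Dd j (Gop h)] against itself and moving everything else to the other side reduces to
    [Gop_Dd] for the reflected kernel. *)
Lemma Dd_Gop K r j h : tame C c K -> tame C c (fun y => K (- y)) -> nice h ->
  n2 (Dd j (Gop K r h)) <= G_const * b_rate ^+ dist r j * n2 h.
Proof.
move=> tK tK' nh; set u := Gop K r h; have nu : nice u := Gop_nice tK r nh.
have nD := Dd_nice l0_gt0 j nu.
have [z|nz] := eqVneq (n2 (Dd j u)) 0.
  rewrite z !mulr_ge0 ?n2_ge0 ?G_const_ge0// exprn_ge0//.
  by have /andP[/ltW] := b_rate01.
have np : 0 < n2 (Dd j u) by rewrite lt_def nz n2_ge0.
rewrite -(ler_pM2l np) -expr2 n2_sqr.
have -> : \int[mu]_x Dd j u x ^+ 2 = \int[mu]_x (Gop (fun y => K (- y)) r (Dd j u) x * h x).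
  rewrite -(Gop_adj r tK nh nD) -/u.
  apply: etrans (_ : _ = \int[mu]_x (Dd j u x * Dd j u x)) _.
    by apply: eq_Rintegral => x _; rewrite expr2.
  rewrite (Dd_sym j nu nD) (Dd_idem j nu).
  by apply: eq_Rintegral => x _; rewrite mulrC.
apply: le_trans (ler_norm _) (le_trans (int_CS (Gop_nice tK' r nD) nh) _).
apply: le_trans (ler_wpM2r (n2_ge0 _ h) (Gop_Dd tK' r j nu)) _.
by rewrite le_eqVlt; apply/orP; left; apply/eqP; ring.
Qed.

End linear_operator.

Section telescoping.
Context {R : realType}.

Definition between (r p t : nat) : bool := ((r <= t) && (t < p))%N || ((p <= t) && (t < r))%N.

(** The unit loss comes from the predictable index j - 1. *)
Lemma between_dist r j t : between r j.-1 t -> (dist r t <= dist r j + 1)%N.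
Proof. by rewrite /between /dist; case: j => [|j] /=; lia. Qed.

Lemma tele_between (g : nat -> R) r p L : (r <= L)%N -> (p <= L)%N ->
  `|g r - g p| <= \sum_(t < L) (between r p t)%:R * `|g t.+1 - g t|.
Proof.
have one r' p' : (r' <= p' <= L)%N -> `|g p' - g r'| <= \sum_(t < L) ((r' <= t) && (t < p'))%N%:R * `|g t.+1 - g t|.
  move=> /andP[rp pL]; rewrite -(telescope_sumr g rp); apply: le_trans (ler_norm_sum _ _ _) _.
  rewrite (big_nat_widenl _ 0)// (big_nat_widen _ _ L)// big_mkord big_mkcond/=.
  by apply: ler_sum => t _; case: (r' <= t)%N; case: (t < p')%N; rewrite ?mul1r ?mul0r.
have bet (A B : nat -> bool) : (forall t, A t -> B t) ->
    \sum_(t < L) (A t)%:R * `|g t.+1 - g t| <= \sum_(t < L) (B t)%:R * `|g t.+1 - g t|.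
  move=> AB; apply: ler_sum => t _; rewrite ler_wpM2r// ler_nat.
  by case: (boolP (A t)) => [/AB ->|].
move=> rL pL; have [rp|pr] := leqP r p.
  rewrite distrC; apply: le_trans (one r p _) _; first by rewrite rp.
  by apply: (bet (fun t => (r <= t) && (t < p))%N) => t h; rewrite /between h.
apply: le_trans (one p r _) _; first by rewrite ltnW.
by apply: (bet (fun t => (p <= t) && (t < r))%N) => t h; rewrite /between h orbT.
Qed.

(** Schur's test: rows and columns of c ^ |r - j| have sums at most 2 / (1 - c). *)
Lemma schur (c : R) (v : nat -> R) A B : 0 <= c < 1 ->
  \sum_(j < B) (\sum_(r < A) c ^+ dist r j * v r) ^+ 2 <= (2 * (1 - c)^-1) ^+ 2 * \sum_(r < A) v r ^+ 2.
Proof.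
move=> c01; have /andP[c0 c1] := c01.
have S0 : 0 <= 2 * (1 - c)^-1 by rewrite mulr_ge0// invr_ge0 subr_ge0 ltW.
apply: (@le_trans _ _ (\sum_(j < B) 2 * (1 - c)^-1 * \sum_(r < A) c ^+ dist j r * v r ^+ 2)).
  apply: ler_sum => j _.
  apply: le_trans (@wsum_CS R A (fun r => c ^+ dist r j) v _) _; first by move=> r; rewrite exprn_ge0.
  apply: ler_pM.
  - by apply: sumr_ge0 => r _; rewrite exprn_ge0.
  - by apply: sumr_ge0 => r _; apply: mulr_ge0; [exact: exprn_ge0|exact: sqr_ge0].
  - exact: dist_sum.
  by apply: ler_sum => r _; rewrite distC.
rewrite -mulr_sumr; set S := 2 * (1 - c)^-1 in S0 *; set Xs := \sum_(r < A) v r ^+ 2.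
rewrite (_ : S ^+ 2 * Xs = S * (S * Xs)); last by ring.
apply: ler_wpM2l => //; exact: (dist_sum2 B A c01 (fun k => sqr_ge0 (v k))).
Qed.

End telescoping.

(** * Martingale transforms *)

Section martingale.
Context {R : realType} {n : nat}.
Notation V := 'rV[R]_n.
Notation mu := (leb R 1 n).
Notation nice := (nice (leb R 1 n)).
Notation n2 := (n2 (leb R 1 n)).
Variable l0 : R.
Hypothesis l0_gt0 : 0 < l0.
Notation lv := (lv l0).
Notation E := (E l0).
Notation Dm := (Dm l0).
Notation Dd := (Dd l0).
Let lvp r : 0 < lv r := lv_gt0 l0_gt0 r.

Lemma E_sumr k N (h : nat -> V -> R) x : (forall j, nice (h j)) ->
  E k (fun y => \sum_(j < N) h j y) x = \sum_(j < N) E k (h j) x.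
Proof.
move=> nh; elim: N => [|N IH].
  rewrite big_ord0 (_ : (fun y => _) = (fun=> 0)); last by apply/funext => y; rewrite big_ord0.
  by rewrite E_id.
rewrite big_ord_recr/= -IH (_ : (fun y => _) = (fun y => (\sum_(j < N) h j y) + h N y)); last first.
  by apply/funext => y; rewrite big_ord_recr.
by rewrite !E_avg avgD//; exact: nice_sum.
Qed.

Lemma Dd_sumr k N (h : nat -> V -> R) x : (forall j, nice (h j)) ->
  Dd k (fun y => \sum_(j < N) h j y) x = \sum_(j < N) Dd k (h j) x.
Proof.
move=> nh; case: k => [|k] /=; first exact: E_sumr.
by rewrite /Dm !E_sumr// -sumrB.
Qed.

Variables (theta : nat -> V -> R) (Y : V -> R).
Hypotheses (th_meas : forall j, measurable_fun setT (theta j)) (th1 : forall j x, `|theta j x| <= 1).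
Hypotheses (th_cst : forall j, cst_on (lv j.-1) (theta j)) (nY : nice Y).

Let z j x := theta j x * Dd j Y x.
Let z_nice j : nice (z j).
Proof. by apply: niceMl => //; [exact: Dd_nice|exists 1]. Qed.

Definition Zsum k x := \sum_(j < k.+1) z j x.

Lemma Zsum_nice k : nice (Zsum k).
Proof. by apply: (nice_sum _ (fun j : 'I_k.+1 => z_nice j)). Qed.

Let z_cst j : cst_on (lv j) (z j).
Proof.
move=> x y s; congr (_ * _); last exact: (Dd_cst l0_gt0 Y s).
by apply: th_cst; apply: (same_lv l0_gt0 (leq_pred j) s).
Qed.

Lemma Zsum_cst k : cst_on (lv k) (Zsum k).
Proof.
move=> x y s; apply: eq_bigr => j _; apply: z_cst.
have jk : (j <= k)%N by rewrite -ltnS.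
exact: (same_lv l0_gt0 jk s).
Qed.

Let E_z k j x : (k < j)%N -> E k (z j) x = 0.
Proof.
case: j => // j; rewrite ltnS => kj.
rewrite -(E_le l0_gt0 (z_nice j.+1) kj) (_ : E j (z j.+1) = (fun=> 0)); first by rewrite E_id.
apply/funext => y; rewrite E_avg.
have := @avg_pull R n (lv j) (lvp j) (theta j.+1) (Dd j.+1 Y) y (Dd_nice l0_gt0 j.+1 nY).
move=> ->; first by rewrite -E_avg E_Dm0 ?mulr0.
by move=> w s; apply/esym/th_cst.
Qed.

(** The multipliers are predictable, [theta j] being constant on cubes of side [lv j.-1], so the
    later increments have conditional mean zero. Hence all partial sums are controlled by one
    maximal function ([Zsum_le]). *)
Lemma E_Zsum k L : (k <= L)%N -> E k (Zsum L) = Zsum k.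
Proof.
move=> kL; apply/funext => x; rewrite -(subnKC kL); elim: (L - k)%N => [|d IH].
  by rewrite addn0 E_id//; exact: Zsum_cst.
rewrite addnS -IH {1}/Zsum E_sumr// big_ord_recr/= E_z ?addr0; last by rewrite ltnS leq_addr.
by rewrite -E_sumr.
Qed.

Lemma Zsum_le k L x : (k <= L)%N -> `|Zsum k x| <= mxf l0 L (Zsum L) x.
Proof. by move=> kL; rewrite -(E_Zsum kL); apply: E_le_mxf => //; exact: Zsum_nice. Qed.

Lemma Zsum_n2 L : n2 (Zsum L) ^+ 2 <= \sum_(j < L.+1) n2 (Dd j Y) ^+ 2.
Proof.
have one j : n2 (z j) ^+ 2 <= n2 (Dd j Y) ^+ 2.
  rewrite lerXn2r ?nnegrE ?n2_ge0//; apply: le_n2 => //; first exact: Dd_nice.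
  by move=> x; rewrite normrM ler_piMl.
elim: L => [|L IH].
  rewrite big_ord1.
  have -> : Zsum 0 = z 0 by apply/funext => x; rewrite /Zsum big_ord1.
  exact: one.
rewrite big_ord_recr/=; apply: le_trans (lerD IH (one L.+1)).
have nZ := Zsum_nice L.
have -> : Zsum L.+1 = (fun x => Zsum L x + z L.+1 x).
  by apply/funext => x; rewrite /Zsum big_ord_recr.
have o : \int[mu]_x (Zsum L x * z L.+1 x) = 0.
  have nu : nice (fun x => Zsum L x * theta L.+1 x) by apply: niceM => //; exists 1.
  rewrite (_ : \int[mu]_x _ = \int[mu]_x (Zsum L x * theta L.+1 x * Dm L Y x)); last first.
    by apply: eq_Rintegral => x _; rewrite mulrA.
  apply: (int_cst_Dm l0_gt0 nu nY) => x y s.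
  by congr (_ * _); [exact: (@Zsum_cst L x y s)|exact: (@th_cst L.+1 x y s)].
rewrite n2_sqr.
have -> : \int[mu]_x (Zsum L x + z L.+1 x) ^+ 2 =
   \int[mu]_x (Zsum L x ^+ 2 + (2 * (Zsum L x * z L.+1 x) + z L.+1 x ^+ 2)).
  by apply: eq_Rintegral => x _; ring.
have nx := niceMM nZ (z_nice L.+1).
rewrite (intD (niceX2 nZ) (niceD (niceZ 2 nx) (niceX2 (z_nice L.+1)))) (intD (niceZ 2 nx) (niceX2 (z_nice L.+1))).
by rewrite (intZ _ nx) o mulr0 add0r -!n2_sqr.
Qed.

End martingale.

Section diagonal.
Context {R : realType} {m n : nat}.
Notation V := 'rV[R]_n.
Notation MM := 'M[R]_(m.+1, n).
Notation mu := (leb R 1 n).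
Notation nice := (nice (leb R 1 n)).
Notation n2 := (n2 (leb R 1 n)).
Variable l0 : R.
Hypothesis l0_gt0 : 0 < l0.
Notation lv := (lv l0).
Notation E := (E l0).
Notation Dm := (Dm l0).
Notation Dd := (Dd l0).
Let lvp r : 0 < lv r := lv_gt0 l0_gt0 r.
Hypothesis n0 : (0 < n)%N.
Variables (C c : R).
Hypotheses (C0 : 0 < C) (c01 : 0 < c < 1).
Variable K : MM -> R.
Hypotheses (tK : tame C c K) (tK' : tame C c (fun y => K (- y))).
Variables (f : 'I_m.+1 -> V -> R) (T T' : nat) (i : 'I_m.+1).
Hypotheses (nf : forall a, nice (f a)) (fT : forall a, cst_on (lv T) (f a)).
Hypothesis f1 : forall a, n2 (f a) <= 1.
Notation G r := (Gop l0 i K r (f i)).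
Notation GC := (@G_const R m n C c).

(** Square roots of rates share a decay between two indices: the smaller of b^p and b^q is at most
    [beta]^(p + q). The rate [gam] repeats this in order to gain decay in a third index. *)
Definition beta : R := Num.sqrt (b_rate c).
Definition gam : R := Num.sqrt beta.

Lemma beta01 : 0 < beta < 1.
Proof.
have /andP[h1 h2] := b_rate01 c01; rewrite sqrtr_gt0 h1/=.
by rewrite -[ltRHS]sqrtr1 ltr_sqrt.
Qed.

Lemma gam01 : 0 < gam < 1.
Proof.
have /andP[h1 h2] := beta01; rewrite sqrtr_gt0 h1/=.
by rewrite -[ltRHS]sqrtr1 ltr_sqrt.
Qed.

Let b0 : 0 <= beta < 1. Proof. by have /andP[/ltW -> ->] := beta01. Qed.
Let g0 : 0 <= gam < 1. Proof. by have /andP[/ltW -> ->] := gam01. Qed.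
Let GC0 : 0 <= GC. Proof. exact: G_const_ge0. Qed.

Let v r := \sum_(k < T.+1) beta ^+ dist r k * n2 (Dd k (f i)).
Let v_ge0 r : 0 <= v r.
Proof.
by apply: sumr_ge0 => k _; apply: mulr_ge0; [apply: exprn_ge0; case/andP: b0|exact: n2_ge0].
Qed.

Let nG r : nice (G r) := Gop_nice l0_gt0 i tK r (nf i).

(** The operator of scale r decays both in the distance of r to the input level k and to the output
    level j; the better of the two bounds is at most their geometric mean. The sum over k is
    collected in [v r], which is square summable in r. *)
Let Dd_G r j : n2 (Dd j (G r)) <= GC * beta ^+ dist r j * v r.
Proof.
have fE : f i = (fun x => \sum_(k < T.+1) Dd k (f i) x).
  by apply/funext => x; rewrite -Dd_sum E_id.
have nD k : nice (Dd k (f i)) := Dd_nice l0_gt0 k (nf i).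
have nGD k := Gop_nice l0_gt0 i tK r (nD k).
have e : Dd j (G r) = (fun x => \sum_(k < T.+1) Dd j (Gop l0 i K r (Dd k (f i))) x).
  rewrite {1}fE (_ : Gop l0 i K r _ = (fun x => \sum_(k < T.+1) Gop l0 i K r (Dd k (f i)) x)).
    by apply/funext => x; rewrite (@Dd_sumr _ _ _ l0_gt0 j T.+1 (fun k => Gop l0 i K r (Dd k (f i)))).
  by apply/funext => x; rewrite (Gop_sum l0_gt0 i tK r _ _ (fun k : 'I_T.+1 => nD k)).
rewrite e; apply: le_trans (n2_sum _ _) _; first by move=> k; exact: (Dd_nice l0_gt0 j (nGD k)).
rewrite mulr_sumr; apply: ler_sum => k _.
have /andP[bp b1] := b_rate01 c01.
have D0 := n2_ge0 mu (Dd k (f i)).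
have h1 := Dd_Gop l0_gt0 C0 c01 i r j tK tK' (nD k).
have h2 := le_trans (Dd_n2 l0_gt0 j (nGD k)) (Gop_Dd l0_gt0 C0 c01 i tK r k (nf i)).
have bsq : b_rate c = beta ^+ 2 by rewrite sqr_sqrtr// ltW.
have bb p q : (p <= q)%N -> beta ^+ (2 * q) <= beta ^+ (p + q).
  by move=> pq; apply: ler_wiXn2l; [case/andP: b0|case/andP: b0 => _ /ltW|rewrite mul2n -addnn leq_add2r].
rewrite -[GC * _ * _]mulrA [beta ^+ dist r j * _]mulrA -exprD mulrA.
have [jk|jk] := leqP (dist r j) (dist r k).
  apply: le_trans h2 _; rewrite ler_wpM2r// ler_wpM2l// bsq -exprM; exact: bb.
apply: le_trans h1 _; rewrite ler_wpM2r// ler_wpM2l// bsq -exprM addnC; apply: bb; exact: ltnW.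
Qed.

Let SB : R := 2 * (1 - beta)^-1.
Let SG : R := 2 * (1 - gam)^-1.

Let v_sqr : \sum_(r < T') v r ^+ 2 <= SB ^+ 2.
Proof.
have h : \sum_(r < T') v r ^+ 2 <= SB ^+ 2 * \sum_(k < T.+1) n2 (Dd k (f i)) ^+ 2.
  apply: le_trans (schur (fun k => n2 (Dd k (f i))) T.+1 T' b0).
  by apply: ler_sum => r _; rewrite /v le_eqVlt; apply/orP; left; apply/eqP; congr (_ ^+ 2); apply: eq_bigr => k _; rewrite distC.
apply: le_trans h _; rewrite ler_piMr ?sqr_ge0//.
apply: le_trans (Dd_bessel l0_gt0 _ (nf i)) _.
by rewrite -[leRHS](expr1n R 2) lerXn2r ?nnegrE ?n2_ge0.
Qed.

Let Y x := \sum_(r < T') G r x.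
Let nY : nice Y. Proof. by apply: (nice_sum _ (fun r : 'I_T' => nG r)). Qed.

Let Y_sqr L : \sum_(j < L.+1) n2 (Dd j Y) ^+ 2 <= (GC * SB ^+ 2) ^+ 2.
Proof.
apply: (@le_trans _ _ (\sum_(j < L.+1) (\sum_(r < T') beta ^+ dist r j * (GC * v r)) ^+ 2)).
  apply: ler_sum => j _; rewrite lerXn2r ?nnegrE ?n2_ge0//.
    apply: sumr_ge0 => r _; apply: mulr_ge0; first by apply: exprn_ge0; case/andP: b0.
    exact: mulr_ge0.
  have -> : Dd j Y = (fun x => \sum_(r < T') Dd j (G r) x).
    by apply/funext => x; rewrite (@Dd_sumr _ _ _ l0_gt0 j T' (fun r => G r)).
  apply: le_trans (n2_sum _ _) _; first by move=> r; exact: (Dd_nice l0_gt0 j (nG r)).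
  by apply: ler_sum => r _; apply: le_trans (Dd_G r j) _; rewrite -mulrA mulrCA.
apply: le_trans (schur (fun r => GC * v r) T' L.+1 b0) _.
rewrite -/SB (eq_bigr (fun r : 'I_T' => GC ^+ 2 * v r ^+ 2)) => [|r _]; last by rewrite exprMn.
rewrite -mulr_sumr (_ : (GC * SB ^+ 2) ^+ 2 = SB ^+ 2 * (GC ^+ 2 * SB ^+ 2)); last by ring.
by apply: ler_wpM2l; [exact: sqr_ge0|apply: ler_wpM2l; [exact: sqr_ge0|exact: v_sqr]].
Qed.

(** The cost of evaluating the coefficient of [Dd j (G r)] at level j - 1 instead of r: telescoping
    over the levels t in between produces a second martingale difference, that of f a. *)
Let Hs L a x := \sum_(r < T') \sum_(j < L.+1) \sum_(t < L)
  (between r (j : nat).-1 t)%:R * (`|Dm t (f a) x| * `|Dd j (G r) x|).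

Let nHt a r j t : nice (fun x => `|Dm t (f a) x| * `|Dd j (G r) x|).
Proof.
by have := niceMM (nice_norm (Dm_nice l0_gt0 t (nf a))) (nice_norm (Dd_nice l0_gt0 j (nG r))).
Qed.

Let Hs_nice L a : nice (Hs L a).
Proof.
do 3 (apply: nice_sum => ?).
apply: niceZ; exact: nHt.
Qed.

Definition H_const : R := GC * gam^-1 * SG ^+ 2 * (1 + SB ^+ 2).

Let Hs_int L a : \int[mu]_x Hs L a x <= H_const.
Proof.
have /andP[gp g1] := gam01.
pose d t := n2 (Dm t (f a)).
have d0 t : 0 <= d t by exact: n2_ge0.
have gsq : beta = gam ^+ 2 by rewrite sqr_sqrtr//; case/andP: b0.
have e : \int[mu]_x Hs L a x = \sum_(r < T') \sum_(j < L.+1) \sum_(t < L)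
   (between r (j : nat).-1 t)%:R * \int[mu]_x (`|Dm t (f a) x| * `|Dd j (G r) x|).
  rewrite int_sum => [|r]; last by do 2 (apply: nice_sum => ?); apply: niceZ; exact: nHt.
  apply: eq_bigr => r _; rewrite int_sum => [|j]; last by apply: nice_sum => t; apply: niceZ; exact: nHt.
  apply: eq_bigr => j _; rewrite int_sum => [|t]; last by apply: niceZ; exact: nHt.
  by apply: eq_bigr => t _; rewrite (intZ _ (nHt a r j t)).
rewrite e; apply: (@le_trans _ _ (\sum_(r < T') \sum_(j < L.+1) \sum_(t < L)
   GC * gam^-1 * (gam ^+ dist r j * (gam ^+ dist r t * (d t ^+ 2 + v r ^+ 2))))).
  apply: ler_sum => r _; apply: ler_sum => j _; apply: ler_sum => t _.
  have Q0 : 0 <= gam ^+ dist r t * (d t ^+ 2 + v r ^+ 2).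
    by apply: mulr_ge0; [apply: exprn_ge0; exact: ltW|apply: addr_ge0; exact: sqr_ge0].
  have Gg0 : 0 <= GC * gam^-1 by rewrite mulr_ge0// invr_ge0 ltW.
  case: (boolP (between r (j : nat).-1 t)) => [bt|_]; last first.
    by rewrite mul0r; apply: mulr_ge0 => //; apply: mulr_ge0 => //; apply: exprn_ge0; exact: ltW.
  rewrite mul1r.
  have h := int_CS (nice_norm (Dm_nice l0_gt0 t (nf a))) (nice_norm (Dd_nice l0_gt0 j (nG r))).
  apply: le_trans (le_trans (ler_norm _) h) _; rewrite !n2_norm -/(d t).
  apply: le_trans (ler_wpM2l (d0 t) (Dd_G r j)) _.
  have dl := between_dist bt.
  (* As beta = gam^2, one factor of decay in j is kept and the other becomes decay in t, which lies
     between r and j - 1; the inverse of gam pays for the index shift. *)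
  have hb : beta ^+ dist r j <= gam^-1 * (gam ^+ dist r j * gam ^+ dist r t).
    rewrite ler_pdivlMl// -exprD gsq -exprM -exprS; apply: ler_wiXn2l; [exact: ltW|exact: ltW|].
    by rewrite mul2n -addnn -addnS leq_add2l -addn1.
  have -> : d t * (GC * beta ^+ dist r j * v r) = GC * (beta ^+ dist r j * (d t * v r)) by ring.
  have -> : GC * gam^-1 * (gam ^+ dist r j * (gam ^+ dist r t * (d t ^+ 2 + v r ^+ 2))) =
     GC * (gam^-1 * (gam ^+ dist r j * gam ^+ dist r t) * (d t ^+ 2 + v r ^+ 2)) by ring.
  rewrite ler_wpM2l//; apply: ler_pM => //.
  - by apply: exprn_ge0; case/andP: b0.
  - exact: mulr_ge0.
  have := sqr_ge0 (d t - v r); have := sqr_ge0 (d t); have := sqr_ge0 (v r); nra.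
have S0 : 0 <= SG by rewrite /SG mulr_ge0// invr_ge0 subr_ge0 ltW.
apply: (@le_trans _ _ (\sum_(r < T') GC * gam^-1 * SG * \sum_(t < L) (gam ^+ dist r t * (d t ^+ 2 + v r ^+ 2)))).
  apply: ler_sum => r _; rewrite exchange_big/= mulr_sumr; apply: ler_sum => t _.
  have Q0 : 0 <= gam ^+ dist r t * (d t ^+ 2 + v r ^+ 2).
    by apply: mulr_ge0; [apply: exprn_ge0; exact: ltW|apply: addr_ge0; exact: sqr_ge0].
  rewrite -mulr_sumr -mulr_suml -[GC * _ * SG * _]mulrA.
  apply: ler_wpM2l; first by rewrite mulr_ge0// invr_ge0 ltW.
  apply: ler_wpM2r => //; rewrite (eq_bigr (fun j : 'I_L.+1 => gam ^+ dist j r)) => [|j _]; last by rewrite distC.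
  exact: dist_sum.
rewrite -mulr_sumr /H_const (_ : GC / gam * SG ^+ 2 * (1 + SB ^+ 2) = GC / gam * SG * (SG * (1 + SB ^+ 2))); last by ring.
apply: ler_wpM2l; first by apply: mulr_ge0 => //; apply: mulr_ge0 => //; rewrite invr_ge0 ltW.
rewrite (eq_bigr (fun r : 'I_T' => \sum_(t < L) gam ^+ dist r t * d t ^+ 2 + \sum_(t < L) gam ^+ dist t r * v r ^+ 2)); last first.
  by move=> r _; rewrite -big_split/=; apply: eq_bigr => t _; rewrite mulrDr [dist t r]distC.
rewrite big_split/= mulrDr mulr1; apply: lerD.
  apply: le_trans (dist_sum2 T' L g0 (fun t => sqr_ge0 (d t))) _.
  rewrite -/SG ler_piMr//.
  have := bessel_shift l0_gt0 0 L (nf a) => h.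
  apply: le_trans h _.
  by rewrite -[leRHS](expr1n R 2) lerXn2r ?nnegrE ?n2_ge0.
rewrite exchange_big/=.
apply: le_trans (dist_sum2 L T' g0 (fun r => sqr_ge0 (v r))) _.
by rewrite -/SG ler_wpM2l.
Qed.

Let Rm L r x := G r x - E L (G r) x.
Let nR L r : nice (Rm L r). Proof. exact: niceB (nG r) (E_nice l0_gt0 L (nG r)). Qed.

(** [Gop] commutes with translations, so [G r] inherits the translation modulus of f i, which is
    constant on cubes of side [lv T]; the distance to the average over cubes of side [lv L] is
    controlled by this modulus. *)
Let Rm_n2 L r : n2 (Rm L r) ^+ 2 <=
  (3 * n%:R + 1) ^+ n * @vol R 1 n 1 * (C ^+ 2 * (4 * n.+1%:R * (3 * lv L / lv T))).
Proof.
have lvL := lvp L.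
set A := C ^+ 2 * _.
have A0 : 0 <= A.
  rewrite /A mulr_ge0 ?sqr_ge0// mulr_ge0// divr_ge0// ?mulr_ge0// ltW//.
have hA (w : V) : (forall j, `|w 0 j| <= 3 * lv L) -> \int[mu]_x (G r (x - w) - G r x) ^+ 2 <= A.
  move=> hw; pose h x := f i (x - w) - f i x.
  have nh : nice h := niceB (shift_nice w (nf i)) (nf i).
  have e : (fun x => G r (x - w) - G r x) = Gop l0 i K r h.
    apply/funext => x; rewrite (GopB l0_gt0 i tK r x (shift_nice w (nf i)) (nf i)); congr (_ - _).
    by apply: eq_Rintegral => y _; rewrite addrAC.
  have -> : \int[mu]_x (G r (x - w) - G r x) ^+ 2 = n2 (Gop l0 i K r h) ^+ 2.
    by rewrite n2_sqr -e.
  have h1 := Gop_n2 l0_gt0 C0 i tK r nh.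
  have h2 : n2 (Gop l0 i K r h) ^+ 2 <= C ^+ 2 * n2 h ^+ 2.
    by rewrite -exprMn lerXn2r ?nnegrE ?n2_ge0// mulr_ge0 ?n2_ge0// ltW.
  apply: le_trans h2 _; rewrite /A ler_wpM2l ?sqr_ge0//.
  have h30 : 0 <= 3 * lv L by rewrite mulr_ge0// ltW.
  have := translation (lvp T) (nf i) (fT i) hw h30 => h3; apply: le_trans h3 _.
  rewrite ler_piMr//; first by rewrite mulr_ge0// divr_ge0// ltW.
  by rewrite -[leRHS](expr1n R 2) lerXn2r ?nnegrE ?n2_ge0.
apply: le_trans (osc_int_gen n0 lvL (nG r) A0 hA).
rewrite n2_sqr; apply: le_int; [exact: niceX2|exact: osc_nice|move=> x].
pose u y := G r y - G r x.
have ln0 : lv L ^+ n != 0 by rewrite gt_eqF// exprn_gt0.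
have [ns is_] := int_same x lvL; have ng := sf_nice lvL x (nG r).
have mu_ : measurable_fun setT u by apply: measurable_funB => //; exact: nice_meas (nG r).
have bu : bdd u.
  have [B hB] := nice_bdd (nG r); exists (B + B) => y.
  by apply: le_trans (ler_normB _ _) _; apply: lerD.
have e1 : Rm L r x = - (lv L ^- n * \int[mu]_y ((same (lv L) x y)%:R * u y)).
  have -> : \int[mu]_y ((same (lv L) x y)%:R * u y) =
      \int[mu]_y ((same (lv L) x y)%:R * G r y - G r x * (same (lv L) x y)%:R).
    by apply: eq_Rintegral => y _; rewrite /u; ring.
  rewrite (intB ng (niceZ _ ns)) (intZ _ ns) is_ /Rm E_avg /avg /kop.
  by move: ln0; move: (lv L ^+ n) => w w0; field.
have ln1 : 0 <= lv L ^- n by rewrite invr_ge0 exprn_ge0// ltW.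
have h := wCS ns (fun y => ler0n R _) mu_ bu.
rewrite is_ in h.
rewrite e1 sqrrN exprMn.
apply: le_trans (ler_wpM2l (sqr_ge0 _) h) _.
rewrite mulrA (_ : lv L ^- n ^+ 2 * lv L ^+ n = lv L ^- n); last by rewrite expr2 -mulrA mulVf// mulr1.
rewrite /osc; apply: ler_wpM2l => //.
apply: le_int.
- by apply: same_nice => //; [exact: measurable_funX|have [B hB] := bu; exists (B ^+ 2) => y; rewrite normrX lerXn2r ?nnegrE// (le_trans _ (hB y))].
- by apply: near_nice => //; [exact: measurable_funX|have [B hB] := bu; exists (B ^+ 2) => y; rewrite normrX lerXn2r ?nnegrE// (le_trans _ (hB y))].
move=> y; rewrite ler_wpM2r ?sqr_ge0//; case: (boolP (same (lv L) x y)) => [/same_near2 ->//|_].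
exact: ler0n.
Qed.

(** [G r] need not be constant on cubes of any level, so its martingale expansion has a remainder.
    The level L depends on T and T', but enters no constant. T' <= L lets the maximal function up to
    L dominate all the averages that occur. *)
Lemma large_level : exists L, (T' <= L)%N /\ \sum_(r < T') n2 (Rm L r) <= 1.
Proof.
set Q := (3 * n%:R + 1) ^+ n * @vol R 1 n 1 * (C ^+ 2 * (4 * n.+1%:R * (3 * 2 ^+ T))).
have Q0 : 0 <= Q.
  by rewrite /Q !mulr_ge0 ?exprn_ge0 ?vol_ge0 ?addr_ge0 ?mulr_ge0 ?(ltW C0).
pose q := T'%:R ^+ 2 * Q.
have q0 : 0 <= q by apply: mulr_ge0; rewrite ?sqr_ge0.
pose L0 := Num.bound q.
exists (maxn T' L0); split; first exact: leq_maxl.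
set L := maxn T' L0.
have hL : q <= 2 ^+ L.
  apply: le_trans (_ : L0%:R <= _); first by apply: ltW; have := archi_boundP q0.
  rewrite -natrX ler_nat; apply: leq_trans (leq_maxr T' L0) _; rewrite -/L.
  exact: ltnW (ltn_expl L (ltnSn 1)).
have one r : T'%:R * n2 (Rm L r) <= 1.
  rewrite -(@ler_pXn2r _ 2) ?nnegrE ?mulr_ge0 ?n2_ge0// expr1n exprMn.
  apply: le_trans (ler_wpM2l (sqr_ge0 _) (Rm_n2 L r)) _.
  have p2 : 0 < 2 ^+ L :> R by rewrite exprn_gt0.
  have e : lv L / lv T = 2 ^+ T / 2 ^+ L.
    have p1 : (2 ^+ T : R) != 0 by rewrite expf_neq0.
    have l00 : l0 != 0 by rewrite gt_eqF.
    rewrite /lv; move: (2 ^+ L : R) (2 ^+ T : R) (lt0r_neq0 p2) p1 => x y x0 y0.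
    by field; rewrite ?x0 ?y0 ?l00.
  rewrite -[3 * lv L / lv T]mulrA e.
  apply: (@le_trans _ _ (q / 2 ^+ L)); last by rewrite ler_pdivrMr// mul1r.
  rewrite le_eqVlt; apply/orP; left; apply/eqP; rewrite /q /Q.
  move: (2 ^+ L : R)^-1 (2 ^+ T : R) ((3 * n%:R + 1 : R) ^+ n) (@vol R 1 n 1) (n.+1%:R : R) (T'%:R : R) => x1 x2 x3 x4 x5 x6.
  by ring.
have [->|T0] := posnP T'; first by rewrite big_ord0.
rewrite (le_trans (_ : _ <= \sum_(r < T') T'%:R^-1))//.
  by apply: ler_sum => r _; rewrite -[leRHS]mulr1 ler_pdivlMl ?ltr0n.
by rewrite sumr_const card_ord -[leLHS]mulr_natl mulfV// pnatr_eq0 -lt0n.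
Qed.

(** A factor 2 from Abel summation, a factor 2 from Doob's inequality, and 1 for the remainders of
    [large_level]. *)
Definition M_const : R := 4 * (GC * SB ^+ 2) + 1.

(** A pointwise bound, since the left-hand side is not a sum that the quasi-norm can take apart. M,
    bounded in L^2, goes with the m remaining maximal functions; H a, bounded in L^1, with the m - 1
    functions other than f i and f a. *)
Lemma diagonal_term : exists L (M : V -> R) (H : 'I_m.+1 -> V -> R),
  [/\ nice M /\ (forall x, 0 <= M x), n2 M <= M_const,
   (forall a, nice (H a)) /\ (forall a x, 0 <= H a x), (forall a, \int[mu]_x H a x <= H_const) &
   forall x, `|\sum_(r < T') (\prod_(a | a != i) E r (f a) x) * G r x| <=
     (\prod_(a | a != i) mxf l0 L (f a) x) * M x +
     \sum_(a | a != i) (\prod_(b | (b != i) && (b != a)) mxf l0 L (f b) x) * H a x].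
Proof.
have [L [TL hL]] := large_level.
pose al r x := \prod_(a | a != i) E r (f a) x.
pose mx k x := \prod_(a | a != i) mxf l0 k (f a) x.
have mx0 k x : 0 <= mx k x by apply: prodr_ge0 => a _; exact: mxf_ge0.
have mxS k x : mx k x <= mx k.+1 x.
  by apply: ler_prod => a _; apply/andP; split; [exact: mxf_ge0|exact: mxf_nd].
have mx_nd k k' x : (k <= k')%N -> mx k x <= mx k' x.
  by move=> kk; apply: ler_prod => a _; apply/andP; split; [exact: mxf_ge0|exact: mxf_nd].
have al_mx r x : `|al r x| <= mx r x.
  by rewrite /al normr_prod; apply: ler_prod => a _; rewrite normr_ge0/=; apply: E_le_mxf.
(* A predictable multiplier of modulus at most 1; dividing by the increasing products of maximal
   functions leaves monotone weights for Abel summation. Where [mx] vanishes so does [al], and the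
   quotient is 0. *)
pose theta j x := al j.-1 x / mx j.-1 x.
have mal r : measurable_fun setT (al r).
  rewrite (_ : al r = (fun x => \prod_a (if a != i then E r (f a) x else 1))); last first.
    by apply/funext => x; rewrite /al big_mkcond.
  apply: measurable_prodr => a; case: (a != i); last exact: measurable_cst.
  exact: nice_meas (E_nice l0_gt0 r (nf a)).
have mmx r : measurable_fun setT (mx r).
  rewrite (_ : mx r = (fun x => \prod_a (if a != i then mxf l0 r (f a) x else 1))); last first.
    by apply/funext => x; rewrite /mx big_mkcond.
  apply: measurable_prodr => a; case: (a != i); last exact: measurable_cst.
  exact: nice_meas (mxf_nice l0_gt0 r (nf a)).
have th_meas j : measurable_fun setT (theta j).
  rewrite (_ : theta j = (fun x => al j.-1 x * (mx j.-1 x) `^ (-1))); last first.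
    by apply/funext => x; rewrite powR_inv1.
  apply: measurable_funM => //; exact: (measurableT_comp (measurable_powR (-1)) (mmx j.-1)).
have th1 j x : `|theta j x| <= 1.
  rewrite /theta normrM normfV (ger0_norm (mx0 _ _)).
  have [z|nz] := eqVneq (mx j.-1 x) 0; first by rewrite z invr0 mulr0.
  by rewrite ler_pdivrMr ?mul1r// lt_def nz mx0.
have th_cst j : cst_on (lv j.-1) (theta j).
  move=> x y s; rewrite /theta; congr (_ / _); apply: eq_bigr => a _.
    exact: (E_cst (f a) s).
  by first [exact: (mxf_cst l0_gt0 _ _ s)|exact: (@mxf_cst _ _ _ l0_gt0 _ _ x y s)|exact: (@mxf_cst _ _ _ _ _ x y s)].
have thE j x : theta j x * mx j.-1 x = al j.-1 x.
  rewrite /theta; have [z|nz] := eqVneq (mx j.-1 x) 0; last by rewrite divfK.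
  rewrite z mulr0; apply/esym/eqP; rewrite -normr_le0.
  by apply: le_trans (al_mx _ _) _; rewrite z.
pose Z := Zsum l0 theta Y.
have nZ : nice (Z L) := Zsum_nice l0_gt0 th_meas th1 nY L.
pose M x := 2 * mxf l0 L (Z L) x + \sum_(r < T') `|Rm L r x|.
have nM2 : nice (fun x => 2 * mxf l0 L (Z L) x) by apply: niceZ; exact: mxf_nice.
have nMs : nice (fun x => \sum_(r < T') `|Rm L r x|).
  by apply: (nice_sum _ (fun r : 'I_T' => nice_norm (nR L r))).
exists L, M, (Hs L); split.
- split; first exact: niceD.
  by move=> x; rewrite addr_ge0 ?mulr_ge0 ?mxf_ge0//; apply: sumr_ge0.
- apply: le_trans (n2D nM2 nMs) _; apply: lerD.
    rewrite (n2Z _ (mxf_nice l0_gt0 L nZ)) ger0_norm// (_ : 4 = 2 * 2 :> R); last by ring.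
    rewrite -mulrA ler_wpM2l//; apply: le_trans (doob l0_gt0 L nZ) _; rewrite ler_wpM2l//.
    have GS0 : 0 <= GC * SB ^+ 2 by apply: mulr_ge0 => //; exact: sqr_ge0.
    rewrite -(@ler_pXn2r _ 2) ?nnegrE ?n2_ge0//.
    exact: le_trans (Zsum_n2 l0_gt0 th_meas th1 th_cst nY L) (Y_sqr L).
  apply: le_trans (n2_sum _ (fun r : 'I_T' => nice_norm (nR L r))) _.
  by apply: le_trans hL; apply: ler_sum => r _; rewrite n2_norm.
- split; first by move=> a; exact: Hs_nice.
  move=> a x; do 3 (apply: sumr_ge0 => ? _).
  by rewrite mulr_ge0// mulr_ge0.
- by move=> a; exact: Hs_int.
move=> x.
have GE r : G r x = \sum_(j < L.+1) Dd j (G r) x + Rm L r x.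
  by rewrite /Rm -Dd_sum addrC subrK.
(* The terms with predictable coefficients, which form a weighted martingale transform of Y; the
   error of changing the coefficients; the remainders of the [G r]. *)
have X1 : \sum_(r < T') al r x * G r x =
   \sum_(j < L.+1) al (j : nat).-1 x * Dd j Y x +
   (\sum_(r < T') \sum_(j < L.+1) (al r x - al (j : nat).-1 x) * Dd j (G r) x + \sum_(r < T') al r x * Rm L r x).
  have -> : \sum_(j < L.+1) al (j : nat).-1 x * Dd j Y x =
     \sum_(r < T') \sum_(j < L.+1) al (j : nat).-1 x * Dd j (G r) x.
    rewrite exchange_big/=; apply: eq_bigr => j _.
    by rewrite (@Dd_sumr _ _ _ l0_gt0 j T' (fun r => G r))// mulr_sumr.
  rewrite -!big_split/=; apply: eq_bigr => r _.
  rewrite addrA -big_split/= GE mulrDr; congr (_ + _); rewrite mulr_sumr.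
  by apply: eq_bigr => j _; rewrite -mulrDl addrC subrK.
rewrite -/(al _ x) X1 /M mulrDr -addrA.
apply: le_trans (ler_normD _ _) _; apply: lerD.
  have hZ k : (k <= L)%N -> `|\sum_(j < k.+1) (theta j x * Dd j Y x)| <= mxf l0 L (Z L) x.
    by move=> kL; exact: (Zsum_le l0_gt0 th_meas th1 th_cst nY x kL).
  have := @abel_bound R (fun k => mx k x) (fun j => theta j x * Dd j Y x) (mxf l0 L (Z L) x) L
    (fun k => mx0 k x) (fun k => mxS k x) hZ.
  have -> : \sum_(j < L.+1) al (j : nat).-1 x * Dd j Y x =
      mx 0%N x * (theta 0%N x * Dd 0 Y x) + \sum_(j < L) mx j x * (theta j.+1 x * Dd j.+1 Y x).
    rewrite big_ord_recl; congr (_ + _).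
      by rewrite -(thE 0%N x) mulrAC mulrC.
    by apply: eq_bigr => j _; rewrite -(thE (bump 0 j)) mulrAC mulrC.
  move=> hab; apply: le_trans hab _; rewrite -/(mx L x) le_eqVlt; apply/orP; left; apply/eqP.
  by ring.
apply: le_trans (ler_normD _ _) _; rewrite addrC; apply: lerD; last first.
  apply: le_trans (ler_norm_sum _ _ _) _; rewrite mulr_sumr; apply: ler_sum => r _.
  rewrite normrM ler_wpM2r//; apply: le_trans (al_mx _ _) _; apply: mx_nd.
  by apply: leq_trans TL; exact: ltnW.
(* The entry 1 at i lets [prod_diff] run over all indices; its own difference vanishes. *)
pose u t a := if a == i then 1 else E t (f a) x.
pose B a := if a == i then 1 else mxf l0 L (f a) x.
have uB t a : (t <= L)%N -> `|u t a| <= B a.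
  by move=> tL; rewrite /u /B; case: (a == i); rewrite ?normr1//; apply: E_le_mxf.
have alu t : al t x = \prod_a u t a.
  by rewrite /al big_mkcond/=; apply: eq_bigr => a _; rewrite /u; case: (a == i).
have Pb a : a != i -> \prod_(b | b != a) B b = \prod_(b | (b != i) && (b != a)) mxf l0 L (f b) x.
  move=> ai; rewrite [LHS]big_mkcond [RHS]big_mkcond/=; apply: eq_bigr => b _; rewrite /B.
  by case: (b == i); case: (b == a).
have step t : (t < L)%N -> `|al t.+1 x - al t x| <=
    \sum_(a | a != i) (\prod_(b | (b != i) && (b != a)) mxf l0 L (f b) x) * `|Dm t (f a) x|.
  move=> tL; rewrite !alu; apply: le_trans (prod_diff (fun a => uB t.+1 a tL) (fun a => uB t a (ltnW tL))) _.
  rewrite (bigD1 i)//= [X in X + _](_ : _ = 0); last first.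
    by rewrite (bigD1 i)//= eqxx /u eqxx subrr normr0 mul0r.
  rewrite add0r; apply: ler_sum => a ai; rewrite (bigD1 a)//= eqxx /u (negbTE ai) mulrC -(Pb a ai).
  rewrite -/(Dm t (f a) x) ler_wpM2r// le_eqVlt; apply/orP; left; apply/eqP.
  by apply: eq_bigr => b /negbTE ->.
pose P a := \prod_(b | (b != i) && (b != a)) mxf l0 L (f b) x.
have -> : \sum_(a | a != i) P a * Hs L a x = \sum_(r < T') \sum_(j < L.+1) \sum_(t < L)
   (between r (j : nat).-1 t)%:R * (\sum_(a | a != i) P a * `|Dm t (f a) x|) * `|Dd j (G r) x|.
  rewrite (eq_bigr (fun a => \sum_(r < T') \sum_(j < L.+1) \sum_(t < L)
     (between r (j : nat).-1 t)%:R * (P a * `|Dm t (f a) x|) * `|Dd j (G r) x|)); last first.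
    move=> a _; rewrite /Hs mulr_sumr; apply: eq_bigr => r _; rewrite mulr_sumr; apply: eq_bigr => j _.
    by rewrite mulr_sumr; apply: eq_bigr => t _; ring.
  rewrite exchange_big/=; apply: eq_bigr => r _; rewrite exchange_big/=; apply: eq_bigr => j _.
  rewrite exchange_big/=; apply: eq_bigr => t _.
  by rewrite -mulr_suml -mulr_sumr.
apply: le_trans (ler_norm_sum _ _ _) _; apply: ler_sum => r _.
apply: le_trans (ler_norm_sum _ _ _) _; apply: ler_sum => j _.
have rL : (r <= L)%N by apply: leq_trans TL; exact: ltnW.
have pL : (j.-1 <= L)%N by rewrite -ltnS; apply: leq_ltn_trans (leq_pred j) _.
rewrite normrM -mulr_suml ler_wpM2r//.
apply: le_trans (tele_between (fun t => al t x) rL pL) _; apply: ler_sum => t _.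
by rewrite ler_wpM2l//; exact: step.
Qed.

End diagonal.

(** * Summation over the scales *)

Section power_means.
Context {R : realType}.

(** A crude bound valid for exponents on both sides of 1, since it serves for 2 / (m+1) as well as
    for q and n + 1. *)
Lemma powR_sum_card (I : finType) (u : I -> R) (p : R) : (forall i, 0 <= u i) -> 0 < p ->
  (\sum_i u i) `^ p <= #|I|%:R `^ p * \sum_i u i `^ p.
Proof.
move=> u0 p0; set Q := \sum_i u i `^ p.
have Q0 : 0 <= Q by apply: sumr_ge0 => i _; exact: powR_ge0.
have pi0 : 0 <= p^-1 by rewrite invr_ge0 ltW.
have one i : u i <= Q `^ p^-1.
  have -> : u i = (u i `^ p) `^ p^-1 by rewrite -powRrM mulfV ?gt_eqF// powRr1.
  apply: ge0_ler_powR; rewrite ?nnegrE ?powR_ge0//.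
  by rewrite /Q (bigD1 i)//= lerDl; apply: sumr_ge0 => j _; exact: powR_ge0.
have h : \sum_i u i <= #|I|%:R * Q `^ p^-1.
  apply: (@le_trans _ _ (\sum_(i : I) Q `^ p^-1)); first by apply: ler_sum => i _; exact: one.
  by rewrite sumr_const mulr_natl.
have s0 : 0 <= \sum_i u i by exact: sumr_ge0.
apply: (@le_trans _ _ ((#|I|%:R * Q `^ p^-1) `^ p)).
  by apply: ge0_ler_powR; rewrite ?nnegrE ?(ltW p0)// (le_trans s0 h).
by rewrite powRM ?powR_ge0// -powRrM mulVf ?gt_eqF// powRr1.
Qed.

(** AM-GM with m+1 entries, namely w a ^ 2 for a outside S and h ^ (2 / |S|) repeated |S| times. *)
Lemma geometric_split m (S : {set 'I_m.+1}) (w : 'I_m.+1 -> R) h : (0 < #|S|)%N ->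
  (forall a, 0 <= w a) -> 0 <= h ->
  ((\prod_(a | a \notin S) w a) * h) `^ (2 / m.+1%:R) <= \sum_a w a ^+ 2 + h `^ (2 / #|S|%:R).
Proof.
move=> S0 w0 h0; have Sn : #|S|%:R != 0 :> R by rewrite pnatr_eq0 -lt0n.
pose v a := if a \in S then h `^ (2 / #|S|%:R) else w a ^+ 2.
have v0 a : 0 <= v a by rewrite /v; case: (a \in S); rewrite ?powR_ge0 ?sqr_ge0.
have P0 : 0 <= (\prod_(a | a \notin S) w a) * h by rewrite mulr_ge0// prodr_ge0.
have := agm_mean v0.
have -> : \prod_a v a = ((\prod_(a | a \notin S) w a) * h) ^+ 2.
  rewrite (bigID (mem S))/= exprMn mulrC; congr (_ * _).
    by rewrite -prodrXl; apply: eq_bigr => a /negbTE aS; rewrite /v aS.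
  rewrite (eq_bigr (fun=> h `^ (2 / #|S|%:R))) => [|a aS]; last by rewrite /v aS.
  by rewrite prodr_const -powR_mulrn ?powR_ge0// -powRrM divfK// powR_mulrn.
rewrite -powR_mulrn// -powRrM => /le_trans; apply.
rewrite ler_pdivrMr// (bigID (mem S))/=.
have n1 : 1 <= m.+1%:R :> R by rewrite ler1n.
have H0 : 0 <= h `^ (2 / #|S|%:R) by exact: powR_ge0.
have W0 : 0 <= \sum_a w a ^+ 2 by apply: sumr_ge0 => a _; exact: sqr_ge0.
have e1 : \sum_(a in S) v a <= h `^ (2 / #|S|%:R) * m.+1%:R.
  rewrite (eq_bigr (fun=> h `^ (2 / #|S|%:R))) => [|a aS]; last by rewrite /v aS.
  rewrite sumr_const -[leLHS]mulr_natr; apply: ler_wpM2l => //; rewrite ler_nat.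
  by apply: leq_trans (max_card _) _; rewrite card_ord.
have e2 : \sum_(a | a \notin S) v a <= \sum_a w a ^+ 2.
  rewrite [leRHS](bigID (mem S))/= (eq_bigr (fun a => w a ^+ 2)) => [|a /negbTE aS]; last by rewrite /v aS.
  by rewrite lerDr; apply: sumr_ge0 => a _; exact: sqr_ge0.
have e3 : \sum_a w a ^+ 2 <= (\sum_a w a ^+ 2) * m.+1%:R by rewrite ler_peMr.
by rewrite mulrDl addrC; apply: lerD => //; exact: le_trans e2 e3.
Qed.

End power_means.

Section real_bound.
Context {R : realType} {m n : nat}.
Notation V := 'rV[R]_n.
Notation MM := 'M[R]_(m.+1, n).
Notation mu := (leb R 1 n).
Notation niceY := (nice (leb R m.+1 n)).
Notation nice := (nice (leb R 1 n)).
Notation n2 := (n2 (leb R 1 n)).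
Notation p := (2 / m.+1%:R : R).

Let p0 : 0 < p. Proof. by rewrite divr_gt0. Qed.

Section one.
Variable l0 : R.
Hypothesis l0_gt0 : 0 < l0.
Notation lv := (lv l0).
Notation E := (E l0).
Let lvp r : 0 < lv r := lv_gt0 l0_gt0 r.
Hypothesis n0 : (0 < n)%N.
Variables (C c : R).
Hypotheses (C0 : 0 < C) (c01 : 0 < c < 1).
Variable K : MM -> R.
Hypotheses (tK : tame C c K) (tK' : tame C c (fun y => K (- y))).
Variables (f : 'I_m.+1 -> V -> R) (T T' : nat).
Hypotheses (nf : forall a, nice (f a)) (fT : forall a, cst_on (lv T) (f a)).
Hypothesis f1 : forall a, n2 (f a) <= 1.

Let mprod (P : pred 'I_m.+1) L : measurable_fun setT (fun x => \prod_(a | P a) mxf l0 L (f a) x).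
Proof.
rewrite (_ : (fun x => _) = (fun x => \prod_a (if P a then mxf l0 L (f a) x else 1))); last first.
  by apply/funext => x; rewrite big_mkcond.
apply: measurable_prodr => a; case: (P a); last exact: measurable_cst.
exact: nice_meas (mxf_nice l0_gt0 L (nf a)).
Qed.

(** Plays the role of Hölder's inequality in the quasi-norm: the factor carrying the differences is
    measured with exponent 2 / |S|, the maximal functions in L^2, where Doob's inequality gives
    squared norms at most 4. *)
Lemma term_int (S : {set 'I_m.+1}) L (h : V -> R) B : (0 < #|S|)%N -> measurable_fun setT h ->
  (forall x, 0 <= h x) -> 0 <= B -> (\int[mu]_x (h x `^ (2 / #|S|%:R))%:E <= B%:E)%E ->
  (\int[mu]_x (((\prod_(a | a \notin S) mxf l0 L (f a) x) * h x) `^ p)%:E <= (4 * m.+1%:R + B)%:E)%E.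
Proof.
move=> S0 mh h0 B0 hB.
have nm a := mxf_nice l0_gt0 L (nf a).
have nS : nice (fun x => \sum_a mxf l0 L (f a) x ^+ 2) by apply: nice_sum => a; exact: niceX2.
have mhp : measurable_fun setT (fun x => (h x `^ (2 / #|S|%:R))%:E).
  by apply/measurable_EFinP; exact: (measurableT_comp (measurable_powR _) mh).
apply: (@le_trans _ _ (\int[mu]_x ((\sum_a mxf l0 L (f a) x ^+ 2)%:E + (h x `^ (2 / #|S|%:R))%:E))%E).
  apply: ge0_le_integral => //.
  - by move=> x _; rewrite lee_fin powR_ge0.
  - apply/measurable_EFinP; apply: (measurableT_comp (measurable_powR p)).
    apply: measurable_funM => //; exact: mprod.
  - by apply: emeasurable_funD => //; apply/measurable_EFinP; exact: nice_meas nS.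
  by move=> x _; rewrite -EFinD lee_fin; apply: geometric_split => // a; exact: mxf_ge0.
have eD : (\int[mu]_x ((\sum_a mxf l0 L (f a) x ^+ 2)%:E + (h x `^ (2 / #|S|%:R))%:E) =
   \int[mu]_x (\sum_a mxf l0 L (f a) x ^+ 2)%:E + \int[mu]_x (h x `^ (2 / #|S|%:R))%:E)%E.
  apply: ge0_integralD => //.
  - by move=> x _; rewrite lee_fin; apply: sumr_ge0 => a _; exact: sqr_ge0.
  - by apply/measurable_EFinP; exact: nice_meas nS.
  by move=> x _; rewrite lee_fin powR_ge0.
rewrite eD EFinD; apply: leeD => //.
rewrite ge0_Rint// lee_fin int_sum => [|a]; last exact: niceX2.
apply: (@le_trans _ _ (\sum_(a < m.+1) (4 : R))); last by rewrite sumr_const card_ord mulr_natr.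
apply: ler_sum => a _; rewrite -n2_sqr (_ : 4 = 2 ^+ 2 :> R); last by ring.
rewrite lerXn2r ?nnegrE ?n2_ge0//; apply: le_trans (doob l0_gt0 L (nf a)) _.
by rewrite ler_piMr.
Qed.

Let Fm S r : measurable_fun setT (Fop l0 K S r f) := Fop_meas l0_gt0 tK nf S r.

Let U (S : {set 'I_m.+1}) x := `|\sum_(r < T') (\prod_(a | a \notin S) E r (f a) x) * Fop l0 K S r f x|.

Let mE (S : {set 'I_m.+1}) r : measurable_fun setT (fun x => \prod_(a | a \notin S) E r (f a) x).
Proof.
rewrite (_ : (fun x => _) = (fun x => \prod_a (if a \notin S then E r (f a) x else 1))); last first.
  by apply/funext => x; rewrite big_mkcond.
apply: measurable_prodr => a; case: (a \notin S); last exact: measurable_cst.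
exact: nice_meas (E_nice l0_gt0 r (nf a)).
Qed.

Let mU S : measurable_fun setT (U S).
Proof.
apply: measurableT_comp => //; apply: measurable_sum => r; apply: measurable_funM => //.
Qed.

Let MC : R := @M_const R m n C c.
Let HC : R := @H_const R m n C c.
Definition off_const : R := \sum_(S : {set 'I_m.+1}) (@loc_const R m n C) `^ (2 / #|S|%:R) * @orad_const R n c.
Definition term_const : R := 4 * m.+1%:R + (MC ^+ 2 + `|HC| + off_const).

Let off0 : 0 <= off_const.
Proof. by apply: sumr_ge0 => S _; rewrite mulr_ge0 ?powR_ge0 ?orad_const_ge0. Qed.

Let U_big (S : {set 'I_m.+1}) : (2 <= #|S|)%N -> (\int[mu]_x (U S x `^ p)%:E <= term_const%:E)%E.
Proof.
move=> S2.
have mh : measurable_fun setT (fun x => \sum_(r < T') `|Fop l0 K S r f x|).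
  by apply: measurable_sum => r; exact: measurableT_comp.
have h0 x : 0 <= \sum_(r < T') `|Fop l0 K S r f x| by exact: sumr_ge0.
have B0 : 0 <= (@loc_const R m n C) `^ (2 / #|S|%:R) * @orad_const R n c.
  by rewrite mulr_ge0 ?powR_ge0 ?orad_const_ge0.
have := term_int T' (ltnW S2) mh h0 B0 (off_diagonal l0_gt0 n0 C0 c01 tK nf fT T' S2 f1) => h.
apply: (@le_trans _ _ (\int[mu]_x (((\prod_(a | a \notin S) mxf l0 T' (f a) x) * \sum_(r < T') `|Fop l0 K S r f x|) `^ p)%:E)%E).
  apply: ge0_le_integral => //.
  - by move=> x _; rewrite lee_fin powR_ge0.
  - by apply/measurable_EFinP; exact: (measurableT_comp (measurable_powR p) (mU S)).
  - apply/measurable_EFinP; apply: (measurableT_comp (measurable_powR p)).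
    by apply: measurable_funM => //; exact: mprod.
  move=> x _; rewrite lee_fin; apply: ge0_ler_powR; rewrite ?nnegrE ?(ltW p0)//.
  - exact: normr_ge0.
  - by rewrite mulr_ge0//; apply: prodr_ge0 => a _; exact: mxf_ge0.
  apply: le_trans (ler_norm_sum _ _ _) _; rewrite mulr_sumr; apply: ler_sum => r _.
  rewrite normrM ler_wpM2r// normr_prod; apply: ler_prod => a _; rewrite normr_ge0/=.
  by apply: E_le_mxf => //; exact: ltnW.
apply: le_trans h _; rewrite lee_fin /term_const lerD2l.
apply: (@le_trans _ _ off_const).
  rewrite /off_const (bigD1 S)//= lerDl; apply: sumr_ge0 => S' _.
  by rewrite mulr_ge0 ?powR_ge0 ?orad_const_ge0.
by rewrite lerDr addr_ge0 ?sqr_ge0.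
Qed.

Definition set_const : R := m.+1%:R `^ p * (m.+1%:R * term_const) + term_const.

Let tc0 : 0 <= term_const.
Proof. by rewrite /term_const !addr_ge0 ?sqr_ge0 ?mulr_ge0. Qed.

Let U_one i : (\int[mu]_x (U [set i]%SET x `^ p)%:E <= set_const%:E)%E.
Proof.
have [L [M [H [[nM M0] hM [nH H0] hH hX]]]] :=
  diagonal_term l0_gt0 n0 C0 c01 tK tK' T' i nf fT f1.
(* In [diagonal_term] the summand with M belongs to the set {i} and the one with H a to the pair {i,
   a}, so that [term_int] applies with exponents 2 and 1. *)
pose S2 a : {set 'I_m.+1} := [set i; a]%SET.
pose W a x := if a == i then (\prod_(b | b \notin [set i]%SET) mxf l0 L (f b) x) * M x
  else (\prod_(b | b \notin S2 a) mxf l0 L (f b) x) * H a x.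
have mW a : measurable_fun setT (W a).
  by rewrite /W; case: (a == i); apply: measurable_funM; rewrite ?mprod//; [exact: nice_meas nM|exact: nice_meas (nH a)].
have W0 a x : 0 <= W a x.
  by rewrite /W; case: (a == i); rewrite mulr_ge0//; apply: prodr_ge0 => b _; exact: mxf_ge0.
have UW x : U [set i]%SET x <= \sum_a W a x.
  apply: le_trans (_ : _ <= _) (le_trans (hX x) _).
    rewrite /U le_eqVlt; apply/orP; left; apply/eqP; congr `|_|; apply: eq_bigr => r _.
    by rewrite (Gop_Fop l0_gt0 tK)//; congr (_ * _); apply: eq_bigl => a; rewrite inE.
  rewrite [leRHS](bigD1 i)//= /W eqxx; apply: lerD.
    by rewrite le_eqVlt; apply/orP; left; apply/eqP; congr (_ * _); apply: eq_bigl => b; rewrite inE.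
  apply: ler_sum => a /negbTE ai; rewrite ai le_eqVlt; apply/orP; left; apply/eqP; congr (_ * _).
  by apply: eq_bigl => b; rewrite !inE negb_or.
have hW a : (\int[mu]_x (W a x `^ p)%:E <= term_const%:E)%E.
  rewrite /W; case: (eqVneq a i) => [_|ai].
    have hB : (\int[mu]_x (M x `^ (2 / #|[set i]%SET|%:R))%:E <= (MC ^+ 2)%:E)%E.
      have e : (\int[mu]_x (M x `^ (2 / #|[set i]%SET|%:R))%:E = \int[mu]_x (M x ^+ 2)%:E)%E.
        by apply: eq_integral => x _; rewrite cards1 divr1 powR_mulrn.
      rewrite e ge0_Rint; last exact: niceX2.
      rewrite -n2_sqr lee_fin lerXn2r ?nnegrE ?n2_ge0//.
      exact: le_trans (n2_ge0 _ _) hM.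
    have := term_int L (_ : (0 < #|[set i]%SET|)%N) (nice_meas nM) M0 (sqr_ge0 _) hB.
    rewrite cards1 => /(_ isT) /le_trans; apply; rewrite lee_fin /term_const lerD2l.
    by rewrite -addrA lerDl addr_ge0.
  have c2 : #|S2 a| = 2%N by rewrite cards2 eq_sym ai.
  have hB : (\int[mu]_x (H a x `^ (2 / #|S2 a|%:R))%:E <= `|HC|%:E)%E.
    have e : (\int[mu]_x (H a x `^ (2 / #|S2 a|%:R))%:E = \int[mu]_x (H a x)%:E)%E.
      by apply: eq_integral => x _; rewrite c2 divff ?powRr1// pnatr_eq0.
    rewrite e ge0_Rint; last exact: nH.
    by rewrite lee_fin; apply: le_trans (hH a) (ler_norm _).
  have := term_int L (_ : (0 < #|S2 a|)%N) (nice_meas (nH a)) (H0 a) (normr_ge0 _) hB.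
  rewrite {1}c2 => /(_ isT) /le_trans; apply; rewrite lee_fin /term_const lerD2l.
  by have := sqr_ge0 MC; have := off0; lra.
have mWp a : measurable_fun setT (fun x => (W a x `^ p)%:E).
  by apply/measurable_EFinP; exact: (measurableT_comp (measurable_powR p) (mW a)).
apply: (@le_trans _ _ (\int[mu]_x ((m.+1%:R `^ p)%:E * \sum_a (W a x `^ p)%:E))%E).
  apply: ge0_le_integral => //.
  - by move=> x _; rewrite lee_fin powR_ge0.
  - by apply/measurable_EFinP; exact: (measurableT_comp (measurable_powR p) (mU _)).
  - by apply: emeasurable_funM => //; exact: emeasurable_sum.
  move=> x _; rewrite sumEFin -EFinM lee_fin.
  have := powR_sum_card (fun a => W0 a x) p0; rewrite card_ord; apply: le_trans.
  by apply: ge0_ler_powR; rewrite ?nnegrE ?(ltW p0)// ?normr_ge0// sumr_ge0.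
have Wp0 a x : (0 <= (W a x `^ p)%:E)%E by rewrite lee_fin powR_ge0.
have eZ : (\int[mu]_x ((m.+1%:R `^ p)%:E * \sum_a (W a x `^ p)%:E) =
   (m.+1%:R `^ p)%:E * \int[mu]_x \sum_a (W a x `^ p)%:E)%E.
  apply: ge0_integralZl => //; first exact: emeasurable_sum.
    by move=> x _; exact: sume_ge0.
have eS : (\int[mu]_x \sum_a (W a x `^ p)%:E = \sum_a \int[mu]_x (W a x `^ p)%:E)%E.
  exact: ge0_integral_sum.
rewrite eZ eS; apply: (@le_trans _ _ ((m.+1%:R `^ p)%:E * \sum_(a < m.+1) term_const%:E)%E).
  by rewrite lee_wpmul2l ?lee_fin ?powR_ge0//; apply: lee_sum => a _; exact: hW.
by rewrite sumEFin -EFinM lee_fin /set_const sumr_const card_ord -[term_const *+ _]mulr_natl lerDl.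
Qed.

Definition real_const : R := #|{set 'I_m.+1}|%:R `^ p * (#|{set 'I_m.+1}|%:R * set_const).

Lemma real_bound_tame : (\int[mu]_x (`|\sum_(r < T') Top (lv r) K f x| `^ p)%:E <= real_const%:E)%E.
Proof.
have sc : term_const <= set_const by rewrite lerDr mulr_ge0 ?powR_ge0// mulr_ge0.
have hU (S : {set 'I_m.+1}) : (\int[mu]_x (U S x `^ p)%:E <= set_const%:E)%E.
  case: (ltngtP #|S| 1) => S1.
  - have /cards0_eq -> : #|S| = 0%N by move: S1; case: #|S|.
    rewrite (_ : (fun x => _) = (fun=> 0%E)) ?integral0 ?lee_fin ?(le_trans tc0)//.
    apply/funext => x; rewrite /U big1 ?normr0 ?powR0 ?gt_eqF// => r _.
    by rewrite (Fop0 l0_gt0 tK) mulr0.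
  - by apply: le_trans (U_big S1) _; rewrite lee_fin.
  by have /eqP/cards1P[i ->] := S1; exact: U_one.
have mUp (S : {set 'I_m.+1}) : measurable_fun setT (fun x => (U S x `^ p)%:E).
  by apply/measurable_EFinP; exact: (measurableT_comp (measurable_powR p) (mU S)).
have U0 (S : {set 'I_m.+1}) x : 0 <= U S x by exact: normr_ge0.
have mT : measurable_fun setT (fun x => \sum_(r < T') Top (lv r) K f x).
  have [_ nKr _ _ _] := tK.
  by apply: measurable_sum => r; apply: nice_meas; apply: Top_nice => //; exact: nKr.
apply: (@le_trans _ _ (\int[mu]_x ((#|{set 'I_m.+1}|%:R `^ p)%:E * \sum_(S : {set 'I_m.+1}) (U S x `^ p)%:E))%E).
  apply: ge0_le_integral => //.
  - by apply/measurable_EFinP; apply: (measurableT_comp (measurable_powR p)); exact: measurableT_comp.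
  - by apply: emeasurable_funM => //; exact: emeasurable_sum.
  move=> x _; rewrite sumEFin -EFinM lee_fin.
  apply: le_trans (powR_sum_card (fun S : {set 'I_m.+1} => U0 S x) p0).
  apply: ge0_ler_powR; rewrite ?nnegrE ?(ltW p0)// ?sumr_ge0//.
  rewrite (eq_bigr (fun r : 'I_T' => \sum_(S : {set 'I_m.+1}) (\prod_(a | a \notin S) E r (f a) x) * Fop l0 K S r f x)) => [|r _]; last first.
    exact: (Top_expand l0_gt0 tK nf).
  by rewrite exchange_big/=; apply: ler_norm_sum.
have Up0 (S : {set 'I_m.+1}) x : (0 <= (U S x `^ p)%:E)%E by rewrite lee_fin powR_ge0.
have eZ : (\int[mu]_x ((#|{set 'I_m.+1}|%:R `^ p)%:E * \sum_(S : {set 'I_m.+1}) (U S x `^ p)%:E) =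
   (#|{set 'I_m.+1}|%:R `^ p)%:E * \int[mu]_x \sum_(S : {set 'I_m.+1}) (U S x `^ p)%:E)%E.
  apply: ge0_integralZl => //; first exact: emeasurable_sum.
    by move=> x _; exact: sume_ge0.
have eS : (\int[mu]_x \sum_(S : {set 'I_m.+1}) (U S x `^ p)%:E = \sum_(S : {set 'I_m.+1}) \int[mu]_x (U S x `^ p)%:E)%E.
  exact: ge0_integral_sum.
rewrite eZ eS; apply: (@le_trans _ _ ((#|{set 'I_m.+1}|%:R `^ p)%:E * \sum_(S : {set 'I_m.+1}) set_const%:E)%E).
  by rewrite lee_wpmul2l ?lee_fin ?powR_ge0//; apply: lee_sum => S _; exact: hU.
by rewrite sumEFin -EFinM lee_fin /real_const sumr_const -[set_const *+ _]mulr_natl.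
Qed.

End one.

Lemma real_bound (q : R) : (0 < n)%N -> @crit R m < q ->
  exists2 CT : R, 0 < CT & forall K, good_kernel q K ->
  forall l0 T T' (f : 'I_m.+1 -> V -> R), 0 < l0 -> (forall a, nice (f a)) ->
    (forall a, cst_on (lv l0 T) (f a)) -> (forall a, n2 (f a) <= 1) ->
    (\int[mu]_x (`|\sum_(r < T') Top (lv l0 r) K f x| `^ p)%:E <= CT%:E)%E.
Proof.
move=> n0 hq; have [C [c [C0 c01 H]]] := @good_tame R m n q n0 hq.
have q1 := le_trans (@crit_ge1 R m) (ltW hq).
exists (`|real_const C c| + 1); first by rewrite ltr_wpDl.
move=> K gK l0 T T' f l0_gt0 nf fT f1.
apply: le_trans (real_bound_tame l0_gt0 n0 C0 c01 (H K gK) (H _ (good_opp q1 gK)) T' nf fT f1) _.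
by rewrite lee_fin; apply: le_trans (ler_norm _) _; rewrite lerDl.
Qed.

End real_bound.

(** * Approximation *)

Section limits.
Context d (T : measurableType d) (R : realType).
Variable nu : {measure set T -> \bar R}.

(* No measurability is needed: the integral of a nonnegative function is a supremum
   over the simple functions below it. *)
Lemma le_nnint (f g : T -> \bar R) : (forall x, 0 <= f x)%E -> (forall x, f x <= g x)%E ->
  (\int[nu]_x f x <= \int[nu]_x g x)%E.
Proof.
move=> f0 fg; have g0 x : (0 <= g x)%E := le_trans (f0 x) (fg x).
rewrite !ge0_integralTE//; apply: le_ereal_sup => _ [h hf <-].
by exists h => // x; exact: le_trans (hf x) (fg x).
Qed.

Lemma le_limn_einf (v : nat -> R) (a : R) :
  (forall e, 0 < e -> \forall k \near \oo, a <= v k + e) -> (a%:E <= limn_einf (fun k => (v k)%:E))%E.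
Proof.
move=> h; rewrite limn_einf_lim; apply/lee_addgt0Pr => e e0.
have [N _ hN] := h e e0.
rewrite -leeBlDr//; apply: lime_ge; first exact: is_cvg_einfs.
exists N => // k Nk; apply: le_ereal_inf_tmp => _ [l /= kl <-].
by rewrite -EFinB lee_fin lerBlDr; apply: hN; exact: leq_trans kl.
Qed.

(** Only an eventual upper bound of g by u k + e is asked instead of convergence. This also covers
    points where a principal value does not exist and the limit takes its default value. *)
Lemma fatou_pow (p C : R) (u : nat -> T -> R) (g : T -> R) : 0 < p ->
  (forall k, measurable_fun setT (u k)) -> (forall k x, 0 <= u k x) -> (forall x, 0 <= g x) ->
  (forall x e, 0 < e -> \forall k \near \oo, g x <= u k x + e) ->
  (forall k, \int[nu]_x (u k x `^ p)%:E <= C%:E)%E -> (\int[nu]_x (g x `^ p)%:E <= C%:E)%E.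
Proof.
move=> p0 mu_ u0 g0 hg hC.
have mup k : measurable_fun setT (fun x => (u k x `^ p)%:E).
  by apply/measurable_EFinP; exact: (measurableT_comp (measurable_powR p) (mu_ k)).
apply: (@le_trans _ _ (\int[nu]_x limn_einf (fun k => (u k x `^ p)%:E))%E).
  apply: le_nnint => x; first by rewrite lee_fin powR_ge0.
  apply: le_limn_einf => e e0.
  have [ge|ge] := leP (g x `^ p) e.
    by near=> k; rewrite (le_trans ge)// lerDr powR_ge0.
  set b := g x `^ p - e; have b0 : 0 < b by rewrite subr_gt0.
  have bg : b `^ p^-1 < g x.
    have -> : g x = (g x `^ p) `^ p^-1 by rewrite -powRrM mulfV ?gt_eqF// powRr1.
    apply: gt0_ltr_powR; rewrite ?invr_gt0// ?nnegrE ?powR_ge0 ?(ltW b0)//.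
    by rewrite ltrBlDr ltrDl.
  have := hg x (g x - b `^ p^-1); rewrite subr_gt0 => /(_ bg) [N _ hN].
  exists N => // k /hN; rewrite addrC => hk; rewrite -lerBlDr -/b.
  have {}hk : b `^ p^-1 <= u k x by move: hk => /=; lra.
  have -> : b = (b `^ p^-1) `^ p by rewrite -powRrM mulVf ?gt_eqF// powRr1// ltW.
  by apply: ge0_ler_powR; rewrite ?nnegrE ?powR_ge0 ?(ltW p0).
apply: le_trans (fatou nu measurableT mup _) _; first by move=> k x _; rewrite lee_fin powR_ge0.
rewrite limn_einf_lim; apply: lime_le; first exact: is_cvg_einfs.
exists 0%N => // k _; apply: le_trans (hC k); apply: ereal_inf_lbound; exists k => //=.
Unshelve. all: by end_near. Qed.

Lemma Rint_dominated (f_ : nat -> T -> R) (f g : T -> R) :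
  (forall k, measurable_fun setT (f_ k)) -> (forall x, f_ k x @[k --> \oo] --> f x) ->
  nu.-integrable setT (EFin \o g) -> (forall k x, `|f_ k x| <= g x) ->
  \int[nu]_x f_ k x @[k --> \oo] --> \int[nu]_x f x.
Proof.
move=> mf cf ig fg.
have mfl : measurable_fun setT f by apply: measurable_fun_cvg mf _ => x _; exact: cf.
have ifk k : nu.-integrable setT (EFin \o f_ k) by exact: integrable_dom (mf k) (fg k) ig.
have fl x : `|f x| <= g x.
  have c : `|f_ k x| @[k --> \oo] --> `|f x| by apply: cvg_norm; exact: cf.
  by apply: (ler_cvg_to c (cvg_cst (g x))); near=> k; exact: fg.
have if_ : nu.-integrable setT (EFin \o f) by exact: integrable_dom mfl fl ig.
have h : (\int[nu]_x (f_ k x)%:E @[k --> \oo] --> \int[nu]_x (f x)%:E)%E.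
  apply: (dominated_cvg measurableT (f_ := fun k x => (f_ k x)%:E) (g := EFin \o g)) => //.
  - by move=> k; exact/measurable_EFinP.
  - by move=> x _; apply: cvg_EFin; [near=> k|exact: cf].
  - by move=> k x _; rewrite lee_fin; exact: fg.
have e : (fun k => \int[nu]_x (f_ k x)%:E)%E = (fun k => (\int[nu]_x f_ k x)%:E).
  by apply/funext => k; rewrite EFin_Rintegral.
by move: h; rewrite e -EFin_Rintegral// => /fine_cvgP[].
Unshelve. all: by end_near. Qed.

End limits.

(** * Kernels given by functions of degree zero *)

Section zero_homogeneous.
Context {R : realType} {m n : nat}.
Notation V := 'rV[R]_n.
Notation MM := 'M[R]_(m.+1, n).
Notation N := (m.+1 * n)%N.
Notation leb2 := (leb R m.+1 n).
Notation niceY := (nice (leb R m.+1 n)).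

Lemma inball_scale t (y : MM) : 0 < t -> inball t (t *: y) = inball 1 y.
Proof. by move=> t0; rewrite /inball enormZ gtr0_norm// -{2}[t]mulr1 ler_pM2l. Qed.

Definition zero_homog (w : MM -> R) := forall t y, 0 < t -> w (t *: y) = w y.

Definition wker (w : MM -> R) y := enorm y ^- N * w y.

Lemma wker_meas w : measurable_fun setT w -> measurable_fun setT (wker w).
Proof.
move=> mw; apply: measurable_funM => //.
rewrite (_ : (fun y : MM => enorm y ^- N) = (fun y => (enorm y `^ (-1)) ^+ N)); last first.
  by apply/funext => y; rewrite powR_inv1 ?enorm_ge0// exprVn.
by apply: measurable_funX; exact: (measurableT_comp (measurable_powR (-1)) (@measurable_enorm R m.+1 n)).
Qed.

Lemma wker_homog w : zero_homog w -> homog (wker w).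
Proof.
move=> hw t y t0; rewrite /wker hw// enormZ gtr0_norm// exprMn invfM mulrA//.
Qed.

Section bounded.
Variables (w : MM -> R) (B : R).
Hypotheses (mw : measurable_fun setT w) (wB : forall y, `|w y| <= B) (hw : zero_homog w).

Let B0 : 0 <= B. Proof. exact: le_trans (normr_ge0 _) (wB 0). Qed.

Let nwb r : niceY (fun y => w y * (inball r y)%:R).
Proof. by apply: niceMl => //; [exact: (int_inball r).1|exists B]. Qed.

Let ball_int r : 0 < r -> \int[leb2]_y (w y * (inball r y)%:R) = r ^+ N * \int[leb2]_y (w y * (inball 1 y)%:R).
Proof.
move=> r0; have [_ e] := int_scale r0 (nwb r).
have rN : r ^+ N != 0 by rewrite expf_neq0// gt_eqF.
have -> : \int[leb2]_y (w y * (inball 1 y)%:R) = \int[leb2]_y (w (r *: y) * (inball r (r *: y))%:R).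
  apply: eq_Rintegral => y _; rewrite hw//; congr (_ * _%:R).
  by rewrite inball_scale.
by rewrite e mulrA mulfV// mul1r.
Qed.

Hypothesis w0 : \int[leb2]_y (w y * (inball 1 y)%:R) = 0.

Lemma inv_pow_diff (a b : R) : 1 <= a -> a <= b -> `|a ^- N - b ^- N| <= N%:R * (b - a).
Proof.
move=> a1 ab; have a0 : 0 < a by apply: lt_le_trans a1.
have b0 : 0 < b by apply: lt_le_trans ab.
have iba : b^-1 <= a^-1 by rewrite lef_pV2.
have ia1 : a^-1 <= 1 by rewrite invf_le1.
case: N => [|k]; first by rewrite !expr0 subrr normr0 mul0r.
rewrite -!exprVn ger0_norm; last first.
  by rewrite subr_ge0 lerXn2r ?nnegrE ?invr_ge0 ?(ltW a0) ?(ltW b0).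
apply: le_trans (subrXX_le k _ iba ia1) _; first by rewrite invr_ge0 ltW.
rewrite expr1n mulr1 ler_wpM2l//.
have -> : a^-1 - b^-1 = (b - a) / (a * b) by field; rewrite !gt_eqF.
rewrite ler_pdivrMr ?mulr_gt0// ler_peMr ?subr_ge0//.
by apply: mulr_ege1 => //; exact: le_trans ab.
Qed.

(* A Riemann sum in the radial variable: [w] has mean zero on every annulus, and
   [enorm y ^- N] is nearly constant on thin ones. *)
Lemma wker_mean0 : \int[leb2]_y Kr 1 (wker w) y = 0.
Proof.
pose k y := Kr 1 (wker w) y.
have mk : measurable_fun setT k by apply: measurable_Kr; exact: wker_meas.
suff key M : (0 < M)%N -> `|\int[leb2]_y k y| <= N%:R * B * @vol R m.+1 n 2 * M%:R^-1.
  apply/eqP; rewrite -normr_le0; apply/ler_addgt0Pr => e e0; rewrite add0r.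
  set D := N%:R * B * @vol R m.+1 n 2 in key.
  have D0 : 0 <= D by rewrite !mulr_ge0 ?vol_ge0.
  have De : 0 <= D / e by rewrite divr_ge0// ltW.
  have hM := archi_boundP De; set M := Num.bound (D / e) in hM.
  have Mp : 0 < M%:R :> R by apply: le_lt_trans hM.
  apply: le_trans (key M _) _; first by rewrite -(ltr0n R).
  by rewrite ler_pdivrMr// mulrC -ler_pdivrMr// ltW.
move=> M0; have Mp : 0 < M%:R :> R by rewrite ltr0n.
pose t (j : nat) : R := 1 + j%:R / M%:R.
have t1 j : 1 <= t j by rewrite lerDl divr_ge0.
have t0 j : 0 < t j by apply: lt_le_trans (t1 j).
have tS j : t j.+1 - t j = M%:R^-1 by rewrite /t -natr1; field; rewrite gt_eqF.
have tle j : t j <= t j.+1 by rewrite -subr_ge0 tS invr_ge0 ltW.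
pose sh j (y : MM) : R := (inball (t j.+1) y)%:R - (inball (t j) y)%:R.
have shE j y : sh j y = ((t j < enorm y) && (enorm y <= t j.+1))%:R.
  rewrite /sh /inball; case: (leP (enorm y) (t j)) => h.
    by rewrite (le_trans h (tle j)) subrr.
  by rewrite subr0.
have annE y : (ann 1 y)%:R = \sum_(j < M) sh j y.
  have -> : \sum_(j < M) sh j y = (inball (t M) y)%:R - (inball (t 0%N) y)%:R.
    rewrite -(big_mkord predT (fun j => sh j y)) /sh.
    exact: (telescope_sumr (fun j => (inball (t j) y)%:R : R) (leq0n M)).
  rewrite /t mul0r addr0 divff ?gt_eqF// /ann /inball mulr1.
  case: (leP (enorm y) 1) => h; last by rewrite subr0.
  by rewrite (le_trans h) ?subrr// ler1n.
have nsw j : niceY (fun y => w y * sh j y).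
  have := niceB (nwb (t j.+1)) (nwb (t j)).
  by rewrite (_ : (fun y => _) = (fun y => w y * sh j y))//; apply/funext => y; rewrite /sh mulrBr.
have zero j : \int[leb2]_y (w y * sh j y) = 0.
  rewrite (_ : \int[leb2]_y _ = \int[leb2]_y (w y * (inball (t j.+1) y)%:R - w y * (inball (t j) y)%:R)); last first.
    by apply: eq_Rintegral => y _; rewrite /sh mulrBr.
  by rewrite (intB (nwb _) (nwb _)) (ball_int (t0 j.+1)) (ball_int (t0 j)) w0 !mulr0 subrr.
pose g j y := (enorm y ^- N - t j ^- N) * (w y * sh j y).
have nb2 := (@int_inball R m.+1 n 2).
have tM j : (j < M)%N -> t j.+1 <= 2.
  by move=> jM; rewrite /t (_ : 2 = 1 + 1 :> R)// lerD2l ler_pdivrMr// mul1r ler_nat.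
have gb j y : `|g j y| <= N%:R * M%:R^-1 * B * sh j y.
  rewrite /g shE; case: (boolP ((t j < enorm y) && (enorm y <= t j.+1))) => [/andP[h1 h2]|_]; last by rewrite !mulr0 normr0.
  rewrite !mulr1 normrM; apply: ler_pM => //.
  rewrite distrC; apply: le_trans (inv_pow_diff (t1 j) (ltW h1)) _.
  by rewrite ler_wpM2l// -(tS j) lerB.
have nsh j : niceY (sh j) by apply: niceB; exact: (int_inball _).1.
have ng j : niceY (g j).
  apply: nice_dom (niceZ (N%:R * M%:R^-1 * B) (nsh j)) _ _.
    apply: measurable_funM; last exact: nice_meas (nsw j).
    apply: measurable_funB => //.
    by have := wker_meas (measurable_cst (1 : R)); rewrite /wker; under eq_fun do rewrite mulr1.
  move=> y; apply: le_trans (gb j y) _; exact: ler_norm.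
have nsg : niceY (fun y => \sum_(j < M) g j y) by exact: nice_sum.
have nc : niceY (fun y => \sum_(j < M) t j ^- N * (w y * sh j y)).
  by apply: nice_sum => j; exact: niceZ.
have kE : \int[leb2]_y k y = \int[leb2]_y (\sum_(j < M) g j y + \sum_(j < M) t j ^- N * (w y * sh j y)).
  apply: eq_Rintegral => y _; rewrite -big_split/= /k /Kr /wker annE mulr_sumr; apply: eq_bigr => j _.
  by rewrite /g; ring.
rewrite kE (intD nsg nc) (int_sum _ (fun j : 'I_M => niceZ (t j ^- N) (nsw j))).
rewrite [X in _ + X]big1 ?addr0 => [|j _]; last by rewrite (intZ _ (nsw j)) zero mulr0.
apply: le_trans (le_norm_int nsg) _.
have na : niceY (fun y => N%:R * M%:R^-1 * B * (inball 2 y)%:R) by exact: niceZ nb2.1.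
apply: (le_trans (le_int (nice_norm nsg) na _)).
  move=> y; apply: le_trans (ler_norm_sum _ _ _) _.
  apply: (@le_trans _ _ (\sum_(j < M) N%:R * M%:R^-1 * B * sh j y)); first by apply: ler_sum => j _; exact: gb.
  rewrite -mulr_sumr -annE ler_wpM2l ?mulr_ge0 ?invr_ge0//.
  by rewrite /ann /inball mulr1 ler_nat; case: (1 < enorm y); case: (enorm y <= 2).
rewrite (intZ _ nb2.1) nb2.2 le_eqVlt; apply/orP; left; apply/eqP; ring.
Qed.

(** The annulus 1 < |y| <= 2 lies in the ball of radius 2, over which the integral is 2 ^ N times
    that over the unit ball, by homogeneity. *)
Lemma good_wker q : 1 <= q -> \int[leb2]_y (`|w y| `^ q * (inball 1 y)%:R) <= 2 ^- N ->
  good_kernel q (wker w).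
Proof.
move=> q1 hq; have q0 : 0 < q by apply: lt_le_trans q1.
have mK := wker_meas mw.
have Kb : exists lam, forall y, 2^-1 < enorm y <= 2 -> `|wker w y| <= lam.
  exists (2 ^+ N * B) => y /andP[h1 _]; rewrite /wker normrM; apply: ler_pM => //.
  have e0 : 0 < enorm y by apply: lt_trans h1; rewrite invr_gt0.
  rewrite ger0_norm ?invr_ge0 ?exprn_ge0 ?enorm_ge0// -exprVn lerXn2r ?nnegrE ?invr_ge0 ?enorm_ge0//.
  by rewrite -(invrK 2) lef_pV2 ?posrE ?invr_gt0// ltW.
split => //; [exact: wker_homog| |exact: wker_mean0].
have nk := Kr_nice mK Kb.
have nq := nice_powR (fun y => normr_ge0 (Kr 1 (wker w) y)) q1 (nice_norm nk).
have nwq r : niceY (fun y => `|w y| `^ q * (inball r y)%:R).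
  apply: niceMl (int_inball r).1 _ _.
    by apply: (measurableT_comp (measurable_powR q)); exact: measurableT_comp.
  exists (B `^ q) => y; rewrite ger0_norm ?powR_ge0//.
  by apply: ge0_ler_powR; rewrite ?nnegrE ?(ltW q0).
apply: (@le_trans _ _ (\int[leb2]_y (`|w y| `^ q * (inball 2 y)%:R))).
  apply: le_int => // y; rewrite /Kr /wker /ann /inball mulr1.
  case: (boolP (1 < enorm y)) => h1; last by rewrite mulr0 normr0 powR0 ?gt_eqF// mulr_ge0 ?powR_ge0.
  case: (boolP (enorm y <= 2)) => h2; last by rewrite mulr0 normr0 powR0 ?gt_eqF// mulr_ge0 ?powR_ge0.
  rewrite !mulr1; apply: ge0_ler_powR; rewrite ?nnegrE ?(ltW q0)//.
  rewrite normrM ler_piMl// ger0_norm ?invr_ge0 ?exprn_ge0 ?enorm_ge0//.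
  by rewrite invf_le1 ?exprn_gt0 ?exprn_ege1 ?(lt_trans ltr01 h1)// ltW.
have two : 0 < 2 :> R by [].
have [_ e] := int_scale two (nwq 2).
have -> : \int[leb2]_y (`|w y| `^ q * (inball 2 y)%:R) = 2 ^+ N * \int[leb2]_y (`|w (2 *: y)| `^ q * (inball 2 (2 *: y))%:R).
  by rewrite e mulrA mulfV ?mul1r// expf_neq0.
have -> : \int[leb2]_y (`|w (2 *: y)| `^ q * (inball 2 (2 *: y))%:R) = \int[leb2]_y (`|w y| `^ q * (inball 1 y)%:R).
  apply: eq_Rintegral => y _; rewrite hw//; congr (_ * _%:R).
  by rewrite inball_scale.
by rewrite -ler_pdivlMl ?exprn_gt0// mulr1.
Qed.

End bounded.
End zero_homogeneous.

Section products_of_limits.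
Context {R : realType}.

Lemma cvg_mulc (u : nat -> R) (c l : R) : u j @[j --> \oo] --> l -> c * u j @[j --> \oo] --> c * l.
Proof. by move=> h; apply: cvgM => //; exact: cvg_cst. Qed.

Lemma cvg_prodr k (u : 'I_k -> nat -> R) (l : 'I_k -> R) :
  (forall b, u b j @[j --> \oo] --> l b) -> \prod_b u b j @[j --> \oo] --> \prod_b l b.
Proof.
elim: k u l => [|k IH] u l h.
  rewrite big_ord0 (_ : (fun j => _) = (fun=> 1)); first exact: cvg_cst.
  by apply/funext => j; rewrite big_ord0.
rewrite big_ord_recl (_ : (fun j => _) = (fun j => u ord0 j * \prod_b u (lift ord0 b) j)).
  by apply: cvgM => //; apply: IH.
by apply/funext => j; rewrite big_ord_recl.
Qed.

End products_of_limits.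

Section approximation.
Context {R : realType} {m n : nat}.
Notation V := 'rV[R]_n.
Notation MM := 'M[R]_(m.+1, n).
Notation N := (m.+1 * n)%N.
Notation mu := (leb R 1 n).
Notation leb2 := (leb R m.+1 n).
Notation niceY := (nice (leb R m.+1 n)).
Notation nice := (nice (leb R 1 n)).
Notation n2 := (n2 (leb R 1 n)).
Notation p := (2 / m.+1%:R : R).

Lemma avg_bdd l (f : V -> R) B x : 0 < l -> nice f -> (forall y, `|f y| <= B) -> `|avg l f x| <= B.
Proof.
move=> l_gt0 nf fB; have [ns is_] := int_same x l_gt0.
have ln : 0 < l ^+ n by rewrite exprn_gt0.
apply: le_trans (avg_norm l_gt0 x nf) _; rewrite /avg /kop.
apply: (@le_trans _ _ (l ^- n * \int[mu]_y (B * (same l x y)%:R))).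
  rewrite ler_wpM2l ?invr_ge0 ?(ltW ln)//; apply: le_int.
  - exact: (sf_nice l_gt0 x (nice_norm nf)).
  - exact: niceZ.
  by move=> y; rewrite mulrC ler_wpM2r.
by rewrite (intZ _ ns) is_ mulrCA mulVf ?mulr1// gt_eqF.
Qed.

Lemma avg_near l (f : V -> R) x e : 0 < l -> nice f ->
  (forall y, same l x y -> `|f y - f x| <= e) -> `|avg l f x - f x| <= e.
Proof.
move=> l_gt0 nf h; have [ns is_] := int_same x l_gt0; have nsf := sf_nice l_gt0 x nf.
have ln : l ^+ n != 0 by rewrite gt_eqF// exprn_gt0.
have lni : 0 <= l ^- n by rewrite invr_ge0 exprn_ge0// ltW.
have -> : avg l f x - f x = l ^- n * \int[mu]_y ((same l x y)%:R * f y - f x * (same l x y)%:R).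
  rewrite (intB nsf (niceZ _ ns)) (intZ _ ns) is_ /avg /kop.
  by move: (l ^+ n) ln => u u0; field.
have nd := niceB nsf (niceZ (f x) ns).
rewrite normrM ger0_norm//.
apply: (@le_trans _ _ (l ^- n * \int[mu]_y (e * (same l x y)%:R))).
  rewrite ler_wpM2l//; apply: le_trans (le_norm_int nd) _; apply: le_int; [exact: nice_norm nd|exact: niceZ|].
  move=> y; case: (boolP (same l x y)) => [s|_]; last by rewrite !mulr0 mul0r subrr normr0.
  by rewrite mul1r !mulr1; exact: h.
by rewrite (intZ _ ns) is_ mulrCA mulVf// mulr1.
Qed.

Lemma E_cvg l0 (f : V -> R) x : 0 < l0 -> nice f -> continuous f ->
  E l0 j f x @[j --> \oo] --> f x.
Proof.
move=> l_gt0 nf cf; apply/cvgrPdist_le => e e0.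
have := cf x; move=> /cvgrPdist_le/(_ e e0) /nbhs_ballP[d /= d0 hd].
have ld : 0 <= l0 / d by rewrite divr_ge0// ltW.
have hM := archi_boundP ld; set J := Num.bound (l0 / d) in hM.
exists J => // j /= Jj; rewrite distrC E_avg; apply: avg_near => //; first exact: lv_gt0.
move=> y s; rewrite distrC; apply: hd; rewrite /ball /=; split => // i k; rewrite ord1.
rewrite /ball /=; apply: le_lt_trans (same_dist k (lv_gt0 l_gt0 j) s) _.
rewrite /lv ltr_pdivrMr ?exprn_gt0// mulrC -ltr_pdivrMr//; apply: lt_le_trans hM _.
rewrite -natrX ler_nat; apply: leq_trans Jj _; exact: ltnW (ltn_expl j (ltnSn 1)).
Qed.

Definition annulus (e : R) k (y : MM) : bool := (e < enorm y) && (enorm y <= e * 2 ^+ k).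

Definition Tek (e : R) k (K : MM -> R) (f : 'I_m.+1 -> V -> R) x : R :=
  \int[leb2]_y (K y * (annulus e k y)%:R * \prod_a f a (x - row a y)).

(** The inner radii of the k annuli run from e 2^(k-1) down to e; they are the [lv l0 r] for l0 half
    the outer radius, which matches the scales of [real_bound]. *)
Lemma Tek_Top (e : R) k (K : MM -> R) f x : 0 < e -> (forall r, 0 < r -> niceY (Kr r K)) ->
  (forall a, nice (f a)) ->
  Tek e k K f x = \sum_(r < k) Top (lv (e * 2 ^+ k / 2) r) K f x.
Proof.
move=> e0 nK nf; set l0 := e * 2 ^+ k / 2.
have l_gt0 : 0 < l0 by rewrite divr_gt0// mulr_gt0// exprn_gt0.
have nn (r : 'I_k) : niceY (fun y => Kr (lv l0 r) K y * \prod_a f a (x - row a y)).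
  by have h := kernel_nice1 (cf_meas nf) (cf_bdd nf) x (nK _ (lv_gt0 l_gt0 r)); exact: h.
apply: etrans (esym _) (int_sum _ nn); apply: eq_Rintegral => y _ /=.
rewrite -mulr_suml; congr (_ * _); rewrite -mulr_sumr; congr (_ * _).
pose s (r : nat) := e * 2 ^+ k / 2 ^+ r.
have sp r : 0 < s r by rewrite divr_gt0 ?mulr_gt0 ?exprn_gt0.
have sS r : s r.+1 = lv l0 r by rewrite /s /lv /l0 exprS invfM mulrA.
have s2 r : s r = 2 * lv l0 r by rewrite /s /lv /l0; field; rewrite expf_neq0.
have aE r : (ann (lv l0 r) y)%:R = (enorm y <= s r)%R%:R - (enorm y <= s r.+1)%R%:R :> R.
  rewrite /ann -s2 -sS; case: (leP (enorm y) (s r.+1)) => h; last by rewrite subr0.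
  have h2 : s r.+1 <= s r by rewrite sS s2 ler_peMl ?ler1n// ltW// lv_gt0.
  by rewrite (le_trans h h2) subrr.
rewrite (eq_bigr _ (fun (r : 'I_k) _ => aE r)).
rewrite -(big_mkord predT (fun r => (enorm y <= s r)%R%:R - (enorm y <= s r.+1)%R%:R : R)).
have -> : \sum_(0 <= r < k) ((enorm y <= s r)%R%:R - (enorm y <= s r.+1)%R%:R : R) =
    (enorm y <= s 0%N)%R%:R - (enorm y <= s k)%R%:R.
  rewrite -(opprB ((enorm y <= s k)%R%:R : R)) -(telescope_sumr (fun r => (enorm y <= s r)%R%:R : R) (leq0n k)).
  by rewrite -sumrN; apply: eq_bigr => r _; rewrite opprB.
have -> : s k = e by rewrite /s -mulrA mulfV ?mulr1// expf_neq0.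
have -> : s 0%N = e * 2 ^+ k by rewrite /s expr0 divr1.
rewrite /annulus; case: (leP (enorm y) e) => h; last by rewrite subr0.
have h2 : e <= e * 2 ^+ k by rewrite ler_peMr ?exprn_ege1 ?ler1n// ltW.
by rewrite (le_trans h h2) subrr.
Qed.

Lemma measurable_Tek e k (K : MM -> R) f : measurable_fun setT K -> (forall a, measurable_fun setT (f a)) ->
  measurable_fun setT (Tek e k K f).
Proof.
move=> mK mf.
apply: (measurable_Rint _ (h := fun q : V * MM => K q.2 * (annulus e k q.2)%:R * \prod_a f a (q.1 - row a q.2))).
apply: measurable_funM; last exact: prod_rows_meas.
apply: measurable_funM; first exact: (measurableT_comp mK measurable_snd).
apply: measurable_boolR; apply: measurable_and.
  by apply: measurable_fun_ltr => //; exact: measurable_enorm_comp.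
by apply: measurable_fun_ler => //; exact: measurable_enorm_comp.
Qed.

(** On the unit ball |w| <= 1 + |w|^q; homogeneity carries this to the other radii. *)
Lemma ball_integrable (q s r : R) (w : MM -> R) : 1 <= q -> measurable_fun setT w -> zero_homog w ->
  (\int[leb2]_y (`|w y| `^ q * (inball 1 y)%:R)%:E <= (s `^ q)%:E)%E -> 0 < r ->
  leb2.-integrable setT (EFin \o (fun y => w y * (inball r y)%:R)).
Proof.
move=> q1 mw hw wq r0.
have mb t : measurable_fun setT (fun y : MM => (inball t y)%:R : R) := nice_meas (int_inball t).1.
have mF t : measurable_fun setT (fun y : MM => `|w y| * (inball t y)%:R).
  by apply: measurable_funM => //; exact: measurableT_comp.
apply: (@integrable_dom _ _ _ _ _ (fun y => `|w y| * (inball r y)%:R)).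
- exact: measurable_funM.
- by move=> y; rewrite normrM (ger0_norm (ler0n R _)).
apply: integrable_ge0; [exact: mF|by move=> y; rewrite mulr_ge0|].
pose F y := (`|w y| * (inball r y)%:R)%:E.
have mFE : measurable_fun setT F by exact/measurable_EFinP.
have F0 y : (0 <= F y)%E by rewrite lee_fin mulr_ge0.
have := ge0_integral_scale mFE F0 r0.
have fin1 : (\int[leb2]_y F (r *: y) < +oo)%E.
  apply: (@le_lt_trans _ _ (\int[leb2]_y ((inball 1 y)%:R%:E + (`|w y| `^ q * (inball 1 y)%:R)%:E))%E).
    apply: le_nnint => // y; rewrite /F hw// inball_scale// -EFinD lee_fin.
    case: (inball 1 y); rewrite ?mulr1 ?mulr0 ?addr0//.
    have := powR_le_add1 (normr_ge0 (w y)) ltr01 q1; rewrite powRr1//.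
  have [nb ib] := @int_inball R m.+1 n 1.
  have e : (\int[leb2]_y ((inball 1 y)%:R%:E + (`|w y| `^ q * (inball 1 y)%:R)%:E) =
     \int[leb2]_y (inball 1 y)%:R%:E + \int[leb2]_y (`|w y| `^ q * (inball 1 y)%:R)%:E)%E.
    apply: ge0_integralD => //.
    - exact/measurable_EFinP.
    apply/measurable_EFinP; apply: measurable_funM => //.
    by apply: (measurableT_comp (measurable_powR q)); exact: measurableT_comp.
  rewrite e (ge0_Rint nb); apply: lte_add_pinfty; rewrite ?ltry//.
  by apply: le_lt_trans wq _; rewrite ltry.
move=> e; have rN : 0 < r ^- (m.+1 * n) by rewrite invr_gt0 exprn_gt0.
by rewrite ltey; apply/eqP => h; move: fin1; rewrite e h gt0_muley ?lte_fin// ltxx.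
Qed.

Lemma cut_integrable (q s e : R) k (w : MM -> R) f x : 1 <= q -> measurable_fun setT w -> zero_homog w ->
  (\int[leb2]_y (`|w y| `^ q * (inball 1 y)%:R)%:E <= (s `^ q)%:E)%E -> 0 < e -> (forall a, nice (f a)) ->
  leb2.-integrable setT (EFin \o (fun y => wker w y * (annulus e k y)%:R * \prod_a f a (x - row a y))).
Proof.
move=> q1 mw hw wq e0 nf.
have r0 : 0 < e * 2 ^+ k by rewrite mulr_gt0// exprn_gt0.
have iw := ball_integrable q1 mw hw wq r0.
pose Bf b := sval (cid (nice_bdd (nf b))).
have hBf b y : `|f b y| <= Bf b := svalP (cid (nice_bdd (nf b))) y.
have ii := integrableZl measurableT (e ^- N * \prod_b Bf b) (integrable_norm iw).
apply: (@integrable_dom _ _ _ _ _ (fun y => e ^- N * (\prod_b Bf b) * `|w y * (inball (e * 2 ^+ k) y)%:R|)); last by exact: ii.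
  apply: measurable_funM; last by apply: prod_rows_meas => // b; exact: nice_meas (nf b).
  apply: measurable_funM; first exact: wker_meas.
  apply: measurable_boolR; apply: measurable_and.
    by apply: measurable_fun_ltr => //; exact: measurable_enorm_comp.
  by apply: measurable_fun_ler => //; exact: measurable_enorm_comp.
have Bf0 b : 0 <= Bf b by apply: le_trans (hBf b 0).
have ei : 0 <= e ^- N by rewrite invr_ge0 exprn_ge0// ltW.
move=> y; rewrite /wker; case: (boolP (annulus e k y)) => cy; last first.
  by rewrite mulr0 mul0r normr0; do 2 apply: mulr_ge0 => //; apply: prodr_ge0.
have /andP[h1 iy] := cy; rewrite /inball iy !mulr1 !normrM mulrAC.
have ey : 0 < enorm y by apply: lt_trans h1.
apply: ler_wpM2r => //; apply: ler_pM => //; last by rewrite normr_prod; apply: ler_prod => b _; rewrite normr_ge0/=.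
rewrite ger0_norm ?invr_ge0 ?exprn_ge0 ?enorm_ge0// lef_pV2 ?posrE ?exprn_gt0//.
by rewrite lerXn2r ?nnegrE ?enorm_ge0 ?ltW.
Qed.

Lemma rough_real (q : R) : (0 < n)%N -> @crit R m < q ->
  exists2 C : R, 0 < C & forall (w : MM -> R) (f : 'I_m.+1 -> V -> R) (s : R) (t : 'I_m.+1 -> R) (e : R) k,
    measurable_fun setT w -> zero_homog w -> 0 < s ->
    (\int[leb2]_y (`|w y| `^ q * (inball 1 y)%:R)%:E <= (s `^ q)%:E)%E ->
    \int[leb2]_y (w y * (inball 1 y)%:R) = 0 ->
    (forall a, nice (f a)) -> (forall a, continuous (f a)) -> (forall a, 0 < t a) ->
    (forall a, n2 (f a) <= t a) -> 0 < e ->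
    (\int[mu]_x (`|Tek e k (wker w) f x| `^ p)%:E <= (C * (s * \prod_a t a) `^ p)%:E)%E.
Proof.
move=> n0 hq; have [CT CT0 H] := @real_bound R m n q n0 hq.
have q1 := le_trans (@crit_ge1 R m) (ltW hq); have qp : 0 < q by apply: lt_le_trans q1.
have p0 : 0 < p by rewrite divr_gt0.
(* Truncation and mean correction multiply the q-th power integral by at most 2^q 2. Division by D s
   turns this into 2 (2^-(N+1))^q <= 2^-N, the normalization of [good_wker]. *)
pose D : R := 2 ^+ N.+2; have D1 : 1 <= D by rewrite exprn_ege1// ler1n.
have D0 : 0 < D by apply: lt_le_trans D1.
exists (D `^ p * CT); first by rewrite mulr_gt0// powR_gt0.
move=> w f s t e k mw hw s0 wq w0 nf cf t0 ft e0.
have [nb1 ib1] := @int_inball R m.+1 n 1; set v1 := @vol R m.+1 n 1 in ib1.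
have v10 : 0 <= v1 by exact: vol_ge0.
pose tr (j : nat) y := w y * (`|w y| <= j%:R)%R%:R.
have mtr j : measurable_fun setT (tr j).
  by apply: measurable_funM => //; apply: measurable_boolR; apply: measurable_fun_ler => //; exact: measurableT_comp.
have trB j y : `|tr j y| <= j%:R.
  by rewrite /tr; case: (boolP (`|w y| <= j%:R)) => h; rewrite ?mulr1// mulr0 normr0.
have trw j y : `|tr j y| <= `|w y|.
  by rewrite /tr; case: (`|w y| <= j%:R); rewrite ?mulr1// mulr0 normr0.
have ntr j : niceY (fun y => tr j y * (inball 1 y)%:R) by apply: niceMl => //; exists j%:R.
(* Truncation destroys the cancellation; subtracting the mean over the unit ball restores it, and
   these means tend to 0. *)
pose a (j : nat) := (\int[leb2]_y (tr j y * (inball 1 y)%:R)) / v1.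
have ia : leb2.-integrable setT (EFin \o (fun y => w y * (inball 1 y)%:R)).
  exact: ball_integrable q1 mw hw wq ltr01.
have ca : a j @[j --> \oo] --> (0 : R).
  have -> : (0 : R) = v1^-1 * \int[leb2]_y (w y * (inball 1 y)%:R) by rewrite w0 mulr0.
  rewrite (_ : a = (fun j => v1^-1 * \int[leb2]_y (tr j y * (inball 1 y)%:R))); last first.
    by apply/funext => j; rewrite /a mulrC.
  apply: cvg_mulc; apply: (Rint_dominated (g := fun y => `|w y * (inball 1 y)%:R|)) => //.
  - by move=> j; exact: nice_meas (ntr j).
  - move=> y; apply: cvg_near_cst; near=> j; rewrite /tr.
    have -> : `|w y| <= j%:R by near: j; exact: nbhs_infty_ger.
    by rewrite mulr1.
  - by have := integrable_norm ia.
  by move=> j y; rewrite normrM [leRHS]normrM; apply: ler_wpM2r => //; exact: trw.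
(* Beyond this index the corrections have q-th power integral at most s^q over the unit ball, so the
   truncations [wj] start at J. *)
have aJ : \forall j \near \oo, `|a j| <= s / (1 + v1).
  have sv : 0 < s / (1 + v1) by rewrite divr_gt0// ltr_pwDl.
  by move: ca => /cvgrPdist_le /(_ _ sv); apply: filterS => j; rewrite sub0r normrN.
have [J _ hJ] := aJ.
pose c1 := (D * s)^-1; have c10 : 0 < c1 by rewrite invr_gt0 mulr_gt0.
pose wj j y := c1 * (tr (j + J) y - a (j + J)).
have mwj j : measurable_fun setT (wj j) by apply: measurable_funM => //; exact: measurable_funB.
have wjB j y : `|wj j y| <= c1 * ((j + J)%:R + `|a (j + J)|).
  rewrite normrM gtr0_norm// ler_wpM2l ?(ltW c10)//; apply: le_trans (ler_normB _ _) _.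
  by apply: lerD.
have hwj j : zero_homog (wj j) by move=> u y u0; rewrite /wj /tr hw.
have wj0 j : \int[leb2]_y (wj j y * (inball 1 y)%:R) = 0.
  have nd := niceB (ntr (j + J)%N) (niceZ (a (j + J)%N) nb1).
  have -> : \int[leb2]_y (wj j y * (inball 1 y)%:R) = c1 * \int[leb2]_y (tr (j + J) y * (inball 1 y)%:R - a (j + J) * (inball 1 y)%:R).
    by rewrite -(intZ _ nd); apply: eq_Rintegral => y _; rewrite /wj; ring.
  rewrite (intB (ntr (j + J)%N) (niceZ (a (j + J)%N) nb1)) (intZ _ nb1) ib1 /a.
  have [v0|vn] := eqVneq v1 0; last by rewrite divfK// subrr mulr0.
  rewrite v0 mulr0 subr0 (_ : \int[leb2]_y _ = 0) ?mulr0//.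
  apply/eqP; rewrite -normr_le0; apply: le_trans (le_norm_int (ntr _)) _.
  apply: (le_trans (le_int (nice_norm (ntr _)) (niceZ (j + J)%:R nb1) _)).
    by move=> y; rewrite normrM (ger0_norm (ler0n R _)) ler_wpM2r.
  by rewrite (intZ _ nb1) ib1 v0 mulr0.
have wjq j : \int[leb2]_y (`|wj j y| `^ q * (inball 1 y)%:R) <= 2 ^- N.
  have aj : `|a (j + J)| <= s / (1 + v1) by apply: hJ => /=; exact: leq_addl.
  have v1p : 0 < 1 + v1 by rewrite ltr_pwDl.
  have mtq : measurable_fun setT (fun y => `|tr (j + J) y| `^ q).
    by apply: (measurableT_comp (measurable_powR q)); exact: measurableT_comp.
  have ntq : niceY (fun y => `|tr (j + J) y| `^ q * (inball 1 y)%:R).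
    apply: niceMl => //; exists ((j + J)%:R `^ q) => y; rewrite ger0_norm ?powR_ge0//.
    by apply: ge0_ler_powR; rewrite ?nnegrE ?(ltW qp).
  have itq : \int[leb2]_y (`|tr (j + J) y| `^ q * (inball 1 y)%:R) <= s `^ q.
    have f0 y : (0 <= (`|tr (j + J) y| `^ q * (inball 1 y)%:R)%:E)%E by rewrite lee_fin mulr_ge0 ?powR_ge0.
    have fg y : ((`|tr (j + J) y| `^ q * (inball 1 y)%:R)%:E <= (`|w y| `^ q * (inball 1 y)%:R)%:E)%E.
      by rewrite lee_fin; apply: ler_wpM2r => //; apply: ge0_ler_powR; rewrite ?nnegrE ?(ltW qp)//.
    have le1 := le_trans (@le_nnint _ _ _ leb2 _ _ f0 fg) wq.
    have e1 := @ge0_Rint _ _ _ _ _ ntq.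
    by move: le1; rewrite e1 lee_fin.
  have aq : `|a (j + J)| `^ q * v1 <= s `^ q.
    have -> : `|a (j + J)| = s * (`|a (j + J)| / s) by rewrite mulrCA mulfV ?mulr1// gt_eqF.
    have x0 : 0 <= `|a (j + J)| / s by rewrite divr_ge0// ltW.
    rewrite powRM ?(ltW s0)// -mulrA ler_piMr ?powR_ge0//.
    have x1 : `|a (j + J)| / s <= (1 + v1)^-1 by rewrite ler_pdivrMr// mulrC.
    have i1 : (1 + v1)^-1 <= 1 by rewrite invf_le1// lerDl.
    have := @powR_le_mul R (`|a (j + J)| / s) 1 q; rewrite x0 (le_trans x1 i1) powR1 mul1r => /(_ isT q1) h.
    apply: le_trans (ler_wpM2r v10 (le_trans h x1)) _.
    by rewrite ler_pdivrMl// mulr1 lerDr.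
  have pw y : `|wj j y| `^ q * (inball 1 y)%:R <=
     c1 `^ q * 2 `^ q * (`|tr (j + J) y| `^ q * (inball 1 y)%:R + `|a (j + J)| `^ q * (inball 1 y)%:R).
    rewrite -mulrDl mulrA ler_wpM2r// /wj normrM gtr0_norm// powRM ?(ltW c10)// -mulrA ler_wpM2l ?powR_ge0//.
    pose u (b : bool) := if b then `|tr (j + J) y| else `|a (j + J)|.
    have u0 b : 0 <= u b by case: b => /=.
    have := powR_sum_card u0 qp; rewrite card_bool !big_bool /=; apply: le_trans.
    by apply: ge0_ler_powR; rewrite ?nnegrE ?(ltW qp)// ?addr_ge0// ler_normB.
  have nwq : niceY (fun y => `|wj j y| `^ q * (inball 1 y)%:R).
    apply: niceMl => //.
      by apply: (measurableT_comp (measurable_powR q)); exact: measurableT_comp.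
    exists ((c1 * ((j + J)%:R + `|a (j + J)|)) `^ q) => y; rewrite ger0_norm ?powR_ge0//.
    by apply: ge0_ler_powR; rewrite ?nnegrE ?(ltW qp)// (le_trans _ (wjB j y)).
  have nR := niceD ntq (niceZ (`|a (j + J)| `^ q) nb1).
  apply: le_trans (le_int nwq (niceZ _ nR) pw) _.
  rewrite (intZ _ nR) (intD ntq (niceZ _ nb1)) (intZ _ nb1) ib1.
  apply: (@le_trans _ _ (c1 `^ q * 2 `^ q * (s `^ q + s `^ q))).
    by rewrite ler_wpM2l ?mulr_ge0 ?powR_ge0// lerD.
  have e1 : c1 `^ q * 2 `^ q * (s `^ q + s `^ q) = 2 * ((2 ^+ N.+1)^-1) `^ q.
    have -> : c1 `^ q * 2 `^ q * (s `^ q + s `^ q) = 2 * (c1 `^ q * 2 `^ q * s `^ q) by ring.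
    rewrite -!powRM ?mulr_ge0 ?(ltW c10) ?(ltW s0)//; congr (2 * _ `^ q).
    rewrite /c1 /D exprS; have : (2 ^+ N.+1 : R) != 0 by rewrite expf_neq0.
    move: (2 ^+ N.+1 : R) => z z0; field; rewrite z0 ?gt_eqF//.
  rewrite e1; have z0 : 0 <= (2 ^+ N.+1)^-1 :> R by rewrite invr_ge0 exprn_ge0.
  have z1 : (2 ^+ N.+1)^-1 <= 1 :> R by rewrite invf_le1 ?exprn_gt0// exprn_ege1// ler1n.
  have := @powR_le_mul R ((2 ^+ N.+1)^-1) 1 q; rewrite z0 z1 powR1 mul1r => /(_ isT q1) h.
  apply: le_trans (ler_wpM2l (ler0n R 2) h) _.
  by rewrite exprS invfM mulrA mulfV// mul1r.
have gj j := good_wker (mwj j) (wjB j) (hwj j) (wj0 j) q1 (wjq j).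
have nKj j r : 0 < r -> niceY (Kr r (wker (wj j))).
  by move=> r0; apply: Kr_nice_scale => //; [exact: wker_homog|exact: good_nice (gj j)].
set l0 := e * 2 ^+ k / 2.
have l_gt0 : 0 < l0 by rewrite divr_gt0// mulr_gt0// exprn_gt0.
(* [real_bound] is uniform in the level on which the functions are constant, so the averages of
   level j may be used; by continuity they converge pointwise to f b. *)
pose fj j b v := (t b)^-1 * E l0 j (f b) v.
have nfj j b : nice (fj j b) by apply: niceZ; exact: E_nice.
have cfj j b : cst_on (lv l0 j) (fj j b) by move=> x y sx; rewrite /fj (E_cst (f b) sx).
have n2fj j b : n2 (fj j b) <= 1.
  rewrite (n2Z _ (E_nice l_gt0 j (nf b))) ger0_norm ?invr_ge0 ?(ltW (t0 b))//.
  by rewrite ler_pdivrMl// mulr1; apply: le_trans (ft b); exact: E_n2.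
pose u j x := `|Tek e k (wker (wj j)) (fj j) x|.
have uC j : (\int[mu]_x (u j x `^ p)%:E <= CT%:E)%E.
  have := H _ (gj j) l0 j k (fj j) l_gt0 (nfj j) (cfj j) (n2fj j); apply: le_trans.
  apply: le_nnint => x; first by rewrite lee_fin powR_ge0.
  by rewrite /u Tek_Top//; exact: nKj.
pose P := \prod_b (t b)^-1.
have P0 : 0 < P by apply: prodr_gt0 => b _; rewrite invr_gt0.
have [Bf hBf] : exists Bf : 'I_m.+1 -> R, forall b y, `|f b y| <= Bf b.
  by exists (fun b => sval (cid (nice_bdd (nf b)))) => b; exact: svalP (cid (nice_bdd (nf b))).
have Bf0 b : 0 <= Bf b by apply: le_trans (hBf b 0).
have cvgT x : Tek e k (wker (wj j)) (fj j) x @[j --> \oo] --> c1 * P * Tek e k (wker w) f x.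
  pose h y := wker w y * (annulus e k y)%:R * \prod_b f b (x - row b y).
  pose G y := e ^- N * (c1 * (`|w y| + s)) * (inball (e * 2 ^+ k) y)%:R * \prod_b ((t b)^-1 * Bf b).
  have r0 : 0 < e * 2 ^+ k by rewrite mulr_gt0// exprn_gt0.
  have iw := ball_integrable q1 mw hw wq r0.
  have [nbr _] := @int_inball R m.+1 n (e * 2 ^+ k).
  have iG0 : leb2.-integrable setT (EFin \o (fun y => `|w y * (inball (e * 2 ^+ k) y)%:R| + s * (inball (e * 2 ^+ k) y)%:R)).
    by have := integrableD measurableT (integrable_norm iw) (nice_int (niceZ s nbr)).
  have mG : measurable_fun setT (fun y => `|w y| * (inball (e * 2 ^+ k) y)%:R).
    by apply: measurable_funM; [exact: measurableT_comp|exact: nice_meas nbr].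
  have iG c2 : leb2.-integrable setT (EFin \o (fun y => c2 * (`|w y * (inball (e * 2 ^+ k) y)%:R| + s * (inball (e * 2 ^+ k) y)%:R))).
    by have := integrableZl measurableT c2 iG0.
  pose c2 := e ^- N * c1 * \prod_b ((t b)^-1 * Bf b).
  have GE y : G y = c2 * (`|w y * (inball (e * 2 ^+ k) y)%:R| + s * (inball (e * 2 ^+ k) y)%:R).
    by rewrite /G /c2 normrM (ger0_norm (ler0n R _)); ring.
  have mrow b : measurable_fun setT (fun y : MM => x - row b y).
    have -> : (fun y : MM => x - row b y) = (fun y => x - 1 *: row b y).
      by apply/funext => y; rewrite scale1r.
    by apply: measurable_subscale => //; exact: measurable_row.
  have mcut : measurable_fun setT (fun y : MM => (annulus e k y)%:R : R).
    apply: measurable_boolR; apply: measurable_and.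
      by apply: measurable_fun_ltr => //; exact: measurable_enorm_comp.
    by apply: measurable_fun_ler => //; exact: measurable_enorm_comp.
  have cutn y : annulus e k y -> `|enorm y ^- N| <= e ^- N.
    move=> /andP[h1 _]; have ey : 0 < enorm y by apply: lt_trans h1.
    rewrite ger0_norm ?invr_ge0 ?exprn_ge0 ?enorm_ge0// lef_pV2 ?posrE ?exprn_gt0//.
    by rewrite lerXn2r ?nnegrE ?enorm_ge0 ?ltW.
  have -> : c1 * P * Tek e k (wker w) f x = \int[leb2]_y (c1 * P * h y).
    by apply/esym; apply: RintegralZl => //; exact: (cut_integrable k x q1 mw hw wq e0 nf).
  apply: (Rint_dominated (g := G)) => //.
  - move=> j; apply: measurable_funM.
      by apply: measurable_funM => //; exact: wker_meas.
    by apply: measurable_prodr => b; exact: (measurableT_comp (nice_meas (nfj j b)) (mrow b)).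
  - move=> y; rewrite /h /wker.
    have cw : wj j y @[j --> \oo] --> c1 * w y.
      have -> : c1 * w y = c1 * (w y - 0) by rewrite subr0.
      apply: cvg_mulc; apply: cvgB; last by have := ca; rewrite -(cvg_shiftn J a).
      apply: cvg_near_cst; near=> j; rewrite /tr.
      have -> : `|w y| <= (j + J)%:R.
        apply: (@le_trans _ _ j%:R); last by rewrite ler_nat leq_addr.
        by near: j; exact: nbhs_infty_ger.
      by rewrite mulr1.
    have cP : \prod_b fj j b (x - row b y) @[j --> \oo] --> \prod_b ((t b)^-1 * f b (x - row b y)).
      apply: cvg_prodr => b; apply: cvg_mulc; apply: E_cvg => //; exact: cf.
    have -> : c1 * P * (enorm y ^- N * w y * (annulus e k y)%:R * \prod_b f b (x - row b y)) =
       enorm y ^- N * (c1 * w y) * (annulus e k y)%:R * \prod_b ((t b)^-1 * f b (x - row b y)).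
      by rewrite big_split/= -/P; ring.
    by apply: cvgM => //; apply: cvgM; [exact: cvg_mulc|exact: cvg_cst].
  - by rewrite (_ : G = (fun y => c2 * (`|w y * (inball (e * 2 ^+ k) y)%:R| + s * (inball (e * 2 ^+ k) y)%:R))) //; apply/funext.
  move=> j y; rewrite /wker /G; case: (boolP (annulus e k y)) => cy; last first.
    rewrite mulr0 mul0r normr0; apply: mulr_ge0; last first.
      by apply: prodr_ge0 => b _; apply: mulr_ge0 => //; rewrite invr_ge0 ltW.
    apply: mulr_ge0 => //; apply: mulr_ge0; first by rewrite invr_ge0 exprn_ge0// ltW.
    by apply: mulr_ge0; [exact: ltW|rewrite addr_ge0// ltW].
  have /andP[_ iy] := cy; rewrite /inball iy !mulr1 normrM; apply: ler_pM => //.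
    rewrite normrM; apply: ler_pM => //; first exact: cutn.
    rewrite /wj normrM gtr0_norm// ler_wpM2l ?(ltW c10)//; apply: le_trans (ler_normB _ _) _; apply: lerD => //.
    have aj : `|a (j + J)| <= s / (1 + v1) by apply: hJ => /=; exact: leq_addl.
    by apply: le_trans aj _; rewrite ler_pdivrMr ?ltr_pwDl// ler_peMr ?(ltW s0)// lerDl.
  rewrite normr_prod; apply: ler_prod => b _; rewrite normr_ge0/= normrM gtr0_norm ?invr_gt0// ler_wpM2l ?invr_ge0 ?(ltW (t0 b))//.
  by rewrite E_avg; apply: avg_bdd => //; exact: lv_gt0.
have mT : measurable_fun setT (Tek e k (wker w) f).
  by apply: measurable_Tek; [exact: wker_meas|move=> b; exact: nice_meas (nf b)].
have c1P : 0 < c1 * P by rewrite mulr_gt0.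
have key : (\int[mu]_x ((c1 * P * `|Tek e k (wker w) f x|) `^ p)%:E <= CT%:E)%E.
  apply: (fatou_pow (u := u)) => //.
  - move=> j; apply: measurableT_comp => //; apply: measurable_Tek; first exact: wker_meas.
    by move=> b; exact: nice_meas (nfj j b).
  - by move=> j x; rewrite /u.
  - by move=> x; apply: mulr_ge0 => //; exact: ltW.
  move=> x d d0.
  have c : `|Tek e k (wker (wj j)) (fj j) x| @[j --> \oo] --> c1 * P * `|Tek e k (wker w) f x|.
    by rewrite -(gtr0_norm c1P) -normrM; apply: cvg_norm; exact: cvgT.
  move: c => /cvgrPdist_le /(_ d d0); apply: filterS => j; rewrite /u ler_norml => /andP[_]; rewrite lerBlDl//.
have E1 x : (`|Tek e k (wker w) f x| `^ p)%:E = (((c1 * P)^-1 `^ p)%:E * ((c1 * P * `|Tek e k (wker w) f x|) `^ p)%:E)%E.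
  rewrite -EFinM -powRM; [|by rewrite invr_ge0 ltW|by apply: mulr_ge0 => //; exact: ltW].
  by rewrite mulrA mulVf ?mul1r// gt_eqF.
rewrite (eq_integral _ _ (fun x _ => E1 x)) ge0_integralZl//; last 3 first.
- apply/measurable_EFinP; apply: (measurableT_comp (measurable_powR p)).
  by apply: measurable_funM => //; exact: measurableT_comp.
- by move=> x _; rewrite lee_fin powR_ge0.
- by rewrite lee_fin powR_ge0.
apply: le_trans (lee_wpmul2l _ key) _; first by rewrite lee_fin powR_ge0.
have st0 : 0 <= s * \prod_b t b by apply: mulr_ge0; [exact: ltW|apply: prodr_ge0 => b _; exact: ltW].
have -> : (c1 * P)^-1 = D * (s * \prod_b t b) by rewrite /c1 /P prodfV -invfM invrK mulrA.
rewrite -EFinM lee_fin (powRM _ (ltW D0) st0) le_eqVlt; apply/orP; left; apply/eqP; ring.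
Unshelve. all: by end_near. Qed.

End approximation.

(** * Complex functions and the sphere *)

Section complex_parts.
Context {R : realType}.
Notation C := (Rcomplex R).

Definition part (b : bool) (z : C) : R := if b then complex.Re z else complex.Im z.

Definition unitC (b : bool) : C := if b then Complex 1 0 else Complex 0 1.

Lemma partD b z1 z2 : part b (z1 + z2) = part b z1 + part b z2.
Proof. by case: b; case: z1 => ? ?; case: z2 => ? ?. Qed.

Lemma partZ b (r : R) (z : C) : part b (r *: z) = r * part b z.
Proof. by case: b; case: z. Qed.

Lemma part_sum b (I : finType) (F : I -> C) : part b (\sum_i F i) = \sum_i part b (F i).
Proof. by apply: (big_morph (part b)); [exact: partD|case: b]. Qed.

Lemma partB b z1 z2 : part b (z1 - z2) = part b z1 - part b z2.
Proof. by case: b; case: z1 => ? ?; case: z2 => ? ?. Qed.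

Lemma scaleMl (r : R) (z1 z2 : C) : (r *: z1) * z2 = r *: (z1 * z2).
Proof. by rewrite -scalerAl. Qed.

Lemma scaleMr (r : R) (z1 z2 : C) : z1 * (r *: z2) = r *: (z1 * z2).
Proof. by rewrite mulrC scaleMl mulrC. Qed.

Lemma norm_CE (x y : R) : `|Complex x y : C| = Num.sqrt (x ^+ 2 + y ^+ 2).
Proof. by []. Qed.

Lemma part_norm b (z : C) : `|part b z| <= `|z|.
Proof.
case: z => x y; rewrite norm_CE; case: b; rewrite /part/= -sqrtr_sqr ler_wsqrtr//.
  by rewrite lerDl sqr_ge0.
by rewrite lerDr sqr_ge0.
Qed.

Lemma norm_parts (z : C) : `|z| <= `|part true z| + `|part false z|.
Proof.
case: z => x y; rewrite norm_CE /part /=.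
have h0 : 0 <= `|x| + `|y| by rewrite addr_ge0.
rewrite -(ger0_norm h0) -sqrtr_sqr ler_wsqrtr//.
by rewrite sqrrD !real_normK ?num_real// addrAC lerDl mulrn_wge0// mulr_ge0//.
Qed.

Lemma split_parts (z : C) : z = \sum_b part b z *: unitC b.
Proof.
rewrite big_bool /=; case: z => x y.
rewrite -[x *: _]/(Complex (x * 1) (x * 0)) -[y *: _]/(Complex (y * 0) (y * 1)) /=.
by rewrite -[_ + _]/(Complex (x * 1 + y * 0) (x * 0 + y * 1)) !mulr0 !mulr1 addr0 add0r.
Qed.

(** The structure constants of complex multiplication in the real basis 1, i: each is 0, 1 or -1.
    They reduce the complex operator to a finite combination of real ones. *)
Definition pcoef m (i : bool * (bool * {ffun 'I_m -> bool})) : R :=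
  part i.1 (unitC i.2.1 * \prod_j unitC (i.2.2 j)).

Lemma part_prod m b (z : C) (u : 'I_m -> C) :
  part b (z * \prod_j u j) =
  \sum_(i : bool * {ffun 'I_m -> bool}) pcoef (b, i) * (part i.1 z * \prod_j part (i.2 j) (u j)).
Proof.
have -> : \prod_j u j = \sum_(S : {ffun 'I_m -> bool}) (\prod_j part (S j) (u j)) *: \prod_j unitC (S j).
  rewrite (eq_bigr _ (fun j _ => split_parts (u j))) bigA_distr_bigA /=.
  apply: eq_bigr => S _; apply: (big_rec3 (fun a b c => a = b *: c)); first by rewrite scale1r.
  by move=> j a1 a2 a3 _ ->; rewrite scaleMl scaleMr scalerA.
rewrite {1}(split_parts z) mulr_suml.
rewrite part_sum -(pair_bigA _ (fun b0 S => pcoef (b, (b0, S)) * (part b0 z * \prod_j part (S j) (u j)))) /=.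
apply: eq_bigr => b0 _; rewrite mulr_sumr part_sum; apply: eq_bigr => S _.
by rewrite scaleMl scaleMr scalerA partZ mulrC.
Qed.

Lemma part_continuous b (T : topologicalType) (f : T -> C) : continuous f -> continuous (fun x => part b (f x)).
Proof.
move=> cf x; apply/cvgrPdist_le => e e0.
have := cf x; move=> /cvgrPdist_le /(_ e e0); apply: filterS => y; apply: le_trans.
by rewrite -partB; exact: part_norm.
Qed.

End complex_parts.

Section nonintegrable.
Context d (T : measurableType d) (R : realType) (nu : {measure set T -> \bar R}).

(* [fine] sends both infinities to [0]. *)
Lemma Rint_nonint (f : T -> R) : measurable_fun setT f -> ~ nu.-integrable setT (EFin \o f) ->
  \int[nu]_x f x = 0.
Proof.
move=> mf nif; apply: contrapT => /eqP f0; apply: nif.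
have mEf : measurable_fun setT (EFin \o f) by exact/measurable_EFinP.
have fin : (\int[nu]_x (f x)%:E)%E \is a fin_num.
  by move: f0; rewrite /Rintegral; case: (\int[nu]_x (f x)%:E)%E => [r| |]//=; rewrite eqxx.
move: fin; rewrite integralE fin_numB => /andP[fp fn].
apply/integrableP; split => //.
rewrite (eq_integral (fun x => ((EFin \o f)^\+ x + (EFin \o f)^\- x)%E)); last first.
  by move=> x _; rewrite -[LHS]/((abse \o (EFin \o f)) x) fune_abse.
rewrite ge0_integralD//; last 2 first.
- exact: measurable_funepos.
- exact: measurable_funeneg.
by apply: lte_add_pinfty; rewrite ltey_eq ?fp ?fn.
Qed.

End nonintegrable.

Section sphere.
Context {R : realType} {m n : nat}.
Notation MM := 'M[R]_(m.+1, n).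
Notation N := (m.+1 * n)%N.
Notation leb2 := (leb R m.+1 n).
Notation sigma := (@surface_measure R m.+1 n).
Notation sph := (@unit_sphere R m.+1 n).

Lemma direction_sphere (y : MM) : 0 < enorm y -> sph (direction y).
Proof.
move=> y0; rewrite /unit_sphere/= /direction enormZ ger0_norm ?invr_ge0 ?enorm_ge0//.
by rewrite mulVf// gt_eqF.
Qed.

Lemma sphere_measurable : measurable sph.
Proof.
rewrite (_ : sph = (@enorm R m.+1 n) @^-1` [set 1]); last by apply/seteqP; split.
by rewrite -[X in measurable X]setTI; exact: measurable_enorm.
Qed.

(** The function on the cone over the sphere to which the surface measure pulls F back. *)
Definition onball (F : MM -> R) y : R := if (0 < enorm y) && (enorm y <= 1) then F (direction y) else 0.

Lemma sphere_ge0 (F : MM -> R) : measurable_fun setT F -> (forall y, 0 <= F y) ->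
  (\int[sigma]_y (F y)%:E = N%:R%:E * \int[leb2]_y (onball F y)%:E)%E.
Proof.
move=> mF F0; have mFE : measurable_fun setT (fun y => (F y)%:E) by exact/measurable_EFinP.
have F0E y : setT y -> (0 <= (F y)%:E)%E by rewrite lee_fin.
rewrite /surface_measure (ge0_integral_mscale _ measurableT _ mFE F0E) /=; congr (_ * _)%E.
have md := @measurable_direction R m.+1 n.
have mB := @measurable_punctured_ball R m.+1 n.
pose nu := mrestr (mx_lebesgue R m.+1 n) mB.
have mFd : measurable_fun setT (fun y : MM => (F (direction y))%:E).
  by exact: (measurableT_comp mFE md).
rewrite -[LHS]/(\int[pushforward nu (@direction R m.+1 n)]_x (F x)%:E)%E.
rewrite (ge0_integral_pushforward md nu measurableT mFE (fun y _ => F0E y I)) preimage_setT.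
have nz : nu (~` @punctured_ball R m.+1 n) = 0%E.
  rewrite /nu.
  by rewrite [LHS]/(mx_lebesgue R m.+1 n (~` @punctured_ball R m.+1 n `&` @punctured_ball R m.+1 n)) setICl; exact: (measure0 (mx_lebesgue R m.+1 n)).
rewrite (ge0_negligible_integral (measurableC mB) measurableT mFd _ nz); last by move=> y _; rewrite lee_fin.
rewrite setTD setCK (@eq_measure_integral _ _ _ _ leb2 nu); last first.
  by move=> A mA AB; rewrite /nu /= /mrestr setIidl.
rewrite integral_mkcond; apply: eq_integral => y _; rewrite patchE /onball.
case: (boolP ((0 < enorm y) && (enorm y <= 1))) => h; first by rewrite mem_set.
by rewrite memNset//; exact/negP.
Qed.

Variable Om : MM -> Rcomplex R.

(** The extension of degree 0 of one real component of [Om]. It is measurable on the whole space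
    although [Om] is so only on the sphere. *)
Definition wpart b (y : MM) : R := if 0 < enorm y then part b (Om (direction y)) else 0.

Lemma wpart_homog b : zero_homog (wpart b).
Proof.
move=> t y t0; rewrite /wpart /direction enormZ gtr0_norm// pmulr_rgt0//.
case: ltP => // y0; congr (part b (Om _)).
by rewrite invfM scalerA mulrAC mulVf ?mul1r// gt_eqF.
Qed.

Hypothesis mOm : complex_measurable sph Om.

Let ext b : MM -> R := (fun y => part b (Om y)) \_ sph.

Let mext b : measurable_fun setT (ext b).
Proof.
apply/(measurable_restrictT _ sphere_measurable).
by case: mOm; case: b.
Qed.

Let extE b y : sph y -> ext b y = part b (Om y).
Proof. by move=> h; rewrite /ext patchE mem_set. Qed.

Lemma wpart_meas b : measurable_fun setT (wpart b).
Proof.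
rewrite (_ : wpart b = (fun y => (0 < enorm y)%R%:R * ext b (direction y))); last first.
  apply/funext => y; rewrite /wpart; case: (ltP 0 (enorm y)) => h; last by rewrite mul0r.
  by rewrite mul1r extE//; exact: direction_sphere.
apply: measurable_funM; last exact: (measurableT_comp (mext b) (@measurable_direction R m.+1 n)).
apply: measurable_boolR; apply: measurable_fun_ltr => //; exact: measurable_enorm.
Qed.

Let onball_wpart b (phi : R -> R) y : phi 0 = 0 ->
  onball (fun y => phi (ext b y)) y = phi (wpart b y * (inball 1 y)%:R).
Proof.
move=> p0; rewrite /onball /wpart /inball; case: ltP => y0 /=; last by rewrite mul0r p0.
by case: (leP (enorm y) 1) => h; rewrite ?mulr1 ?mulr0// extE//; exact: direction_sphere.
Qed.

(** The integral over the sphere is N times the one over the ball, and N >= 1. *)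
Lemma wpart_powR b (q : R) (B : \bar R) : (0 < N)%N -> 0 < q ->
  (\int[sigma]_y ((fun y => (`|Om y| `^ q)%:E) \_ sph) y <= B)%E ->
  (\int[leb2]_y (`|wpart b y| `^ q * (inball 1 y)%:R)%:E <= B)%E.
Proof.
move=> N0 q0; apply: le_trans.
have mF : measurable_fun setT (fun y => `|ext b y| `^ q).
  by apply: (measurableT_comp (measurable_powR q)); exact: (measurableT_comp _ (mext b)).
apply: (@le_trans _ _ (\int[sigma]_y (`|ext b y| `^ q)%:E)%E); last first.
  apply: le_nnint => y; first by rewrite lee_fin powR_ge0.
  rewrite patchE /ext patchE; case: ifP => h; last by rewrite normr0 powR0// gt_eqF.
  by rewrite lee_fin; apply: ge0_ler_powR; rewrite ?nnegrE ?(ltW q0)//; exact: part_norm.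
rewrite (sphere_ge0 mF); last by move=> y; exact: powR_ge0.
have e0 : `|0 : R| `^ q = 0 by rewrite normr0 powR0// gt_eqF.
rewrite (eq_integral (fun y => (onball (fun y => `|ext b y| `^ q) y)%:E)); last first.
  move=> y _; rewrite (@onball_wpart b (fun x => `|x| `^ q) y e0).
  rewrite /inball; case: (enorm y <= 1); first by rewrite !mulr1.
  by rewrite !mulr0 e0.
apply: lee_pemull; last by rewrite lee_fin ler1n.
apply: integral_ge0 => y _; rewrite lee_fin /onball; case: ifP => // _; exact: powR_ge0.
Qed.

Lemma wpart_mean0 b : (0 < N)%N -> sphere_integral Om = 0 ->
  leb2.-integrable setT (EFin \o (fun y => wpart b y * (inball 1 y)%:R)) ->
  \int[leb2]_y (wpart b y * (inball 1 y)%:R) = 0.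
Proof.
move=> N0 h0 /integrableP[mi ii].
have hb : \int[sigma]_(y in sph) part b (Om y) = 0.
  by have := congr1 (part b) h0; case: b {mi ii}.
move: hb; rewrite /Rintegral integral_mkcond.
rewrite (_ : _ \_ sph = (fun y => (ext b y)%:E)); last first.
  by apply/funext => y; rewrite /ext !patchE; case: ifP.
(* [sphere_ge0] concerns nonnegative functions, so positive and negative parts are transferred
   separately and recombined once they are known to be finite. *)
pose P (x : R) := Num.max x 0; pose M (x : R) := Num.max (- x) 0.
have mP : measurable_fun setT (fun y => P (ext b y)) by apply: measurable_maxr => //; exact: mext.
have mM : measurable_fun setT (fun y => M (ext b y)).
  by apply: measurable_maxr => //; apply: measurable_funN; exact: mext.
have P0 x : 0 <= P x by rewrite /P le_max lexx orbT.
have M0 x : 0 <= M x by rewrite /M le_max lexx orbT.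
have Pz : P 0 = 0 by rewrite /P maxxx.
have Mz : M 0 = 0 by rewrite /M oppr0 maxxx.
rewrite integralE [in X in _ -> X]integralE.
have e1 : (\int[sigma]_y ((fun y => (ext b y)%:E)^\+ y) = N%:R%:E * \int[leb2]_y ((fun y => (wpart b y * (inball 1 y)%:R)%:E)^\+ y))%E.
  rewrite (eq_integral (fun y => (P (ext b y))%:E)); last by move=> y _; rewrite funeposE /P EFin_max.
  rewrite (sphere_ge0 mP)//; congr (_ * _)%E; apply: eq_integral => y _.
  by rewrite (@onball_wpart b P y Pz) funeposE /P EFin_max.
have e2 : (\int[sigma]_y ((fun y => (ext b y)%:E)^\- y) = N%:R%:E * \int[leb2]_y ((fun y => (wpart b y * (inball 1 y)%:R)%:E)^\- y))%E.
  rewrite (eq_integral (fun y => (M (ext b y))%:E)); last by move=> y _; rewrite funenegE /M EFin_max.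
  rewrite (sphere_ge0 mM)//; congr (_ * _)%E; apply: eq_integral => y _.
  by rewrite (@onball_wpart b M y Mz) funenegE /M EFin_max.
rewrite e1 e2.
have ig : leb2.-integrable setT (EFin \o (fun y => wpart b y * (inball 1 y)%:R)) by apply/integrableP.
have ip := integrable_pos_fin_num measurableT ig; have im := integrable_neg_fin_num measurableT ig.
rewrite -(fineK ip) -(fineK im) -!EFinM -!EFinB /= -mulrBr => /eqP.
by rewrite mulf_eq0 pnatr_eq0 -[(_ == 0)%N]negbK -lt0n N0 /= => /eqP.
Qed.

End sphere.

Section Lnorm_real.
Context d (T : measurableType d) (R : realType) (mu : {measure set T -> \bar R}).
Variable f : T -> Rcomplex R.

Lemma complex_LnormE (p : R) :
  complex_Lnorm mu p%:E f = ((\int[mu]_x (`|f x| `^ p)%:E) `^ p^-1)%E.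
Proof.
rewrite /complex_Lnorm unlock /=; congr (_ `^ _)%E; apply: eq_integral => x _ /=.
by rewrite normr_id.
Qed.

Let I0 (p : R) : (0 <= \int[mu]_x (`|f x| `^ p)%:E)%E.
Proof. by apply: integral_ge0 => x _; rewrite lee_fin powR_ge0. Qed.

Lemma Lnorm_le_int (p t : R) : 0 < p -> 0 <= t -> (complex_Lnorm mu p%:E f <= t%:E)%E ->
  (\int[mu]_x (`|f x| `^ p)%:E <= (t `^ p)%:E)%E.
Proof.
move=> p0 t0; rewrite complex_LnormE; move: (I0 p); case: (\int[mu]_x _)%E => [a| |] //=.
  rewrite !lee_fin => a0 h; have -> : a = (a `^ p^-1) `^ p by rewrite -powRrM mulVf ?gt_eqF// powRr1.
  by apply: ge0_ler_powR; rewrite ?nnegrE ?powR_ge0 ?(ltW p0).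
by rewrite invr_eq0 gt_eqF.
Qed.

Lemma int_le_Lnorm (p t : R) : 0 < p -> 0 <= t -> (\int[mu]_x (`|f x| `^ p)%:E <= (t `^ p)%:E)%E ->
  (complex_Lnorm mu p%:E f <= t%:E)%E.
Proof.
move=> p0 t0; rewrite complex_LnormE; move: (I0 p); case: (\int[mu]_x _)%E => [a| |] //=.
rewrite !lee_fin => a0 h; have -> : t = (t `^ p) `^ p^-1 by rewrite -powRrM mulfV ?gt_eqF// powRr1.
by apply: ge0_ler_powR; rewrite ?nnegrE ?powR_ge0 ?invr_ge0 ?(ltW p0).
Qed.

End Lnorm_real.

Section sphere_exponent.
Context {R : realType} {m n : nat}.
Notation MM := 'M[R]_(m.+1, n).
Notation sigma := (@surface_measure R m.+1 n).
Notation sph := (@unit_sphere R m.+1 n).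

Lemma surface_measure_fin : (sigma setT < +oo)%E.
Proof.
have -> : sigma setT = ((m.+1 * n)%:R%:E * mx_lebesgue R m.+1 n
    (setT `&` @punctured_ball R m.+1 n))%E by [].
rewrite setTI lte_mul_pinfty//; apply: le_lt_trans (@ball_lty R m.+1 n 1).
apply: (le_measure (leb R m.+1 n)); rewrite ?inE//; first exact: measurable_punctured_ball.
  have -> : [set y | inball 1 y] = (@enorm R m.+1 n) @^-1` `]-oo, 1].
    by apply/seteqP; split => y; rewrite /inball /= in_itv.
  by rewrite -[X in measurable X]setTI; exact: measurable_enorm.
by move=> y /andP[].
Qed.

Lemma sphere_norm_meas (Om : MM -> Rcomplex R) (q : R) : complex_measurable sph Om ->
  measurable_fun setT ((fun y => (`|Om y| `^ q)%:E) \_ sph).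
Proof.
move=> [m1 m2]; apply/(measurable_restrictT _ (@sphere_measurable R m n)).
apply/measurable_EFinP; apply: (measurableT_comp (measurable_powR q)).
rewrite (_ : (fun y => `|Om y|) = (fun y => (complex.Re (Om y) ^+ 2 + complex.Im (Om y) ^+ 2) `^ 2^-1)); last first.
  apply/funext => y; case: (Om y) => a b; rewrite norm_CE powR12_sqrt//=.
  by rewrite addr_ge0// sqr_ge0.
apply: (measurableT_comp (measurable_powR _)).
by apply: measurable_funD; apply: measurable_funX.
Qed.

(** Replaces the extended exponent by a finite one. The sphere has finite measure, so an essential
    bound controls every finite power. *)
Lemma sphere_exponent (q : \bar R) : ((@crit R m)%:E < q)%E ->
  exists q' B : R, [/\ @crit R m < q', 0 < B & forall (Om : MM -> Rcomplex R) r,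
    complex_measurable sph Om -> 0 <= r -> (sphere_Lnorm q Om <= r%:E)%E ->
    (\int[sigma]_y ((fun y => (`|Om y| `^ q')%:E) \_ sph) y <= ((B * r) `^ q')%:E)%E].
Proof.
have c0 : 0 < @crit R m by apply: lt_le_trans (@crit_ge1 R m).
case: q => [q| |//].
  rewrite lte_fin => hq; exists q, 1; split => // Om r mO r0 h; rewrite mul1r.
  have q0 : 0 < q by apply: lt_trans hq.
  apply: le_trans (Lnorm_le_int q0 r0 h); apply: le_nnint => y; rewrite patchE; case: ifP => // _.
  by rewrite lee_fin powR_ge0.
move=> _; set s := fine (sigma setT).
have s0 : 0 <= s by exact: fine_ge0.
have sE : sigma setT = s%:E by rewrite fineK// ge0_fin_numE// surface_measure_fin.
(* The case q = +oo: the exponent [crit] + 1 is finite and supercritical, and (1 + s)^q' is at least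
   the total mass s because q' >= 1. *)
exists (@crit R m + 1), (1 + s); split; [by rewrite ltrDl|by rewrite ltr_pwDl|].
move=> Om r mO r0; set q := @crit R m + 1.
have q0 : 0 < q by rewrite addr_gt0.
have q1 : 1 <= q by rewrite lerDr ltW.
rewrite /sphere_Lnorm /complex_Lnorm unlock => h.
(* If the total mass is zero the sup norm is 0 by convention, but then every statement holds almost
   everywhere. *)
have ae : {ae sigma, forall y, `|Om y| <= r}.
  move: h; case: ifP => [_ /ess_sup_inf.ess_supP|/negbT].
    by apply: filterS => y /=; rewrite normr_id lee_fin.
  rewrite -leNgt => h _; exists setT; split => //.
  by apply/eqP; rewrite eq_le h measure_ge0.
apply: (@le_trans _ _ (\int[sigma]_y cst (r `^ q)%:E y)%E); last first.
  rewrite integral_cst// [X in (_ * X)%E]sE -EFinM lee_fin powRM ?addr_ge0// mulrC ler_wpM2r ?powR_ge0//.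
  apply: (@le_trans _ _ (1 + s)); first by rewrite lerDr.
  by rewrite -{1}[1 + s]powRr1 ?addr_ge0// ler_powR// lerDl.
apply: ae_ge0_le_integral => //.
- by move=> y _; rewrite patchE; case: ifP => // _; rewrite lee_fin powR_ge0.
- exact: sphere_norm_meas.
- by move=> y _; rewrite lee_fin powR_ge0.
apply: filterS ae => y hy _; rewrite patchE; case: ifP => _ /=.
  by rewrite lee_fin; apply: ge0_ler_powR; rewrite ?nnegrE ?(ltW q0).
by rewrite lee_fin powR_ge0.
Qed.

End sphere_exponent.

(** * Schwartz functions are bounded and integrable *)

Section schwartz_nice.
Context {R : realType} {n : nat}.
Notation V := 'rV[R]_n.
Notation mu := (leb R 1 n).
Notation nice := (nice (leb R 1 n)).
Notation n2 := (n2 (leb R 1 n)).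

Lemma cell_measurable l (phi : {ffun 'I_n -> int} -> R) :
  measurable_fun setT (fun x : V => phi [ffun i => gfl l x i]).
Proof.
move=> _ B mB; rewrite setTI.
pose cell (k : {ffun 'I_n -> int}) : set V := [set x | forall i, gfl l x i = k i].
have -> : (fun x : V => phi [ffun i => gfl l x i]) @^-1` B =
    \bigcup_k (cell k `&` [set _ | B (phi k)]).
  apply/seteqP; split => x /=.
    by move=> h; exists [ffun i => gfl l x i] => //; split => // i; rewrite ffunE.
  move=> [k _ [ck /= Bk]]; have -> : [ffun i => gfl l x i] = k by apply/ffunP => i; rewrite ffunE ck.
  exact: Bk.
apply: countable_bigcupT_measurable; first exact: countableP.
move=> k; have mc : measurable (cell k).
  have -> : cell k = \bigcap_(i in [set: 'I_n]) ((fun x : V => (gfl l x i)%:~R : R) @^-1` [set (k i)%:~R]).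
    apply/seteqP; split => x /= h i; first by move=> _ /=; rewrite h.
    by have /eqP := h i I; rewrite eqr_int => /eqP.
  apply: fin_bigcap_measurable; first exact: finite_finset.
  by move=> i _; rewrite -[X in measurable X]setTI; exact: measurable_gfl.
case: (pselect (B (phi k))) => h.
  by rewrite (_ : _ `&` _ = cell k)//; apply/seteqP; split => x //= [].
by rewrite (_ : _ `&` _ = set0)//; apply/seteqP; split => x //= [].
Qed.

(** The sigma-algebra is generated by the coordinates, not by the topology. A continuous function is
    the pointwise limit of step functions on the grids of side 2^-j, evaluated at the lower corners
    of the cells. *)
Lemma continuous_meas (f : V -> R) : continuous f -> measurable_fun setT f.
Proof.
move=> cf; pose c (j : nat) (k : {ffun 'I_n -> int}) : V := \row_i ((k i)%:~R * (2 ^+ j)^-1).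
pose g j (x : V) := f (c j [ffun i => gfl (2 ^+ j)^-1 x i]).
apply: (measurable_fun_cvg (h := g)).
  by move=> j; exact: (cell_measurable _ (fun k => f (c j k))).
move=> x _; apply/cvgrPdist_le => e e0.
have := cf x; move=> /cvgrPdist_le/(_ e e0) /nbhs_ballP[d /= d0 hd].
have ld : 0 <= d^-1 by rewrite invr_ge0 ltW.
have hM := archi_boundP ld; set J := Num.bound d^-1 in hM.
exists J => // j /= Jj; apply: hd; rewrite /ball /=; split => // i k; rewrite ord1 /ball /= mxE ffunE.
set l := (2 ^+ j)^-1; have l0 : 0 < l by rewrite invr_gt0 exprn_gt0.
apply: le_lt_trans (_ : l < d).
  rewrite /gfl; have /andP[h1 h2] := floor_itv (x 0 k / l).
  move: h1 h2; set F := (Num.floor _)%:~R; rewrite intrD => h1 h2.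
  have -> : x 0 k - F * l = (x 0 k / l - F) * l by rewrite mulrBl divfK// gt_eqF.
  rewrite normrM (gtr0_norm l0) ler_piMl// ?(ltW l0)// ger0_norm ?subr_ge0// lerBlDl.
  by rewrite ltW.
rewrite /l invf_plt ?posrE ?exprn_gt0//; apply: lt_le_trans hM _.
rewrite -natrX ler_nat; apply: leq_trans Jj _; exact: ltnW (ltn_expl j (ltnSn 1)).
Qed.

(** Decay of order 2 (n + 1) makes the integrals over the shells between dyadic balls a convergent
    geometric series, and Fatou's lemma passes to the whole space. *)
Lemma nice_decay (g : V -> R) M0 M1 : measurable_fun setT g -> (forall x, `|g x| <= M0) ->
  (forall x : V, (enorm x ^+ 2) ^+ n.+1 * `|g x| <= M1) -> nice g.
Proof.
move=> mg gM0 gM1.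
have M00 : 0 <= M0 by apply: le_trans (gM0 0).
have M10 : 0 <= M1 by apply: le_trans (gM1 0); rewrite mulr_ge0// exprn_ge0// sqr_ge0.
pose v := @vol R 1 n 1; have v0 : 0 <= v by exact: vol_ge0.
pose b (j : nat) (x : V) : R := (inball (2 ^+ j) x)%:R.
have nb j : nice (b j) := (int_inball _).1.
have ngb j : nice (fun x => `|g x| * b j x).
  apply: niceMl => //; first exact: measurableT_comp.
  by exists M0 => x; rewrite normr_id.
pose S j := \int[mu]_x (`|g x| * b j x).
(* On the shell from radius 2^j to 2^(j+1) the function is at most M1 2^(-2j(n+1)) and the volume at
   most v 2^(n(j+1)); the product is at most D 2^-j. *)
pose D := M1 * 2 ^+ n * v.
have D0 : 0 <= D by rewrite mulr_ge0// mulr_ge0// exprn_ge0.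
have step j : S j.+1 <= S j + D * 2 ^- j.
  have z0 : 0 < 2 ^+ j :> R by rewrite exprn_gt0.
  have z1 : 1 <= 2 ^+ j :> R by rewrite exprn_ege1// ler1n.
  have nn := niceD (ngb j) (niceZ (M1 * ((2 ^+ j) ^+ 2) ^- n.+1) (nb j.+1)).
  apply: le_trans (le_int (ngb j.+1) nn _) _.
    move=> x; rewrite /b /inball; case: (leP (enorm x) (2 ^+ j)) => h.
      have -> : enorm x <= 2 ^+ j.+1 by apply: le_trans h _; rewrite exprS ler_peMl ?ler1n// ltW.
      by rewrite !mulr1 lerDl mulr_ge0// invr_ge0 exprn_ge0// sqr_ge0.
    rewrite mulr0 add0r; apply: ler_wpM2r => //.
    rewrite ler_pdivlMr ?exprn_gt0// mulrC; apply: le_trans (gM1 x); apply: ler_wpM2r => //.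
    by rewrite lerXn2r ?nnegrE ?sqr_ge0// lerXn2r ?nnegrE ?enorm_ge0 ?ltW.
  rewrite (intD (ngb j) (niceZ _ (nb j.+1))) (intZ _ (nb j.+1)) lerD2l (int_inball _).2.
  rewrite vol_scale ?exprn_gt0// mul1n -/v /D (exprS 2 j) (exprMn n 2 (2 ^+ j)).
  have -> : M1 * ((2 ^+ j) ^+ 2) ^- n.+1 * (2 ^+ n * (2 ^+ j) ^+ n * v) =
     M1 * 2 ^+ n * v * ((2 ^+ j) ^- 2 * (2 ^+ j) ^- n).
    move: z0; move: (2 ^+ j : R) (2 ^+ n : R) => z w z0.
    have -> : (z ^+ 2) ^+ n.+1 = z ^+ 2 * (z ^+ n) ^+ 2 by rewrite exprS -!exprM mulnC.
    have zn : z ^+ n != 0 by rewrite expf_neq0// gt_eqF.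
    by move: (z ^+ n) zn => y y0; field; rewrite y0 gt_eqF.
  apply: ler_wpM2l => //; rewrite expr2 invfM -mulrA ler_piMr ?invr_ge0 ?(ltW z0)//.
  by rewrite mulr_ile1 ?invr_ge0 ?exprn_ge0 ?(ltW z0)// invf_le1 ?exprn_gt0// exprn_ege1.
have Sb j : S j <= S 0%N + 2 * D - 2 * D * 2 ^- j.
  elim: j => [|j IH]; first by rewrite expr0 invr1 mulr1; lra.
  apply: le_trans (step j) _; rewrite exprS invfM; lra.
have key : (\int[mu]_x (`|g x| `^ 1)%:E <= (S 0%N + 2 * D)%:E)%E.
  apply: (fatou_pow (u := fun j x => `|g x| * b j x)) => //.
  - by move=> j; exact: nice_meas (ngb j).
  - by move=> j x; rewrite mulr_ge0.
  - move=> x e e0; have hM := archi_boundP (@enorm_ge0 R 1 n x); set J := Num.bound (enorm x) in hM.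
    exists J => // j /= Jj; rewrite /b /inball.
    have -> : enorm x <= 2 ^+ j.
      apply/ltW/(lt_le_trans hM); rewrite -natrX ler_nat; apply: leq_trans Jj _.
      exact: ltnW (ltn_expl j (ltnSn 1)).
    by rewrite mulr1 lerDl ltW.
  move=> j; under eq_integral do rewrite powRr1 ?mulr_ge0//.
  rewrite (ge0_Rint (ngb j)) lee_fin; apply: le_trans (Sb j) _.
  by rewrite gerBl// mulr_ge0 ?invr_ge0 ?exprn_ge0// mulr_ge0.
split => //; first by exists M0.
apply/integrableP; split; first exact/measurable_EFinP.
apply: le_lt_trans (ltry (S 0%N + 2 * D)); apply: le_trans key.
by apply: le_nnint => x //=; rewrite powRr1.
Qed.

Lemma schwartz_nice (f : V -> Rcomplex R) b : schwartz f ->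
  nice (fun x => part b (f x)) /\ continuous (fun x => part b (f x)).
Proof.
move=> [sm dec]; have cf : continuous f by have [] := sm [::].
have cp := @part_continuous R b _ f cf.
split => //.
have [M0 hM0] := dec (fun _ => 0%N) [::].
have [M1 hM1] : exists M1 : 'I_n -> R, forall i (x : V), `|x 0 i| ^+ (2 * n.+1) * `|f x| <= M1 i.
  have h i : exists M, forall x : V, `|x 0 i| ^+ (2 * n.+1) * `|f x| <= M.
    have [M hM] := dec (fun j => if j == i then (2 * n.+1)%N else 0%N) [::].
    exists M => x; apply: le_trans (hM x); rewrite (bigD1 i)//= eqxx big1 ?mulr1 ?normrX//.
    by move=> j /negbTE ->; rewrite expr0.
  by exists (fun i => sval (cid (h i))) => i; exact: svalP (cid (h i)).
apply: (@nice_decay _ M0 (n%:R ^+ n.+1 * \sum_i M1 i)).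
- exact: continuous_meas.
- move=> x; apply: le_trans (part_norm b _) _; have := hM0 x.
  by rewrite big1 ?normr1 ?mul1r// => i _; rewrite expr0.
move=> x; apply: (@le_trans _ _ ((enorm x ^+ 2) ^+ n.+1 * `|f x|)).
  by apply: ler_wpM2l; [rewrite exprn_ge0// sqr_ge0|exact: part_norm].
(* Reduces the power of the norm to monomials in one coordinate, which the definition of Schwartz
   functions controls. *)
have h : (enorm x ^+ 2) ^+ n.+1 <= n%:R ^+ n.+1 * \sum_i `|x 0 i| ^+ (2 * n.+1).
  rewrite enorm_sqr big_ord1.
  have u0 (i : 'I_n) : 0 <= x 0 i ^+ 2 by exact: sqr_ge0.
  have np : (0 : R) < n.+1%:R by [].
  have := powR_sum_card u0 np; rewrite card_ord.
  rewrite powR_mulrn ?sumr_ge0// powR_mulrn// => h; apply: le_trans h _.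
  rewrite ler_wpM2l ?exprn_ge0//; apply: ler_sum => i _.
  by rewrite powR_mulrn// -exprM -normrX ler_norm.
apply: le_trans (ler_wpM2r (normr_ge0 _) h) _.
rewrite -mulrA ler_wpM2l ?exprn_ge0// mulr_suml; apply: ler_sum => i _; exact: hM1.
Qed.

Lemma n2_part (f : V -> Rcomplex R) b (t : R) : nice (fun x => part b (f x)) -> 0 <= t ->
  (Rn_Lnorm 2 f <= t%:E)%E -> n2 (fun x => part b (f x)) <= t.
Proof.
move=> nf t0 h; rewrite -(@ler_pXn2r _ 2)// ?nnegrE ?n2_ge0// n2_sqr.
have two : 0 < 2 :> R by [].
have := Lnorm_le_int two t0 h; rewrite -lee_fin -(ge0_Rint (niceX2 nf)) powR_mulrn//; apply: le_trans.
apply: le_nnint => x; first by rewrite lee_fin sqr_ge0.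
rewrite lee_fin powR_mulrn// -[leLHS]real_normK ?num_real//.
by rewrite lerXn2r ?nnegrE// part_norm.
Qed.

End schwartz_nice.

(** * From real components to the complex operator *)

Section assembly.
Context {R : realType} {m n : nat}.
Notation V := 'rV[R]_n.
Notation MM := 'M[R]_(m.+1, n).
Notation mu := (leb R 1 n).
Notation leb2 := (leb R m.+1 n).
Notation nice := (nice (leb R 1 n)).
Notation n2 := (n2 (leb R 1 n)).
Notation p := (2 / m.+1%:R : R).
Notation I := (bool * {ffun 'I_m.+1 -> bool})%type.

Section pieces.
Variables (Om : MM -> Rcomplex R) (f : 'I_m.+1 -> V -> Rcomplex R).

Definition fpart (S : {ffun 'I_m.+1 -> bool}) (a : 'I_m.+1) (x : V) : R := part (S a) (f a x).

Definition piece (i : I) (x : V) (y : MM) : R :=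
  wker (wpart Om i.1) y * \prod_a fpart i.2 a (x - row a y).

Definition real_integrand b (x : V) (y : MM) : R := \sum_i pcoef (b, i) * piece i x y.

Definition majorant e k (x : V) : R :=
  \sum_(i : bool * I) `|pcoef i| * `|Tek e k (wker (wpart Om i.2.1)) (fpart i.2.2) x|.

(** Dominates the modulus of the truncated integral and is built from real integrals, to which
    measurability and convergence results apply. *)
Definition parts_sum e (x : V) : R := \sum_b `|part b (truncated_rough_integral Om f e x)|.

Lemma truncated_part b e x : 0 < e ->
  part b (truncated_rough_integral Om f e x) = \int[leb2]_y ((e < enorm y)%R%:R * real_integrand b x y).
Proof.
move=> e0; pose k y := rough_kernel Om y * \prod_j f j (x - row j y).
have -> : part b (truncated_rough_integral Om f e x) = \int[leb2]_(y in [set y | e < enorm y]) part b (k y).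
  by case: b.
rewrite /Rintegral integral_mkcond; congr fine; apply: eq_integral => y _; rewrite patchE.
case: ifP => h; last first.
  have -> : (e < enorm y) = false by apply/negbTE/negP => h'; move: h; rewrite mem_set.
  by rewrite mul0r.
have ey : e < enorm y by move/set_mem: h.
rewrite ey mul1r /k /rough_kernel scaleMl partZ part_prod mulr_sumr; congr (_%:E).
apply: eq_bigr => i _; rewrite /piece /wker /wpart (lt_trans e0 ey) /fpart; ring.
Qed.

Hypothesis mOm : complex_measurable (@unit_sphere R m.+1 n) Om.
Hypothesis nf : forall b a, nice (fun x => part b (f a x)).

Lemma real_integrand_meas b d (T : measurableType d) (h : T -> V) (g : T -> MM) :
  measurable_fun setT h -> measurable_fun setT g ->
  measurable_fun setT (fun z => real_integrand b (h z) (g z)).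
Proof.
move=> mh mg; apply: measurable_sum => i; apply: measurable_funM => //; apply: measurable_funM.
  by apply: (measurableT_comp _ mg); apply: wker_meas; exact: wpart_meas.
by apply: prod_rows_meas => // a; exact: nice_meas (nf _ a).
Qed.

Lemma parts_sum_meas e : 0 < e -> measurable_fun setT (parts_sum e).
Proof.
move=> e0; apply: measurable_sum => b; apply: measurableT_comp => //.
under eq_fun do rewrite truncated_part//.
apply: (measurable_Rint _ (h := fun z : V * MM => (e < enorm z.2)%R%:R * real_integrand b z.1 z.2)).
apply: measurable_funM; last exact: real_integrand_meas.
by apply: measurable_boolR; apply: measurable_fun_ltr => //; exact: measurable_enorm_comp.
Qed.

Variables (q s : R).
Hypothesis q1 : 1 <= q.
Hypothesis ws : forall b, (\int[leb2]_y (`|wpart Om b y| `^ q * (inball 1 y)%:R)%:E <= (s `^ q)%:E)%E.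

(** Between the radii e and e 2^k each piece is integrable, so linearity may be used there without
    knowing whether the integral over |y| > e converges. *)
Let cut_sum b e k x : 0 < e ->
  \int[leb2]_y ((annulus e k y)%:R * real_integrand b x y) =
  \sum_i pcoef (b, i) * Tek e k (wker (wpart Om i.1)) (fpart i.2) x /\
  leb2.-integrable setT (EFin \o (fun y => (annulus e k y)%:R * real_integrand b x y)).
Proof.
move=> e0.
pose h (i : I) y := wker (wpart Om i.1) y * (annulus e k y)%:R * \prod_a fpart i.2 a (x - row a y).
have ih i : leb2.-integrable setT (EFin \o h i).
  apply: (cut_integrable (f := fpart i.2) k x q1 (wpart_meas mOm i.1) (@wpart_homog _ _ _ Om i.1) (ws i.1) e0).
  by move=> a; exact: nf.
have ich i : leb2.-integrable setT (EFin \o (fun y => pcoef (b, i) * h i y)).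
  by have := integrableZl measurableT (pcoef (b, i)) (ih i).
have E y : (annulus e k y)%:R * real_integrand b x y = \sum_i pcoef (b, i) * h i y.
  by rewrite mulr_sumr; apply: eq_bigr => i _; rewrite /piece /h; ring.
have key (r : seq I) : \int[leb2]_y (\sum_(i <- r) pcoef (b, i) * h i y) =
    \sum_(i <- r) pcoef (b, i) * Tek e k (wker (wpart Om i.1)) (fpart i.2) x /\
    leb2.-integrable setT (EFin \o (fun y => \sum_(i <- r) pcoef (b, i) * h i y)).
  elim: r => [|i r [IH1 IH2]].
    split; last by under eq_fun do rewrite big_nil; exact: integrable0.
    rewrite big_nil /Rintegral (eq_integral (cst 0%E)); first by rewrite integral0.
    by move=> y _; rewrite big_nil.
  have es : (fun y => \sum_(j <- i :: r) pcoef (b, j) * h j y) =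
     (fun y => pcoef (b, i) * h i y + \sum_(j <- r) pcoef (b, j) * h j y).
    by apply/funext => y; rewrite big_cons.
  rewrite es big_cons; split.
    rewrite (RintegralD measurableT (ich i) IH2) IH1; congr (_ + _).
    exact: RintegralZl.
  by have := integrableD measurableT (ich i) IH2.
have [k1 k2] := key (index_enum _); split; first by rewrite -k1; apply: eq_Rintegral => y _.
by move: k2; congr (integrable _ _ (EFin \o _)); apply/funext => y; rewrite E.
Qed.

(* When the truncated integral diverges its value is the junk value [0] of [fine]. *)
Lemma parts_sum_le e x d : 0 < e -> 0 < d -> \forall k \near \oo, parts_sum e x <= majorant e k x + d.
Proof.
move=> e0 d0; pose d2 := d / 2; have d20 : 0 < d2 by rewrite divr_gt0.
have H b : \forall k \near \oo, `|part b (truncated_rough_integral Om f e x)| <=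
    `|\int[leb2]_y ((annulus e k y)%:R * real_integrand b x y)| + d2.
  rewrite (truncated_part b x e0).
  pose F y := (e < enorm y)%R%:R * real_integrand b x y.
  have mri : measurable_fun setT (real_integrand b x) by exact: real_integrand_meas.
  have mF : measurable_fun setT F.
    apply: measurable_funM => //; apply: measurable_boolR; apply: measurable_fun_ltr => //.
    exact: measurable_enorm.
  case: (pselect (leb2.-integrable setT (EFin \o F))) => [iF|niF]; last first.
    by rewrite (Rint_nonint mF niF) normr0; near=> k; rewrite addr_ge0// ltW.
  have c : \int[leb2]_y ((annulus e k y)%:R * real_integrand b x y) @[k --> \oo] --> \int[leb2]_y F y.
    apply: (Rint_dominated (g := fun y => `|F y|)).
    - move=> k; apply: measurable_funM => //; apply: measurable_boolR; apply: measurable_and.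
        by apply: measurable_fun_ltr => //; exact: measurable_enorm.
      by apply: measurable_fun_ler => //; exact: measurable_enorm.
    - move=> y; apply: cvg_near_cst.
      have ye : 0 <= enorm y / e by rewrite divr_ge0 ?enorm_ge0// ltW.
      have hM := archi_boundP ye; set J := Num.bound (enorm y / e) in hM.
      exists J => // k /= Jk; rewrite /F /annulus.
      have -> : enorm y <= e * 2 ^+ k.
        rewrite mulrC -ler_pdivrMr//; apply/ltW/(lt_le_trans hM); rewrite -natrX ler_nat.
        by apply: leq_trans Jk _; exact: ltnW (ltn_expl k (ltnSn 1)).
      by rewrite andbT.
    - by have := integrable_norm iF.
    move=> k y; rewrite /F !normrM; apply: ler_wpM2r => //; rewrite !ger0_norm// ler_nat /annulus.
    by case: (e < enorm y); case: (enorm y <= _).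
  have cn : `|\int[leb2]_y ((annulus e k y)%:R * real_integrand b x y)| @[k --> \oo] --> `|\int[leb2]_y F y|.
    by apply: cvg_norm.
  move: cn => /cvgrPdist_le /(_ d2 d20); apply: filterS => k; rewrite ler_norml => /andP[_].
  by rewrite lerBlDl.
have Ht := H true; have Hf := H false.
near=> k.
have ht : `|part true (truncated_rough_integral Om f e x)| <=
    `|\int[leb2]_y ((annulus e k y)%:R * real_integrand true x y)| + d2 by near: k.
have hf : `|part false (truncated_rough_integral Om f e x)| <=
    `|\int[leb2]_y ((annulus e k y)%:R * real_integrand false x y)| + d2 by near: k.
have hb b : `|\int[leb2]_y ((annulus e k y)%:R * real_integrand b x y)| <=
    \sum_i `|pcoef (b, i)| * `|Tek e k (wker (wpart Om i.1)) (fpart i.2) x|.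
  rewrite (cut_sum b k x e0).1; apply: le_trans (ler_norm_sum _ _ _) _.
  by apply: ler_sum => i _; rewrite normrM.
have -> : majorant e k x = \sum_b \sum_i `|pcoef (b, i)| * `|Tek e k (wker (wpart Om i.1)) (fpart i.2) x|.
  rewrite /majorant (pair_bigA _ (fun b i => `|pcoef (b, i)| * `|Tek e k (wker (wpart Om i.1)) (fpart i.2) x|)) /=.
  by apply: eq_bigr => -[b i] _.
rewrite /parts_sum !big_bool /=.
have := le_trans ht (lerD (hb true) (lexx d2)); have := le_trans hf (lerD (hb false) (lexx d2)).
by rewrite /d2; lra.
Unshelve. all: by end_near. Qed.

End pieces.

(** Two applications of Fatou's lemma: the outer radius e 2^k tends to infinity for fixed e, and
    then e runs through the powers 2^-j. The bound for the doubly truncated operators is uniform in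
    both. *)
Lemma rough_complex (q : \bar R) : (0 < n)%N -> ((@crit R m)%:E < q)%E ->
  exists2 C : R, 0 < C & forall (Om : MM -> Rcomplex R) (f : 'I_m.+1 -> V -> Rcomplex R) (s : R) (t : 'I_m.+1 -> R),
    complex_measurable (@unit_sphere R m.+1 n) Om -> sphere_integral Om = 0 ->
    0 < s -> (sphere_Lnorm q Om <= s%:E)%E -> (forall a, schwartz (f a)) ->
    (forall a, 0 < t a) -> (forall a, Rn_Lnorm 2 (f a) <= (t a)%:E)%E ->
    (\int[mu]_x (`|rough_integral Om f x| `^ p)%:E <= (C * (s * \prod_a t a) `^ p)%:E)%E.
Proof.
move=> n0 /(@sphere_exponent R m n)[q' [B [hq' B0 hB]]].
have [C0 C00 hC] := @rough_real R m n q' n0 hq'.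
have q1 : 1 <= q' := le_trans (@crit_ge1 R m) (ltW hq'); have q0 : 0 < q' by apply: lt_le_trans q1.
have N0 : (0 < m.+1 * n)%N by rewrite muln_gt0.
have p0 : 0 < p by rewrite divr_gt0.
(* The constant of [powR_sum_card] for the finite sum [majorant], for which no triangle inequality
   is available. *)
pose K : R := #|{: bool * I}|%:R `^ p * \sum_(i : bool * I) `|@pcoef R m.+1 i| `^ p.
have K0 : 0 <= K by apply: mulr_ge0; [exact: powR_ge0|apply: sumr_ge0 => i _; exact: powR_ge0].
exists ((K + 1) * (C0 * B `^ p)); first by rewrite !mulr_gt0 ?powR_gt0// ltr_wpDl.
move=> Om f s t mO O0 s0 hs sf t0 ft; set Q := (s * \prod_a t a) `^ p.
have pt0 : 0 <= \prod_a t a by apply: prodr_ge0 => a _; exact: ltW.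
have Q0 : 0 <= Q by exact: powR_ge0.
have Bs : 0 < B * s by rewrite mulr_gt0.
have ws b : (\int[leb2]_y (`|wpart Om b y| `^ q' * (inball 1 y)%:R)%:E <= ((B * s) `^ q')%:E)%E.
  by apply: wpart_powR => //; apply: hB => //; exact: ltW.
have nf b a := (schwartz_nice b (sf a)).1; have cf b a := (schwartz_nice b (sf a)).2.
have nt b a := n2_part (nf b a) (ltW (t0 a)) (ft a).
have mw b := wpart_meas mO b; have hw b := @wpart_homog R m n Om b.
have w0 b : \int[leb2]_y (wpart Om b y * (inball 1 y)%:R) = 0.
  apply: wpart_mean0 => //; exact: (ball_integrable q1 (mw b) (hw b) (ws b) ltr01).
have bound e k : 0 < e -> (\int[mu]_x (majorant Om f e k x `^ p)%:E <= (K * (C0 * B `^ p * Q))%:E)%E.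
  move=> e0.
  pose Tx (i : bool * I) x := Tek e k (wker (wpart Om i.2.1)) (fpart f i.2.2) x.
  have hT i : (\int[mu]_x (`|Tx i x| `^ p)%:E <= (C0 * B `^ p * Q)%:E)%E.
    have -> : C0 * B `^ p * Q = C0 * (B * s * \prod_a t a) `^ p.
      by rewrite /Q -mulrA -[B * s * _]mulrA (powRM _ (ltW B0)) ?mulr_ge0// ltW.
    apply: (hC (wpart Om i.2.1) (fpart f i.2.2) (B * s) t e k) => //.
    - by move=> a; exact: nf.
    - by move=> a; exact: cf.
    - by move=> a; exact: nt.
  have mT i : measurable_fun setT (fun x => (`|Tx i x| `^ p)%:E).
    apply/measurable_EFinP; apply: (measurableT_comp (measurable_powR p)); apply: measurableT_comp => //.
    by apply: measurable_Tek; [exact: wker_meas|move=> a; exact: nice_meas (nf _ a)].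
  pose c (i : bool * I) : R := #|{: bool * I}|%:R `^ p * `|pcoef i| `^ p.
  have c0 i : 0 <= c i by apply: mulr_ge0; exact: powR_ge0.
  apply: (@le_trans _ _ (\int[mu]_x \sum_(i : bool * I) (c i)%:E * (`|Tx i x| `^ p)%:E)%E).
    apply: le_nnint => x; first by rewrite lee_fin powR_ge0.
    have u0 i : 0 <= `|pcoef i| * `|Tx i x| by rewrite mulr_ge0.
    under eq_bigr do rewrite -EFinM.
    rewrite sumEFin lee_fin; apply: le_trans (powR_sum_card u0 p0) _.
    rewrite mulr_sumr; apply: ler_sum => i _; rewrite powRM// mulrA//.
  rewrite ge0_integral_sum//; last 2 first.
  - by move=> i; apply: measurable_funeM.
  - by move=> i x _; rewrite -EFinM lee_fin mulr_ge0// powR_ge0.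
  apply: (@le_trans _ _ (\sum_(i : bool * I) (c i * (C0 * B `^ p * Q))%:E)%E).
    apply: lee_sum => i _; have ci0 : (0 <= (c i)%:E)%E by rewrite lee_fin.
    rewrite ge0_integralZl//.
    by rewrite EFinM; exact: (lee_wpmul2l ci0 (hT i)).
  by rewrite sumEFin lee_fin -mulr_suml -mulr_sumr.
have bound2 e : 0 < e -> (\int[mu]_x (parts_sum Om f e x `^ p)%:E <= (K * (C0 * B `^ p * Q))%:E)%E.
  move=> e0; apply: (fatou_pow (u := majorant Om f e)) => //.
  - move=> k; apply: measurable_sum => i; apply: measurable_funM => //; apply: measurableT_comp => //.
    by apply: measurable_Tek; [exact: wker_meas|move=> a; exact: nice_meas (nf _ a)].
  - by move=> k x; apply: sumr_ge0 => i _; rewrite mulr_ge0.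
  - by move=> x; apply: sumr_ge0.
  - by move=> x d d0; exact: (parts_sum_le mO nf q1 ws).
  by move=> k; exact: bound.
pose ej (j : nat) : R := (2 ^+ j)^-1; have ej0 j : 0 < ej j by rewrite invr_gt0 exprn_gt0.
apply: (@le_trans _ _ (K * (C0 * B `^ p * Q))%:E); last first.
  rewrite lee_fin mulrA; apply: ler_wpM2r => //; apply: ler_wpM2r; last by rewrite lerDl.
  by apply: mulr_ge0; [exact: ltW|exact: powR_ge0].
apply: (fatou_pow (u := fun j => parts_sum Om f (ej j))) => //.
- by move=> j; exact: parts_sum_meas.
- by move=> j x; apply: sumr_ge0.
- move=> x d d0; have AF j : `|truncated_rough_integral Om f (ej j) x| <= parts_sum Om f (ej j) x.
    by rewrite /parts_sum big_bool; exact: norm_parts.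
  (* Where the principal value does not exist, [lim] takes the default value 0 and the bound is
     trivial. *)
  case: (pselect (cvg (truncated_rough_integral Om f eps x @[eps --> 0^'+]))) => [cv|ncv]; last first.
    rewrite /rough_integral (dvgP ncv) normr0; near=> j.
    by rewrite addr_ge0 ?(ltW d0)// sumr_ge0.
  have := cv; rewrite -/(rough_integral Om f x) => /cvgrPdist_le /(_ d d0) [r /= r0 hr].
  have ld : 0 <= r^-1 by rewrite invr_ge0 ltW.
  have hM := archi_boundP ld; set J := Num.bound r^-1 in hM.
  exists J => // j /= Jj.
  have ejr : ej j < r.
    rewrite /ej invf_plt ?posrE ?exprn_gt0//; apply: lt_le_trans hM _.
    by rewrite -natrX ler_nat; apply: leq_trans Jj _; exact: ltnW (ltn_expl j (ltnSn 1)).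
  have := hr (ej j); rewrite /ball_ /= sub0r normrN gtr0_norm// => /(_ ejr (ej0 j)) h.
  rewrite addrC -lerBlDr; apply: le_trans h; rewrite lerBlDr addrC -lerBlDr.
  apply: le_trans (AF j); rewrite lerBlDl.
  have := ler_normD (rough_integral Om f x - truncated_rough_integral Om f (ej j) x)
    (truncated_rough_integral Om f (ej j) x).
  by rewrite subrK.
by move=> j; exact: bound2.
Unshelve. all: by end_near. Qed.

(** With finite norms the product on the right of the theorem can be computed in the reals, away
    from products of zero and infinity. *)
Lemma Rn_Lnorm2_fin (f : V -> Rcomplex R) : schwartz f -> Rn_Lnorm 2 f \is a fin_num.
Proof.
move=> sf; have [nt _] := schwartz_nice true sf; have [nf _] := schwartz_nice false sf.
rewrite ge0_fin_numE; last by rewrite /Rn_Lnorm complex_LnormE poweR_ge0.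
rewrite /Rn_Lnorm complex_LnormE; apply: poweR_lty.
have nn := niceD (niceX2 nt) (niceX2 nf).
rewrite (eq_integral (fun x => (part true (f x) ^+ 2 + part false (f x) ^+ 2)%:E)); last first.
  move=> x _; rewrite powR_mulrn//; case: (f x) => a b; rewrite norm_CE sqr_sqrtr//.
  by rewrite addr_ge0// sqr_ge0.
by rewrite (ge0_Rint nn) ltry.
Qed.

End assembly.

Unset Implicit Arguments.

Theorem theorem1p2 (R : realType) (n m : nat) (hn : (1 <= n)%N)
    (hm : (1 <= m)%N) (q : \bar R)
    (hq : ((2 * m%:R / (m%:R + 1))%:E < q)%E) :
  exists2 C : R, 0 < C &
    forall Omega : 'M[R]_(m, n) -> Rcomplex R,
      sphere_Lq q Omega -> sphere_integral Omega = 0 ->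
    forall f : 'I_m -> 'rV[R]_n -> Rcomplex R,
      (forall j, schwartz (f j)) ->
      (Rn_Lnorm (2 / m%:R) (rough_integral Omega f) <=
       C%:E * sphere_Lnorm q Omega * \prod_(j < m) Rn_Lnorm 2 (f j))%E.
Proof.
case: m hm hq => [//|m] _ hq.
have {}hq : ((@crit R m)%:E < q)%E by move: hq; rewrite natr1.
have [C C0 hC] := @rough_complex R m n q hn hq.
set p : R := 2 / m.+1%:R in hC *; have p0 : 0 < p by rewrite divr_gt0.
pose A := C `^ p^-1; have A0 : 0 < A by exact: powR_gt0.
exists A => // Om [mO Oq] O0 f sf.
have r0 : (0 <= sphere_Lnorm q Om)%E by exact: Lnorm_ge0.
have rf : sphere_Lnorm q Om \is a fin_num by rewrite ge0_fin_numE.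
set r := fine (sphere_Lnorm q Om); pose v a := fine (Rn_Lnorm 2 (f a)).
have rE : sphere_Lnorm q Om = r%:E by rewrite fineK.
have vE a : Rn_Lnorm 2 (f a) = (v a)%:E by rewrite fineK// Rn_Lnorm2_fin.
have v0 a : 0 <= v a by apply: fine_ge0; exact: Lnorm_ge0.
have r00 : 0 <= r by exact: fine_ge0.
(* Numbers strictly above the norms are positive, as the normalization in [rough_complex] requires,
   even when a norm vanishes. *)
have bound s t : r < s -> (forall a, v a < t a) ->
    (Rn_Lnorm p (rough_integral Om f) <= (A * s * \prod_a t a)%:E)%E.
  move=> rs vt; have s0 : 0 < s := le_lt_trans r00 rs.
  have t0 a : 0 < t a := le_lt_trans (v0 a) (vt a).
  have pt0 : 0 <= \prod_a t a by apply: prodr_ge0 => a _; exact: ltW.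
  have st0 : 0 <= s * \prod_a t a by apply: mulr_ge0 => //; exact: ltW.
  apply: int_le_Lnorm => //; first by rewrite -mulrA mulr_ge0// ltW.
  rewrite -mulrA powRM// ?(ltW A0)// /A -powRrM mulVf ?gt_eqF// powRr1 ?(ltW C0)//.
  apply: hC => //.
  - by rewrite rE lee_fin ltW.
  - by move=> a; rewrite vE lee_fin ltW.
have L0 : (0 <= Rn_Lnorm p (rough_integral Om f))%E by exact: Lnorm_ge0.
have Lf : Rn_Lnorm p (rough_integral Om f) \is a fin_num.
  rewrite ge0_fin_numE//; apply: le_lt_trans (bound (r + 1) (fun a => v a + 1) _ _) _ => //.
  - by rewrite ltrDl.
  - by move=> a; rewrite ltrDl.
  exact: ltry.
rewrite rE (eq_bigr _ (fun a _ => vE a)) prodEFin -!EFinM -(fineK Lf) lee_fin.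
apply: prod_inf => //; first by rewrite mulr_ge0// ltW.
move=> t vt; have t0 a : 0 <= t a := le_trans (v0 a) (ltW (vt a)).
have pt0 : 0 <= \prod_a t a by exact: prodr_ge0.
(* The same passage to the limit for the norm of [Om], seen as a product with one factor. *)
have := @prod_inf R 1 (fun=> r) (A * \prod_a t a) (fine (Rn_Lnorm p (rough_integral Om f))) (fun=> r00).
rewrite big_ord1 mulrAC; apply; first by rewrite mulr_ge0// ltW.
move=> s rs; rewrite big_ord1 mulrAC -lee_fin fineK//; exact: bound.
Qed.
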